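(* Let $\rho:\Gamma\to GL_5(\mathbb{C})$ be a $T$-unitarizable, $T$-determined representation and $\upsilon$ a multiplier system with cusp parameter $m$. Let $\widetilde{\lambda_1},\dots,\widetilde{\lambda_5}$ and $\lambda_0$ be as in the context, and assume $\frac{12(\lambda_0+1)}{5}-m\in\mathbb{Z}$. Put $k_1=\frac{12}{5}(\lambda_0+1)-4$. Let $F_1\in\mathcal{H}(k_1,\rho,\upsilon)$ be a vector whose components form a fundamental system of solutions of the (unique) fifth order MLDE in weight $k_1$ with indicial roots $\widetilde{\lambda_1}+1,\widetilde{\lambda_2},\widetilde{\lambda_3},\widetilde{\lambda_4},\widetilde{\lambda_5}$, and let $G$ be a nonzero element of $\mathcal{H}(k_1,\rho,\upsilon)$ such that $\Delta G$ lies in the $\mathbb{C}$-span of $E_4D^4F_1,\ E_6D^3F_1,\ E_8D^2F_1,\ E_{10}DF_1,\ E_{12}F_1$. Then: (i) $\mathcal{H}(\rho,\upsilon)$ is a free $\mathcal{M}$-module of rank 5 with basis $\{F_1,G,DF_1,DG,D^2F_1\}$; (ii) for each integer $k\ge0$, $\dim\mathcal{H}(k_1+2k,\rho,\upsilon)=\left[\frac{5k}{6}\right]+1$ if $k\equiv5\pmod6$ and $=\left[\frac{5k}{6}\right]+2$ if $k\not\equiv5\pmod6$.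
   Context: $\Gamma=SL(2,\mathbb{Z})$ acts on the upper half-plane $\mathbb{H}$ by Möbius transformations; $T=\begin{pmatrix}1&1\\0&1\end{pmatrix}$; $q=e^{2\pi iz}$, $\mathbf{e}(r)=e^{2\pi ir}$; $[x]$ is the greatest integer $\le x$. Complex powers use the principal branch of $\log$. For $k\in\mathbb{R}$, a multiplier system of weight $k$ is a map $\upsilon:\Gamma\to\{|w|=1\}$ such that $\nu(\gamma,z)=\upsilon(\gamma)(cz+d)^k$ satisfies $\nu(\gamma\sigma,z)=\nu(\gamma,\sigma z)\nu(\sigma,z)$; it is also one of weight $k+n$, $n\in\mathbb{Z}$. Cusp parameter: the $m\in[0,12)$ with $\upsilon(T)=\mathbf{e}(m/12)$. Slash: $(f|_k^\upsilon\gamma)(z)=\upsilon(\gamma)^{-1}(cz+d)^{-k}f(\gamma z)$. Moderate growth: $|f(x+iy)|\le y^N$ for $y>c$. $\mathcal{H}(k,\rho,\upsilon)$: column vectors $F$ of holomorphic moderate-growth functions on $\mathbb{H}$ with $F|_k^\upsilon\gamma=\rho(\gamma)F$ for all $\gamma$; $\mathcal{H}(\rho,\upsilon)=\bigoplus_{n\in\mathbb{Z}}\mathcal{H}(k+n,\rho,\upsilon)$. $\mathcal{M}=\mathbb{C}[E_4,E_6]$ is the graded ring of holomorphic integral-weight modular forms for $\Gamma$ with trivial multiplier, acting by multiplication; $E_k$ ($k\ge4$ even) is the normalized Eisenstein series $1-\frac{2k}{B_k}\sum_{n\ge1}\sigma_{k-1}(n)q^n$ and $\Delta=q\prod_{n\ge1}(1-q^n)^{24}$.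 $T$-unitarizable: $\rho(T)$ conjugate to a unitary matrix. An irreducible $\rho$ of dimension $d$ is $T$-determined if every indecomposable $\rho':\Gamma\to GL_d(\mathbb{C})$ with $\rho'(T)$ having the same eigenvalues as $\rho(T)$ is irreducible. $\eta=q^{1/24}\prod_{n\ge1}(1-q^n)$, $P=\frac{i}{\pi}\frac{\eta'}{\eta}$, $D_kf=\frac{1}{2\pi i}\frac{df}{dz}+kPf$; $D$ acts on $\mathcal{H}(k,\rho,\upsilon)$ componentwise as $D_k$, $D^n=D_{k+2(n-1)}\circ\cdots\circ D_k$. An MLDE of order $n$ in weight $k$ is $D_k^nf+M_4D_k^{n-2}f+\cdots+M_{2n}f=0$, $M_{2j}\in\mathcal{M}_{2j}$; rewriting it as $q^n\frac{d^nf}{dq^n}+\sum_{j<n}q^jg_j(q)\frac{d^jf}{dq^j}=0$ with $g_j$ holomorphic at $0$, its indicial roots are the roots of $r(r-1)\cdots(r-n+1)+\sum_{j<n}g_j(0)r(r-1)\cdots(r-j+1)$; a fundamental system is a basis of its solution space. Setting: write the eigenvalues of $\rho(T)$ as $\mathbf{e}(r_1),\dots,\mathbf{e}(r_5)$, $0\le r_1<\dots<r_5<1$; $\widetilde{\lambda_j}\in[0,1)$ with $\widetilde{\lambda_j}\equiv r_j+\frac{m}{12}\pmod{\mathbb{Z}}$; $\lambda_0=\sum_j\widetilde{\lambda_j}$. *)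

(* Defs.v *)
From Stdlib Require Import Reals Lra ZArith List ClassicalEpsilon.
From Coquelicot Require Import Coquelicot.
Import ListNotations.

Open Scope R_scope.

Definition cexp (w : C) : C :=
  (exp (Re w) * cos (Im w), exp (Re w) * sin (Im w)).

(* principal argument in (-PI, PI] *)
Definition Carg (w : C) : R :=
  let x := Re w in let y := Im w in
  if Rlt_dec 0 x then atan (y / x)
  else if Rlt_dec x 0 then
         (if Rle_dec 0 y then atan (y / x) + PI else atan (y / x) - PI)
  else if Rlt_dec 0 y then PI / 2
  else if Rlt_dec y 0 then - (PI / 2)
  else 0.

Definition Clog (w : C) : C := (ln (Cmod w), Carg w).

Definition Cpow (w s : C) : C :=
  if Ceq_dec w 0 then 0%C else cexp (s * Clog w)%C.

Definition ee (r : C) : C := cexp (2 * PI * Ci * r)%C.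

Definition qq (z : C) : C := ee z.

Definition upper (z : C) : Prop := 0 < Im z.

(* complex derivative (chosen value; meaningful where f is differentiable) *)
Definition cderiv (f : C -> C) (z : C) : C :=
  epsilon (inhabits (RtoC 0))
    (fun l : C => @is_derive C_AbsRing C_NormedModule f z l).

Definition holo_H (f : C -> C) : Prop :=
  forall z, upper z -> @ex_derive C_AbsRing C_NormedModule f z.

Definition cseries (a : nat -> C) : C :=
  epsilon (inhabits (RtoC 0)) (fun l : C => @is_series C_AbsRing C_NormedModule a l).

Fixpoint csum (n : nat) (a : nat -> C) : C :=
  match n with O => 0%C | S n' => (csum n' a + a n')%C end.

Fixpoint cprodn (N : nat) (a : nat -> C) : C :=
  match N with O => 1%C | S N' => (cprodn N' a * a N)%C end.

Definition cprod_inf (a : nat -> C) : C :=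
  epsilon (inhabits (RtoC 0))
    (fun l : C => filterlim (fun N => cprodn N a) eventually (locally l)).

Fixpoint Cpown (w : C) (n : nat) : C :=
  match n with O => 1%C | S n' => (w * Cpown w n')%C end.

Fixpoint bern_list (n : nat) : list R :=
  match n with
  | O => []
  | S n' =>
      let l := bern_list n' in
      l ++ [ match n' with
             | O => 1
             | _ => - / INR (n' + 1) *
                      fold_right Rplus 0
                        (map (fun j => Binomial.C (n' + 1) j * nth j l 0)
                             (seq 0 n'))
             end ]
  end.

(* B_n, with B_0 = 1, B_1 = -1/2, B_2 = 1/6, ... *)
Definition bernoulli (n : nat) : R := nth n (bern_list (S n)) 0.

Definition sigma (s n : nat) : R :=
  fold_right Rplus 0
    (map (fun d => if Nat.eqb (Nat.modulo n d) 0 then INR d ^ s else 0)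
         (seq 1 n)).

Definition Eis (k : nat) (z : C) : C :=
  (1 - RtoC (2 * INR k / bernoulli k) *
       cseries (fun n => match n with
                         | O => 0%C
                         | S _ => (RtoC (sigma (k - 1) n) * Cpown (qq z) n)%C
                         end))%C.

Definition Delta_q (z : C) : C :=
  (qq z * cprod_inf (fun n => Cpown (1 - Cpown (qq z) n) 24))%C.

Definition eta (z : C) : C :=
  (ee (z / 24) * cprod_inf (fun n => 1 - Cpown (qq z) n))%C.

Definition Pfun (z : C) : C := (Ci / RtoC PI * (cderiv eta z / eta z))%C.

Definition Dk (k : R) (f : C -> C) (z : C) : C :=
  (/ (2 * RtoC PI * Ci) * cderiv f z + RtoC k * Pfun z * f z)%C.

Fixpoint Dn (n : nat) (k : R) (f : C -> C) : C -> C :=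
  match n with
  | O => f
  | S n' => Dk (k + 2 * INR n') (Dn n' k f)
  end.

Record SL2Z := mkSL2Z {
  ma : Z; mb : Z; mc : Z; md : Z;
  mdet : (ma * md - mb * mc = 1)%Z }.

Definition SL2Z_mul (g h : SL2Z) : SL2Z.
Proof.
  refine (mkSL2Z (ma g * ma h + mb g * mc h) (ma g * mb h + mb g * md h)
                 (mc g * ma h + md g * mc h) (mc g * mb h + md g * md h) _).
  destruct g as [a b c d e], h as [a' b' c' d' e']; simpl.
  replace ((a * a' + b * c') * (c * b' + d * d') - (a * b' + b * d') * (c * a' + d * c'))%Z
    with ((a * d - b * c) * (a' * d' - b' * c'))%Z by ring.
  rewrite e, e'; reflexivity.
Defined.

Definition Tmat : SL2Z := mkSL2Z 1 1 0 1 eq_refl.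

Definition mobius (g : SL2Z) (z : C) : C :=
  ((RtoC (IZR (ma g)) * z + RtoC (IZR (mb g))) /
   (RtoC (IZR (mc g)) * z + RtoC (IZR (md g))))%C.

Definition jfac (g : SL2Z) (z : C) : C :=
  (RtoC (IZR (mc g)) * z + RtoC (IZR (md g)))%C.

Definition nu (k : R) (v : SL2Z -> C) (g : SL2Z) (z : C) : C :=
  (v g * Cpow (jfac g z) (RtoC k))%C.

Definition multiplier_system (k : R) (v : SL2Z -> C) : Prop :=
  (forall g, Cmod (v g) = 1) /\
  (forall g h z, upper z ->
     nu k v (SL2Z_mul g h) z = (nu k v g (mobius h z) * nu k v h z)%C).

Definition cusp_parameter (v : SL2Z -> C) (m : R) : Prop :=
  0 <= m < 12 /\ v Tmat = ee (RtoC (m / 12)).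

Definition dim5 : nat := 5.

Definition vec := nat -> C.         (* only components 0..4 matter *)
Definition mat := nat -> nat -> C.  (* only entries 0..4 matter *)

Definition veq (v w : vec) : Prop := forall i, (i < dim5)%nat -> v i = w i.
Definition vzero : vec := fun _ => 0%C.

Definition mat_vec (M : mat) (v : vec) : vec := fun i => csum dim5 (fun j => (M i j * v j)%C).
Definition mat_mul (M N : mat) : mat := fun i j => csum dim5 (fun l => (M i l * N l j)%C).
Definition mat_id : mat := fun i j => if Nat.eqb i j then 1%C else 0%C.
Definition meq (M N : mat) : Prop :=
  forall i j, (i < dim5)%nat -> (j < dim5)%nat -> M i j = N i j.
Definition mat_adj (M : mat) : mat := fun i j => Cconj (M j i).

Definition invertible (M : mat) : Prop :=
  exists N, meq (mat_mul M N) mat_id /\ meq (mat_mul N M) mat_id.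

Definition unitary (U : mat) : Prop := meq (mat_mul U (mat_adj U)) mat_id.

Definition representation (rho : SL2Z -> mat) : Prop :=
  (forall g, invertible (rho g)) /\
  (forall g h, meq (rho (SL2Z_mul g h)) (mat_mul (rho g) (rho h))).

Definition T_unitarizable (rho : SL2Z -> mat) : Prop :=
  exists P Pinv U, meq (mat_mul P Pinv) mat_id /\ meq (mat_mul Pinv P) mat_id /\
    unitary U /\ meq (rho Tmat) (mat_mul P (mat_mul U Pinv)).

Definition eigenvalue (M : mat) (l : C) : Prop :=
  exists v, ~ veq v vzero /\ veq (mat_vec M v) (fun i => (l * v i)%C).

Definition subspace (W : vec -> Prop) : Prop :=
  W vzero /\
  (forall v w, veq v w -> W v -> W w) /\
  (forall v w, W v -> W w -> W (fun i => (v i + w i)%C)) /\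
  (forall (c : C) v, W v -> W (fun i => (c * v i)%C)).

Definition invariant (rho : SL2Z -> mat) (W : vec -> Prop) : Prop :=
  forall g v, W v -> W (mat_vec (rho g) v).

Definition trivial_sub (W : vec -> Prop) : Prop := forall v, W v -> veq v vzero.
Definition full_sub (W : vec -> Prop) : Prop := forall v, W v.

Definition irreducible (rho : SL2Z -> mat) : Prop :=
  forall W, subspace W -> invariant rho W -> trivial_sub W \/ full_sub W.

Definition indecomposable (rho : SL2Z -> mat) : Prop :=
  ~ exists W1 W2, subspace W1 /\ subspace W2 /\
      invariant rho W1 /\ invariant rho W2 /\
      ~ trivial_sub W1 /\ ~ trivial_sub W2 /\
      (forall v, W1 v -> W2 v -> veq v vzero) /\
      (forall v, exists w1 w2, W1 w1 /\ W2 w2 /\ veq v (fun i => (w1 i + w2 i)%C)).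

Definition T_determined (rho : SL2Z -> mat) : Prop :=
  irreducible rho /\
  forall rho' : SL2Z -> mat, representation rho' -> indecomposable rho' ->
    (forall l, eigenvalue (rho' Tmat) l <-> eigenvalue (rho Tmat) l) ->
    irreducible rho'.

Definition vfun := nat -> C -> C.

Definition moderate_growth (f : C -> C) : Prop :=
  exists (N : nat) (c : R), forall x y : R, c < y -> 0 < y -> Cmod (f (x, y)) <= y ^ N.

(* F |_k^v g = rho(g) F on H *)
Definition transforms (k : R) (rho : SL2Z -> mat) (v : SL2Z -> C) (F : vfun) : Prop :=
  forall g z i, upper z -> (i < dim5)%nat ->
    (/ v g * Cpow (jfac g z) (RtoC (- k)) * F i (mobius g z))%C
    = csum dim5 (fun j => (rho g i j * F j z)%C).

Definition Hk (k : R) (rho : SL2Z -> mat) (v : SL2Z -> C) (F : vfun) : Prop :=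
  (forall i, (i < dim5)%nat -> holo_H (F i) /\ moderate_growth (F i)) /\
  transforms k rho v F.

Definition vfeqH (F G : vfun) : Prop :=
  forall z i, upper z -> (i < dim5)%nat -> F i z = G i z.

Definition vfzero : vfun := fun _ _ => 0%C.

(* H(rho,v) = sum over n in Z of H(k+n, rho, v): finite sums of homogeneous elements *)
Definition Hsum (k : R) (rho : SL2Z -> mat) (v : SL2Z -> C) (F : vfun) : Prop :=
  exists l : list (Z * vfun),
    (forall p, In p l -> Hk (k + IZR (fst p)) rho v (snd p)) /\
    vfeqH F (fun i z => fold_right Cplus 0%C (map (fun p => snd p i z) l)).

Definition monos (l : list (C * nat * nat)) (z : C) : C :=
  fold_right Cplus 0%C
    (map (fun t => let '(c, a, b) := t in
                   (c * Cpown (Eis 4 z) a * Cpown (Eis 6 z) b)%C) l).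

Definition inM (f : C -> C) : Prop :=
  exists l, forall z, upper z -> f z = monos l z.

Definition inMw (w : nat) (f : C -> C) : Prop :=
  exists l, (forall t, In t l -> let '(_, a, b) := t in (4 * a + 6 * b = w)%nat) /\
    forall z, upper z -> f z = monos l z.

Definition mlde5 (k : R) (M4 M6 M8 M10 : C -> C) (f : C -> C) : C -> C :=
  fun z => (Dn 5 k f z + M4 z * Dn 3 k f z + M6 z * Dn 2 k f z
            + M8 z * Dn 1 k f z + M10 z * f z)%C.

(* Indicial polynomial: writing the MLDE as
     q^n f^(n) + sum_j q^j g_j(q) f^(j) = 0,
   applying the operator to q^r = e(r z) gives
     (r(r-1)..(r-n+1) + sum_j g_j(q) r(r-1)..(r-j+1)) q^r,
   so the indicial polynomial at r is the limit of q^{-r} L(q^r) at q -> 0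
   (z = i y, y -> +oo). *)
Definition indicial_value (k : R) (M4 M6 M8 M10 : C -> C) (r : C) (p : C) : Prop :=
  filterlim
    (fun y : R => (mlde5 k M4 M6 M8 M10 (fun z => ee (r * z)%C) (0, y)
                   / ee (r * (0, y)%C))%C)
    (Rbar_locally p_infty) (locally p).

Definition has_indicial_roots (k : R) (M4 M6 M8 M10 : C -> C) (rts : nat -> R) : Prop :=
  forall r : C, indicial_value k M4 M6 M8 M10 r
    ((r - RtoC (rts 0%nat)) * (r - RtoC (rts 1%nat)) * (r - RtoC (rts 2%nat))
     * (r - RtoC (rts 3%nat)) * (r - RtoC (rts 4%nat)))%C.

Definition fundamental_system (k : R) (M4 M6 M8 M10 : C -> C) (F : vfun) : Prop :=
  (forall i, (i < dim5)%nat -> holo_H (F i) /\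
     forall z, upper z -> mlde5 k M4 M6 M8 M10 (F i) z = 0%C) /\
  (forall c : nat -> C,
     (forall z, upper z -> csum dim5 (fun i => (c i * F i z)%C) = 0%C) ->
     forall i, (i < dim5)%nat -> c i = 0%C) /\
  (forall f, holo_H f -> (forall z, upper z -> mlde5 k M4 M6 M8 M10 f z = 0%C) ->
     exists c : nat -> C, forall z, upper z -> f z = csum dim5 (fun i => (c i * F i z)%C)).

Definition has_dimension (S : vfun -> Prop) (d : nat) : Prop :=
  exists b : nat -> vfun,
    (forall l, (l < d)%nat -> S (b l)) /\
    (forall c : nat -> C,
       vfeqH (fun i z => csum d (fun l => (c l * b l i z)%C)) vfzero ->
       forall l, (l < d)%nat -> c l = 0%C) /\
    (forall F, S F -> exists c : nat -> C,
       vfeqH F (fun i z => csum d (fun l => (c l * b l i z)%C))).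

Definition vD (k : R) (F : vfun) : vfun := fun i => Dk k (F i).
Definition vDn (n : nat) (k : R) (F : vfun) : vfun := fun i => Dn n k (F i).
Definition vscale (f : C -> C) (F : vfun) : vfun := fun i z => (f z * F i z)%C.

(* Main.v *)
From mathcomp Require all_boot all_fingroup all_algebra boolp.
From HB Require structures.
Require Import Defs.
From Stdlib Require Import Reals ZArith.
From Coquelicot Require Import Coquelicot.
From Stdlib Require Import Lra Lia List FunctionalExtensionality Eqdep_dec.
From Stdlib Require Import ClassicalEpsilon Classical.
Open Scope R_scope.

(* The transformation laws of P, Delta, E4 and E6 are read off from F1 and G instead of being
   proved by lattice sums. Let pi_g be the defect of the quasimodular law of P under g. Expanding
   D^5 F1 | g and comparing with the MLDE, whose Wronskian matrix (D^n F1)_{n<5} is invertible at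
   every point, gives (5 k_1 + 20) pi_g = 0, and 5 k_1 + 20 = 12 (lambda_0 + 1) > 0. Hence D preserves
   the transformation laws, Delta has weight 12, and comparing the coefficients of D^n F1 in
   (Delta G) | g shows that c_0 E4, c_1 E6 and c_2 E8 are modular.

   In an eigenbasis of rho(T) the components of F1 have leading exponents lambda_1 + 1, lambda_2,
   ..., lambda_5. Since those of Delta G are at least lambda_j + 1, the symbol sum_n c_{4-n} p_n of
   degree 4 vanishes at lambda_2, ..., lambda_5, so c_0 <> 0 and
   c_1 = c_0 (lambda_1 - k_1/12 + 1/3). If c_1 = 0 or c_1 = c_0/3, then the values
   of three D^n F1 at i and of two at e^{i pi/3}, eigenvectors of rho(S) and of rho(TS), force the
   T-eigenfunctional of lambda_1 to be Gamma-invariant up to scalars, contradicting irreducibility.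

   The determinant of (F1, DF1, D^2 F1, G, DG) relative to the Wronskian matrix is Theta / Delta^2
   with Theta modular of weight 12. Comparison of exponents makes Theta vanish at infinity, and
   Theta(e^{i pi/3}) = c_1 (c_1 - c_0/3) E6(e^{i pi/3})^2 <> 0, so Theta is a nonzero multiple of Delta.
   Thus the determinant normalised by the exponents has no zero in |q| < 1, and by Cramer's rule every
   F has coefficients holomorphic in q, which are modular by uniqueness. The dimensions
   follow from H(k) = (+)_i C e_i B_i (+) Delta H(k - 12), e_i a monomial in E4 and E6. *)

(** * Determinants of 5 x 5 complex matrices *)

(** Eta, Delta and the E_k are given only as products and series in q, so at the outset nothing is
    known about z -> -1/z; what F1 and G do under Gamma is the sole source of such knowledge. The
    free basis rests on a count. Its weights k_1, k_1, k_1 + 2, k_1 + 2, k_1 + 4 have sum 5 k_1 + 8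
    = 12 lambda_0, and its exponents are at least lambda_1, ..., lambda_5, with sum lambda_0. A
    nonzero determinant therefore has no room for further zeros, in the half-plane or at the cusp:
    it behaves like eta^(24 lambda_0). What remains is that it is not zero, and this is tested at
    e^{i pi/3} because E4 vanishes there. The factor c_1 - c_0/3 stems from D E4 = -E6/3. The two
    bad cases are lambda_1 - k_1/12 = -a/3, with a = 1 for c_1 = 0 and a = 0 for c_1 = c_0/3. In
    them the eigenvalue of rho(TS) on D^a F1 at e^{i pi/3} is the eigenvalue of rho(T) attached to
    lambda_1 times that of rho(S) on F1 at i; this coincidence produces the invariant functional. *)

Module LinearAlgebra.
Import structures all_boot perm all_algebra GRing.Theory.
Local Open Scope ring_scope.
Set Implicit Arguments. Unset Strict Implicit. Unset Printing Implicit Defensive.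

(** The complex numbers of Coquelicot receive a MathComp field structure, so that determinants and
    adjugates can be formed over them. *)
Fact C_addNr (x : C) : (- x + x)%C = RtoC 0.
Proof. by rewrite Cplus_comm Cplus_opp_r. Qed.
Fact C_one_neq0 : RtoC 1 <> RtoC 0.
Proof. move=> h; apply: R1_neq_R0; exact: (f_equal fst h). Qed.
HB.instance Definition _ := boolp.gen_eqMixin C.
HB.instance Definition _ := boolp.gen_choiceMixin C.
HB.instance Definition _ :=
  GRing.isZmodule.Build C Cplus_assoc Cplus_comm Cplus_0_l C_addNr.
Fact C_one_neq0b : RtoC 1 != 0%R :> C.
Proof. apply/eqP; exact: C_one_neq0. Qed.
HB.instance Definition _ :=
  GRing.Zmodule_isComNzRing.Build C Cmult_assoc Cmult_comm Cmult_1_l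
    (fun x y z => Cmult_plus_distr_r x y z) C_one_neq0b.
Fact C_mulVr (x : C) : x != 0%R -> (/ x * x)%C = 1%R.
Proof. move=> /eqP; exact: Cinv_l. Qed.
(** The field interface asks for an inverse that sends 0 to 0. *)
Definition Cinvx (x : C) : C := if x == 0%R then 0%R else (/ x)%C.
Fact C_mulVx (x : C) : x != 0%R -> (Cinvx x * x)%C = 1%R.
Proof. move=> h; rewrite /Cinvx (negbTE h); exact: C_mulVr. Qed.
Fact C_invx0 : Cinvx 0%R = 0%R.
Proof. by rewrite /Cinvx eqxx. Qed.
HB.instance Definition _ := GRing.ComNzRing_isField.Build C C_mulVx C_invx0.

Definition mx5 (M : mat) : 'M[C]_5 := \matrix_(i < 5, j < 5) M i j.
Definition cv5 (v : vec) : 'cV[C]_5 := \col_(i < 5) v i.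
Definition det5 (M : mat) : C := \det (mx5 M).
(** [inord] converts natural indices to ordinals; only the values at indices below 5 carry
    meaning. *)
Definition adj5 (M : mat) : mat := fun i j => (\adj (mx5 M))%R (inord i) (inord j).

Lemma csum5E (f : nat -> C) : csum 5 f = (\sum_(i < 5) f i)%R.
Proof. by rewrite !big_ord_recr big_ord0. Qed.

Lemma ord5 (i : nat) : (i < 5)%coq_nat -> exists o : 'I_5, i = o.
Proof. by move=> /ltP h; exists (Ordinal h). Qed.

Lemma mx5_mul (M N : mat) : mx5 (mat_mul M N) = (mx5 M *m mx5 N)%R.
Proof.
apply/matrixP=> i j; rewrite !mxE /mat_mul csum5E.
by apply: eq_bigr => k _; rewrite !mxE.
Qed.

Lemma mx5_ext (M N : mat) : meq M N -> mx5 M = mx5 N.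
Proof. by move=> h; apply/matrixP=> i j; rewrite !mxE; apply: h; apply/ltP. Qed.

Lemma det5_ext (M N : mat) : meq M N -> det5 M = det5 N.
Proof. by move=> h; rewrite /det5 (mx5_ext h). Qed.

Lemma det5_mul (M N : mat) : det5 (mat_mul M N) = (det5 M * det5 N)%C.
Proof. by rewrite /det5 mx5_mul det_mulmx. Qed.

Lemma det5_tr (M : mat) : det5 (fun i j => M j i) = det5 M.
Proof.
rewrite /det5 -[RHS]det_tr; congr determinant.
by apply/matrixP=> i j; rewrite !mxE.
Qed.

Lemma mat_mul_adj5 (M : mat) (i j : nat) : (i < 5)%coq_nat -> (j < 5)%coq_nat ->
  mat_mul M (adj5 M) i j = if Nat.eqb i j then det5 M else RtoC 0.
Proof.
move=> /ord5 [a ->] /ord5 [b ->]; rewrite /mat_mul csum5E.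
transitivity ((mx5 M *m \adj (mx5 M))%R a b).
  rewrite !mxE; apply: eq_bigr => k _; rewrite /adj5 !inord_val.
  by congr (_ * _)%C; rewrite mxE.
rewrite mul_mx_adj !mxE; case: eqP => [->|h]; first by rewrite PeanoNat.Nat.eqb_refl.
case: PeanoNat.Nat.eqb_spec => // /val_inj //.
Qed.

Lemma adj5_mat_mul (M : mat) (i j : nat) : (i < 5)%coq_nat -> (j < 5)%coq_nat ->
  mat_mul (adj5 M) M i j = if Nat.eqb i j then det5 M else RtoC 0.
Proof.
move=> /ord5 [a ->] /ord5 [b ->]; rewrite /mat_mul csum5E.
transitivity ((\adj (mx5 M) *m mx5 M)%R a b).
  rewrite !mxE; apply: eq_bigr => k _; rewrite /adj5 !inord_val.
  by congr (_ * _)%C; rewrite mxE.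
rewrite mul_adj_mx !mxE; case: eqP => [->|h]; first by rewrite PeanoNat.Nat.eqb_refl.
case: PeanoNat.Nat.eqb_spec => // /val_inj //.
Qed.

Lemma det5_0_kernel (M : mat) : det5 M = RtoC 0 ->
  exists v, ~ veq v vzero /\ veq (mat_vec M v) vzero.
Proof.
move=> h0; have /eqP/det0P [w wn0 hw] : \det (mx5 M)^T%R = 0%R by rewrite det_tr.
exists (fun i => w ord0 (inord i)); split.
  move=> hv; case/eqP: wn0; apply/rowP=> i; rewrite mxE.
  by have := hv i (elimT ltP (ltn_ord i)); rewrite inord_val.
move=> i /ord5 [a ->]; rewrite /mat_vec csum5E /vzero.
have := congr1 (fun X : 'rV_5 => X ord0 a) hw; rewrite [LHS]mxE [RHS]mxE => e.
etransitivity; last exact: e.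
apply: eq_bigr => k _; rewrite !mxE inord_val; exact: Cmult_comm.
Qed.

(** Determinants and adjugate entries are polynomials in the matrix entries, so they stay in any
    class of functions that contains the constants and is closed under sums and products. Later the
    class is that of the functions holomorphic on a disc. *)
Section Closed.
Variables (X : Type) (P : (X -> C) -> Prop).
Hypotheses (Pc : forall c, P (fun _ => c))
  (Pa : forall f g, P f -> P g -> P (fun x => (f x + g x)%C))
  (Pm : forall f g, P f -> P g -> P (fun x => (f x * g x)%C)).

Lemma sum_closed (I : Type) (r : seq I) (F : I -> X -> C) :
  (forall i, P (F i)) -> P (fun x => \sum_(i <- r) F i x)%R.
Proof.
move=> h; elim: r => [|a r IH].
  rewrite (_ : (fun x => _) = (fun _ => RtoC 0)); first exact: Pc.
  by apply: functional_extensionality => x; rewrite big_nil.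
rewrite (_ : (fun x => _) = (fun x => F a x + (\sum_(i <- r) F i x)%R)%C).
  by apply: Pa.
by apply: functional_extensionality => x; rewrite big_cons.
Qed.

Lemma prod_closed (I : Type) (r : seq I) (F : I -> X -> C) :
  (forall i, P (F i)) -> P (fun x => \prod_(i <- r) F i x)%R.
Proof.
move=> h; elim: r => [|a r IH].
  rewrite (_ : (fun x => _) = (fun _ => RtoC 1)); first exact: Pc.
  by apply: functional_extensionality => x; rewrite big_nil.
rewrite (_ : (fun x => _) = (fun x => F a x * (\prod_(i <- r) F i x)%R)%C).
  by apply: Pm.
by apply: functional_extensionality => x; rewrite big_cons.
Qed.

Lemma det_closed n (M : X -> 'M[C]_n) :
  (forall i j, P (fun x => M x i j)) -> P (fun x => \det (M x)).
Proof.
move=> h.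
apply: (@sum_closed _ _ (fun (s : 'S_n) x => ((-1) ^+ s * \prod_i M x i (s i))%R)) => s.
apply: (Pm (f := fun _ => ((-1) ^+ s)%R) (g := fun x => (\prod_i M x i (s i))%R)).
  exact: Pc.
exact: (@prod_closed _ _ (fun i x => M x i (s i))).
Qed.

Lemma det5_closed (M : nat -> nat -> X -> C) :
  (forall i j, (i < 5)%coq_nat -> (j < 5)%coq_nat -> P (M i j)) ->
  P (fun x => det5 (fun i j => M i j x)).
Proof.
move=> h; apply: det_closed => i j.
rewrite (_ : (fun x => _) = M i j); first by apply: h; apply/ltP.
by apply: functional_extensionality => x; rewrite mxE.
Qed.

Lemma adj5_closed (M : nat -> nat -> X -> C) (a b : nat) :
  (forall i j, (i < 5)%coq_nat -> (j < 5)%coq_nat -> P (M i j)) ->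
  P (fun x => adj5 (fun i j => M i j x) a b).
Proof.
move=> h.
rewrite (_ : (fun x => _) = fun x => ((-1) ^+ ((inord b : 'I_5) + (inord a : 'I_5)) *
   \det (row' (inord b) (col' (inord a) (mx5 (fun i j => M i j x)))))%R).
  apply: (Pm (f := fun _ => _) (g := fun x => \det _)); first exact: Pc.
  apply: det_closed => i j.
  set i' := lift (inord b) i; set j' := lift (inord a) j.
  rewrite (_ : (fun x => _) = M i' j'); first by apply: h; apply/ltP.
  by apply: functional_extensionality => x; rewrite !mxE.
by apply: functional_extensionality => x; rewrite /adj5 mxE.
Qed.
End Closed.

(* The last two columns carry the 2x2 block [p3 r3; p4 r4]. *)
Lemma det5_bordered (p r : vec) :
  det5 (fun i j => if Nat.ltb j 3 then mat_id i j else if Nat.eqb j 3 then p i else r i)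
  = (p 3%N * r 4%N - r 3%N * p 4%N)%C.
Proof.
rewrite /det5; set M := mx5 _.
have e0 (i j : 'I_5) : (j < 3)%N -> M i j = if i == j then RtoC 1 else RtoC 0.
  move=> hj; rewrite mxE /mat_id; move/ltP/PeanoNat.Nat.ltb_lt: hj => ->.
  case: eqP => [->|h]; first by rewrite PeanoNat.Nat.eqb_refl.
  by case: PeanoNat.Nat.eqb_spec => // /val_inj.
have dcol n (A : 'M[C]_n.+1) : (forall i, A i ord0 = if i == ord0 then RtoC 1 else RtoC 0) ->
  \det A = \det (row' ord0 (col' ord0 A)).
  move=> hA; rewrite (expand_det_col A ord0) (bigD1 ord0) //= big1 ?addr0 => [|i /negbTE hi].
    by rewrite hA eqxx /cofactor addn0 expr0 mul1r; exact: Cmult_1_l.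
  by rewrite hA hi; exact: Cmult_0_l.
rewrite dcol => [|i]; last by rewrite e0.
rewrite dcol => [|i]; last by rewrite /M !mxE; case: i => [[|[|[|[|]]]] ?].
rewrite dcol => [|i]; last by rewrite /M !mxE; case: i => [[|[|[|]]] ?].
rewrite (expand_det_row _ ord0) !big_ord_recr big_ord0 /= /cofactor !det_mx11 !mxE /=.
by rewrite /bump /= expr0 expr1 mul1r add0r mulN1r mulrN.
Qed.

Lemma det5_scale_row0 (q : C) (M : mat) :
  det5 (fun i j => if Nat.eqb i 0 then (q * M i j)%C else M i j) = (q * det5 M)%C.
Proof.
rewrite /det5 (determinant_multilinear (i0 := ord0) (b := q) (B := mx5 M) (c := 0%R) (C := mx5 M)).
- by rewrite mul0r addr0.
- by apply/rowP => j; rewrite !mxE /= mul0r addr0.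
- by apply/matrixP => i j; rewrite !mxE.
- by apply/matrixP => i j; rewrite !mxE.
Qed.
End LinearAlgebra.

Export LinearAlgebra(det5, adj5, det5_ext, det5_mul, det5_tr, mat_mul_adj5, adj5_mat_mul, det5_0_kernel, det5_closed, adj5_closed, det5_bordered, det5_scale_row0).

Notation Cpow := Defs.Cpow.
Notation sigma := Defs.sigma.

(** * Complex derivatives and integrals along segments *)

Definition cd (f : C -> C) (z l : C) : Prop := @is_derive C_AbsRing C_NormedModule f z l.

Lemma locally_C (z : C) (P : C -> Prop) :
  locally (T := C_UniformSpace) z P <->
  exists d, 0 < d /\ forall w, Cmod (w - z) < d -> P w.
Proof.
  split.
  - intros [e He]. exists e. split; [apply cond_pos|].
    intros w Hw. apply He. apply (norm_compat1 (K := C_AbsRing) (V := C_NormedModule)).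
    exact Hw.
  - intros [d [Hd H]].
    destruct (@locally_le_locally_norm C_AbsRing C_NormedModule z P) as [e He].
    { exists (mkposreal d Hd). intros w Hw. apply H. exact Hw. }
    exists e. exact He.
Qed.

Lemma cd_eps (f : C -> C) (z l : C) :
  cd f z l <->
  forall eps, 0 < eps -> exists d, 0 < d /\
    forall w, Cmod (w - z) < d -> Cmod (f w - f z - l * (w - z)) <= eps * Cmod (w - z).
Proof.
  split.
  - intros [_ H] eps Heps.
    specialize (H z (fun P HP => HP) (mkposreal eps Heps)).
    destruct H as [d Hd]. exists d. split; [apply cond_pos|].
    intros w Hw. specialize (Hd w Hw).
    replace (f w - f z - l * (w - z))%C with (f w + - f z + - ((w + - z) * l))%C by ring.
    exact Hd.
  - intros H. split; [apply is_linear_scal_l|].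
    intros x Hx. apply (@is_filter_lim_locally_unique C_AbsRing (AbsRing_NormedModule C_AbsRing)) in Hx. subst x.
    intros eps. destruct (H eps (cond_pos eps)) as [d [Hd H']].
    exists (mkposreal d Hd). intros w Hw.
    specialize (H' w Hw).
    replace (f w - f z - l * (w - z))%C with (f w + - f z + - ((w + - z) * l))%C in H' by ring.
    exact H'.
Qed.

Definition ccont (f : C -> C) (z : C) :=
  forall eps, 0 < eps -> exists d, 0 < d /\
    forall w, Cmod (w - z) < d -> Cmod (f w - f z) < eps.

Lemma cd_cont (f : C -> C) (z l : C) : cd f z l -> ccont f z.
Proof.
  intros H eps Heps.
  destruct (proj1 (cd_eps f z l) H 1 Rlt_0_1) as [d [Hd H']].
  pose proof (Cmod_ge_0 l) as Hl.
  exists (Rmin d (eps / (2 + Cmod l))).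
  assert (0 < eps / (2 + Cmod l)) by (apply Rdiv_lt_0_compat; lra).
  split; [apply Rmin_pos; lra|].
  intros w Hw.
  assert (H1 := H' w (Rlt_le_trans _ _ _ Hw (Rmin_l _ _))).
  assert (H2 : Cmod (w - z) < eps / (2 + Cmod l)) by (eapply Rlt_le_trans; [exact Hw|apply Rmin_r]).
  replace (f w - f z)%C with ((f w - f z - l * (w - z)) + l * (w - z))%C by ring.
  eapply Rle_lt_trans; [apply Cmod_triangle|].
  rewrite Cmod_mult.
  apply (Rmult_lt_compat_r (2 + Cmod l)) in H2; [|lra].
  unfold Rdiv in H2. rewrite Rmult_assoc, Rinv_l, Rmult_1_r in H2 by lra.
  pose proof (Cmod_ge_0 (w - z)). nra.
Qed.

Lemma cd_ext_loc (f g : C -> C) (z l : C) d : 0 < d ->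
  (forall w, Cmod (w - z) < d -> f w = g w) -> cd f z l -> cd g z l.
Proof.
  intros Hd Hfg H. apply cd_eps. intros eps Heps.
  destruct (proj1 (cd_eps f z l) H eps Heps) as [d' [Hd' H']].
  exists (Rmin d d'). split; [apply Rmin_pos; lra|].
  intros w Hw.
  rewrite <- (Hfg w), <- (Hfg z).
  - apply H'. eapply Rlt_le_trans; [exact Hw|apply Rmin_r].
  - replace (z - z)%C with (RtoC 0) by ring. rewrite Cmod_0. lra.
  - eapply Rlt_le_trans; [exact Hw|apply Rmin_l].
Qed.

Lemma cd_ext (f g : C -> C) (z l : C) : (forall w, f w = g w) -> cd f z l -> cd g z l.
Proof. intros H. apply cd_ext_loc with 1; [lra|]. auto. Qed.

Lemma cd_const (c z : C) : cd (fun _ => c) z 0%C.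
Proof. exact (is_derive_const c z). Qed.

(** The product and chain rules are stated for C as a normed module over its own absolute ring,
    whereas [cderiv] refers to [C_NormedModule]. Both carry the same norm, so only the linearity
    record has to be rebuilt. *)
Lemma cd_absring (f : C -> C) (z l : C) :
  cd f z l <-> @is_derive C_AbsRing (AbsRing_NormedModule C_AbsRing) f z l.
Proof.
  split; intros [[L1 L2 L3] H]; (split; [split; [exact L1|exact L2|exact L3]|exact H]).
Qed.

Lemma cd_id z : cd (fun w => w) z 1%C.
Proof. apply cd_absring. exact (is_derive_id z). Qed.

Lemma cd_plus (f g : C -> C) (z l m : C) : cd f z l -> cd g z m -> cd (fun w => f w + g w)%C z (l + m)%C.
Proof. exact (is_derive_plus f g z l m). Qed.

Lemma cd_minus (f g : C -> C) (z l m : C) : cd f z l -> cd g z m -> cd (fun w => f w - g w)%C z (l - m)%C.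
Proof. exact (is_derive_minus f g z l m). Qed.

Lemma cd_mult (f g : C -> C) (z l m : C) : cd f z l -> cd g z m ->
  cd (fun w => f w * g w)%C z (l * g z + f z * m)%C.
Proof.
  intros H1 H2. apply cd_absring in H1, H2. apply cd_absring.
  exact (is_derive_mult f g z l m H1 H2 Cmult_comm).
Qed.

Lemma cd_scal (c : C) f z l : cd f z l -> cd (fun w => c * f w)%C z (c * l)%C.
Proof.
  intros H. replace (c * l)%C with (0 * f z + c * l)%C by ring.
  apply cd_mult; [apply cd_const|exact H].
Qed.

Lemma cd_comp (f g : C -> C) (z l m : C) : cd f (g z) l -> cd g z m -> cd (fun w => f (g w)) z (m * l)%C.
Proof.
  intros H1 H2. apply cd_absring in H2.
  exact (@is_derive_comp C_AbsRing C_NormedModule f g z l m H1 H2).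
Qed.

Lemma cd_eq (f : C -> C) (z l m : C) : l = m -> cd f z l -> cd f z m.
Proof. intros ->; auto. Qed.

Lemma cd_inv0 (z : C) : z <> 0%C -> cd Cinv z (- / (z * z))%C.
Proof.
  intros Hz. apply cd_eps. intros eps Heps.
  assert (Hm : 0 < Cmod z) by (apply (proj1 (Cmod_gt_0 _)); exact Hz).
  set (m := Cmod z) in *.
  (* The first radius keeps |w| > m/2; the second makes the exact remainder |w - z|^2 / (|w| m^2) at
     most eps |w - z|. *)
  exists (Rmin (m / 2) (eps * m ^ 3 / 2)).
  assert (0 < eps * m ^ 3 / 2).
  { apply Rdiv_lt_0_compat; [|lra]. apply Rmult_lt_0_compat; [lra|]. apply pow_lt; lra. }
  split; [apply Rmin_pos; lra|].
  intros w Hw.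
  assert (H1 : Cmod (w - z) < m / 2) by (eapply Rlt_le_trans; [exact Hw|apply Rmin_l]).
  assert (H2 : Cmod (w - z) < eps * m ^ 3 / 2) by (eapply Rlt_le_trans; [exact Hw|apply Rmin_r]).
  assert (Hwm : m / 2 < Cmod w).
  { assert (m <= Cmod w + Cmod (w - z)).
    { unfold m. replace z with (w + - (w - z))%C at 1 by ring.
      eapply Rle_trans; [apply Cmod_triangle|]. rewrite Cmod_opp. lra. }
    lra. }
  assert (Hw0 : w <> 0%C) by (intros ->; rewrite Cmod_0 in Hwm; lra).
  replace (/ w - / z - - / (z * z) * (w - z))%C
    with ((w - z) * (w - z) * / (w * (z * z)))%C by (field; auto).
  rewrite !Cmod_mult, Cmod_inv, !Cmod_mult by (repeat apply Cmult_neq_0; assumption). fold m.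
  set (D := Cmod (w - z)) in *. assert (0 <= D) by apply Cmod_ge_0.
  assert (Hp : 0 < Cmod w * (m * m)) by (repeat apply Rmult_lt_0_compat; lra).
  apply (Rmult_le_reg_r (Cmod w * (m * m))); [exact Hp|].
  rewrite Rmult_assoc, Rinv_l, Rmult_1_r by lra.
  apply Rle_trans with (D * (eps * m ^ 3 / 2)); [nra|].
  replace (eps * D * (Cmod w * (m * m))) with (D * (eps * (m * m) * Cmod w)) by ring.
  apply Rmult_le_compat_l; [lra|].
  replace (eps * m ^ 3 / 2) with (eps * (m * m) * (m / 2)) by field.
  apply Rmult_le_compat_l; nra.
Qed.

Lemma cd_inv (f : C -> C) (z l : C) : f z <> 0%C -> cd f z l -> cd (fun w => / f w)%C z (- l / (f z * f z))%C.
Proof.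
  intros H0 H. apply cd_eq with (l * - / (f z * f z))%C.
  - field. auto.
  - apply (cd_comp Cinv f); [apply cd_inv0; auto|exact H].
Qed.

Lemma cd_div (f g : C -> C) (z l m : C) : g z <> 0%C -> cd f z l -> cd g z m ->
  cd (fun w => f w / g w)%C z ((l * g z - f z * m) / (g z * g z))%C.
Proof.
  intros H0 H1 H2.
  apply cd_eq with (l * / g z + f z * (- m / (g z * g z)))%C; [field; auto|].
  apply (cd_mult f (fun w => / g w)%C); [exact H1|apply cd_inv; auto].
Qed.

Lemma cd_unique (f : C -> C) (z l m : C) : cd f z l -> cd f z m -> l = m.
Proof.
  intros H1 H2.
  destruct (classic (l = m)) as [|Hn]; [auto|exfalso].
  assert (Hp : 0 < Cmod (l - m)).
  { apply (proj1 (Cmod_gt_0 _)). intros H. apply Hn.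
    replace l with ((l - m) + m)%C by ring. rewrite H. ring. }
  set (e := Cmod (l - m)) in *.
  destruct (proj1 (cd_eps _ _ _) H1 (e / 3)) as [d1 [Hd1 K1]]; [lra|].
  destruct (proj1 (cd_eps _ _ _) H2 (e / 3)) as [d2 [Hd2 K2]]; [lra|].
  set (d := Rmin d1 d2 / 2).
  assert (Hd : 0 < Rmin d1 d2) by (apply Rmin_pos; lra).
  pose proof (Rmin_l d1 d2). pose proof (Rmin_r d1 d2).
  assert (Hz : Cmod ((z + RtoC d) - z) = d).
  { replace ((z + RtoC d) - z)%C with (RtoC d) by ring. rewrite Cmod_R.
    apply Rabs_pos_eq. unfold d; lra. }
  specialize (K1 (z + RtoC d)%C). specialize (K2 (z + RtoC d)%C).
  rewrite Hz in K1, K2.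
  assert (d < d1 /\ d < d2) as [? ?] by (unfold d; lra).
  specialize (K1 ltac:(auto)). specialize (K2 ltac:(auto)).
  assert (Hbd : Cmod ((l - m) * RtoC d) <= e / 3 * d + e / 3 * d).
  { replace ((l - m) * RtoC d)%C with
      ((f (z + RtoC d) - f z - m * (z + RtoC d - z)) +
       - (f (z + RtoC d) - f z - l * (z + RtoC d - z)))%C by ring.
    eapply Rle_trans; [apply Cmod_triangle|]. rewrite Cmod_opp. lra. }
  rewrite Cmod_mult, Cmod_R in Hbd. fold e in Hbd.
  rewrite Rabs_pos_eq in Hbd by (unfold d; lra).
  assert (0 < d) by (unfold d; lra). nra.
Qed.

Lemma cderiv_eq f z l : cd f z l -> cderiv f z = l.
Proof.
  intros H. unfold cderiv.
  apply (cd_unique f z); [|exact H].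
  apply (epsilon_spec (inhabits (RtoC 0)) (fun l : C => cd f z l)).
  exists l; exact H.
Qed.

(** * Complex-valued functions of a real variable and their integrals *)

Notation CV := C_R_CompleteNormedModule.

Definition rcont (f : R -> C) (t : R) :=
  forall eps, 0 < eps -> exists d, 0 < d /\
    forall s, Rabs (s - t) < d -> Cmod (f s - f t) < eps.

Definition rd (f : R -> C) (t : R) (l : C) : Prop :=
  @is_derive R_AbsRing C_R_NormedModule f t l.

Lemma norm_CV (x : C) : @norm R_AbsRing CV x = Cmod x.
Proof.
  change (sqrt (Rabs (fst x) ^ 2 + Rabs (snd x) ^ 2) = Cmod x).
  rewrite !pow2_abs. reflexivity.
Qed.

Lemma rcont_continuous (f : R -> C) (t : R) : rcont f t -> @continuous R_UniformSpace CV f t.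
Proof.
  intros H P HP. apply (proj1 (locally_C (f t) P)) in HP.
  destruct HP as [e [He HP]]. destruct (H e He) as [d [Hd Hd']].
  exists (mkposreal d Hd). intros s Hs. apply HP. apply Hd'. exact Hs.
Qed.

Lemma rd_eps (f : R -> C) (t : R) (l : C) :
  rd f t l <->
  forall eps, 0 < eps -> exists d, 0 < d /\
    forall s, Rabs (s - t) < d ->
      Cmod (f s - f t - l * RtoC (s - t)) <= eps * Rabs (s - t).
Proof.
  assert (Hs : forall s, (f s - f t - l * RtoC (s - t))%C =
    @minus CV (minus (f s) (f t)) (scal (minus s t) l)).
  { intros s. destruct l as [l1 l2]. destruct (f s), (f t).
    cbv [Cminus Cplus Copp Cmult RtoC minus plus opp scal mult]. simpl.
    cbv [mult plus opp]. simpl. cbv [prod_plus prod_opp prod_scal scal plus opp mult]. simpl. cbv [mult]. simpl. unfold Rminus. f_equal; ring. }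
  split.
  - intros [_ H] eps Heps.
    destruct (H t (fun P HP => HP) (mkposreal eps Heps)) as [d Hd].
    exists d. split; [apply cond_pos|].
    intros s Hs'. specialize (Hd s Hs'). rewrite Hs, <- norm_CV. exact Hd.
  - intros H. split; [apply is_linear_scal_l|].
    intros x Hx. apply (@is_filter_lim_locally_unique R_AbsRing R_NormedModule) in Hx. subst x.
    intros eps. destruct (H eps (cond_pos eps)) as [d [Hd H']].
    exists (mkposreal d Hd). intros s Hs'. specialize (H' s Hs').
    rewrite Hs, <- norm_CV in H'. exact H'.
Qed.

Lemma Cmod_le_abs (a b : R) : Cmod (a, b) <= Rabs a + Rabs b.
Proof.
  replace (a, b) with (RtoC a + Ci * RtoC b)%C
    by (cbv [RtoC Ci Cplus Cmult]; simpl; f_equal; ring).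
  eapply Rle_trans; [apply Cmod_triangle|].
  rewrite Cmod_mult, !Cmod_R.
  replace (Cmod Ci) with 1; [lra|].
  unfold Cmod, Ci. simpl. rewrite !Rmult_0_l, Rmult_1_l, Rplus_0_l. rewrite Rmult_1_l. symmetry. apply sqrt_1.
Qed.

Lemma rd_pair (f g : R -> R) (t l m : R) :
  is_derive f t l -> is_derive g t m -> rd (fun s => (f s, g s)) t (l, m).
Proof.
  intros H1 H2. apply rd_eps. intros eps Heps.
  destruct H1 as [_ H1]. destruct H2 as [_ H2].
  assert (He : 0 < eps / 2) by lra.
  destruct (H1 t (fun P HP => HP) (mkposreal _ He)) as [d1 K1].
  destruct (H2 t (fun P HP => HP) (mkposreal _ He)) as [d2 K2].
  exists (Rmin d1 d2). split; [apply Rmin_pos; apply cond_pos|].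
  intros s Hs.
  assert (S1 := K1 s (Rlt_le_trans _ _ _ Hs (Rmin_l _ _))).
  assert (S2 := K2 s (Rlt_le_trans _ _ _ Hs (Rmin_r _ _))).
  cbv [norm minus plus opp scal mult] in S1, S2. simpl in S1, S2.
  cbv [abs plus opp mult] in S1, S2. simpl in S1, S2.
  replace ((f s, g s) - (f t, g t) - (l, m) * RtoC (s - t))%C
    with (f s + - f t + - ((s + - t) * l), g s + - g t + - ((s + - t) * m))
    by (cbv [RtoC Cminus Cplus Copp Cmult]; simpl; f_equal; ring).
  eapply Rle_trans; [apply Cmod_le_abs|].
  unfold Rminus. lra.
Qed.

Lemma rd_comp (F : C -> C) (g : R -> C) (t : R) (l m : C) :
  cd F (g t) l -> rd g t m -> rd (fun s => F (g s)) t (m * l)%C.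
Proof.
  intros H1 H2. apply rd_eps. intros eps Heps.
  pose proof (Cmod_ge_0 l) as Hl. pose proof (Cmod_ge_0 m) as Hm.
  set (e1 := eps / (2 * (2 + Cmod m))).
  set (e2 := Rmin 1 (eps / (2 * (1 + Cmod l)))).
  assert (He1 : 0 < e1) by (apply Rdiv_lt_0_compat; lra).
  assert (He2 : 0 < e2) by (apply Rmin_pos; [lra|apply Rdiv_lt_0_compat; lra]).
  destruct (proj1 (cd_eps _ _ _) H1 e1 He1) as [d1 [Hd1 K1]].
  destruct (proj1 (rd_eps _ _ _) H2 e2 He2) as [d2 [Hd2 K2]].
  exists (Rmin d2 (d1 / (2 + Cmod m))).
  split; [apply Rmin_pos; [lra|apply Rdiv_lt_0_compat; lra]|].
  intros s Hs.
  assert (Hs2 := K2 s (Rlt_le_trans _ _ _ Hs (Rmin_l _ _))).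
  assert (Hs1 : Rabs (s - t) < d1 / (2 + Cmod m)) by (eapply Rlt_le_trans; [exact Hs|apply Rmin_r]).
  set (a := Rabs (s - t)) in *. assert (Ha : 0 <= a) by apply Rabs_pos.
  assert (E1 : e2 <= 1) by apply Rmin_l.
  assert (E2 : e2 <= eps / (2 * (1 + Cmod l))) by apply Rmin_r.
  assert (Hg : Cmod (g s - g t) <= (1 + Cmod m) * a).
  { replace (g s - g t)%C with ((g s - g t - m * RtoC (s - t)) + m * RtoC (s - t))%C by ring.
    eapply Rle_trans; [apply Cmod_triangle|]. rewrite Cmod_mult, Cmod_R. fold a. nra. }
  assert (Hgd : Cmod (g s - g t) < d1).
  { apply (Rmult_lt_compat_r (2 + Cmod m)) in Hs1; [|lra].
    unfold Rdiv in Hs1. rewrite Rmult_assoc, Rinv_l, Rmult_1_r in Hs1 by lra. nra. }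
  specialize (K1 _ Hgd).
  replace (F (g s) - F (g t) - m * l * RtoC (s - t))%C
    with ((F (g s) - F (g t) - l * (g s - g t)) + l * (g s - g t - m * RtoC (s - t)))%C by ring.
  eapply Rle_trans; [apply Cmod_triangle|]. rewrite Cmod_mult.
  assert (G1 : e1 * (2 + Cmod m) = eps / 2) by (unfold e1; field; lra).
  assert (G2 : e2 * (1 + Cmod l) <= eps / 2).
  { apply Rle_trans with (eps / (2 * (1 + Cmod l)) * (1 + Cmod l)).
    - apply Rmult_le_compat_r; lra.
    - right. field. lra. }
  assert (T1 : e1 * Cmod (g s - g t) <= eps / 2 * a).
  { apply Rle_trans with (e1 * ((1 + Cmod m) * a)); [apply Rmult_le_compat_l; lra|].
    rewrite <- G1. rewrite Rmult_assoc. apply Rmult_le_compat_l; nra. }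
  assert (T2 : Cmod l * Cmod (g s - g t - m * RtoC (s - t)) <= eps / 2 * a).
  { apply Rle_trans with (Cmod l * (e2 * a)); [apply Rmult_le_compat_l; lra|].
    rewrite <- Rmult_assoc. apply Rmult_le_compat_r; nra. }
  lra.
Qed.

Lemma Cmod_Im_le (z : C) : Rabs (Im z) <= Cmod z.
Proof.
  destruct z as [x y]. simpl. eapply Rle_trans; [|apply Rmax_Cmod]. apply Rmax_r.
Qed.

Lemma Cmod_sub_sym (a b : C) : Cmod (a - b) = Cmod (b - a).
Proof. rewrite <- Cmod_opp. f_equal. ring. Qed.

Lemma Cmod_sub_triangle (a b c : C) : Cmod (a - c) <= Cmod (a - b) + Cmod (b - c).
Proof. replace (a - c)%C with ((a - b) + (b - c))%C by ring. apply Cmod_triangle. Qed.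

Lemma le_eps (a b : R) : (forall e, 0 < e -> a <= b + e) -> a <= b.
Proof. intros H. apply Rnot_lt_le. intros Hlt. specialize (H ((a - b) / 2)). lra. Qed.

Lemma pow_lim0 (t e : R) : 0 <= t < 1 -> 0 < e -> exists n, forall m, (n <= m)%nat -> t ^ m < e.
Proof.
  intros Ht He. destruct (pow_lt_1_zero t) with (y := e) as [n Hn]; [rewrite Rabs_pos_eq; lra|lra|].
  exists n. intros m Hm. eapply Rle_lt_trans; [apply Rle_abs|]. apply Hn. lia.
Qed.

Lemma geometric_increments (u : nat -> C) (K t : R) : 0 <= K -> 0 <= t < 1 ->
  (forall n, Cmod (u (S n) - u n) <= K * t ^ n) ->
  forall k n, Cmod (u (n + k)%nat - u n) <= K * t ^ n / (1 - t).
Proof.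
  intros HK Ht H.
  (* The factor 1 - t^k records the partial geometric sum exactly, which is what lets the induction
     on k close. *)
  assert (G : forall k n, Cmod (u (n + k)%nat - u n) <= K * t ^ n * (1 - t ^ k) / (1 - t)).
  { induction k; intros n.
    - rewrite Nat.add_0_r. replace (u n - u n)%C with (RtoC 0) by ring. rewrite Cmod_0. simpl.
      right. field. lra.
    - eapply Rle_trans; [apply Cmod_sub_triangle with (b := u (n + k)%nat)|].
      rewrite Nat.add_succ_r. specialize (IHk n). specialize (H (n + k)%nat).
      rewrite pow_add in H.
      apply Rle_trans with (K * (t ^ n * t ^ k) + K * t ^ n * (1 - t ^ k) / (1 - t)); [lra|].
      right. simpl. field. lra. }
  intros k n. eapply Rle_trans; [apply G|].
  unfold Rdiv. apply Rmult_le_compat_r; [left; apply Rinv_0_lt_compat; lra|].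
  rewrite <- (Rmult_1_r (K * t ^ n)) at 2. apply Rmult_le_compat_l.
  - apply Rmult_le_pos; [lra|apply pow_le; lra].
  - assert (0 <= t ^ k) by (apply pow_le; lra). lra.
Qed.

Lemma geometric_limit (u : nat -> C) (K t : R) : 0 <= K -> 0 <= t < 1 ->
  (forall n, Cmod (u (S n) - u n) <= K * t ^ n) ->
  exists l, forall n, Cmod (u n - l) <= K * t ^ n / (1 - t).
Proof.
  intros HK Ht H. pose proof (geometric_increments u K t HK Ht H) as G.
  assert (Gc : forall e, 0 < e -> exists N, forall n m, (N <= n)%nat -> (N <= m)%nat ->
     Cmod (u n - u m) < e).
  { intros e He.
    destruct (pow_lim0 t (e * (1 - t) / (2 * (K + 1)))) as [N HN]; [lra| |].
    { apply Rdiv_lt_0_compat; [apply Rmult_lt_0_compat|]; lra. }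
    exists N. intros n m Hn Hm.
    specialize (HN N (le_n N)).
    assert (B : K * t ^ N / (1 - t) < e / 2).
    { apply (Rmult_lt_reg_r (1 - t)); [lra|].
      unfold Rdiv at 1. rewrite Rmult_assoc, Rinv_l, Rmult_1_r by lra.
      apply Rle_lt_trans with ((K + 1) * t ^ N).
      - apply Rmult_le_compat_r; [apply pow_le; lra|lra].
      - apply Rlt_le_trans with ((K + 1) * (e * (1 - t) / (2 * (K + 1)))).
        + apply Rmult_lt_compat_l; lra.
        + right. field. lra. }
    eapply Rle_lt_trans; [apply Cmod_sub_triangle with (b := u N)|].
    pose proof (G (n - N)%nat N) as Gn. pose proof (G (m - N)%nat N) as Gm.
    replace (N + (n - N))%nat with n in Gn by lia.
    replace (N + (m - N))%nat with m in Gm by lia.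
    rewrite (Cmod_sub_sym (u N)). lra. }
  destruct (Rcomplete.R_complete (fun n => Re (u n))) as [x Hx].
  { intros e He. destruct (Gc e He) as [N HN]. exists N. intros n m Hn Hm.
    unfold Rdist. eapply Rle_lt_trans; [|apply (HN n m Hn Hm)].
    eapply Rle_trans; [|apply re_le_Cmod]. right. reflexivity. }
  destruct (Rcomplete.R_complete (fun n => Im (u n))) as [y Hy].
  { intros e He. destruct (Gc e He) as [N HN]. exists N. intros n m Hn Hm.
    unfold Rdist. eapply Rle_lt_trans; [|apply (HN n m Hn Hm)].
    eapply Rle_trans; [|apply Cmod_Im_le]. right. reflexivity. }
  exists (x, y). intros n. apply le_eps. intros e He.
  destruct (Hx (e / 2)) as [N1 H1]; [lra|]. destruct (Hy (e / 2)) as [N2 H2]; [lra|].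
  set (k := (N1 + N2)%nat).
  eapply Rle_trans; [apply Cmod_sub_triangle with (b := u (n + k)%nat)|].
  rewrite Cmod_sub_sym. apply Rplus_le_compat; [apply G|].
  specialize (H1 (n + k)%nat ltac:(unfold k; lia)). specialize (H2 (n + k)%nat ltac:(unfold k; lia)).
  unfold Rdist in H1, H2. destruct (u (n + k)%nat) as [a b]. simpl in H1, H2.
  replace ((a, b) - (x, y))%C with (a - x, b - y) by reflexivity.
  eapply Rle_trans; [apply Cmod_le_abs|]. lra.
Qed.

Definition cint (f : R -> C) (a b : R) : C := @RInt CV f a b.
Definition rcont_on (f : R -> C) (a b : R) := forall t, a <= t <= b -> rcont f t.

Lemma ex_cint f a b : a <= b -> rcont_on f a b -> @ex_RInt CV f a b.
Proof.
  intros Hab H. apply ex_RInt_continuous. intros t Ht.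
  rewrite Rmin_left, Rmax_right in Ht by lra. apply rcont_continuous. auto.
Qed.

Lemma cint_is f a b : a <= b -> rcont_on f a b -> @is_RInt CV f a b (cint f a b).
Proof. intros Hab H. apply (@RInt_correct CV). apply ex_cint; auto. Qed.

Lemma cint_unique f a b (l : C) : @is_RInt CV f a b l -> cint f a b = l.
Proof. exact (@is_RInt_unique CV f a b l). Qed.

Lemma cint_ext f g a b : a <= b -> (forall t, a <= t <= b -> f t = g t) -> cint f a b = cint g a b.
Proof.
  intros Hab H. apply (@RInt_ext CV). intros t Ht.
  rewrite Rmin_left, Rmax_right in Ht by lra. apply H. lra.
Qed.

Lemma RtoC_scal (u : R) (z : C) : @scal R_AbsRing CV u z = (RtoC u * z)%C.
Proof.
  apply injective_projections.
  - change (u * fst z = u * fst z - 0 * snd z). ring.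
  - change (u * snd z = u * snd z + 0 * fst z). ring.
Qed.

Lemma cint_const (c : C) a b : cint (fun _ => c) a b = (RtoC (b - a) * c)%C.
Proof.
  apply cint_unique.
  replace (RtoC (b - a) * c)%C with (@scal R_AbsRing CV (b - a) c).
  - apply (@is_RInt_const CV).
  - apply RtoC_scal.
Qed.

Lemma cint_plus f g a b : a <= b -> rcont_on f a b -> rcont_on g a b ->
  cint (fun t => f t + g t)%C a b = (cint f a b + cint g a b)%C.
Proof.
  intros Hab Hf Hg. apply cint_unique.
  apply (@is_RInt_plus CV f g a b (cint f a b) (cint g a b)); apply cint_is; auto.
Qed.

(** The integral is only R-linear by construction, so a complex factor is moved out through real and
    imaginary parts. *)
Lemma cint_scal (c : C) f a b : a <= b -> rcont_on f a b ->
  cint (fun t => c * f t)%C a b = (c * cint f a b)%C.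
Proof.
  intros Hab Hf. apply cint_unique.
  pose proof (cint_is f a b Hab Hf) as H.
  pose proof (@is_RInt_fct_extend_fst R_NormedModule R_NormedModule f a b _ H) as H1.
  pose proof (@is_RInt_fct_extend_snd R_NormedModule R_NormedModule f a b _ H) as H2.
  destruct c as [x y]. set (I := cint f a b) in *.
  apply (@is_RInt_fct_extend_pair R_NormedModule R_NormedModule (fun t => ((x, y) * f t)%C) a b
    (x * fst I - y * snd I) (x * snd I + y * fst I)).
  - apply (@is_RInt_minus R_NormedModule (fun t => x * fst (f t)) (fun t => y * snd (f t)));
      apply (@is_RInt_scal R_NormedModule); assumption.
  - apply (@is_RInt_plus R_NormedModule (fun t => x * snd (f t)) (fun t => y * fst (f t)));
      apply (@is_RInt_scal R_NormedModule); assumption.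
Qed.

Lemma rcont_const (c : C) t : rcont (fun _ => c) t.
Proof.
  intros e He. exists 1. split; [lra|]. intros s _.
  replace (c - c)%C with (RtoC 0) by ring. rewrite Cmod_0. auto.
Qed.

Lemma rcont_plus f g t : rcont f t -> rcont g t -> rcont (fun s => f s + g s)%C t.
Proof.
  intros H1 H2 e He. destruct (H1 (e / 2)) as [d1 [Hd1 K1]]; [lra|].
  destruct (H2 (e / 2)) as [d2 [Hd2 K2]]; [lra|].
  exists (Rmin d1 d2). split; [apply Rmin_pos; auto|]. intros s Hs.
  specialize (K1 s (Rlt_le_trans _ _ _ Hs (Rmin_l _ _))).
  specialize (K2 s (Rlt_le_trans _ _ _ Hs (Rmin_r _ _))).
  replace (f s + g s - (f t + g t))%C with ((f s - f t) + (g s - g t))%C by ring.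
  eapply Rle_lt_trans; [apply Cmod_triangle|]. lra.
Qed.

Lemma rcont_comp (F : C -> C) g t : ccont F (g t) -> rcont g t -> rcont (fun s => F (g s)) t.
Proof.
  intros H1 H2 e He. destruct (H1 e He) as [d [Hd K1]].
  destruct (H2 d Hd) as [d2 [Hd2 K2]]. exists d2. split; [auto|]. intros s Hs. auto.
Qed.

Lemma rd_cont f t l : rd f t l -> rcont f t.
Proof.
  intros H e He. destruct (proj1 (rd_eps _ _ _) H 1 Rlt_0_1) as [d [Hd K]].
  pose proof (Cmod_ge_0 l) as Hl.
  exists (Rmin d (e / (2 + Cmod l))).
  split; [apply Rmin_pos; [lra|apply Rdiv_lt_0_compat; lra]|].
  intros s Hs.
  specialize (K s (Rlt_le_trans _ _ _ Hs (Rmin_l _ _))).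
  assert (H2 : Rabs (s - t) < e / (2 + Cmod l)) by (eapply Rlt_le_trans; [exact Hs|apply Rmin_r]).
  replace (f s - f t)%C with ((f s - f t - l * RtoC (s - t)) + l * RtoC (s - t))%C by ring.
  eapply Rle_lt_trans; [apply Cmod_triangle|]. rewrite Cmod_mult, Cmod_R.
  apply (Rmult_lt_compat_r (2 + Cmod l)) in H2; [|lra].
  unfold Rdiv in H2. rewrite Rmult_assoc, Rinv_l, Rmult_1_r in H2 by lra.
  pose proof (Rabs_pos (s - t)). nra.
Qed.

Lemma ccont_scal (c : C) (f : C -> C) z : ccont f z -> ccont (fun w => c * f w)%C z.
Proof.
  intros H e He. pose proof (Cmod_ge_0 c) as Hc.
  destruct (H (e / (1 + Cmod c))) as [d [Hd K]]; [apply Rdiv_lt_0_compat; lra|].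
  exists d. split; [auto|]. intros w Hw. specialize (K w Hw).
  replace (c * f w - c * f z)%C with (c * (f w - f z))%C by ring. rewrite Cmod_mult.
  apply (Rmult_lt_compat_r (1 + Cmod c)) in K; [|lra].
  unfold Rdiv in K. rewrite Rmult_assoc, Rinv_l, Rmult_1_r in K by lra.
  pose proof (Cmod_ge_0 (f w - f z)). nra.
Qed.

Lemma rcont_scal (c : C) f t : rcont f t -> rcont (fun s => c * f s)%C t.
Proof.
  intros H. apply (rcont_comp (fun w => c * w)%C f); [|exact H].
  apply ccont_scal. apply cd_cont with (RtoC 1). apply cd_id.
Qed.

Lemma rcont_mult f g t : rcont f t -> rcont g t -> rcont (fun s => f s * g s)%C t.
Proof.
  intros H1 H2 e He.
  set (A := Cmod (f t)). set (B := Cmod (g t)).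
  assert (HA : 0 <= A) by apply Cmod_ge_0. assert (HB : 0 <= B) by apply Cmod_ge_0.
  set (x := Rmin 1 (e / (2 * (2 + A + B)))).
  assert (Hx : 0 < x) by (apply Rmin_pos; [lra|apply Rdiv_lt_0_compat; lra]).
  assert (Hx1 : x <= 1) by apply Rmin_l.
  assert (Hx2 : x * (2 + A + B) <= e / 2).
  { apply Rle_trans with (e / (2 * (2 + A + B)) * (2 + A + B)).
    - apply Rmult_le_compat_r; [lra|apply Rmin_r].
    - right. field. lra. }
  destruct (H1 x Hx) as [d1 [Hd1 K1]]. destruct (H2 x Hx) as [d2 [Hd2 K2]].
  exists (Rmin d1 d2). split; [apply Rmin_pos; auto|]. intros s Hs.
  specialize (K1 s (Rlt_le_trans _ _ _ Hs (Rmin_l _ _))).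
  specialize (K2 s (Rlt_le_trans _ _ _ Hs (Rmin_r _ _))).
  replace (f s * g s - f t * g t)%C
    with ((f s - f t) * (g s - g t) + ((f s - f t) * g t + f t * (g s - g t)))%C by ring.
  eapply Rle_lt_trans; [apply Cmod_triangle|]. rewrite Cmod_mult.
  eapply Rle_lt_trans; [apply Rplus_le_compat_l, Cmod_triangle|]. rewrite !Cmod_mult.
  fold A B. pose proof (Cmod_ge_0 (f s - f t)). pose proof (Cmod_ge_0 (g s - g t)).
  set (p := Cmod (f s - f t)) in *. set (q := Cmod (g s - g t)) in *.
  assert (p * q <= x) by nra. assert (p * B <= x * B) by nra. assert (A * q <= x * A) by nra.
  nra.
Qed.

Lemma cint_bound f a b M : a <= b -> rcont_on f a b ->
  (forall t, a <= t <= b -> Cmod (f t) <= M) -> Cmod (cint f a b) <= M * (b - a).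
Proof.
  intros Hab Hf HM. rewrite <- norm_CV.
  apply (@norm_RInt_le CV f (fun _ => M) a b).
  - exact Hab.
  - intros t Ht. rewrite norm_CV. auto.
  - apply cint_is; auto.
  - replace (M * (b - a)) with (@scal R_AbsRing R_NormedModule (b - a) M)
      by (cbv [scal]; simpl; cbv [mult]; simpl; ring).
    apply (@is_RInt_const R_NormedModule).
Qed.

Lemma cint_chasles f a b c : a <= b -> b <= c -> rcont_on f a c ->
  (cint f a b + cint f b c)%C = cint f a c.
Proof.
  intros H1 H2 H. apply (@RInt_Chasles CV f a b c); apply ex_cint; auto; intros t Ht; apply H; lra.
Qed.

Lemma cint_ftc F f a b : a <= b -> (forall t, a <= t <= b -> rd F t (f t)) -> rcont_on f a b ->
  cint f a b = (F b - F a)%C.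
Proof.
  intros Hab HF Hf. apply cint_unique. apply (@is_RInt_derive CV F f).
  - intros t Ht. rewrite Rmin_left, Rmax_right in Ht by lra. apply HF. auto.
  - intros t Ht. rewrite Rmin_left, Rmax_right in Ht by lra. apply rcont_continuous. auto.
Qed.

Lemma cint_lin f (u v a b : R) : a <= b -> @ex_RInt CV f (u * a + v) (u * b + v) ->
  cint (fun t => RtoC u * f (u * t + v)%R)%C a b = cint f (u * a + v) (u * b + v).
Proof.
  intros Hab H. unfold cint. rewrite <- (@RInt_comp_lin CV f u v a b H).
  apply cint_ext; [auto|]. intros t _. symmetry. apply RtoC_scal.
Qed.

Lemma cd_to (f : C -> C) (z l m : C) : cd f z l -> l = m -> cd f z m.
Proof. intros H <-; auto. Qed.

Lemma RtoC_neq_0 (x : R) : x <> 0 -> RtoC x <> RtoC 0.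
Proof. intros H E. apply H. exact (f_equal fst E). Qed.

(** * Integrals along segments and around triangles *)

Definition disc (R : R) (z : C) : Prop := Cmod z < R.

Definition seg (a b : C) (t : R) : C := (a + RtoC t * (b - a))%C.

Definition segI (f : C -> C) (a b : C) : C := ((b - a) * cint (fun t => f (seg a b t)) 0 1)%C.

Definition tri (f : C -> C) (a b c : C) : C := (segI f a b + segI f b c + segI f c a)%C.

Lemma seg_rd a b t : rd (seg a b) t (b - a)%C.
Proof.
  apply rd_eps. intros e He. exists 1. split; [lra|]. intros s _.
  replace (seg a b s - seg a b t - (b - a) * RtoC (s - t))%C with (RtoC 0).
  - rewrite Cmod_0. apply Rmult_le_pos; [lra|apply Rabs_pos].
  - unfold seg. rewrite RtoC_minus. ring.
Qed.

Lemma Cmod_RtoC_pos x : 0 <= x -> Cmod (RtoC x) = x.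
Proof. intros H. rewrite Cmod_R. apply Rabs_pos_eq. auto. Qed.

Lemma seg_disc r a b t : Cmod a <= r -> Cmod b <= r -> 0 <= t <= 1 -> Cmod (seg a b t) <= r.
Proof.
  intros Ha Hb Ht. unfold seg.
  replace (a + RtoC t * (b - a))%C with (RtoC (1 - t) * a + RtoC t * b)%C
    by (rewrite RtoC_minus; ring).
  eapply Rle_trans; [apply Cmod_triangle|]. rewrite !Cmod_mult, !Cmod_RtoC_pos by lra. nra.
Qed.

Lemma seg_disc_lt r a b t : Cmod a < r -> Cmod b < r -> 0 <= t <= 1 -> Cmod (seg a b t) < r.
Proof.
  intros Ha Hb Ht. eapply Rle_lt_trans; [apply (seg_disc (Rmax (Cmod a) (Cmod b)))|].
  - apply Rmax_l. - apply Rmax_r. - auto. - apply Rmax_lub_lt; auto.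
Qed.

Definition cont_on (f : C -> C) (R : R) := forall z, disc R z -> ccont f z.
Definition hol (f : C -> C) (R : R) := forall z, disc R z -> exists l, cd f z l.

Lemma hol_cont f R : hol f R -> cont_on f R.
Proof. intros H z Hz. destruct (H z Hz) as [l Hl]. eapply cd_cont; eauto. Qed.

Lemma seg_rcont f R a b : cont_on f R -> disc R a -> disc R b ->
  rcont_on (fun t => f (seg a b t)) 0 1.
Proof.
  intros Hf Ha Hb t Ht. apply rcont_comp.
  - apply Hf. apply seg_disc_lt; auto.
  - eapply rd_cont. apply seg_rd.
Qed.

Lemma segI_bound f R a b M : cont_on f R -> disc R a -> disc R b ->
  (forall t, 0 <= t <= 1 -> Cmod (f (seg a b t)) <= M) ->
  Cmod (segI f a b) <= Cmod (b - a) * M.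
Proof.
  intros Hf Ha Hb H. unfold segI. rewrite Cmod_mult.
  apply Rmult_le_compat_l; [apply Cmod_ge_0|].
  replace M with (M * (1 - 0)) by ring. apply cint_bound; [lra| |auto].
  eapply seg_rcont; eauto.
Qed.

Lemma segI_primitive F f R a b : (forall z, disc R z -> cd F z (f z)) -> cont_on f R ->
  disc R a -> disc R b -> segI f a b = (F b - F a)%C.
Proof.
  intros HF Hf Ha Hb. unfold segI. rewrite <- cint_scal; [|lra|eapply seg_rcont; eauto].
  rewrite (cint_ftc (fun t => F (seg a b t))).
  - f_equal; [|f_equal]; f_equal; unfold seg; ring.
  - lra.
  - intros t Ht. apply rd_comp; [apply HF; apply seg_disc_lt; auto|apply seg_rd].
  - intros t Ht. apply rcont_scal. eapply seg_rcont; eauto.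
Qed.

Lemma segI_plus f g R a b : cont_on f R -> cont_on g R -> disc R a -> disc R b ->
  segI (fun z => f z + g z)%C a b = (segI f a b + segI g a b)%C.
Proof.
  intros Hf Hg Ha Hb. unfold segI. rewrite cint_plus; [ring|lra| |]; eapply seg_rcont; eauto.
Qed.

Lemma segI_affine (p q a b : C) :
  segI (fun z => p + q * z)%C a b = ((b - a) * (p + q * (a + b) / 2))%C.
Proof.
  set (F := fun z : C => (p * z + (q / 2) * (z * z))%C).
  rewrite (segI_primitive F _ (Cmod a + Cmod b + 1)).
  - unfold F. field.
  - intros z _. eapply cd_to; [apply cd_plus; apply cd_scal; [apply cd_id|apply cd_mult; apply cd_id]|].
    cbv beta. field.
  - intros z _. apply cd_cont with (0 + q * 1)%C.
    apply cd_plus; [apply cd_const|apply cd_scal, cd_id].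
  - unfold disc. pose proof (Cmod_ge_0 b). lra.
  - unfold disc. pose proof (Cmod_ge_0 a). lra.
Qed.

Definition mid (a b : C) : C := ((a + b) / 2)%C.

Lemma seg_mid a b : mid a b = seg a b (1 / 2).
Proof. unfold mid, seg. rewrite RtoC_div by lra. field. Qed.

Lemma disc_mid R a b : disc R a -> disc R b -> disc R (mid a b).
Proof. intros. rewrite seg_mid. apply seg_disc_lt; auto. lra. Qed.

Lemma segI_rev f R a b : cont_on f R -> disc R a -> disc R b -> segI f b a = (- segI f a b)%C.
Proof.
  intros Hf Ha Hb. unfold segI.
  assert (H : cint (fun t => f (seg b a t)) 0 1 = cint (fun t => f (seg a b t)) 0 1).
  { pose proof (@is_RInt_comp_lin CV (fun t => f (seg a b t)) (-1) 1 0 1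
      (opp (cint (fun t => f (seg a b t)) 0 1))) as H.
    apply cint_unique.
    rewrite <- (@opp_opp CV (cint (fun t => f (seg a b t)) 0 1)).
    replace (-1 * 0 + 1) with 1 in H by ring. replace (-1 * 1 + 1) with 0 in H by ring.
    specialize (H (@is_RInt_swap CV _ _ _ _ (cint_is _ 0 1 Rle_0_1 (seg_rcont f R a b Hf Ha Hb)))).
    apply (@is_RInt_opp CV) in H.
    eapply (@is_RInt_ext CV); [|exact H].
    intros t _. simpl. rewrite RtoC_scal.
    replace (seg a b (-1 * t + 1)) with (seg b a t).
    - change (- (RtoC (-1) * f (seg b a t)) = f (seg b a t))%C. ring.
    - unfold seg. rewrite RtoC_plus, RtoC_mult. ring. }
  rewrite H. ring.
Qed.

Lemma segI_mid f R a b : cont_on f R -> disc R a -> disc R b ->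
  segI f a b = (segI f a (mid a b) + segI f (mid a b) b)%C.
Proof.
  intros Hf Ha Hb. unfold segI.
  pose proof (seg_rcont f R a b Hf Ha Hb) as Hc.
  rewrite <- (cint_chasles _ 0 (1 / 2) 1) by (try lra; exact Hc).
  assert (E1 : cint (fun t => f (seg a (mid a b) t)) 0 1
     = (2 * cint (fun t => f (seg a b t)) 0 (1 / 2))%C).
  { pose proof (cint_lin (fun t => f (seg a b t)) (1 / 2) 0 0 1 Rle_0_1) as H.
    replace (1 / 2 * 0 + 0) with 0 in H by ring. replace (1 / 2 * 1 + 0) with (1 / 2) in H by ring.
    rewrite <- H.
    - rewrite <- cint_scal.
      + apply cint_ext; [lra|]. intros t _.
        replace (seg a b (1 / 2 * t + 0)) with (seg a (mid a b) t).
        * rewrite RtoC_div by lra. field.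
        * unfold seg, mid. rewrite Rplus_0_r, RtoC_mult, RtoC_div by lra. field.
      + lra.
      + intros t Ht. apply rcont_scal.
        apply (rcont_comp f (fun s => seg a b (1 / 2 * s + 0))).
        * apply Hf. apply seg_disc_lt; auto. lra.
        * intros e He. destruct (rd_cont _ _ _ (seg_rd a b (1 / 2 * t + 0)) e He) as [d [Hd K]].
          exists d. split; [auto|]. intros s Hs. apply K.
          replace (1 / 2 * s + 0 - (1 / 2 * t + 0)) with (1 / 2 * (s - t)) by ring.
          rewrite Rabs_mult, (Rabs_pos_eq (1 / 2)) by lra. pose proof (Rabs_pos (s - t)). lra.
    - apply ex_cint; [lra|]. intros t Ht; apply Hc; lra. }
  assert (E2 : cint (fun t => f (seg (mid a b) b t)) 0 1
     = (2 * cint (fun t => f (seg a b t)) (1 / 2) 1)%C).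
  { pose proof (cint_lin (fun t => f (seg a b t)) (1 / 2) (1 / 2) 0 1 Rle_0_1) as H.
    replace (1 / 2 * 0 + 1 / 2) with (1 / 2) in H by ring.
    replace (1 / 2 * 1 + 1 / 2) with 1 in H by field.
    rewrite <- H.
    - rewrite <- cint_scal.
      + apply cint_ext; [lra|]. intros t _.
        replace (seg a b (1 / 2 * t + 1 / 2)) with (seg (mid a b) b t).
        * rewrite RtoC_div by lra. field.
        * unfold seg, mid. rewrite RtoC_plus, RtoC_mult, RtoC_div by lra. field.
      + lra.
      + intros t Ht. apply rcont_scal.
        apply (rcont_comp f (fun s => seg a b (1 / 2 * s + 1 / 2))).
        * apply Hf. apply seg_disc_lt; auto. lra.
        * intros e He. destruct (rd_cont _ _ _ (seg_rd a b (1 / 2 * t + 1 / 2)) e He) as [d [Hd K]].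
          exists d. split; [auto|]. intros s Hs. apply K.
          replace (1 / 2 * s + 1 / 2 - (1 / 2 * t + 1 / 2)) with (1 / 2 * (s - t)) by ring.
          rewrite Rabs_mult, (Rabs_pos_eq (1 / 2)) by lra. pose proof (Rabs_pos (s - t)). lra.
    - apply ex_cint; [lra|]. intros t Ht; apply Hc; lra. }
  rewrite E1, E2. unfold mid. field.
Qed.

Lemma tri_mid f R a b c : cont_on f R -> disc R a -> disc R b -> disc R c ->
  tri f a b c = (tri f a (mid a b) (mid c a) + tri f (mid a b) b (mid b c)
     + tri f (mid c a) (mid b c) c + tri f (mid a b) (mid b c) (mid c a))%C.
Proof.
  intros Hf Ha Hb Hc.
  pose proof (disc_mid R a b Ha Hb) as H1. pose proof (disc_mid R b c Hb Hc) as H2.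
  pose proof (disc_mid R c a Hc Ha) as H3.
  unfold tri.
  rewrite (segI_mid f R a b), (segI_mid f R b c), (segI_mid f R c a) by auto.
  rewrite (segI_rev f R (mid a b) (mid c a)) by auto.
  rewrite (segI_rev f R (mid c a) (mid b c)) by auto.
  rewrite (segI_rev f R (mid b c) (mid a b)) by auto.
  ring.
Qed.

(** * Goursat's lemma and primitives on discs *)

Definition triT (f : C -> C) (T : C * C * C) : C := let '(a, b, c) := T in tri f a b c.
Definition lenT (T : C * C * C) : R :=
  let '(a, b, c) := T in Cmod (b - a) + Cmod (c - b) + Cmod (a - c).
Definition inT (r : R) (T : C * C * C) : Prop :=
  let '(a, b, c) := T in Cmod a <= r /\ Cmod b <= r /\ Cmod c <= r.
Definition subT (i : nat) (T : C * C * C) : C * C * C :=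
  let '(a, b, c) := T in
  match i with
  | O => (a, mid a b, mid c a)
  | 1%nat => (mid a b, b, mid b c)
  | 2%nat => (mid c a, mid b c, c)
  | _ => (mid a b, mid b c, mid c a)
  end.
(** Goursat's selection made explicit: the first quarter whose integral has at least a quarter of
    the modulus. If the first three fail, the triangle inequality shows that the fourth qualifies
    ([nextT_tri]). *)
Definition nextT (f : C -> C) (T : C * C * C) : C * C * C :=
  let ok i := Rle_dec (Cmod (triT f T) / 4) (Cmod (triT f (subT i T))) in
  if ok 0%nat then subT 0 T else if ok 1%nat then subT 1 T
  else if ok 2%nat then subT 2 T else subT 3 T.
Fixpoint iterT (f : C -> C) (T : C * C * C) (n : nat) : C * C * C :=
  match n with O => T | S n' => nextT f (iterT f T n') end.
Definition vertT (T : C * C * C) : C := fst (fst T).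

Lemma nextT_sub f T : exists i, nextT f T = subT i T.
Proof.
  unfold nextT.
  destruct Rle_dec; [exists 0%nat; auto|]. destruct Rle_dec; [exists 1%nat; auto|].
  destruct Rle_dec; [exists 2%nat; auto|]. exists 3%nat; auto.
Qed.

Lemma inT_sub r i T : inT r T -> inT r (subT i T).
Proof.
  destruct T as [[a b] c]. intros (Ha & Hb & Hc).
  assert (H : forall x y, Cmod x <= r -> Cmod y <= r -> Cmod (mid x y) <= r).
  { intros x y Hx Hy. rewrite seg_mid. apply seg_disc; auto. lra. }
  destruct i as [|[|[|i]]]; simpl; auto.
Qed.

Lemma Cmod_half (z : C) : Cmod (z / 2) = Cmod z / 2.
Proof.
  unfold Cdiv. rewrite Cmod_mult, <- RtoC_inv, Cmod_R, Rabs_pos_eq by lra. reflexivity.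
Qed.

Lemma lenT_sub i T : lenT (subT i T) = lenT T / 2.
Proof.
  destruct T as [[a b] c]. unfold subT, lenT, mid.
  destruct i as [|[|[|i]]].
  - replace ((a + b) / 2 - a)%C with ((b - a) / 2)%C by field.
    replace ((c + a) / 2 - (a + b) / 2)%C with ((c - b) / 2)%C by field.
    replace (a - (c + a) / 2)%C with ((a - c) / 2)%C by field.
    rewrite !Cmod_half. lra.
  - replace (b - (a + b) / 2)%C with ((b - a) / 2)%C by field.
    replace ((b + c) / 2 - b)%C with ((c - b) / 2)%C by field.
    replace ((a + b) / 2 - (b + c) / 2)%C with ((a - c) / 2)%C by field.
    rewrite !Cmod_half. lra.
  - replace ((b + c) / 2 - (c + a) / 2)%C with ((b - a) / 2)%C by field.
    replace (c - (b + c) / 2)%C with ((c - b) / 2)%C by field.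
    replace ((c + a) / 2 - c)%C with ((a - c) / 2)%C by field.
    rewrite !Cmod_half. lra.
  - replace ((b + c) / 2 - (a + b) / 2)%C with (- ((a - c) / 2))%C by field.
    replace ((c + a) / 2 - (b + c) / 2)%C with (- ((b - a) / 2))%C by field.
    replace ((a + b) / 2 - (c + a) / 2)%C with (- ((c - b) / 2))%C by field.
    rewrite !Cmod_opp, !Cmod_half. lra.
Qed.

Lemma vertT_sub i T : Cmod (vertT (subT i T) - vertT T) <= lenT T.
Proof.
  destruct T as [[a b] c]. unfold vertT, lenT, subT, mid.
  pose proof (Cmod_ge_0 (b - a)). pose proof (Cmod_ge_0 (c - b)). pose proof (Cmod_ge_0 (a - c)).
  destruct i as [|[|[|i]]]; cbn [fst snd].
  - replace (a - a)%C with (RtoC 0) by ring. rewrite Cmod_0. lra.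
  - replace ((a + b) / 2 - a)%C with ((b - a) / 2)%C by field. rewrite Cmod_half. lra.
  - replace ((c + a) / 2 - a)%C with (- ((a - c) / 2))%C by field. rewrite Cmod_opp, Cmod_half. lra.
  - replace ((a + b) / 2 - a)%C with ((b - a) / 2)%C by field. rewrite Cmod_half. lra.
Qed.

Lemma nextT_tri f R r T : cont_on f R -> r < R -> inT r T ->
  Cmod (triT f T) / 4 <= Cmod (triT f (nextT f T)).
Proof.
  intros Hf Hr HT. unfold nextT.
  destruct Rle_dec as [|H0]; [auto|]. destruct Rle_dec as [|H1]; [auto|].
  destruct Rle_dec as [|H2]; [auto|]. apply Rnot_lt_le. intros H3.
  apply Rnot_le_lt in H0, H1, H2.
  assert (Cmod (triT f T) <= Cmod (triT f (subT 0 T)) + Cmod (triT f (subT 1 T))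
     + Cmod (triT f (subT 2 T)) + Cmod (triT f (subT 3 T))); [|lra].
  destruct T as [[a b] c]. destruct HT as (Ha & Hb & Hc). unfold triT, subT.
  rewrite (tri_mid f R a b c) by (auto; unfold disc; lra).
  eapply Rle_trans; [apply Cmod_triangle|]. apply Rplus_le_compat_r.
  eapply Rle_trans; [apply Cmod_triangle|]. apply Rplus_le_compat_r.
  apply Cmod_triangle.
Qed.

Lemma ccont_plus (f g : C -> C) z : ccont f z -> ccont g z -> ccont (fun w => f w + g w)%C z.
Proof.
  intros H1 H2 e He. destruct (H1 (e / 2)) as [d1 [Hd1 K1]]; [lra|].
  destruct (H2 (e / 2)) as [d2 [Hd2 K2]]; [lra|].
  exists (Rmin d1 d2). split; [apply Rmin_pos; auto|]. intros s Hs.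
  specialize (K1 s (Rlt_le_trans _ _ _ Hs (Rmin_l _ _))).
  specialize (K2 s (Rlt_le_trans _ _ _ Hs (Rmin_r _ _))).
  replace (f s + g s - (f z + g z))%C with ((f s - f z) + (g s - g z))%C by ring.
  eapply Rle_lt_trans; [apply Cmod_triangle|]. lra.
Qed.

Lemma ccont_affine (p q z : C) : ccont (fun w => p + q * w)%C z.
Proof. apply cd_cont with (0 + q * 1)%C. apply cd_plus; [apply cd_const|apply cd_scal, cd_id]. Qed.

Lemma goursat f R a b c : hol f R -> disc R a -> disc R b -> disc R c -> tri f a b c = RtoC 0.
Proof.
  intros Hf Ha Hb Hc.
  pose proof (hol_cont f R Hf) as Hcf.
  set (r := Rmax (Cmod a) (Rmax (Cmod b) (Cmod c))).
  assert (Hr : r < R) by (repeat apply Rmax_lub_lt; auto).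
  set (T0 := (a, b, c)).
  assert (HT0 : inT r T0).
  { unfold r. split; [apply Rmax_l|split].
    - eapply Rle_trans; [apply Rmax_l|apply Rmax_r].
    - eapply Rle_trans; [apply Rmax_r|apply Rmax_r]. }
  set (T := iterT f T0). set (L := lenT T0).
  assert (HL : 0 <= L).
  { unfold L, lenT, T0. pose proof (Cmod_ge_0 (b - a)). pose proof (Cmod_ge_0 (c - b)).
    pose proof (Cmod_ge_0 (a - c)). lra. }
  assert (HT : forall n, inT r (T n)).
  { induction n; [exact HT0|]. simpl. destruct (nextT_sub f (iterT f T0 n)) as [i Hi].
    unfold T. simpl. rewrite Hi. apply inT_sub. exact IHn. }
  assert (Hlen : forall n, lenT (T n) = L * (1 / 2) ^ n).
  { induction n; [change (L = L * 1); ring|]. unfold T in *. simpl.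
    destruct (nextT_sub f (iterT f T0 n)) as [i Hi].
    rewrite Hi, lenT_sub, IHn. field. }
  assert (Htri : forall n, Cmod (triT f T0) <= 4 ^ n * Cmod (triT f (T n))).
  { induction n; [simpl; unfold T; simpl; lra|].
    pose proof (nextT_tri f R r (T n) Hcf Hr (HT n)) as H.
    eapply Rle_trans; [exact IHn|]. change (T (S n)) with (nextT f (T n)). simpl.
    assert (0 < 4 ^ n) by (apply pow_lt; lra). nra. }
  destruct (geometric_limit (fun n => vertT (T n)) L (1 / 2)) as [p Hp]; [auto|lra| |].
  { intros n. rewrite <- Hlen. unfold T. simpl. destruct (nextT_sub f (iterT f T0 n)) as [i Hi].
    rewrite Hi. apply vertT_sub. }
  assert (Hv : forall n, Cmod (vertT (T n)) <= r).
  { intros n. specialize (HT n). destruct (T n) as [[x y] z]. apply HT. }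
  assert (HpR : disc R p).
  { unfold disc. apply Rle_lt_trans with r; [|auto]. apply le_eps. intros e He.
    destruct (pow_lim0 (1 / 2) (e / (2 * (L + 1)))) as [n Hn]; [lra|apply Rdiv_lt_0_compat; lra|].
    specialize (Hn n (le_n n)). specialize (Hp n). specialize (Hv n).
    replace p with (vertT (T n) + - (vertT (T n) - p))%C by ring.
    eapply Rle_trans; [apply Cmod_triangle|]. rewrite Cmod_opp.
    apply (Rmult_lt_compat_r (2 * (L + 1))) in Hn; [|lra].
    unfold Rdiv in Hn at 2. rewrite Rmult_assoc, Rinv_l, Rmult_1_r in Hn by lra.
    assert (0 < (1 / 2) ^ n) by (apply pow_lt; lra).
    assert (L * (1 / 2) ^ n / (1 - 1 / 2) <= e); [|lra].
    replace (L * (1 / 2) ^ n / (1 - 1 / 2)) with (2 * L * (1 / 2) ^ n) by field. nra. }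
  destruct (Hf p HpR) as [l Hl].
  assert (Hfin : Cmod (triT f T0) <= 0).
  { apply le_eps. intros e0 He0. rewrite Rplus_0_l.
    (* With perimeter L/2^n at step n the integral is at most 3 e (L/2^n)^2, and the factor 4^n
       gathered by the subdivision cancels 2^(-2n); this e makes 3 e L^2 at most e0. *)
    set (e := e0 / (3 * (L * L + 1))).
    assert (He : 0 < e) by (apply Rdiv_lt_0_compat; nra).
    destruct (proj1 (cd_eps _ _ _) Hl e He) as [d [Hd K]].
    destruct (pow_lim0 (1 / 2) (d / (3 * (L + 1)))) as [n Hn]; [lra|apply Rdiv_lt_0_compat; lra|].
    specialize (Hn n (le_n n)).
    apply (Rmult_lt_compat_r (3 * (L + 1))) in Hn; [|lra].
    unfold Rdiv in Hn at 2. rewrite Rmult_assoc, Rinv_l, Rmult_1_r in Hn by lra.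
    assert (Hpn : 0 < (1 / 2) ^ n) by (apply pow_lt; lra).
    specialize (Hp n). specialize (Hlen n). specialize (HT n). specialize (Htri n).
    destruct (T n) as [[x y] z]. unfold vertT in Hp. simpl in Hp.
    destruct HT as (Hx & Hy & Hz). unfold lenT in Hlen.
    set (ln := L * (1 / 2) ^ n) in *.
    replace (ln / (1 - 1 / 2)) with (2 * ln) in Hp by field.
    assert (Hln : 0 <= ln) by (unfold ln; nra).
    pose proof (Cmod_ge_0 (y - x)) as G1. pose proof (Cmod_ge_0 (z - y)) as G2.
    pose proof (Cmod_ge_0 (x - z)) as G3.
    assert (Vx : Cmod (x - p) <= 3 * ln) by lra.
    assert (Vy : Cmod (y - p) <= 3 * ln) by (pose proof (Cmod_sub_triangle y x p); lra).
    assert (Vz : Cmod (z - p) <= 3 * ln).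
    { pose proof (Cmod_sub_triangle z x p). rewrite (Cmod_sub_sym z x) in H. lra. }
    (* Subtracting the tangent map at p does not change the integral, because an affine function
       integrates to 0 around a triangle. *)
    set (al := (f p - l * p)%C).
    set (g := fun w => (f w + (- al + - l * w))%C).
    assert (Hg : cont_on g R).
    { intros w Hw. apply ccont_plus; [apply Hcf; auto|apply ccont_affine]. }
    assert (Haf : cont_on (fun w => al + l * w)%C R) by (intros w _; apply ccont_affine).
    assert (Hxd : disc R x) by (unfold disc; lra). assert (Hyd : disc R y) by (unfold disc; lra).
    assert (Hzd : disc R z) by (unfold disc; lra).
    assert (Split : forall u v, disc R u -> disc R v ->
      segI f u v = (segI g u v + segI (fun w => al + l * w) u v)%C).
    { intros u v Hu Hv'. rewrite <- (segI_plus g _ R) by auto. unfold segI. f_equal.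
      apply cint_ext; [lra|]. intros t _. unfold g. ring. }
    assert (Bd : forall u v, disc R u -> disc R v -> Cmod (u - p) <= 3 * ln -> Cmod (v - p) <= 3 * ln ->
       Cmod (segI g u v) <= Cmod (v - u) * (e * (3 * ln))).
    { intros u v Hu Hv' Hup Hvp. apply segI_bound with R; auto. intros t Ht.
      assert (Hs : Cmod (seg u v t - p) <= 3 * ln).
      { replace (seg u v t - p)%C with (seg (u - p) (v - p) t) by (unfold seg; ring).
        apply seg_disc; auto. }
      replace (g (seg u v t)) with (f (seg u v t) - f p - l * (seg u v t - p))%C
        by (unfold g, al; ring).
      eapply Rle_trans; [apply K|].
      - unfold ln in Hs. nra.
      - apply Rmult_le_compat_l; lra. }
    unfold triT at 2 in Htri. unfold tri in Htri.
    rewrite !Split, !segI_affine in Htri by auto.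
    match type of Htri with _ <= _ * Cmod ?X =>
      replace X with (segI g x y + segI g y z + segI g z x)%C in Htri by field end.
    assert (Cmod (segI g x y + segI g y z + segI g z x) <= 3 * e * (ln * ln)).
    { eapply Rle_trans; [apply Cmod_triangle|].
      eapply Rle_trans; [apply Rplus_le_compat_r, Cmod_triangle|].
      pose proof (Bd x y Hxd Hyd Vx Vy). pose proof (Bd y z Hyd Hzd Vy Vz).
      pose proof (Bd z x Hzd Hxd Vz Vx).
      apply Rle_trans with (ln * (e * (3 * ln))); [|right; ring].
      rewrite <- Hlen at 1. lra. }
    assert (H4 : 0 < 4 ^ n) by (apply pow_lt; lra).
    eapply Rle_trans; [exact Htri|].
    eapply Rle_trans; [apply Rmult_le_compat_l; [lra|exact H]|].
    replace (4 ^ n * (3 * e * (ln * ln))) with (3 * e * (L * L)).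
    - apply Rle_trans with (3 * e * (L * L + 1)); [nra|]. unfold e. right. field. nra.
    - unfold ln. replace (4 ^ n * (3 * e * (L * (1 / 2) ^ n * (L * (1 / 2) ^ n))))
        with (3 * e * (L * L) * (4 ^ n * ((1 / 2) ^ n * (1 / 2) ^ n))) by ring.
      rewrite <- !Rpow_mult_distr. replace (4 * (1 / 2 * (1 / 2))) with 1 by field.
      rewrite pow1. ring. }
  unfold triT, T0 in Hfin. apply Cmod_eq_0. pose proof (Cmod_ge_0 (tri f a b c)). lra.
Qed.

(** The primitive is the integral along the radius; Goursat's lemma on the triangle 0, z, w turns
    its increment into the integral along [z, w]. *)
Lemma primitive f R : 0 < R -> hol f R -> exists F, forall z, disc R z -> cd F z (f z).
Proof.
  intros HR Hf. pose proof (hol_cont f R Hf) as Hcf.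
  exists (fun z => segI f 0 z). intros z Hz.
  assert (H0 : disc R 0%C) by (unfold disc; rewrite Cmod_0; auto).
  apply cd_eps. intros e He.
  destruct (Hcf z Hz e He) as [d [Hd K]].
  assert (Hz' : 0 < R - Cmod z) by (unfold disc in Hz; lra).
  exists (Rmin d (R - Cmod z)). split; [apply Rmin_pos; lra|].
  intros w Hw.
  assert (Hw1 : Cmod (w - z) < d) by (eapply Rlt_le_trans; [exact Hw|apply Rmin_l]).
  assert (Hw2 : Cmod (w - z) < R - Cmod z) by (eapply Rlt_le_trans; [exact Hw|apply Rmin_r]).
  assert (HwR : disc R w).
  { unfold disc. replace w with (z + (w - z))%C by ring.
    eapply Rle_lt_trans; [apply Cmod_triangle|]. lra. }
  pose proof (goursat f R 0%C z w Hf H0 Hz HwR) as G. unfold tri in G.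
  rewrite (segI_rev f R 0%C w) in G by auto.
  assert (E : (segI f 0 w - segI f 0 z)%C = segI f z w).
  { replace (segI f z w) with (segI f z w - (segI f 0 z + segI f z w + - segI f 0 w))%C
      by (rewrite G; ring). ring. }
  rewrite E.
  assert (Hg : cont_on (fun u => f u + - f z)%C R).
  { intros u Hu. apply (ccont_plus f (fun _ => - f z)%C); [apply Hcf; auto|].
    apply cd_cont with (RtoC 0). apply cd_const. }
  replace (segI f z w - f z * (w - z))%C with (segI (fun u => f u + - f z)%C z w).
  - rewrite Rmult_comm. apply segI_bound with R; auto. intros t Ht. left. apply K.
    replace (seg z w t - z)%C with (RtoC t * (w - z))%C by (unfold seg; ring).
    rewrite Cmod_mult, Cmod_RtoC_pos by lra. pose proof (Cmod_ge_0 (w - z)). nra.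
  - rewrite (segI_plus f (fun _ => - f z)%C R); auto.
    + unfold segI at 2. rewrite cint_const. rewrite Rminus_0_r. ring.
    + intros u _. apply cd_cont with (RtoC 0). apply cd_const.
Qed.

Lemma disc_bounded f Rd r : cont_on f Rd -> r < Rd -> exists M, 0 < M /\ forall z, Cmod z <= r -> Cmod (f z) <= M.
Proof.
  intros Hf Hr.
  (* One number serves both as the size of a neighbourhood of p and as the inverse of a bound on it,
     since the compactness lemma handles a single gauge and returns a uniform lower bound for it. *)
  assert (H : forall p : R * R, exists d : posreal, forall x y,
    Rabs (x - fst p) < d -> Rabs (y - snd p) < d -> Cmod (x, y) <= r -> Cmod (f (x, y)) <= / d).
  { intros [u v]. simpl.
    destruct (Rle_dec (Cmod (u, v)) r) as [Hin|Hout].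
    - destruct (Hf (u, v)) with (eps := 1) as [d [Hd K]]; [unfold disc; lra|lra|].
      set (m := Cmod (f (u, v))). assert (Hm : 0 <= m) by apply Cmod_ge_0.
      assert (Hp : 0 < Rmin (d / 2) (/ (1 + m))).
      { apply Rmin_pos; [lra|apply Rinv_0_lt_compat; lra]. }
      exists (mkposreal _ Hp). simpl. intros x y Hx Hy _.
      assert (Hx' : Rabs (x - u) < d / 2) by (eapply Rlt_le_trans; [exact Hx|apply Rmin_l]).
      assert (Hy' : Rabs (y - v) < d / 2) by (eapply Rlt_le_trans; [exact Hy|apply Rmin_l]).
      apply Rle_trans with (1 + m).
      + specialize (K (x, y)).
        replace ((x, y) - (u, v))%C with (x - u, y - v) in K by reflexivity.
        pose proof (Cmod_le_abs (x - u) (y - v)).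
        specialize (K ltac:(lra)).
        replace (f (x, y)) with ((f (x, y) - f (u, v)) + f (u, v))%C by ring.
        eapply Rle_trans; [apply Cmod_triangle|]. fold m. lra.
      + rewrite <- (Rinv_inv (1 + m)) at 1. apply Rinv_le_contravar; [exact Hp|apply Rmin_r].
    (* Outside the closed disc the neighbourhood is made to miss the disc, so the claim is vacuous
       there. *)
    - apply Rnot_le_lt in Hout. assert (Hp : 0 < (Cmod (u, v) - r) / 2) by lra.
      exists (mkposreal _ Hp). simpl. intros x y Hx Hy Hxy. exfalso.
      pose proof (Cmod_le_abs (x - u) (y - v)).
      assert (Cmod (u, v) <= Cmod (x, y) + Cmod (x - u, y - v)); [|lra].
      rewrite <- (Cmod_opp (x - u, y - v)).
      eapply Rle_trans; [|apply Cmod_triangle]. right. f_equal.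
      cbv [Cplus Copp]; simpl. f_equal; ring. }
  set (dl := fun p => proj1_sig (constructive_indefinite_description _ (H p))).
  assert (Hdl : forall p x y, Rabs (x - fst p) < dl p -> Rabs (y - snd p) < dl p ->
     Cmod (x, y) <= r -> Cmod (f (x, y)) <= / dl p).
  { intros p. unfold dl. destruct constructive_indefinite_description as [d Hd]. exact Hd. }
  destruct (compactness_value_2d (- r) r (- r) r (fun u v => dl (u, v))) as [d Hd].
  exists (/ d). split; [apply Rinv_0_lt_compat, cond_pos|].
  intros [x y] Hz.
  assert (Hxr : Rabs x <= r) by (eapply Rle_trans; [apply (re_le_Cmod (x, y))|auto]).
  assert (Hyr : Rabs y <= r) by (eapply Rle_trans; [apply (Cmod_Im_le (x, y))|auto]).
  apply Rabs_le_between in Hxr, Hyr.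
  destruct (Rle_dec (Cmod (f (x, y))) (/ d)) as [|Hn]; [auto|exfalso].
  apply (Hd x y Hxr Hyr). intros (u & v & _ & _ & Hu & Hv & Hduv). apply Hn.
  eapply Rle_trans; [apply (Hdl (u, v)); auto|].
  apply Rinv_le_contravar; [apply cond_pos|auto].
Qed.

(** * Cauchy's integral formula on circles centred at 0 *)

Definition ce (r t : R) : C := (r * cos t, r * sin t).

Lemma ce_rd r t : rd (ce r) t (Ci * ce r t)%C.
Proof.
  replace (Ci * ce r t)%C with (r * - sin t, r * cos t)
    by (unfold ce, Ci, Cmult; simpl; f_equal; ring).
  apply rd_pair.
  - apply is_derive_scal. apply is_derive_Reals. apply derivable_pt_lim_cos.
  - apply is_derive_scal. apply is_derive_Reals. apply derivable_pt_lim_sin.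
Qed.

Lemma Cmod_ce r t : 0 <= r -> Cmod (ce r t) = r.
Proof.
  intros Hr. unfold Cmod, ce. simpl.
  replace (r * cos t * (r * cos t * 1) + r * sin t * (r * sin t * 1))
    with (r * r * ((sin t)² + (cos t)²)) by (unfold Rsqr; ring).
  rewrite sin2_cos2, Rmult_1_r. apply sqrt_square. auto.
Qed.

Lemma ce_period r : ce r (2 * PI) = ce r 0.
Proof. unfold ce. rewrite cos_2PI, sin_2PI, cos_0, sin_0. reflexivity. Qed.

(** N steps of length 1/N change psi by at most K/N in total. This takes the place of
    differentiation under the integral sign in the two Cauchy formulas that follow. *)
Lemma const_of_quadratic (psi : R -> C) K : 0 <= K ->
  (forall s h, 0 <= s <= 1 -> 0 <= s + h <= 1 -> Cmod (psi (s + h) - psi s) <= K * (h * h)) ->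
  psi 1 = psi 0.
Proof.
  intros HK H.
  assert (E : Cmod (psi 1 - psi 0) <= 0).
  { apply le_eps. intros e He. rewrite Rplus_0_l.
    destruct (archimed_cor1 (e / (K + 1))) as [N [HN HN0]]; [apply Rdiv_lt_0_compat; lra|].
    assert (HNR : 0 < INR N) by (apply lt_0_INR; lia).
    assert (G : forall n, (n <= N)%nat ->
       Cmod (psi (INR n / INR N) - psi 0) <= INR n * (K * (/ INR N * / INR N))).
    { induction n; intros Hn.
      - simpl INR. replace (0 / INR N) with 0 by (field; lra).
        replace (psi 0 - psi 0)%C with (RtoC 0) by ring. rewrite Cmod_0. lra.
      - specialize (IHn ltac:(lia)).
        eapply Rle_trans; [apply Cmod_sub_triangle with (b := psi (INR n / INR N))|].
        assert (Hle : INR (S n) <= INR N) by (apply le_INR; lia).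
        rewrite S_INR in Hle |- *. pose proof (pos_INR n) as Hn0.
        specialize (H (INR n / INR N) (/ INR N)).
        replace (INR n / INR N + / INR N) with ((INR n + 1) / INR N) in H by (field; lra).
        assert (B1 : 0 <= INR n / INR N <= 1).
        { split; [apply Rmult_le_pos; [lra|left; apply Rinv_0_lt_compat; lra]|].
          apply (Rmult_le_reg_r (INR N)); [lra|]. unfold Rdiv.
          rewrite Rmult_assoc, Rinv_l by lra. lra. }
        assert (B2 : 0 <= (INR n + 1) / INR N <= 1).
        { split; [apply Rmult_le_pos; [lra|left; apply Rinv_0_lt_compat; lra]|].
          apply (Rmult_le_reg_r (INR N)); [lra|]. unfold Rdiv.
          rewrite Rmult_assoc, Rinv_l by lra. lra. }
        specialize (H B1 B2). lra. }
    specialize (G N (le_n N)).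
    replace (INR N / INR N) with 1 in G by (field; lra).
    eapply Rle_trans; [exact G|].
    replace (INR N * (K * (/ INR N * / INR N))) with (K * / INR N) by (field; lra).
    apply Rle_trans with (K * (e / (K + 1))); [apply Rmult_le_compat_l; lra|].
    apply Rle_trans with ((K + 1) * (e / (K + 1))).
    - apply Rmult_le_compat_r; [|lra]. left. apply Rdiv_lt_0_compat; lra.
    - right. field. lra. }
  pose proof (Cmod_ge_0 (psi 1 - psi 0)).
  replace (psi 1) with ((psi 1 - psi 0) + psi 0)%C by ring.
  rewrite (Cmod_eq_0 (psi 1 - psi 0)) by lra. ring.
Qed.

Lemma two_PI_pos : 0 <= 2 * PI.
Proof. pose proof PI_RGT_0. lra. Qed.

Lemma ce_neq r w t : Cmod w < r -> (ce r t - w)%C <> RtoC 0.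
Proof.
  intros Hw E. assert (ce r t = w) by (transitivity ((ce r t - w) + w)%C; [ring|rewrite E; ring]).
  assert (Hr : 0 <= r) by (pose proof (Cmod_ge_0 w); lra).
  rewrite <- H, Cmod_ce in Hw; lra.
Qed.

Lemma ce_dist r w t : Cmod w < r -> r - Cmod w <= Cmod (ce r t - w).
Proof.
  intros Hw. pose proof (Cmod_ge_0 w).
  assert (Cmod (ce r t) <= Cmod (ce r t - w) + Cmod w).
  { replace (ce r t) with ((ce r t - w) + w)%C at 1 by ring. apply Cmod_triangle. }
  rewrite Cmod_ce in H0; lra.
Qed.

Lemma ce_rcont r t : rcont (ce r) t.
Proof. eapply rd_cont, ce_rd. Qed.

Lemma cint_minus f g a b : a <= b -> rcont_on f a b -> rcont_on g a b ->
  cint (fun t => f t - g t)%C a b = (cint f a b - cint g a b)%C.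
Proof.
  intros Hab Hf Hg.
  transitivity (cint (fun t => f t + (-1) * g t)%C a b).
  - apply cint_ext; [auto|]. intros. ring.
  - rewrite cint_plus, cint_scal; auto; [ring|]. intros t Ht. apply rcont_scal. auto.
Qed.

Lemma cd_rcont_comp F (g : R -> C) t l : cd F (g t) l -> rcont g t -> rcont (fun s => F (g s)) t.
Proof. intros H. apply rcont_comp. eapply cd_cont; eauto. Qed.

Lemma rcont_ce_inv r w t : Cmod w < r -> rcont (fun t => / (ce r t - w))%C t.
Proof.
  intros Hw. eapply (cd_rcont_comp (fun z => / (z - w))%C (ce r)).
  - apply cd_inv; [apply ce_neq; auto|]. apply cd_minus; [apply cd_id|apply cd_const].
  - apply ce_rcont.
Qed.

(** Replace w by s w. The s-derivative of the integrand is an exact derivative along the circle, so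
    the integral does not depend on s, and at s = 0 the integrand is 1. *)
Lemma cauchy_kernel r w : Cmod w < r ->
  cint (fun t => ce r t * / (ce r t - w))%C 0 (2 * PI) = RtoC (2 * PI).
Proof.
  intros Hw. pose proof (Cmod_ge_0 w) as Hw0.
  set (c := r - Cmod w). assert (Hc : 0 < c) by (unfold c; lra).
  assert (Hs : forall s, 0 <= s <= 1 -> Cmod (RtoC s * w) <= Cmod w).
  { intros s Hs. rewrite Cmod_mult, Cmod_RtoC_pos by lra. nra. }
  set (psi := fun s => cint (fun t => ce r t * / (ce r t - RtoC s * w))%C 0 (2 * PI)).
  assert (Hcont : forall s, 0 <= s <= 1 ->
     rcont_on (fun t => ce r t * / (ce r t - RtoC s * w))%C 0 (2 * PI)).
  { intros s H t _. apply rcont_mult; [apply ce_rcont|apply rcont_ce_inv]. specialize (Hs s H). lra. }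
  assert (E : psi 1 = psi 0).
  { apply const_of_quadratic with (r * (Cmod w * Cmod w) * (/ c * (/ c * / c)) * (2 * PI)).
    - assert (0 < / c) by (apply Rinv_0_lt_compat; auto). pose proof PI_RGT_0.
      repeat first [lra | apply Rmult_le_pos].
    - intros s h H1 H2. unfold psi.
      (* This is h times the s-derivative of the integrand; along the circle it has the primitive h
         w i / (z - s w), whence its integral is 0. *)
      set (k := fun t => (RtoC h * w * (ce r t * (/ (ce r t - RtoC s * w) * / (ce r t - RtoC s * w))))%C).
      assert (Hk : rcont_on k 0 (2 * PI)).
      { intros t _. apply rcont_scal. specialize (Hs s H1).
        apply rcont_mult; [apply ce_rcont|]. apply rcont_mult; apply rcont_ce_inv; lra. }
      assert (Ik : cint k 0 (2 * PI) = RtoC 0).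
      { unfold k.
        rewrite cint_scal.
        - rewrite (cint_ftc (fun t => Ci * / (ce r t - RtoC s * w))%C).
          + rewrite ce_period. ring.
          + apply two_PI_pos.
          + intros t _. specialize (Hs s H1).
            pose proof (ce_neq r (RtoC s * w)%C t ltac:(lra)) as Hne.
            match goal with |- rd _ _ ?X =>
              replace X with (Ci * ce r t * (Ci * (- (1 - 0) / ((ce r t - RtoC s * w) * (ce r t - RtoC s * w)))))%C end.
            * apply (rd_comp (fun z => Ci * / (z - RtoC s * w))%C (ce r)); [|apply ce_rd].
              apply cd_scal. apply (cd_inv (fun z => z - RtoC s * w)%C); [auto|].
              apply cd_minus; [apply cd_id|apply cd_const].
            * replace (Ci * ce r t * (Ci * (- (1 - 0) / ((ce r t - RtoC s * w) * (ce r t - RtoC s * w)))))%C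
                with ((Ci * Ci) * (- (ce r t * (/ (ce r t - RtoC s * w) * / (ce r t - RtoC s * w)))))%C by (field; auto).
              replace (Ci * Ci)%C with (- (1))%C by (unfold Ci, Cmult, Copp, RtoC; simpl; f_equal; ring).
              ring.
          + intros t _. specialize (Hs s H1).
            apply rcont_mult; [apply ce_rcont|]. apply rcont_mult; apply rcont_ce_inv; lra.
        - apply two_PI_pos.
        - intros t _. specialize (Hs s H1).
          apply rcont_mult; [apply ce_rcont|]. apply rcont_mult; apply rcont_ce_inv; lra. }
      replace (cint (fun t => ce r t * / (ce r t - RtoC (s + h) * w))%C 0 (2 * PI)
         - cint (fun t => ce r t * / (ce r t - RtoC s * w))%C 0 (2 * PI))%C
        with (cint (fun t => ce r t * / (ce r t - RtoC (s + h) * w)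
           - ce r t * / (ce r t - RtoC s * w) - k t)%C 0 (2 * PI)).
      + match goal with |- _ <= ?X =>
          replace X with (r * (Cmod w * Cmod w) * (/ c * (/ c * / c)) * (h * h) * (2 * PI - 0)) by ring end.
        apply cint_bound; [apply two_PI_pos| |].
        * intros t Ht.
          replace (fun t0 => ce r t0 * / (ce r t0 - RtoC (s + h) * w)
             - ce r t0 * / (ce r t0 - RtoC s * w) - k t0)%C
            with (fun t0 => (ce r t0 * / (ce r t0 - RtoC (s + h) * w)
             + ((-1) * (ce r t0 * / (ce r t0 - RtoC s * w)) + (-1) * k t0))%C)
            by (apply functional_extensionality; intros; ring).
          apply rcont_plus; [apply Hcont; auto|]. apply rcont_plus; apply rcont_scal; [apply Hcont; auto|auto].
        * intros t Ht. pose proof (Hs s H1) as Hs1. pose proof (Hs (s + h) H2) as Hs2.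
          pose proof (ce_neq r (RtoC s * w)%C t ltac:(lra)) as N1.
          pose proof (ce_neq r (RtoC (s + h) * w)%C t ltac:(lra)) as N2.
          pose proof (ce_dist r (RtoC s * w)%C t ltac:(lra)) as D1.
          pose proof (ce_dist r (RtoC (s + h) * w)%C t ltac:(lra)) as D2.
          replace (ce r t * / (ce r t - RtoC (s + h) * w) - ce r t * / (ce r t - RtoC s * w) - k t)%C
            with (ce r t * (w * w) * (/ (ce r t - RtoC (s + h) * w)
               * (/ (ce r t - RtoC s * w) * / (ce r t - RtoC s * w))) * (RtoC h * RtoC h))%C
            by (unfold k; rewrite RtoC_plus in *; field; auto).
          rewrite !Cmod_mult, !Cmod_inv by auto. rewrite Cmod_ce by lra.
          rewrite Cmod_R. rewrite <- (Rabs_mult h h), (Rabs_pos_eq (h * h)) by nra.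
          assert (I1 : / Cmod (ce r t - RtoC s * w) <= / c) by (apply Rinv_le_contravar; unfold c; lra).
          assert (I2 : / Cmod (ce r t - RtoC (s + h) * w) <= / c) by (apply Rinv_le_contravar; unfold c; lra).
          assert (J1 : 0 < / Cmod (ce r t - RtoC s * w)) by (apply Rinv_0_lt_compat; unfold c in *; lra).
          assert (J2 : 0 < / Cmod (ce r t - RtoC (s + h) * w)) by (apply Rinv_0_lt_compat; unfold c in *; lra).
          apply Rmult_le_compat_r; [nra|].
          apply Rmult_le_compat_l; [apply Rmult_le_pos; nra|].
          apply Rmult_le_compat; [lra|apply Rmult_le_pos; lra|auto|apply Rmult_le_compat; lra].
      + rewrite cint_minus; [|apply two_PI_pos| |auto].
        * rewrite Ik, cint_minus; [ring|apply two_PI_pos|apply Hcont; auto|apply Hcont; auto].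
        * intros t Ht.
          replace (fun t0 => ce r t0 * / (ce r t0 - RtoC (s + h) * w)
             - ce r t0 * / (ce r t0 - RtoC s * w))%C
            with (fun t0 => (ce r t0 * / (ce r t0 - RtoC (s + h) * w)
             + ((-1) * (ce r t0 * / (ce r t0 - RtoC s * w))))%C)
            by (apply functional_extensionality; intros; ring).
          apply rcont_plus; [apply Hcont; auto|]. apply rcont_scal. apply Hcont; auto. }
  transitivity (psi 1).
  - unfold psi. apply cint_ext; [apply two_PI_pos|]. intros t _. do 3 f_equal. ring.
  - rewrite E. unfold psi. transitivity (cint (fun _ => RtoC 1) 0 (2 * PI)).
    + apply cint_ext; [apply two_PI_pos|]. intros t _.
      replace (ce r t - 0 * w)%C with (ce r t) by ring. apply Cinv_r.
      replace (ce r t) with (ce r t - 0)%C by ring. apply ce_neq. rewrite Cmod_0. lra.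
    + rewrite cint_const, Rminus_0_r. ring.
Qed.

Definition chol (f : C -> C) (Rd : R) := forall z, disc Rd z -> cd f z (cderiv f z).

Lemma hol_chol f Rd : hol f Rd -> chol f Rd.
Proof. intros H z Hz. destruct (H z Hz) as [l Hl]. rewrite (cderiv_eq _ _ _ Hl). auto. Qed.

Lemma rcont_minus f g t : rcont f t -> rcont g t -> rcont (fun s => f s - g s)%C t.
Proof.
  intros H1 H2. replace (fun s => f s - g s)%C with (fun s => f s + (-1) * g s)%C
    by (apply functional_extensionality; intros; ring).
  apply rcont_plus; [auto|]. apply rcont_scal. auto.
Qed.

(** At this point a holomorphic function is not known to have further derivatives, so two of them
    are given as data. The resulting formula is first applied to a second primitive, in
    [hol_deriv]. *)
Section CauchyC2.
Variables (f0 f1 f2 : C -> C) (Rd : R).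
Hypothesis (H01 : forall z, disc Rd z -> cd f0 z (f1 z))
  (H12 : forall z, disc Rd z -> cd f1 z (f2 z)) (H2 : cont_on f2 Rd).

(** Taylor's bound by two integrations along segments, of f1 - f1(a) and then of f2. *)
Lemma quadratic_remainder r M : r < Rd -> (forall z, Cmod z <= r -> Cmod (f2 z) <= M) ->
  forall a b, Cmod a <= r -> Cmod b <= r ->
  Cmod (f0 b - f0 a - (b - a) * f1 a) <= M * (Cmod (b - a) * Cmod (b - a)).
Proof.
  intros Hr HM a b Ha Hb.
  assert (Ha' : disc Rd a) by (unfold disc; lra). assert (Hb' : disc Rd b) by (unfold disc; lra).
  assert (Hc : cont_on (fun z => f1 z - f1 a)%C Rd).
  { intros z Hz. eapply cd_cont. apply cd_minus; [apply H12; auto|apply cd_const]. }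
  assert (E : segI (fun z => f1 z - f1 a)%C a b = (f0 b - f0 a - (b - a) * f1 a)%C).
  { rewrite (segI_primitive (fun z => f0 z - f1 a * z)%C _ Rd); auto; [ring|].
    intros z Hz. eapply cd_to; [apply cd_minus; [apply H01; auto|apply cd_scal; apply cd_id]|]. cbv beta. ring. }
  rewrite <- E.
  replace (M * (Cmod (b - a) * Cmod (b - a))) with (Cmod (b - a) * (Cmod (b - a) * M)) by ring.
  apply segI_bound with Rd; auto. intros t Ht.
  assert (Hs : Cmod (seg a b t) <= r) by (apply seg_disc; auto).
  rewrite <- (segI_primitive f1 f2 Rd); auto; [|unfold disc; lra].
  eapply Rle_trans.
  - apply segI_bound with (R := Rd) (M := M); auto; [unfold disc; lra|].
    intros u Hu. apply HM. apply seg_disc; auto.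
  - apply Rmult_le_compat_r.
    + eapply Rle_trans; [apply Cmod_ge_0|apply (HM a Ha)].
    + replace (seg a b t - a)%C with (RtoC t * (b - a))%C by (unfold seg; ring).
      rewrite Cmod_mult, Cmod_RtoC_pos by lra. pose proof (Cmod_ge_0 (b - a)). nra.
Qed.

(* With f of class C^2, the integral of f(w + s(z - w)) z / (z - w) over |z| = r has increments O(h^2) in s,
   hence is constant for 0 <= s <= 1. *)
Lemma cauchy_formula_C2 r w : r < Rd -> Cmod w < r ->
  cint (fun t => f0 (ce r t) * (ce r t * / (ce r t - w)))%C 0 (2 * PI) = (RtoC (2 * PI) * f0 w)%C.
Proof.
  intros Hr Hw. pose proof (Cmod_ge_0 w) as Hw0. pose proof two_PI_pos as HPI.
  destruct (disc_bounded f2 Rd r H2 Hr) as [M [HM0 HM]].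
  pose proof (quadratic_remainder r M Hr HM) as Q.
  set (c := r - Cmod w). assert (Hc : 0 < c) by (unfold c; lra).
  assert (Hcr : forall t, Cmod (ce r t) = r) by (intros; apply Cmod_ce; lra).
  assert (Hpt : forall s t, 0 <= s <= 1 -> Cmod (seg w (ce r t) s) <= r).
  { intros s t Hs. apply seg_disc; auto; [lra|rewrite Hcr; lra]. }
  assert (Cseg : forall s t, rcont (fun t => seg w (ce r t) s) t).
  { intros s t. unfold seg. apply rcont_plus; [apply rcont_const|]. apply rcont_scal.
    apply rcont_minus; [apply ce_rcont|apply rcont_const]. }
  assert (Ck : forall t, rcont (fun t => ce r t * / (ce r t - w))%C t).
  { intros t. apply rcont_mult; [apply ce_rcont|apply rcont_ce_inv; auto]. }
  assert (C0 : forall s t, 0 <= s <= 1 -> rcont (fun t => f0 (seg w (ce r t) s)) t).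
  { intros s t Hs. apply (rcont_comp f0); [|apply Cseg].
    eapply cd_cont. apply H01. unfold disc. specialize (Hpt s t Hs). lra. }
  assert (C1 : forall s t, 0 <= s <= 1 -> rcont (fun t => f1 (seg w (ce r t) s)) t).
  { intros s t Hs. apply (rcont_comp f1); [|apply Cseg].
    eapply cd_cont. apply H12. unfold disc. specialize (Hpt s t Hs). lra. }
  set (psi := fun s => cint (fun t => f0 (seg w (ce r t) s) * (ce r t * / (ce r t - w)))%C 0 (2 * PI)).
  assert (E : psi 1 = psi 0).
  { apply const_of_quadratic with (M * (2 * r * r) * (2 * PI)).
    - repeat first [lra | apply Rmult_le_pos].
    - intros s h S1 S2. unfold psi.
      set (k := fun t => (RtoC h * (f1 (seg w (ce r t) s) * ce r t))%C).
      assert (Hk0 : rcont_on (fun t => f1 (seg w (ce r t) s) * ce r t)%C 0 (2 * PI)).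
      { intros t _. apply rcont_mult; [apply C1; auto|apply ce_rcont]. }
      assert (Hk : rcont_on k 0 (2 * PI)) by (intros t Ht; apply rcont_scal, Hk0; auto).
      assert (Ik : cint k 0 (2 * PI) = RtoC 0).
      { unfold k. rewrite cint_scal by auto.
        assert (CiCi : (Ci * Ci)%C = (- (1))%C)
          by (unfold Ci, Cmult, Copp, RtoC; simpl; f_equal; ring).
        assert (Ci0 : Ci <> RtoC 0) by (intros X; apply (f_equal snd) in X; simpl in X; lra).
        (* The primitive along the circle is -i f0(w + s (z - w)) / s, which is meaningless at s =
           0; there the integrand reduces to f1(w) z. *)
        destruct (Req_dec s 0) as [Hs0|Hs0].
        - rewrite (cint_ftc (fun t => f1 w * (- Ci * ce r t))%C).
          + rewrite ce_period. ring.
          + auto.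
          + intros t _. replace (seg w (ce r t) s) with w by (subst s; unfold seg; ring).
            replace (f1 w * ce r t)%C with (Ci * ce r t * (f1 w * (- Ci * 1)))%C.
            * apply (rd_comp (fun z => f1 w * (- Ci * z))%C (ce r)); [|apply ce_rd].
              do 2 apply cd_scal. apply cd_id.
            * transitivity (- (Ci * Ci) * (f1 w * ce r t))%C; [ring|]. rewrite CiCi. ring.
          + auto.
        - assert (Hs' : RtoC s <> RtoC 0) by (apply RtoC_neq_0; auto).
          rewrite (cint_ftc (fun t => - Ci * / RtoC s * f0 (w + RtoC s * (ce r t - w)))%C).
          + rewrite ce_period. ring.
          + auto.
          + intros t _.
            replace (f1 (seg w (ce r t) s) * ce r t)%C with
              (Ci * ce r t * (- Ci * / RtoC s * ((0 + RtoC s * (1 - 0)) * f1 (seg w (ce r t) s))))%C.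
            * apply (rd_comp (fun z => - Ci * / RtoC s * f0 (w + RtoC s * (z - w)))%C (ce r)); [|apply ce_rd].
              apply cd_scal. apply (cd_comp f0).
              -- apply H01. cbv beta. unfold disc. specialize (Hpt s t S1). lra.
              -- apply cd_plus; [apply cd_const|apply cd_scal; apply cd_minus; [apply cd_id|apply cd_const]].
            * transitivity (- (Ci * Ci) * (f1 (seg w (ce r t) s) * ce r t))%C; [field; auto|].
              rewrite CiCi. ring.
          + auto. }
      assert (HA : forall s, 0 <= s <= 1 -> rcont_on (fun t => f0 (seg w (ce r t) s) * (ce r t * / (ce r t - w)))%C 0 (2 * PI)).
      { intros s' Hs' t _. apply rcont_mult; [apply C0; auto|auto]. }
      replace (cint (fun t => f0 (seg w (ce r t) (s + h)) * (ce r t * / (ce r t - w)))%C 0 (2 * PI)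
         - cint (fun t => f0 (seg w (ce r t) s) * (ce r t * / (ce r t - w)))%C 0 (2 * PI))%C
        with (cint (fun t => f0 (seg w (ce r t) (s + h)) * (ce r t * / (ce r t - w))
           - f0 (seg w (ce r t) s) * (ce r t * / (ce r t - w)) - k t)%C 0 (2 * PI)).
      + replace (M * (2 * r * r) * (2 * PI) * (h * h)) with (M * (2 * r * r) * (h * h) * (2 * PI - 0)) by ring.
        apply cint_bound; [auto| |].
        * intros t Ht. apply rcont_minus; [apply rcont_minus|]; [apply HA; auto|apply HA; auto|auto].
        * intros t Ht. pose proof (ce_neq r w t Hw) as N1.
          specialize (Q (seg w (ce r t) s) (seg w (ce r t) (s + h)) (Hpt s t S1) (Hpt (s + h) t S2)).
          replace (seg w (ce r t) (s + h) - seg w (ce r t) s)%C with (RtoC h * (ce r t - w))%C in Q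
            by (unfold seg; rewrite RtoC_plus; ring).
          match goal with |- Cmod ?X <= _ => replace X with
            ((f0 (seg w (ce r t) (s + h)) - f0 (seg w (ce r t) s) - RtoC h * (ce r t - w) * f1 (seg w (ce r t) s))
              * (ce r t * / (ce r t - w)))%C by (unfold k; field; auto) end.
          rewrite Cmod_mult, Cmod_mult, Cmod_inv, Hcr by auto.
          rewrite Cmod_mult, Cmod_R in Q.
          set (A := Cmod (ce r t - w)) in *.
          assert (HA0 : 0 < A) by (apply (proj1 (Cmod_gt_0 _)); auto).
          assert (HA2 : A <= 2 * r).
          { unfold A. eapply Rle_trans; [apply Cmod_triangle|]. rewrite Cmod_opp, Hcr. lra. }
          eapply Rle_trans; [apply Rmult_le_compat_r; [|exact Q]|].
          { apply Rmult_le_pos; [lra|left; apply Rinv_0_lt_compat; auto]. }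
          replace (M * (Rabs h * A * (Rabs h * A)) * (r * / A)) with (M * r * (Rabs h * Rabs h) * A) by (field; lra).
          rewrite <- Rabs_mult, (Rabs_pos_eq (h * h)) by nra.
          replace (M * (2 * r * r) * (h * h)) with (M * r * (h * h) * (2 * r)) by ring.
          apply Rmult_le_compat_l; [|auto]. apply Rmult_le_pos; [|nra]. apply Rmult_le_pos; lra.
      + rewrite cint_minus; [|auto| |auto].
        * rewrite Ik, cint_minus; [ring|auto|apply HA; auto|apply HA; auto].
        * intros t Ht. apply rcont_minus; apply HA; auto. }
  transitivity (psi 1).
  - unfold psi. apply cint_ext; [auto|]. intros t _. do 2 f_equal. unfold seg. ring.
  - rewrite E. unfold psi. transitivity (cint (fun t => f0 w * (ce r t * / (ce r t - w)))%C 0 (2 * PI)).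
    + apply cint_ext; [auto|]. intros t _. f_equal. f_equal. unfold seg. ring.
    + rewrite cint_scal; [|auto|intros t _; auto]. rewrite cauchy_kernel by auto. ring.
Qed.
End CauchyC2.

(** Cauchy-type integrals: they are holomorphic in w for every bounded continuous weight on the
    circle, and differentiation in w merely raises the exponent of the kernel. *)
Definition Phi (r : R) (psi : R -> C) (n : nat) (w : C) : C :=
  cint (fun t => psi t * Cpown (/ (ce r t - w)) n)%C 0 (2 * PI).

Lemma rcont_pown g n t : rcont g t -> rcont (fun t => Cpown (g t) n) t.
Proof.
  intros H. induction n; simpl; [apply rcont_const|]. apply rcont_mult; auto.
Qed.

Lemma Cmod_pown (z : C) n : Cmod (Cpown z n) = Cmod z ^ n.
Proof. induction n; simpl; [apply Cmod_1|]. rewrite Cmod_mult, IHn. ring. Qed.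

Lemma kernel_expand (B : R) n : 0 <= B -> exists K, 0 <= K /\ forall x y h : C,
  Cmod x <= B -> Cmod y <= B -> (x - y)%C = (h * (x * y))%C ->
  Cmod (Cpown x n - Cpown y n - h * (RtoC (INR n) * Cpown y (S n))) <= K * (Cmod h * Cmod h).
Proof.
  intros HB. induction n.
  - exists 0. split; [lra|]. intros x y h _ _ _. simpl.
    replace (1 - 1 - h * (0 * (y * 1)))%C with (RtoC 0) by ring. rewrite Cmod_0. lra.
  - destruct IHn as [K [HK H]].
    set (b := B ^ n). assert (Hb : 0 <= b) by (apply pow_le; auto).
    exists (B * K + b * (B * B * B) + INR n * (b * B * (B * B))).
    pose proof (pos_INR n) as Hn. split.
    { repeat apply Rplus_le_le_0_compat; repeat first [lra | apply Rmult_le_pos]. }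
    intros x y h Hx Hy E.
    specialize (H x y h Hx Hy E).
    replace (Cpown x (S n) - Cpown y (S n) - h * (RtoC (INR (S n)) * Cpown y (S (S n))))%C
      with (x * (Cpown x n - Cpown y n - h * (RtoC (INR n) * Cpown y (S n)))
        + Cpown y n * (h * y * (x - y)) + RtoC (INR n) * (h * (y * Cpown y n) * (x - y)))%C.
    + rewrite E. eapply Rle_trans; [apply Cmod_triangle|].
      eapply Rle_trans; [apply Rplus_le_compat_r, Cmod_triangle|].
      rewrite (Cmod_mult x). rewrite !Cmod_mult, Cmod_pown, Cmod_RtoC_pos by auto.
      set (p := Cmod x) in *. set (q := Cmod y) in *. set (g := Cmod h).
      assert (Hp : 0 <= p) by apply Cmod_ge_0. assert (Hq : 0 <= q) by apply Cmod_ge_0.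
      assert (Hg : 0 <= g) by apply Cmod_ge_0.
      assert (Hqn : q ^ n <= b) by (apply pow_incr; lra).
      assert (Hq0 : 0 <= q ^ n) by (apply pow_le; lra).
      fold g in H.
      rewrite !Rmult_plus_distr_r. apply Rplus_le_compat; [apply Rplus_le_compat|].
      * rewrite Rmult_assoc. apply Rmult_le_compat; auto. apply Cmod_ge_0.
      * replace (q ^ n * (g * q * (g * (p * q)))) with (q ^ n * (q * p * q) * (g * g)) by ring.
        apply Rmult_le_compat_r; [nra|]. apply Rmult_le_compat; auto; [nra|].
        apply Rmult_le_compat; try nra.
      * replace (INR n * (g * (q * q ^ n) * (g * (p * q)))) with (INR n * (q ^ n * q * (p * q)) * (g * g)) by ring.
        apply Rmult_le_compat_r; [nra|]. apply Rmult_le_compat_l; auto.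
        apply Rmult_le_compat; try nra.
    + rewrite S_INR, RtoC_plus. simpl Cpown.
      match goal with |- ?L = ?Rt => transitivity (Rt + - Cpown y n * ((x - y) - h * (x * y)))%C end; [ring|].
      rewrite E. ring.
Qed.

Lemma Phi_deriv r psi n w : rcont_on psi 0 (2 * PI) ->
  (exists M, forall t, 0 <= t <= 2 * PI -> Cmod (psi t) <= M) -> Cmod w < r ->
  cd (Phi r psi n) w (RtoC (INR n) * Phi r psi (S n) w)%C.
Proof.
  intros Hpsi [M HM] Hw. pose proof (Cmod_ge_0 w) as Hw0. pose proof two_PI_pos as HPI.
  set (c := (r - Cmod w) / 2). assert (Hc : 0 < c) by (unfold c; lra).
  assert (HM0 : 0 <= M) by (eapply Rle_trans; [apply Cmod_ge_0|apply (HM 0); lra]).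
  destruct (kernel_expand (/ c) n) as [K [HK Hx]]; [left; apply Rinv_0_lt_compat; auto|].
  assert (Hcont : forall n w, Cmod w < r -> rcont_on (fun t => psi t * Cpown (/ (ce r t - w)) n)%C 0 (2 * PI)).
  { intros m w' Hw' t Ht. apply rcont_mult; [auto|]. apply rcont_pown, rcont_ce_inv; auto. }
  apply cd_eps. intros e He.
  set (D := M * K * (2 * PI)). assert (HD : 0 <= D) by (unfold D; repeat first [lra | apply Rmult_le_pos]).
  exists (Rmin c (e / (D + 1))). split; [apply Rmin_pos; [lra|apply Rdiv_lt_0_compat; lra]|].
  intros w' Hw'.
  assert (Hw1 : Cmod (w' - w) < c) by (eapply Rlt_le_trans; [exact Hw'|apply Rmin_l]).
  assert (Hw2 : Cmod (w' - w) < e / (D + 1)) by (eapply Rlt_le_trans; [exact Hw'|apply Rmin_r]).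
  assert (Hwr : Cmod w' < r - c).
  { replace w' with (w + (w' - w))%C by ring. eapply Rle_lt_trans; [apply Cmod_triangle|]. unfold c in *; lra. }
  assert (B : forall u t, Cmod u < r -> c <= r - Cmod u -> Cmod (/ (ce r t - u)) <= / c).
  { intros u t Hu Hu'. rewrite Cmod_inv by (apply ce_neq; auto).
    apply Rinv_le_contravar; [auto|]. pose proof (ce_dist r u t Hu). lra. }
  assert (Hwr' : Cmod w' < r) by lra.
  unfold Phi.
  replace (cint (fun t => psi t * Cpown (/ (ce r t - w')) n)%C 0 (2 * PI)
    - cint (fun t => psi t * Cpown (/ (ce r t - w)) n)%C 0 (2 * PI)
    - RtoC (INR n) * cint (fun t => psi t * Cpown (/ (ce r t - w)) (S n))%C 0 (2 * PI) * (w' - w))%C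
   with (cint (fun t => psi t * Cpown (/ (ce r t - w')) n - psi t * Cpown (/ (ce r t - w)) n
      - (RtoC (INR n) * (w' - w)) * (psi t * Cpown (/ (ce r t - w)) (S n)))%C 0 (2 * PI)).
  - apply Rle_trans with (M * K * (Cmod (w' - w) * Cmod (w' - w)) * (2 * PI - 0)).
    + apply cint_bound; [auto| |].
      * intros t Ht. apply rcont_minus; [apply rcont_minus|apply rcont_scal]; apply Hcont; auto.
      * intros t Ht.
        pose proof (ce_neq r w t Hw) as N1. pose proof (ce_neq r w' t Hwr') as N2.
        match goal with |- Cmod ?X <= _ => replace X with (psi t * (Cpown (/ (ce r t - w')) n
           - Cpown (/ (ce r t - w)) n - (w' - w) * (RtoC (INR n) * Cpown (/ (ce r t - w)) (S n))))%C by ring end.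
        rewrite Cmod_mult, Rmult_assoc. apply Rmult_le_compat; [apply Cmod_ge_0|apply Cmod_ge_0|auto|].
        apply Hx.
        -- apply B; auto. lra.
        -- apply B; auto. unfold c. lra.
        -- field. auto.
    + assert (Cmod (w' - w) * (D + 1) <= e).
      { left. apply (Rmult_lt_compat_r (D + 1)) in Hw2; [|lra].
        unfold Rdiv in Hw2. rewrite Rmult_assoc, Rinv_l, Rmult_1_r in Hw2 by lra. auto. }
      pose proof (Cmod_ge_0 (w' - w)) as Hg.
      replace (M * K * (Cmod (w' - w) * Cmod (w' - w)) * (2 * PI - 0))
        with (D * Cmod (w' - w) * Cmod (w' - w)) by (unfold D; ring).
      apply Rmult_le_compat_r; nra.
  - rewrite cint_minus; [|auto| |].
    + rewrite cint_minus; [|auto|apply Hcont; auto|apply Hcont; auto].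
      rewrite cint_scal; [ring|auto|apply Hcont; auto].
    + intros t Ht. apply rcont_minus; apply Hcont; auto.
    + intros t Ht. apply rcont_scal. apply Hcont; auto.
Qed.

(** * Regularity, uniform limits and division of holomorphic functions *)

Lemma cd_ext_disc f g r z l : (forall w, Cmod w < r -> f w = g w) -> Cmod z < r ->
  cd f z l -> cd g z l.
Proof.
  intros H Hz. apply cd_ext_loc with (r - Cmod z); [lra|]. intros w Hw. apply H.
  replace w with (z + (w - z))%C by ring. eapply Rle_lt_trans; [apply Cmod_triangle|]. lra.
Qed.

(** On the circle z dt = dz / i, so the constant in Cauchy's formula is 2 pi for this
    normalisation. *)
Definition cauchy_int (f : C -> C) r w := Phi r (fun t => f (ce r t) * ce r t)%C 1 w.

Lemma cauchy_intE f r w :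
  cint (fun t => f (ce r t) * (ce r t * / (ce r t - w)))%C 0 (2 * PI) = cauchy_int f r w.
Proof.
  apply cint_ext; [apply two_PI_pos|]. intros t _. simpl. ring.
Qed.

Lemma twoPI_C_neq0 : RtoC (2 * PI) <> RtoC 0.
Proof. apply RtoC_neq_0. pose proof PI_RGT_0. lra. Qed.

Lemma cont_circle f Rd r : cont_on f Rd -> 0 <= r < Rd -> forall t, rcont (fun t => f (ce r t)) t.
Proof.
  intros Hf Hr t. apply rcont_comp; [apply Hf; unfold disc; rewrite Cmod_ce; lra|apply ce_rcont].
Qed.

Lemma Phi_circle_deriv f Rd r n w : cont_on f Rd -> r < Rd -> Cmod w < r ->
  cd (Phi r (fun t => f (ce r t) * ce r t)%C n) w
     (RtoC (INR n) * Phi r (fun t => f (ce r t) * ce r t)%C (S n) w)%C.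
Proof.
  intros Hf Hr Hw. assert (0 <= r) by (pose proof (Cmod_ge_0 w); lra).
  apply Phi_deriv; [|  |auto].
  - intros t _. apply rcont_mult; [eapply cont_circle; eauto|apply ce_rcont].
  - destruct (disc_bounded f Rd r Hf Hr) as [M [HM K]]. exists (M * r). intros t _.
    rewrite Cmod_mult, Cmod_ce by lra. apply Rmult_le_compat_r; [lra|]. apply K. rewrite Cmod_ce; lra.
Qed.

(** A second primitive of f is C^2 and so equals a Cauchy integral, which can be differentiated any
    number of times. Its third derivative is f', and one more derivative shows that f' is
    differentiable. *)
Lemma hol_deriv f Rd : hol f Rd -> hol (cderiv f) Rd.
Proof.
  intros Hf z Hz. unfold disc in Hz. pose proof (Cmod_ge_0 z).
  assert (HR : 0 < Rd) by lra.
  destruct (primitive f Rd HR Hf) as [F1 H1].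
  destruct (primitive F1 Rd HR) as [F2 H2].
  { intros w Hw. exists (f w). auto. }
  set (r := (Cmod z + Rd) / 2). assert (Hr : r < Rd) by (unfold r; lra).
  assert (Hzr : Cmod z < r) by (unfold r; lra).
  assert (HF2 : cont_on F2 Rd) by (intros w Hw; eapply cd_cont; eauto).
  set (psi := fun t => (F2 (ce r t) * ce r t)%C).
  set (c := (/ RtoC (2 * PI))%C).
  assert (E2 : forall w, Cmod w < r -> (c * Phi r psi 1 w)%C = F2 w).
  { intros w Hw.
    pose proof (cauchy_formula_C2 F2 F1 f Rd H2 H1 (hol_cont _ _ Hf) r w Hr Hw) as E.
    rewrite cauchy_intE in E. unfold cauchy_int in E. fold psi in E. rewrite E. unfold c.
    field. apply RtoC_neq_0. pose proof PI_RGT_0. lra. }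
  assert (D : forall n w, Cmod w < r -> cd (Phi r psi n) w (RtoC (INR n) * Phi r psi (S n) w)%C).
  { intros. eapply Phi_circle_deriv; eauto. }
  assert (Hd : forall w, Cmod w < r -> disc Rd w) by (intros w Hw; unfold disc; lra).
  assert (E1 : forall w, Cmod w < r -> (c * (RtoC (INR 1) * Phi r psi 2 w))%C = F1 w).
  { intros w Hw. apply (cd_unique F2 w); [|auto].
    eapply (cd_ext_disc _ _ r); [exact E2|auto|]. apply cd_scal. auto. }
  assert (E0 : forall w, Cmod w < r ->
     (c * (RtoC (INR 1) * (RtoC (INR 2) * Phi r psi 3 w)))%C = f w).
  { intros w Hw. apply (cd_unique F1 w); [|auto].
    eapply (cd_ext_disc _ _ r); [exact E1|auto|]. do 2 apply cd_scal. auto. }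
  assert (E : forall w, Cmod w < r ->
     (c * (RtoC (INR 1) * (RtoC (INR 2) * (RtoC (INR 3) * Phi r psi 4 w))))%C = cderiv f w).
  { intros w Hw. symmetry. apply cderiv_eq.
    eapply (cd_ext_disc _ _ r); [exact E0|auto|]. do 3 apply cd_scal. auto. }
  eexists. eapply (cd_ext_disc _ _ r); [exact E|auto|]. do 4 apply cd_scal. apply D. auto.
Qed.

Lemma cauchy_formula f Rd r w : hol f Rd -> r < Rd -> Cmod w < r ->
  cauchy_int f r w = (RtoC (2 * PI) * f w)%C.
Proof.
  intros Hf Hr Hw. rewrite <- cauchy_intE.
  apply (cauchy_formula_C2 f (cderiv f) (cderiv (cderiv f)) Rd); auto.
  - apply hol_chol; auto.
  - apply hol_chol, hol_deriv; auto.
  - apply hol_cont, hol_deriv, hol_deriv; auto.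
Qed.

Lemma cauchy_int_bound f Rd r w M : cont_on f Rd -> r < Rd -> Cmod w < r ->
  (forall t, Cmod (f (ce r t)) <= M) -> Cmod (cauchy_int f r w) <= M * r / (r - Cmod w) * (2 * PI).
Proof.
  intros Hf Hr Hw HM. pose proof (Cmod_ge_0 w).
  assert (HM0 : 0 <= M) by (eapply Rle_trans; [apply Cmod_ge_0|apply (HM 0)]).
  rewrite <- cauchy_intE. replace (2 * PI) with (2 * PI - 0) at 2 by ring.
  apply cint_bound; [apply two_PI_pos| |].
  - intros t _. apply rcont_mult; [eapply cont_circle; eauto; lra|].
    apply rcont_mult; [apply ce_rcont|apply rcont_ce_inv; auto].
  - intros t _. rewrite !Cmod_mult, Cmod_inv, Cmod_ce by (try apply ce_neq; lra).
    unfold Rdiv. rewrite Rmult_assoc. apply Rmult_le_compat; [apply Cmod_ge_0| |auto|].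
    + apply Rmult_le_pos; [lra|]. left. apply Rinv_0_lt_compat.
      pose proof (ce_dist r w t Hw). lra.
    + apply Rmult_le_compat_l; [lra|]. apply Rinv_le_contravar; [lra|apply ce_dist; auto].
Qed.

(** A weak maximum principle read off from Cauchy's formula; the loss factor r/(r - |w|) is harmless
    in the limits where it is applied. *)
Lemma hol_circle_bound f Rd r w M : hol f Rd -> r < Rd -> Cmod w < r ->
  (forall t, Cmod (f (ce r t)) <= M) -> Cmod (f w) <= M * r / (r - Cmod w).
Proof.
  intros Hf Hr Hw HM.
  pose proof (cauchy_int_bound f Rd r w M (hol_cont _ _ Hf) Hr Hw HM) as B.
  rewrite (cauchy_formula f Rd r w Hf Hr Hw), Cmod_mult, Cmod_RtoC_pos in B by apply two_PI_pos.
  pose proof PI_RGT_0. apply (Rmult_le_reg_l (2 * PI)); [lra|]. lra.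
Qed.

Lemma cauchy_int_hol f Rd : cont_on f Rd ->
  (forall r w, r < Rd -> Cmod w < r -> cauchy_int f r w = (RtoC (2 * PI) * f w)%C) -> hol f Rd.
Proof.
  intros Hf H z Hz. unfold disc in Hz. set (r := (Cmod z + Rd) / 2).
  assert (Hr : r < Rd) by (unfold r; lra). assert (Hzr : Cmod z < r) by (unfold r; lra).
  eexists. apply (cd_ext_disc (fun w => / RtoC (2 * PI) * cauchy_int f r w)%C _ r).
  - intros w Hw. rewrite H by auto. field. apply RtoC_neq_0. pose proof PI_RGT_0. lra.
  - auto.
  - apply cd_scal. exact (Phi_circle_deriv f Rd r 1 z Hf Hr Hzr).
Qed.

Lemma uniform_limit_cont (fn : nat -> C -> C) f Rd : (forall n, cont_on (fn n) Rd) ->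
  (forall r e, r < Rd -> 0 < e -> exists n, forall z, Cmod z <= r -> Cmod (fn n z - f z) <= e) ->
  cont_on f Rd.
Proof.
  intros Hn H z Hz e He. unfold disc in Hz. set (r := (Cmod z + Rd) / 2).
  assert (Hr : r < Rd) by (unfold r; lra). assert (Hzr : Cmod z < r) by (unfold r; lra).
  destruct (H r (e / 4) Hr) as [n K]; [lra|].
  destruct (Hn n z Hz (e / 4)) as [d [Hd L]]; [lra|].
  exists (Rmin d (r - Cmod z)). split; [apply Rmin_pos; lra|]. intros w Hw.
  specialize (L w (Rlt_le_trans _ _ _ Hw (Rmin_l _ _))).
  assert (Hwr : Cmod w <= r).
  { assert (Cmod (w - z) < r - Cmod z) by (eapply Rlt_le_trans; [exact Hw|apply Rmin_r]).
    replace w with (z + (w - z))%C by ring. eapply Rle_trans; [apply Cmod_triangle|]. lra. }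
  pose proof (K w Hwr) as K1. pose proof (K z (Rlt_le _ _ Hzr)) as K2.
  pose proof (Cmod_sub_triangle (f w) (fn n w) (f z)) as T1.
  pose proof (Cmod_sub_triangle (fn n w) (fn n z) (f z)) as T2.
  rewrite (Cmod_sub_sym (f w) (fn n w)) in T1. lra.
Qed.

(** Cauchy's formula survives locally uniform limits, and a continuous function that satisfies it is
    holomorphic. *)
Lemma weierstrass (fn : nat -> C -> C) f Rd : (forall n, hol (fn n) Rd) ->
  (forall r e, r < Rd -> 0 < e -> exists n, forall z, Cmod z <= r -> Cmod (fn n z - f z) <= e) ->
  hol f Rd.
Proof.
  intros Hn H.
  assert (Hf : cont_on f Rd).
  { apply (uniform_limit_cont fn); [intros n; apply hol_cont; auto|auto]. }
  apply cauchy_int_hol; [auto|]. intros r w Hr Hw. pose proof (Cmod_ge_0 w) as Hw0.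
  assert (G : Cmod (cauchy_int f r w - RtoC (2 * PI) * f w) <= 0).
  { apply le_eps. intros e He. rewrite Rplus_0_l.
    pose proof PI_RGT_0 as HPI.
    set (B := r / (r - Cmod w)).
    assert (HB : 0 < B) by (unfold B; apply Rdiv_lt_0_compat; lra).
    assert (HD : 0 < 2 * PI * (B + 1)) by (apply Rmult_lt_0_compat; lra).
    destruct (H r (e / (2 * PI * (B + 1))) Hr) as [n K]; [apply Rdiv_lt_0_compat; lra|].
    set (e' := e / (2 * PI * (B + 1))) in *.
    assert (He' : e' * (2 * PI * (B + 1)) = e) by (unfold e'; field; lra).
    assert (Hg : cont_on (fun z => fn n z + (-1) * f z)%C Rd).
    { intros z Hz. apply ccont_plus; [apply (hol_cont _ _ (Hn n)); auto|apply ccont_scal; auto]. }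
    pose proof (cauchy_int_bound (fun z => fn n z + (-1) * f z)%C Rd r w e' Hg Hr Hw) as Bd.
    assert (E : cauchy_int (fun z => fn n z + (-1) * f z)%C r w
       = (RtoC (2 * PI) * fn n w - cauchy_int f r w)%C).
    { rewrite <- (cauchy_formula _ Rd r w (Hn n) Hr Hw). rewrite <- !cauchy_intE.
      assert (Hk : forall g, cont_on g Rd -> rcont_on (fun t => g (ce r t) * (ce r t * / (ce r t - w)))%C 0 (2 * PI)).
      { intros g Hg' t _. apply rcont_mult; [eapply cont_circle; eauto; lra|].
        apply rcont_mult; [apply ce_rcont|apply rcont_ce_inv; auto]. }
      rewrite <- cint_minus; [|apply two_PI_pos|apply Hk, hol_cont; auto|apply Hk; auto].
      apply cint_ext; [apply two_PI_pos|]. intros; ring. }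
    rewrite E in Bd.
    assert (Bd' := Bd (fun t => ltac:(replace (fn n (ce r t) + (-1) * f (ce r t))%C with (fn n (ce r t) - f (ce r t))%C by ring;
        apply K; rewrite Cmod_ce; lra))). clear Bd.
    pose proof (K w (Rlt_le _ _ Hw)) as Kw.
    replace (cauchy_int f r w - RtoC (2 * PI) * f w)%C
      with (- (RtoC (2 * PI) * fn n w - cauchy_int f r w) + RtoC (2 * PI) * (fn n w - f w))%C by ring.
    eapply Rle_trans; [apply Cmod_triangle|]. rewrite Cmod_opp, Cmod_mult, Cmod_RtoC_pos by lra.
    replace (e' * r / (r - Cmod w)) with (e' * B) in Bd' by (unfold B; field; lra).
    assert (2 * PI * Cmod (fn n w - f w) <= 2 * PI * e') by (apply Rmult_le_compat_l; lra).
    lra. }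
  pose proof (Cmod_ge_0 (cauchy_int f r w - RtoC (2 * PI) * f w)).
  transitivity ((cauchy_int f r w - RtoC (2 * PI) * f w) + RtoC (2 * PI) * f w)%C; [ring|].
  rewrite (Cmod_eq_0 (cauchy_int f r w - RtoC (2 * PI) * f w)) by lra. ring.
Qed.

Lemma hol_divide f Rd : 0 < Rd -> hol f Rd -> f (RtoC 0) = RtoC 0 ->
  exists g, hol g Rd /\ forall w, disc Rd w -> f w = (w * g w)%C.
Proof.
  intros HR Hf Hf0.
  set (g := fun w : C => if Ceq_dec w 0 then cderiv f 0 else (f w / w)%C).
  assert (H0d : disc Rd 0%C) by (unfold disc; rewrite Cmod_0; auto).
  assert (Hfg : forall w, disc Rd w -> f w = (w * g w)%C).
  { intros w Hw. unfold g. destruct (Ceq_dec w 0) as [->|Hn]; [rewrite Hf0; ring|field; auto]. }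
  exists g. split; [|auto]. intros z Hz.
  destruct (Ceq_dec z 0) as [->|Hz0].
  - set (r := Rd / 2). assert (Hr : r < Rd) by (unfold r; lra). assert (Hr0 : 0 < r) by (unfold r; lra).
    (* The weight has no factor z: as f(0) = 0, subtracting Cauchy's formula at 0 from the one at w
       turns z/(z - w) - 1 into w/(z - w). This exhibits f(w)/w as a Cauchy-type integral near 0. *)
    set (psi := fun t => f (ce r t)).
    set (k := fun w => (/ RtoC (2 * PI) * Phi r psi 1 w)%C).
    assert (Hpsi : rcont_on psi 0 (2 * PI)).
    { intros t _. eapply cont_circle; [eapply hol_cont; eauto|lra]. }
    assert (HB : exists M, forall t, 0 <= t <= 2 * PI -> Cmod (psi t) <= M).
    { destruct (disc_bounded f Rd r (hol_cont _ _ Hf) Hr) as [M [_ HM]]. exists M. intros t _.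
      apply HM. rewrite Cmod_ce; lra. }
    assert (Hk : forall w, Cmod w < r -> cd k w (/ RtoC (2 * PI) * (RtoC (INR 1) * Phi r psi 2 w))%C).
    { intros w Hw. apply cd_scal. apply Phi_deriv; auto. }
    assert (E : forall w, Cmod w < r -> f w = (w * k w)%C).
    { intros w Hw.
      pose proof (cauchy_formula f Rd r w Hf Hr Hw) as C1.
      assert (Hw0 : Cmod (RtoC 0) < r) by (rewrite Cmod_0; auto).
      pose proof (cauchy_formula f Rd r 0%C Hf Hr Hw0) as C0. rewrite Hf0 in C0.
      rewrite <- cauchy_intE in C0, C1.
      assert (Hc : forall u, Cmod u < r -> rcont_on (fun t => f (ce r t) * (ce r t * / (ce r t - u)))%C 0 (2 * PI)).
      { intros u Hu t Ht. apply rcont_mult; [apply Hpsi; auto|].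
        apply rcont_mult; [apply ce_rcont|apply rcont_ce_inv; auto]. }
      assert (X : (RtoC (2 * PI) * f w - RtoC (2 * PI) * 0)%C = (w * Phi r psi 1 w)%C).
      { rewrite <- C0, <- C1. rewrite <- cint_minus; [|apply two_PI_pos|auto|auto].
        unfold Phi. rewrite <- cint_scal; [|apply two_PI_pos|].
        - apply cint_ext; [apply two_PI_pos|]. intros t _.
          pose proof (ce_neq r w t Hw). pose proof (ce_neq r 0%C t Hw0) as Hc0.
          replace (ce r t - 0)%C with (ce r t) in Hc0 by ring.
          unfold psi. simpl. field. repeat split; auto.
        - intros t Ht. apply rcont_mult; [auto|]. apply rcont_pown, rcont_ce_inv; auto. }
      unfold k. pose proof twoPI_C_neq0.
      transitivity (/ RtoC (2 * PI) * (RtoC (2 * PI) * f w - RtoC (2 * PI) * 0))%C; [field; auto|].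
      rewrite X. ring. }
    eexists. apply (cd_ext_disc k _ r); [|rewrite Cmod_0; auto|apply Hk; rewrite Cmod_0; auto].
    intros w Hw. unfold g. destruct (Ceq_dec w 0) as [->|Hn].
    + symmetry. apply cderiv_eq.
      apply (cd_ext_disc (fun w => w * k w)%C _ r); [intros; symmetry; auto|rewrite Cmod_0; auto|].
      eapply cd_to; [apply cd_mult; [apply cd_id|apply Hk; rewrite Cmod_0; auto]|]. cbv beta. ring.
    + rewrite E by auto. field. auto.
  - destruct (Hf z Hz) as [l Hl]. eexists.
    apply (cd_ext_loc (fun w => f w / w)%C _ _ _ (Cmod z)).
    + apply (proj1 (Cmod_gt_0 _)); auto.
    + intros w Hw. unfold g. destruct (Ceq_dec w 0) as [->|Hn]; [|auto].
      exfalso. replace (0 - z)%C with (- z)%C in Hw by ring. rewrite Cmod_opp in Hw. lra.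
    + apply cd_div; [auto|exact Hl|apply cd_id].
Qed.

(** Were f divisible by every power of w, the circle bound for f/w^n would give |f(z0)| <= C
    (|z0|/r)^n for all n, and f(z0) would be 0. *)
Lemma hol_leading f Rd z0 : 0 < Rd -> hol f Rd -> disc Rd z0 -> f z0 <> RtoC 0 ->
  exists n g, hol g Rd /\ g (RtoC 0) <> RtoC 0 /\ forall w, disc Rd w -> f w = (Cpown w n * g w)%C.
Proof.
  intros HR Hf Hz0 Hfz. apply NNPP. intros Hno.
  assert (G : forall n, exists g, hol g Rd /\ forall w, disc Rd w -> f w = (Cpown w n * g w)%C).
  { induction n.
    - exists f. split; [auto|]. intros; simpl; ring.
    - destruct IHn as [g [Hg E]].
      destruct (Ceq_dec (g 0%C) 0) as [H0|H0].
      + destruct (hol_divide g Rd HR Hg H0) as [g' [Hg' E']]. exists g'. split; [auto|].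
        intros w Hw. rewrite E, E' by auto. simpl. ring.
      + exfalso. apply Hno. exists n, g. auto. }
  unfold disc in Hz0. pose proof (Cmod_ge_0 z0).
  set (r := (Cmod z0 + Rd) / 2). assert (Hr : r < Rd) by (unfold r; lra).
  assert (Hzr : Cmod z0 < r) by (unfold r; lra). assert (Hr0 : 0 < r) by lra.
  destruct (disc_bounded f Rd r (hol_cont _ _ Hf) Hr) as [M [HM0 HM]].
  assert (B : Cmod (f z0) <= 0).
  { apply le_eps. intros e He. rewrite Rplus_0_l.
    set (D := M * r / (r - Cmod z0)). assert (HD : 0 < D) by (unfold D; apply Rdiv_lt_0_compat; nra).
    set (q := Cmod z0 / r).
    assert (Hq : 0 <= q < 1).
    { unfold q. split; [apply Rmult_le_pos; [lra|left; apply Rinv_0_lt_compat; lra]|].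
      apply (Rmult_lt_reg_r r); [lra|]. unfold Rdiv. rewrite Rmult_assoc, Rinv_l by lra. lra. }
    destruct (pow_lim0 q (e / D) Hq) as [n Hn]; [apply Rdiv_lt_0_compat; lra|].
    specialize (Hn n (le_n n)). destruct (G n) as [g [Hg E]].
    assert (Hrn : 0 < r ^ n) by (apply pow_lt; lra).
    assert (Bg : Cmod (g z0) <= (M / r ^ n) * r / (r - Cmod z0)).
    { apply hol_circle_bound with Rd; auto. intros t.
      specialize (HM (ce r t)). rewrite Cmod_ce in HM by lra. specialize (HM (Rle_refl r)).
      rewrite E, Cmod_mult, Cmod_pown in HM by (unfold disc; rewrite Cmod_ce; lra).
      rewrite Cmod_ce in HM by lra.
      apply (Rmult_le_reg_l (r ^ n)); [auto|]. replace (r ^ n * (M / r ^ n)) with M by (field; lra). auto. }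
    rewrite E, Cmod_mult, Cmod_pown by auto.
    assert (Hz0n : 0 <= Cmod z0 ^ n) by (apply pow_le; auto).
    eapply Rle_trans; [apply Rmult_le_compat_l; [auto|exact Bg]|].
    replace (Cmod z0 ^ n * (M / r ^ n * r / (r - Cmod z0))) with (D * q ^ n).
    - apply (Rmult_lt_compat_l D) in Hn; [|auto]. replace (D * (e / D)) with e in Hn by (field; lra). lra.
    - unfold D, q. unfold Rdiv at 2. rewrite Rpow_mult_distr, pow_inv. field. lra. }
  apply Hfz. apply Cmod_eq_0. pose proof (Cmod_ge_0 (f z0)). lra.
Qed.

(** * The exponential, the logarithm and complex powers *)

Lemma C_eta (w : C) : w = (Re w, Im w).
Proof. destruct w; reflexivity. Qed.

Lemma cexp_plus a b : cexp (a + b)%C = (cexp a * cexp b)%C.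
Proof.
  destruct a as [x y], b as [u v]. unfold cexp, Cmult. simpl.
  rewrite exp_plus, cos_plus, sin_plus. f_equal; ring.
Qed.

Lemma cexp_0 : cexp 0%C = RtoC 1.
Proof. unfold cexp, RtoC. simpl. rewrite exp_0, cos_0, sin_0. f_equal; ring. Qed.

Lemma Cmod_cexp w : Cmod (cexp w) = exp (Re w).
Proof.
  change (cexp w) with (ce (exp (Re w)) (Im w)). apply Cmod_ce. left. apply exp_pos.
Qed.

Lemma cexp_neq_0 w : cexp w <> RtoC 0.
Proof.
  intros H. pose proof (exp_pos (Re w)). rewrite <- Cmod_cexp, H, Cmod_0 in H0. lra.
Qed.

Lemma cexp_opp w : cexp (- w)%C = (/ cexp w)%C.
Proof.
  pose proof (cexp_neq_0 w).
  transitivity (cexp (- w) * cexp w * / cexp w)%C; [field; auto|].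
  rewrite <- cexp_plus. replace (- w + w)%C with (RtoC 0) by ring. rewrite cexp_0. ring.
Qed.

Lemma cexp_eq_1 w : cexp w = RtoC 1 -> exists n : Z, w = (2 * RtoC PI * Ci * RtoC (IZR n))%C.
Proof.
  intros H. pose proof (Cmod_cexp w) as M. rewrite H, Cmod_1 in M.
  assert (Hr : Re w = 0) by (apply exp_inv; rewrite exp_0; auto).
  unfold cexp in H. rewrite Hr, exp_0 in H. apply (f_equal fst) in H. simpl in H.
  assert (S0 : sin (Im w / 2) = 0).
  { pose proof (cos_2a_sin (Im w / 2)) as E. replace (2 * (Im w / 2)) with (Im w) in E by field. nra. }
  apply sin_eq_0_0 in S0. destruct S0 as [n Hn]. exists n.
  rewrite (C_eta w), Hr. replace (Im w) with (2 * (IZR n * PI)) by lra.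
  unfold Cmult, Ci, RtoC. simpl. f_equal; ring.
Qed.

Lemma exp_o (e : R) : 0 < e -> exists d, 0 < d /\ forall x, Rabs x < d -> Rabs (exp x - 1 - x) <= e * Rabs x.
Proof.
  intros He. destruct (derivable_pt_lim_exp 0 e He) as [d Hd]. exists d. split; [apply cond_pos|].
  intros x Hx. destruct (Req_dec x 0) as [->|Hn].
  - rewrite exp_0. replace (1 - 1 - 0) with 0 by ring. rewrite Rabs_R0. lra.
  - specialize (Hd x Hn Hx). rewrite Rplus_0_l, exp_0 in Hd.
    replace (exp x - 1 - x) with (((exp x - 1) / x - 1) * x) by (field; auto).
    rewrite Rabs_mult. apply Rmult_le_compat_r; [apply Rabs_pos|lra].
Qed.

Lemma sin_o (e : R) : 0 < e -> exists d, 0 < d /\ forall x, Rabs x < d -> Rabs (sin x - x) <= e * Rabs x.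
Proof.
  intros He. destruct (derivable_pt_lim_sin 0 e He) as [d Hd]. exists d. split; [apply cond_pos|].
  intros x Hx. destruct (Req_dec x 0) as [->|Hn].
  - rewrite sin_0. replace (0 - 0) with 0 by ring. rewrite Rabs_R0. lra.
  - specialize (Hd x Hn Hx). rewrite Rplus_0_l, sin_0, cos_0 in Hd.
    replace (sin x - x) with (((sin x - 0) / x - 1) * x) by (field; auto).
    rewrite Rabs_mult. apply Rmult_le_compat_r; [apply Rabs_pos|lra].
Qed.

Lemma cos_o (e : R) : 0 < e -> exists d, 0 < d /\ forall x, Rabs x < d -> Rabs (cos x - 1) <= e * Rabs x.
Proof.
  intros He. destruct (derivable_pt_lim_cos 0 e He) as [d Hd]. exists d. split; [apply cond_pos|].
  intros x Hx. destruct (Req_dec x 0) as [->|Hn].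
  - rewrite cos_0. replace (1 - 1) with 0 by ring. rewrite Rabs_R0. lra.
  - specialize (Hd x Hn Hx). rewrite Rplus_0_l, sin_0, cos_0 in Hd.
    replace (cos x - 1) with (((cos x - 1) / x - - 0) * x) by (field; auto).
    rewrite Rabs_mult. apply Rmult_le_compat_r; [apply Rabs_pos|lra].
Qed.

Lemma cexp_o (e : R) : 0 < e -> exists d, 0 < d /\
  forall w, Cmod w < d -> Cmod (cexp w - 1 - w) <= e * Cmod w.
Proof.
  intros He. set (k := Rmin (1 / 2) (e / 20)). assert (Hk : 0 < k) by (apply Rmin_pos; lra).
  assert (Hk1 : k <= 1 / 2) by apply Rmin_l. assert (Hk2 : k <= e / 20) by apply Rmin_r.
  destruct (exp_o k Hk) as [d1 [Hd1 K1]]. destruct (sin_o k Hk) as [d2 [Hd2 K2]].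
  destruct (cos_o k Hk) as [d3 [Hd3 K3]].
  exists (Rmin k (Rmin d1 (Rmin d2 d3))). split; [apply Rmin_pos; [auto|apply Rmin_pos; [auto|apply Rmin_pos; auto]]|].
  intros [x y] Hw.
  assert (Hx : Rabs x <= Cmod (x, y)) by apply (re_le_Cmod (x, y)).
  assert (Hy : Rabs y <= Cmod (x, y)) by apply (Cmod_Im_le (x, y)).
  assert (L0 : Cmod (x, y) < k) by (eapply Rlt_le_trans; [exact Hw|apply Rmin_l]).
  assert (L : Cmod (x, y) < Rmin d1 (Rmin d2 d3)) by (eapply Rlt_le_trans; [exact Hw|apply Rmin_r]).
  assert (L1 : Cmod (x, y) < d1) by (eapply Rlt_le_trans; [exact L|apply Rmin_l]).
  assert (L' : Cmod (x, y) < Rmin d2 d3) by (eapply Rlt_le_trans; [exact L|apply Rmin_r]).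
  assert (L2 : Cmod (x, y) < d2) by (eapply Rlt_le_trans; [exact L'|apply Rmin_l]).
  assert (L3 : Cmod (x, y) < d3) by (eapply Rlt_le_trans; [exact L'|apply Rmin_r]).
  specialize (K1 x ltac:(lra)). specialize (K2 y ltac:(lra)). specialize (K3 y ltac:(lra)).
  set (m := Cmod (x, y)) in *.
  replace (cexp (x, y) - 1 - (x, y))%C with
    ((exp x - 1 - x) + exp x * (cos y - 1), (exp x - 1) * y + exp x * (sin y - y))
    by (unfold cexp, Cminus, Cplus, Copp, RtoC; simpl; f_equal; ring).
  eapply Rle_trans; [apply Cmod_le_abs|].
  pose proof (Rabs_pos x). pose proof (Rabs_pos y).
  assert (Bx : Rabs (exp x - 1) <= 2 * Rabs x).
  { replace (exp x - 1) with ((exp x - 1 - x) + x) by ring. eapply Rle_trans; [apply Rabs_triang|]. nra. }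
  assert (Be : Rabs (exp x) <= 2).
  { replace (exp x) with ((exp x - 1) + 1) by ring. eapply Rle_trans; [apply Rabs_triang|].
    rewrite Rabs_R1. lra. }
  assert (T1 : Rabs (exp x - 1 - x + exp x * (cos y - 1)) <= k * m + 2 * (k * m)).
  { eapply Rle_trans; [apply Rabs_triang|]. apply Rplus_le_compat; [nra|].
    rewrite Rabs_mult. apply Rmult_le_compat; auto; try apply Rabs_pos. nra. }
  assert (T2 : Rabs ((exp x - 1) * y + exp x * (sin y - y)) <= 2 * k * m + 2 * (k * m)).
  { eapply Rle_trans; [apply Rabs_triang|]. rewrite !Rabs_mult. apply Rplus_le_compat.
    - apply Rmult_le_compat; try apply Rabs_pos; lra.
    - apply Rmult_le_compat; auto; try apply Rabs_pos. nra. }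
  assert (0 <= m) by lra. nra.
Qed.

Lemma cd_cexp z : cd cexp z (cexp z).
Proof.
  apply cd_eps. intros e He. pose proof (Cmod_ge_0 (cexp z)) as H0.
  destruct (cexp_o (e / (1 + Cmod (cexp z)))) as [d [Hd K]]; [apply Rdiv_lt_0_compat; lra|].
  exists d. split; [auto|]. intros w Hw. specialize (K _ Hw).
  replace (cexp w - cexp z - cexp z * (w - z))%C with (cexp z * (cexp (w - z) - 1 - (w - z)))%C.
  - rewrite Cmod_mult. pose proof (Cmod_ge_0 (w - z)).
    eapply Rle_trans; [apply Rmult_le_compat_l; [auto|exact K]|].
    rewrite <- Rmult_assoc. apply Rmult_le_compat_r; [auto|].
    apply (Rmult_le_reg_r (1 + Cmod (cexp z))); [lra|].
    replace (Cmod (cexp z) * (e / (1 + Cmod (cexp z))) * (1 + Cmod (cexp z))) with (Cmod (cexp z) * e) by (field; lra).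
    nra.
  - transitivity (cexp z * cexp (w - z) - cexp z - cexp z * (w - z))%C; [ring|].
    rewrite <- cexp_plus. do 3 f_equal. ring.
Qed.

Lemma Carg_pos x y : 0 < x -> Carg (x, y) = atan (y / x).
Proof. intros H. unfold Carg. simpl. destruct Rlt_dec; [auto|lra]. Qed.

(** A single formula replaces the case distinction of [Carg] on y > 0, so continuity across x = 0
    requires no gluing. *)
Lemma Carg_upper x y : 0 < y -> Carg (x, y) = PI / 2 - atan (x / y).
Proof.
  intros Hy. unfold Carg. simpl. destruct (Rlt_dec 0 x) as [Hx|Hx].
  - rewrite <- atan_inv by (apply Rdiv_lt_0_compat; auto). f_equal. field. lra.
  - destruct (Rlt_dec x 0) as [Hx'|Hx'].
    + destruct (Rle_dec 0 y); [|lra].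
      replace (y / x) with (- (/ ((- x) / y))) by (field; lra).
      rewrite atan_opp, atan_inv by (apply Rdiv_lt_0_compat; lra).
      replace (- x / y) with (- (x / y)) by (field; lra). rewrite atan_opp. lra.
    + assert (x = 0) by lra. subst x. destruct (Rlt_dec 0 y); [|lra].
      replace (0 / y) with 0 by (field; lra). rewrite atan_0. lra.
Qed.

Lemma Carg_lower x y : y < 0 -> Carg (x, y) = - (PI / 2) - atan (x / y).
Proof.
  intros Hy. unfold Carg. simpl. destruct (Rlt_dec 0 x) as [Hx|Hx].
  - replace (y / x) with (- (/ (x / (- y)))) by (field; lra).
    rewrite atan_opp, atan_inv by (apply Rdiv_lt_0_compat; lra).
    replace (x / - y) with (- (x / y)) by (field; lra). rewrite atan_opp. lra.
  - destruct (Rlt_dec x 0) as [Hx'|Hx'].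
    + destruct (Rle_dec 0 y); [lra|].
      replace (y / x) with (/ (x / y)) by (field; lra).
      rewrite atan_inv; [lra|].
      replace (x / y) with ((- x) / (- y)) by (field; lra). apply Rdiv_lt_0_compat; lra.
    + assert (x = 0) by lra. subst x. destruct (Rlt_dec 0 y); [lra|]. destruct (Rlt_dec y 0); [|lra].
      replace (0 / y) with 0 by (field; lra). rewrite atan_0. lra.
Qed.

Lemma cexp_Clog w : w <> RtoC 0 -> cexp (Clog w) = w.
Proof.
  intros Hw. assert (Hm : 0 < Cmod w) by (apply (proj1 (Cmod_gt_0 _)); auto).
  unfold cexp, Clog. simpl. rewrite exp_ln by auto.
  destruct w as [x y].
  assert (Hn : forall u v, u <> 0 -> 0 < sqrt (1 + (v / u)²) /\ Rabs u * sqrt (1 + (v / u)²) = Cmod (u, v)).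
  { intros u v Hu.
    assert (0 < 1 + (v / u)²) by (pose proof (Rle_0_sqr (v / u)); lra).
    split; [apply sqrt_lt_R0; auto|].
    unfold Cmod. simpl. rewrite <- sqrt_Rsqr_abs, <- sqrt_mult by (try apply Rle_0_sqr; lra).
    f_equal. unfold Rsqr. field. auto. }
  assert (Hu : forall u v, Cmod (u, v) = Cmod (v, u)).
  { intros. unfold Cmod. simpl. f_equal. ring. }
  destruct (Rtotal_order y 0) as [Hy|[Hy|Hy]].
  - rewrite Carg_lower by auto. destruct (Hn y x) as [Hs He]; [lra|].
    rewrite (Hu y x) in He. rewrite Rabs_left in He by auto.
    replace (- (PI / 2) - atan (x / y)) with (- (PI / 2 + atan (x / y))) by ring.
    rewrite cos_neg, sin_neg, cos_plus, sin_plus, cos_PI2, sin_PI2, cos_atan, sin_atan, <- He.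
    f_equal; field; lra.
  - subst y. destruct (Rtotal_order x 0) as [Hx|[Hx|Hx]].
    + unfold Carg. simpl. destruct (Rlt_dec 0 x); [lra|]. destruct (Rlt_dec x 0); [|lra].
      destruct (Rle_dec 0 0); [|lra]. destruct (Hn x 0) as [Hs He]; [lra|].
      rewrite Rabs_left in He by auto.
      rewrite neg_cos, neg_sin, cos_atan, sin_atan, <- He. f_equal; field; lra.
    + subst x. exfalso. apply Hw. reflexivity.
    + rewrite Carg_pos by auto. destruct (Hn x 0) as [Hs He]; [lra|].
      rewrite Rabs_pos_eq in He by lra. rewrite cos_atan, sin_atan, <- He. f_equal; field; lra.
  - rewrite Carg_upper by auto. destruct (Hn y x) as [Hs He]; [lra|].
    rewrite (Hu y x) in He. rewrite Rabs_pos_eq in He by lra.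
    rewrite cos_shift, sin_shift, cos_atan, sin_atan, <- He. f_equal; field; lra.
Qed.

Definition rcontC (g : C -> R) (z : C) := @continuous C_UniformSpace R_UniformSpace g z.

Lemma rcontC_eps g z : rcontC g z -> forall e, 0 < e -> exists d, 0 < d /\
  forall w, Cmod (w - z) < d -> Rabs (g w - g z) < e.
Proof.
  intros H e He. apply (locally_C z (fun w => Rabs (g w - g z) < e)).
  apply (H (fun u => Rabs (u - g z) < e)). exists (mkposreal e He). intros u Hu. exact Hu.
Qed.

Lemma rcontC_ext_loc (f g : C -> R) z d : 0 < d -> (forall w, Cmod (w - z) < d -> f w = g w) ->
  rcontC f z -> rcontC g z.
Proof.
  intros Hd H Hf. apply (continuous_ext_loc (T := C_UniformSpace) g f); [|exact Hf].
  apply (locally_C z). exists d. split; auto.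
Qed.

Lemma continuous_atan x : continuous atan x.
Proof. apply continuity_pt_filterlim. apply derivable_continuous_pt. apply derivable_pt_atan. Qed.

Lemma rcontC_atan_div (f g : C -> R) z : rcontC f z -> rcontC g z -> g z <> 0 ->
  rcontC (fun w => atan (f w / g w)) z.
Proof.
  intros Hf Hg H0. apply (continuous_comp (U := C_UniformSpace) (fun w => f w / g w) atan); [|apply continuous_atan].
  apply (continuous_mult (U := C_UniformSpace) (K := R_AbsRing)); [exact Hf|].
  apply (continuous_comp (U := C_UniformSpace) g Rinv); [exact Hg|].
  apply continuity_pt_filterlim. apply continuity_pt_inv; [apply continuity_pt_id|auto].
Qed.

Lemma rcontC_fst z : rcontC fst z.
Proof. destruct z. apply continuous_fst. Qed.
Lemma rcontC_snd z : rcontC snd z.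
Proof. destruct z. apply continuous_snd. Qed.

Definition off_cut (z : C) := 0 < Re z \/ Im z <> 0.

Lemma Carg_cont z : off_cut z -> rcontC Carg z.
Proof.
  intros H. destruct z as [x y]. unfold off_cut in H. simpl in H.
  assert (Cx : forall w : C, Rabs (fst w - x) <= Cmod (w - (x, y))).
  { intros w. eapply Rle_trans; [|apply re_le_Cmod]. right. destruct w; reflexivity. }
  assert (Cy : forall w : C, Rabs (snd w - y) <= Cmod (w - (x, y))).
  { intros w. eapply Rle_trans; [|apply Cmod_Im_le]. right. destruct w; reflexivity. }
  destruct (Rlt_dec 0 x) as [Hx|Hx].
  - apply (rcontC_ext_loc (fun w => atan (snd w / fst w)) _ _ x); [auto| |].
    + intros w Hw. destruct w as [u v]. symmetry. apply Carg_pos.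
      destruct (Rabs_def2 (u - x) x (Rle_lt_trans _ _ _ (Cx (u, v)) Hw)). simpl. lra.
    + apply rcontC_atan_div; [apply rcontC_snd|apply rcontC_fst|simpl; lra].
  - destruct H as [H|H]; [lra|].
    assert (Cc : forall c, rcontC (fun w => c - atan (fst w / snd w)) (x, y)).
    { intros c. apply (continuous_minus (U := C_UniformSpace) (V := R_NormedModule)); [apply continuous_const|].
      apply rcontC_atan_div; [apply rcontC_fst|apply rcontC_snd|simpl; lra]. }
    destruct (Rlt_dec 0 y) as [Hy|Hy].
    + apply (rcontC_ext_loc (fun w => PI / 2 - atan (fst w / snd w)) _ _ y); [auto| |apply Cc].
      intros w Hw. destruct w as [u v]. symmetry. apply Carg_upper.
      destruct (Rabs_def2 (v - y) _ (Rle_lt_trans _ _ _ (Cy (u, v)) Hw)). simpl. lra.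
    + apply (rcontC_ext_loc (fun w => - (PI / 2) - atan (fst w / snd w)) _ _ (- y)); [lra| |apply Cc].
      intros w Hw. destruct w as [u v]. symmetry. apply Carg_lower.
      destruct (Rabs_def2 (v - y) _ (Rle_lt_trans _ _ _ (Cy (u, v)) Hw)). simpl. lra.
Qed.

Lemma off_cut_neq0 z : off_cut z -> z <> RtoC 0.
Proof. intros [H|H] ->; simpl in H; lra. Qed.

Lemma Cmod_rcontC z : rcontC Cmod z.
Proof.
  intros P [e He]. apply (locally_C z). exists e. split; [apply cond_pos|].
  intros w Hw. apply He. eapply Rle_lt_trans; [|exact Hw].
  apply Rabs_le. split.
  - assert (Cmod z <= Cmod w + Cmod (w - z)); [|unfold minus, plus, opp; simpl; lra].
    replace z with (w + - (w - z))%C at 1 by ring. eapply Rle_trans; [apply Cmod_triangle|].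
    rewrite Cmod_opp. lra.
  - assert (Cmod w <= Cmod z + Cmod (w - z)); [|unfold minus, plus, opp; simpl; lra].
    replace w with (z + (w - z))%C at 1 by ring. apply Cmod_triangle.
Qed.

Lemma Clog_cont z : off_cut z -> ccont Clog z.
Proof.
  intros Hz e He. pose proof (off_cut_neq0 z Hz) as Hz0.
  assert (H1 : rcontC (fun w => ln (Cmod w)) z).
  { apply (continuous_comp (U := C_UniformSpace) Cmod ln); [apply Cmod_rcontC|].
    apply continuity_pt_filterlim. apply derivable_continuous_pt.
    exists (/ Cmod z). apply derivable_pt_lim_ln. apply (proj1 (Cmod_gt_0 _)); auto. }
  destruct (rcontC_eps _ _ H1 (e / 2)) as [d1 [Hd1 K1]]; [lra|].
  destruct (rcontC_eps _ _ (Carg_cont z Hz) (e / 2)) as [d2 [Hd2 K2]]; [lra|].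
  exists (Rmin d1 d2). split; [apply Rmin_pos; auto|]. intros w Hw.
  specialize (K1 w (Rlt_le_trans _ _ _ Hw (Rmin_l _ _))).
  specialize (K2 w (Rlt_le_trans _ _ _ Hw (Rmin_r _ _))).
  change (Clog w - Clog z)%C with (ln (Cmod w) - ln (Cmod z), Carg w - Carg z).
  eapply Rle_lt_trans; [apply Cmod_le_abs|]. lra.
Qed.

(** Inverse function argument: for L = Clog w - Clog z the difference exp(L) - 1 is exactly (w -
    z)/z, and L is small by continuity of the branch, so the expansion of exp at 0 can be
    inverted. *)
Lemma cd_Clog z : off_cut z -> cd Clog z (/ z)%C.
Proof.
  intros Hz. pose proof (off_cut_neq0 z Hz) as Hz0.
  assert (Hm : 0 < Cmod z) by (apply (proj1 (Cmod_gt_0 _)); auto). set (m := Cmod z) in *.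
  apply cd_eps. intros e He.
  set (e1 := Rmin (1 / 2) (e * m / 2)).
  assert (He1 : 0 < e1) by (apply Rmin_pos; [lra|]; nra).
  assert (He1a : e1 <= 1 / 2) by apply Rmin_l. assert (He1b : e1 <= e * m / 2) by apply Rmin_r.
  destruct (cexp_o e1 He1) as [d1 [Hd1 K1]].
  destruct (Clog_cont z Hz d1 Hd1) as [d2 [Hd2 K2]].
  exists (Rmin d2 m). split; [apply Rmin_pos; auto|]. intros w Hw.
  specialize (K2 w (Rlt_le_trans _ _ _ Hw (Rmin_l _ _))).
  assert (Hw0 : w <> RtoC 0).
  { intros ->. assert (X : Cmod (0 - z) < m) by (eapply Rlt_le_trans; [exact Hw|apply Rmin_r]).
    replace (0 - z)%C with (- z)%C in X by ring. rewrite Cmod_opp in X. unfold m in X. lra. }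
  specialize (K1 _ K2). set (L := (Clog w - Clog z)%C) in *.
  assert (E : (cexp L - 1)%C = ((w - z) / z)%C).
  { unfold L. replace (Clog w - Clog z)%C with (Clog w + - Clog z)%C by ring.
    rewrite cexp_plus, cexp_opp, !cexp_Clog by auto. field. auto. }
  rewrite E in K1.
  assert (HD : Cmod ((w - z) / z) = Cmod (w - z) / m).
  { unfold Cdiv. rewrite Cmod_mult, Cmod_inv by auto. reflexivity. }
  assert (HL : Cmod L <= 2 * (Cmod (w - z) / m)).
  { assert (Cmod L <= Cmod ((w - z) / z) + Cmod ((w - z) / z - L)).
    { replace L with ((w - z) / z + - ((w - z) / z - L))%C at 1 by ring.
      eapply Rle_trans; [apply Cmod_triangle|]. rewrite Cmod_opp. lra. }
    rewrite HD in H. pose proof (Cmod_ge_0 L). nra. }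
  replace (L - / z * (w - z))%C with (- ((w - z) / z - L))%C by (field; auto).
  rewrite Cmod_opp. eapply Rle_trans; [exact K1|].
  pose proof (Cmod_ge_0 (w - z)) as Hg.
  apply Rle_trans with (e * m / 2 * (2 * (Cmod (w - z) / m))).
  - apply Rmult_le_compat; auto; [lra|apply Cmod_ge_0].
  - right. field. lra.
Qed.


Lemma Cpow_neq0 w (s : C) : w <> RtoC 0 -> Cpow w s = cexp (s * Clog w)%C.
Proof. intros H. unfold Cpow. destruct Ceq_dec; [contradiction|auto]. Qed.

Lemma Cpow_plus w (a b : R) : w <> RtoC 0 -> Cpow w (RtoC (a + b)) = (Cpow w (RtoC a) * Cpow w (RtoC b))%C.
Proof.
  intros H. rewrite !Cpow_neq0 by auto. rewrite <- cexp_plus. f_equal. rewrite RtoC_plus. ring.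
Qed.

Lemma Cpow_nz w (a : C) : w <> RtoC 0 -> Cpow w a <> RtoC 0.
Proof. intros H. rewrite Cpow_neq0 by auto. apply cexp_neq_0. Qed.

Lemma Cpow_0 w : w <> RtoC 0 -> Cpow w (RtoC 0) = RtoC 1.
Proof. intros H. rewrite Cpow_neq0 by auto. replace (0 * Clog w)%C with (RtoC 0) by ring. apply cexp_0. Qed.

Lemma Cpow_1 w : w <> RtoC 0 -> Cpow w (RtoC 1) = w.
Proof. intros H. rewrite Cpow_neq0 by auto. rewrite Cmult_1_l. apply cexp_Clog; auto. Qed.

Lemma Cpow_INR w n : w <> RtoC 0 -> Cpow w (RtoC (INR n)) = Cpown w n.
Proof.
  intros H. induction n; [apply Cpow_0; auto|].
  rewrite S_INR, Cpow_plus, IHn, Cpow_1 by auto. simpl. ring.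
Qed.

Lemma Cpow_opp w (a : R) : w <> RtoC 0 -> Cpow w (RtoC (- a)) = (/ Cpow w (RtoC a))%C.
Proof.
  intros H. rewrite !Cpow_neq0 by auto. rewrite <- cexp_opp. f_equal. rewrite RtoC_opp. ring.
Qed.

Lemma Cmod_Cpow w (a : R) : w <> RtoC 0 -> Cmod (Cpow w (RtoC a)) = Rpower (Cmod w) a.
Proof.
  intros H. rewrite Cpow_neq0, Cmod_cexp by auto. unfold Rpower, Clog, Cmult, RtoC. simpl.
  f_equal. ring.
Qed.

Lemma cd_Cpow z (a : C) : off_cut z -> cd (fun w => Cpow w a) z (a / z * Cpow z a)%C.
Proof.
  intros Hz. pose proof (off_cut_neq0 z Hz) as Hz0.
  apply (cd_ext_loc (fun w => cexp (a * Clog w)) _ _ _ (Cmod z)).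
  - apply (proj1 (Cmod_gt_0 _)); auto.
  - intros w Hw. symmetry. apply Cpow_neq0. intros ->.
    replace (0 - z)%C with (- z)%C in Hw by ring. rewrite Cmod_opp in Hw. lra.
  - eapply cd_to; [apply (cd_comp cexp); [apply cd_cexp|apply cd_scal, cd_Clog; auto]|].
    rewrite Cpow_neq0 by auto. unfold Cdiv. ring.
Qed.

(** * Expansions in q *)

Lemma upper_open z w : upper z -> Cmod (w - z) < Im z -> upper w.
Proof.
  unfold upper. intros Hz Hw.
  pose proof (Cmod_Im_le (w - z)) as H. destruct w as [u v], z as [x y]. simpl in *.
  destruct (Rabs_def2 (v + - y) y) as [A B]; [|lra].
  eapply Rle_lt_trans; [exact H|exact Hw].
Qed.

Lemma holo_cd f z : holo_H f -> upper z -> cd f z (cderiv f z).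
Proof. intros H Hz. destruct (H z Hz) as [l Hl]. rewrite (cderiv_eq f z l Hl). exact Hl. Qed.

Lemma cd_ext_upper f g z l : (forall w, upper w -> f w = g w) -> upper z -> cd f z l -> cd g z l.
Proof.
  intros H Hz. apply cd_ext_loc with (Im z); [exact Hz|]. intros w Hw. apply H.
  eapply upper_open; eauto.
Qed.

Lemma holo_ext f g : (forall w, upper w -> f w = g w) -> holo_H f -> holo_H g.
Proof. intros H Hf z Hz. exists (cderiv f z). eapply cd_ext_upper; eauto. apply holo_cd; auto. Qed.

Lemma cderiv_ext f g z : (forall w, upper w -> f w = g w) -> upper z -> holo_H f ->
  cderiv f z = cderiv g z.
Proof.
  intros H Hz Hf. symmetry. apply cderiv_eq. eapply cd_ext_upper; eauto. apply holo_cd; auto.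
Qed.

Lemma holo_const c : holo_H (fun _ => c).
Proof. intros z _. exists (RtoC 0). apply cd_const. Qed.
Lemma holo_plus f g : holo_H f -> holo_H g -> holo_H (fun z => f z + g z)%C.
Proof. intros Hf Hg z Hz. eexists. apply cd_plus; apply holo_cd; auto. Qed.
Lemma holo_mult f g : holo_H f -> holo_H g -> holo_H (fun z => f z * g z)%C.
Proof. intros Hf Hg z Hz. eexists. apply cd_mult; apply holo_cd; auto. Qed.
Lemma holo_scal c f : holo_H f -> holo_H (fun z => c * f z)%C.
Proof. apply holo_mult, holo_const. Qed.
Lemma holo_minus f g : holo_H f -> holo_H g -> holo_H (fun z => f z - g z)%C.
Proof. intros Hf Hg z Hz. eexists. apply cd_minus; apply holo_cd; auto. Qed.
Lemma holo_div f g : holo_H f -> holo_H g -> (forall z, upper z -> g z <> RtoC 0) ->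
  holo_H (fun z => f z / g z)%C.
Proof. intros Hf Hg H z Hz. eexists. apply cd_div; [auto| |]; apply holo_cd; auto. Qed.
Lemma holo_pown f n : holo_H f -> holo_H (fun z => Cpown (f z) n).
Proof. intros Hf. induction n; simpl; [apply holo_const|apply holo_mult; auto]. Qed.
Lemma holo_csum n (f : nat -> C -> C) : (forall i, (i < n)%nat -> holo_H (f i)) ->
  holo_H (fun z => csum n (fun i => f i z)).
Proof.
  induction n; intros H; simpl; [apply holo_const|]. apply holo_plus; auto.
Qed.

Lemma cd_shift (f : C -> C) (a w l : C) : cd f (a + w)%C l -> cd (fun u => f (a + u)%C) w l.
Proof.
  intros H. eapply cd_to; [apply (cd_comp f); [exact H|apply cd_plus; [apply cd_const|apply cd_id]]|]. ring.
Qed.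

Lemma holo_deriv f : holo_H f -> holo_H (cderiv f).
Proof.
  intros Hf z Hz.
  set (g := fun w => f (z + w)%C).
  assert (Hup : forall w, disc (Im z) w -> upper (z + w)%C).
  { intros w Hw. apply (upper_open z); [auto|]. replace (z + w - z)%C with w by ring. exact Hw. }
  assert (Hd : forall w, disc (Im z) w -> cd g w (cderiv f (z + w)%C)).
  { intros w Hw. apply cd_shift. apply holo_cd; auto. }
  assert (Hg : hol g (Im z)) by (intros w Hw; eexists; apply Hd; auto).
  destruct (hol_deriv g (Im z) Hg 0%C) as [l Hl]; [unfold disc; rewrite Cmod_0; exact Hz|].
  exists l.
  apply (cd_ext_loc (fun w => cderiv g (- z + w)%C) _ _ _ (Im z)); [exact Hz| |].
  - intros w Hw.
    assert (Hw' : disc (Im z) (- z + w)%C).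
    { unfold disc. replace (- z + w)%C with (w - z)%C by ring. exact Hw. }
    rewrite (cderiv_eq g _ _ (Hd _ Hw')).
    f_equal. ring.
  - apply cd_shift. replace (- z + z)%C with (RtoC 0) by ring. exact Hl.
Qed.

Definition tpi : C := (2 * RtoC PI * Ci)%C.

Lemma tpi_neq0 : tpi <> RtoC 0.
Proof.
  unfold tpi. pose proof PI_RGT_0. intros E. apply (f_equal snd) in E.
  unfold Cmult, RtoC, Ci in E. simpl in E. lra.
Qed.

Lemma qqE z : qq z = cexp (tpi * z)%C.
Proof. reflexivity. Qed.

Lemma Re_tpi_mult z : Re (tpi * z)%C = - (2 * PI * Im z).
Proof. destruct z as [x y]. unfold tpi, Cmult, Ci, RtoC. simpl. ring. Qed.

Lemma Cmod_qq z : Cmod (qq z) = exp (- (2 * PI * Im z)).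
Proof. rewrite qqE, Cmod_cexp, Re_tpi_mult. reflexivity. Qed.

Lemma qq_disc z : upper z -> disc 1 (qq z).
Proof.
  intros Hz. unfold disc. rewrite Cmod_qq, <- exp_0. apply exp_increasing.
  unfold upper in Hz. pose proof PI_RGT_0. nra.
Qed.

Lemma disc_qq z : disc 1 (qq z) -> upper z.
Proof.
  unfold disc, upper. rewrite Cmod_qq. rewrite <- exp_0 at 1. intros H. apply exp_lt_inv in H.
  pose proof PI_RGT_0. nra.
Qed.

Lemma qq_neq0 z : qq z <> RtoC 0.
Proof. apply cexp_neq_0. Qed.

Lemma cd_ee (r : C) z : cd (fun z => ee (r * z)%C) z (tpi * r * ee (r * z))%C.
Proof.
  unfold ee. fold tpi.
  eapply cd_to; [apply (cd_comp cexp); [apply cd_cexp|apply cd_scal, cd_scal, cd_id]|]. cbv beta. ring.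
Qed.

Lemma cd_qq z : cd qq z (tpi * qq z)%C.
Proof.
  unfold qq, ee. fold tpi.
  eapply cd_to; [apply (cd_comp cexp); [apply cd_cexp|apply cd_scal, cd_id]|]. cbv beta. ring.
Qed.

Lemma ee_plus a b : ee (a + b)%C = (ee a * ee b)%C.
Proof. unfold ee. rewrite <- cexp_plus. f_equal. ring. Qed.

Lemma ee_neq0 a : ee a <> RtoC 0.
Proof. apply cexp_neq_0. Qed.

Lemma ee_opp a : ee (- a)%C = (/ ee a)%C.
Proof. unfold ee. rewrite <- cexp_opp. f_equal. ring. Qed.

Lemma ee_0 : ee (RtoC 0) = RtoC 1.
Proof. unfold ee. replace (2 * RtoC PI * Ci * 0)%C with (RtoC 0) by ring. apply cexp_0. Qed.

Lemma ee_1 : ee (RtoC 1) = RtoC 1.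
Proof.
  unfold ee, cexp. replace (2 * RtoC PI * Ci * 1)%C with (0, 2 * PI)
    by (unfold Cmult, Ci, RtoC; simpl; f_equal; ring).
  simpl. rewrite exp_0, cos_2PI, sin_2PI. unfold RtoC. f_equal; ring.
Qed.

Lemma qq_plus1 z : qq (z + 1)%C = qq z.
Proof. unfold qq. rewrite ee_plus, ee_1. ring. Qed.

Lemma ee_eq_1 a : ee a = RtoC 1 -> exists n : Z, a = RtoC (IZR n).
Proof.
  intros H. destruct (cexp_eq_1 _ H) as [n Hn]. exists n. fold tpi in Hn.
  pose proof tpi_neq0. transitivity (/ tpi * (tpi * a))%C; [field; auto|]. rewrite Hn. field. auto.
Qed.

Lemma qq_inj z w : qq z = qq w -> exists n : Z, z = (w + RtoC (IZR n))%C.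
Proof.
  intros H. destruct (ee_eq_1 (z - w)%C) as [n Hn].
  - replace (z - w)%C with (z + - w)%C by ring. rewrite ee_plus, ee_opp.
    change (ee z) with (qq z). rewrite H. apply Cinv_r. apply ee_neq0.
  - exists n. rewrite <- Hn. ring.
Qed.

(** The branch cut makes this discontinuous in q, but a function of period 1 composed with it does
    not see the jump. *)
Definition zq (q : C) : C := (Clog q / tpi)%C.

Lemma qq_zq q : q <> RtoC 0 -> qq (zq q) = q.
Proof.
  intros H. rewrite qqE. unfold zq. replace (tpi * (Clog q / tpi))%C with (Clog q) by (field; apply tpi_neq0).
  apply cexp_Clog; auto.
Qed.

Lemma zq_upper q : q <> RtoC 0 -> disc 1 q -> upper (zq q).
Proof. intros H0 H. apply disc_qq. rewrite qq_zq; auto. Qed.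

Lemma upper_plus_real z (x : R) : upper z -> upper (z + RtoC x)%C.
Proof. unfold upper. destruct z as [a b]. simpl. intros; lra. Qed.

Lemma period_Z (f : C -> C) : (forall z, upper z -> f (z + 1)%C = f z) ->
  forall n z, upper z -> f (z + RtoC (IZR n))%C = f z.
Proof.
  intros H.
  assert (P : forall (n : nat) z, upper z -> f (z + RtoC (INR n))%C = f z).
  { induction n; intros z Hz.
    - f_equal. simpl. ring.
    - transitivity (f ((z + RtoC (INR n)) + 1)%C).
      + f_equal. rewrite S_INR, RtoC_plus. ring.
      + rewrite H by (apply upper_plus_real; auto). auto. }
  intros n z Hz. destruct (Z_le_dec 0 n) as [Hn|Hn].
  - rewrite <- (Z2Nat.id n Hn), <- INR_IZR_INZ. apply P; auto.
  - rewrite <- (P (Z.to_nat (- n)) (z + RtoC (IZR n))%C) by (apply upper_plus_real; auto).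
    f_equal. rewrite INR_IZR_INZ, Z2Nat.id by lia. rewrite opp_IZR, RtoC_opp. ring.
Qed.

(* A function of q on the punctured disc that is o(1/|q|) at 0 extends
   holomorphically: [q^2 h] is then differentiable at 0 with zero derivative. *)
Lemma q_expansion (f : C -> C) : holo_H f -> (forall z, upper z -> f (z + 1)%C = f z) ->
  (forall e, 0 < e -> exists c, forall z, upper z -> c < Im z -> Cmod (f z) * Cmod (qq z) <= e) ->
  exists h, hol h 1 /\ forall z, upper z -> f z = h (qq z).
Proof.
  intros Hf Hp Hg. pose proof tpi_neq0 as Ht.
  set (h := fun q : C => f (zq q)).
  assert (Hfh : forall z, upper z -> f z = h (qq z)).
  { intros z Hz. unfold h.
    assert (Hz' : upper (zq (qq z))) by (apply zq_upper; [apply qq_neq0|apply qq_disc; auto]).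
    destruct (qq_inj z (zq (qq z))) as [n Hn]; [rewrite qq_zq; [auto|apply qq_neq0]|].
    rewrite Hn at 1. apply period_Z; auto. }
  assert (Hd : forall q, q <> RtoC 0 -> disc 1 q -> exists l, cd h q l).
  { intros q Hq0 Hq. set (z0 := zq q). assert (Hz0 : upper z0) by (apply zq_upper; auto).
    assert (O1 : off_cut (q / q)%C).
    { left. replace (q / q)%C with (RtoC 1) by (field; auto). simpl. lra. }
    (* A local inverse of [qq] near q with value z0 at q; [zq] itself may jump there. *)
    set (br := fun w => (z0 + / tpi * Clog (w / q))%C).
    assert (Hbr : br q = z0).
    { unfold br. replace (q / q)%C with (RtoC 1) by (field; auto).
      replace (Clog 1) with (RtoC 0); [ring|]. unfold Clog. rewrite Cmod_1, ln_1.
      unfold Carg, RtoC. simpl. destruct Rlt_dec; [|lra]. replace (0 / 1) with 0 by field.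
      rewrite atan_0. reflexivity. }
    assert (Db : exists m, cd br q m).
    { eexists. apply cd_plus; [apply cd_const|]. apply cd_scal.
      apply (cd_comp Clog); [apply cd_Clog; exact O1|].
      apply cd_mult; [apply cd_id|apply cd_const]. }
    destruct Db as [m Hm]. eexists.
    assert (Hq1 : 0 < Rmin (Cmod q) (1 - Cmod q)).
    { apply Rmin_pos; [apply (proj1 (Cmod_gt_0 _)); auto|unfold disc in Hq; lra]. }
    apply (cd_ext_loc (fun w => f (br w)) _ _ _ (Rmin (Cmod q) (1 - Cmod q))); [exact Hq1| |].
    - intros w Hw.
      assert (W0 : w <> RtoC 0).
      { intros ->. assert (X : Cmod (0 - q) < Cmod q) by (eapply Rlt_le_trans; [exact Hw|apply Rmin_l]).
        replace (0 - q)%C with (- q)%C in X by ring. rewrite Cmod_opp in X. lra. }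
      assert (W1 : disc 1 w).
      { assert (X : Cmod (w - q) < 1 - Cmod q) by (eapply Rlt_le_trans; [exact Hw|apply Rmin_r]).
        unfold disc. replace w with (q + (w - q))%C by ring.
        eapply Rle_lt_trans; [apply Cmod_triangle|]. lra. }
      assert (E : qq (br w) = w).
      { unfold br. rewrite qqE. replace (tpi * (z0 + / tpi * Clog (w / q)))%C
          with (tpi * z0 + Clog (w / q))%C by (field; auto).
        rewrite cexp_plus, <- qqE. unfold z0. rewrite qq_zq by auto.
        rewrite cexp_Clog.
        - field. auto.
        - intros X. apply W0. transitivity (w / q * q)%C; [field; auto|rewrite X; ring]. }
      rewrite Hfh by (apply disc_qq; rewrite E; auto). rewrite E. reflexivity.
    - apply (cd_comp f); [|exact Hm]. rewrite Hbr. apply holo_cd; auto. }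
  set (g := fun q => (q * q * h q)%C).
  assert (Hg0 : cd g 0%C 0%C).
  { apply cd_eps. intros e He. destruct (Hg e He) as [c Hc].
    exists (Rmin 1 (exp (- (2 * PI * c)))). split; [apply Rmin_pos; [lra|apply exp_pos]|].
    intros q Hq. replace (q - 0)%C with q in * by ring.
    replace (g q - g 0 - 0 * q)%C with (q * (h q * q))%C by (unfold g; ring).
    rewrite Cmod_mult, Rmult_comm. apply Rmult_le_compat_r; [apply Cmod_ge_0|].
    destruct (Ceq_dec q 0) as [->|Hq0].
    - replace (h 0 * 0)%C with (RtoC 0) by ring. rewrite Cmod_0. lra.
    - assert (Q1 : Cmod q < 1) by (eapply Rlt_le_trans; [exact Hq|apply Rmin_l]).
      assert (Q2 : Cmod q < exp (- (2 * PI * c))) by (eapply Rlt_le_trans; [exact Hq|apply Rmin_r]).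
      rewrite <- (qq_zq q Hq0) in Q2. rewrite Cmod_qq in Q2. apply exp_lt_inv in Q2.
      rewrite Cmod_mult. rewrite <- (qq_zq q Hq0) at 2. unfold h. apply Hc.
      + apply zq_upper; auto.
      + pose proof PI_RGT_0. nra. }
  assert (Hgh : hol g 1).
  { intros q Hq. destruct (Ceq_dec q 0) as [->|Hq0]; [exists 0%C; exact Hg0|].
    destruct (Hd q Hq0 Hq) as [l Hl]. eexists. apply cd_mult; [|exact Hl].
    apply cd_mult; apply cd_id. }
  destruct (hol_divide g 1 Rlt_0_1 Hgh) as [g1 [Hg1 E1]]; [unfold g; ring|].
  assert (D0 : disc 1 0%C) by (unfold disc; rewrite Cmod_0; lra).
  assert (g10 : g1 0%C = RtoC 0).
  { apply (cd_unique g 0%C); [|exact Hg0].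
    destruct (Hg1 _ D0) as [l Hl].
    apply (cd_ext_disc (fun w => w * g1 w)%C _ 1); [intros; symmetry; auto|rewrite Cmod_0; lra|].
    eapply cd_to; [apply cd_mult; [apply cd_id|exact Hl]|]. cbv beta. ring. }
  destruct (hol_divide g1 1 Rlt_0_1 Hg1 g10) as [h' [Hh' E2]].
  exists h'. split; [auto|]. intros z Hz. rewrite Hfh by auto.
  pose proof (qq_neq0 z) as Hq0. pose proof (qq_disc z Hz) as Hq.
  specialize (E1 _ Hq). specialize (E2 _ Hq). unfold g in E1. rewrite E2 in E1.
  transitivity (/ (qq z * qq z) * (qq z * qq z * h (qq z)))%C; [field; auto|].
  rewrite E1. field. auto.
Qed.

(** * Eta, Delta, P and the Eisenstein series as functions of q *)

Definition clim (u : nat -> C) (l : C) :=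
  forall e, 0 < e -> exists N, forall n, (N <= n)%nat -> Cmod (u n - l) <= e.

Lemma clim_unique u l m : clim u l -> clim u m -> l = m.
Proof.
  intros H1 H2. assert (E : Cmod (l - m) <= 0).
  { apply le_eps. intros e He. destruct (H1 (e / 2)) as [N1 K1]; [lra|].
    destruct (H2 (e / 2)) as [N2 K2]; [lra|].
    specialize (K1 (N1 + N2)%nat ltac:(lia)). specialize (K2 (N1 + N2)%nat ltac:(lia)).
    pose proof (Cmod_sub_triangle l (u (N1 + N2)%nat) m) as T.
    rewrite (Cmod_sub_sym l (u _)) in T. lra. }
  pose proof (Cmod_ge_0 (l - m)).
  transitivity ((l - m) + m)%C; [ring|]. rewrite (Cmod_eq_0 (l - m)) by lra. ring.
Qed.

Lemma clim_filterlim u l : clim u l <-> filterlim u eventually (locally (T := C_UniformSpace) l).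
Proof.
  split.
  - intros H P HP. apply (proj1 (locally_C l P)) in HP. destruct HP as [d [Hd HP]].
    destruct (H (d / 2)) as [N K]; [lra|]. exists N. intros n Hn. apply HP.
    specialize (K n Hn). lra.
  - intros H e He.
    destruct (H (fun w => Cmod (w - l) < e)) as [N K].
    + apply (locally_C l). exists e. split; auto.
    + exists N. intros n Hn. left. apply K. auto.
Qed.

Lemma cseries_clim a l : clim (sum_n (G := C_AbelianGroup) a) l -> cseries a = l.
Proof.
  intros H. apply (clim_unique (sum_n (G := C_AbelianGroup) a)); [|exact H].
  apply clim_filterlim. unfold cseries.
  apply (epsilon_spec (inhabits (RtoC 0)) (fun l : C => @is_series C_AbsRing C_NormedModule a l)).
  exists l. apply clim_filterlim in H. exact H.
Qed.

Lemma cprod_clim a l : clim (fun N => cprodn N a) l -> cprod_inf a = l.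
Proof.
  intros H. apply (clim_unique (fun N => cprodn N a)); [|exact H].
  apply clim_filterlim. unfold cprod_inf.
  apply (epsilon_spec (inhabits (RtoC 0))
    (fun l : C => filterlim (fun N => cprodn N a) eventually (locally l))).
  exists l. apply clim_filterlim in H. exact H.
Qed.

Lemma clim_cont f u l : ccont f l -> clim u l -> clim (fun n => f (u n)) (f l).
Proof.
  intros Hf H e He. destruct (Hf e He) as [d [Hd K]]. destruct (H (d / 2)) as [N HN]; [lra|].
  exists N. intros n Hn. left. apply K. specialize (HN n Hn). lra.
Qed.

Lemma uniform_limit (u : nat -> C -> C) : (forall n, hol (u n) 1) ->
  (forall r, 0 <= r < 1 -> exists K t, 0 <= K /\ 0 <= t < 1 /\
     forall n z, Cmod z <= r -> Cmod (u (S n) z - u n z) <= K * t ^ n) ->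
  exists f, hol f 1 /\ forall z, disc 1 z -> clim (fun n => u n z) (f z).
Proof.
  intros Hu H.
  set (f := fun z => epsilon (inhabits (RtoC 0)) (clim (fun n => u n z))).
  assert (Tail : forall K t e, 0 <= K -> 0 <= t < 1 -> 0 < e ->
     exists N, forall n, (N <= n)%nat -> K * t ^ n / (1 - t) <= e).
  { intros K t e HK Ht He.
    destruct (pow_lim0 t (e * (1 - t) / (K + 1)) Ht) as [N HN].
    { apply Rdiv_lt_0_compat; [apply Rmult_lt_0_compat|]; lra. }
    exists N. intros n Hn. specialize (HN n Hn).
    apply (Rmult_le_reg_r (1 - t)); [lra|].
    replace (K * t ^ n / (1 - t) * (1 - t)) with (K * t ^ n) by (field; lra).
    assert (0 <= t ^ n) by (apply pow_le; lra).
    apply (Rmult_lt_compat_r (K + 1)) in HN; [|lra].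
    replace (e * (1 - t) / (K + 1) * (K + 1)) with (e * (1 - t)) in HN by (field; lra). nra. }
  assert (Hf : forall z, disc 1 z -> clim (fun n => u n z) (f z)).
  { intros z Hz. unfold f. apply epsilon_spec.
    destruct (H (Cmod z)) as (K & t & HK & Ht & B); [split; [apply Cmod_ge_0|exact Hz]|].
    destruct (geometric_limit (fun n => u n z) K t HK Ht) as [l Hl].
    { intros n. apply B. lra. }
    exists l. intros e He. destruct (Tail K t e HK Ht He) as [N HN].
    exists N. intros n Hn. eapply Rle_trans; [apply Hl|]. auto. }
  exists f. split; [|auto].
  apply (weierstrass u); [auto|]. intros r e Hr He.
  set (r' := Rmax 0 r). assert (Hr' : 0 <= r' < 1) by (unfold r'; split; [apply Rmax_l|apply Rmax_lub_lt; lra]).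
  destruct (H r' Hr') as (K & t & HK & Ht & B).
  destruct (Tail K t e HK Ht He) as [N HN]. exists N. intros z Hz.
  assert (Hzr : Cmod z <= r') by (eapply Rle_trans; [exact Hz|apply Rmax_r]).
  destruct (geometric_limit (fun n => u n z) K t HK Ht) as [l Hl].
  { intros n. apply B. auto. }
  assert (El : l = f z).
  { apply (clim_unique (fun n => u n z)); [|apply Hf; unfold disc; lra].
    intros e' He'. destruct (Tail K t e' HK Ht He') as [M HM]. exists M. intros n Hn.
    eapply Rle_trans; [apply Hl|]. auto. }
  rewrite <- El. eapply Rle_trans; [apply Hl|]. apply HN. lia.
Qed.

Lemma hol_const c Rd : hol (fun _ => c) Rd.
Proof. intros z _. exists (RtoC 0). apply cd_const. Qed.
Lemma hol_id Rd : hol (fun z => z) Rd.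
Proof. intros z _. exists (RtoC 1). apply cd_id. Qed.
Lemma hol_plus f g Rd : hol f Rd -> hol g Rd -> hol (fun z => f z + g z)%C Rd.
Proof. intros Hf Hg z Hz. destruct (Hf z Hz), (Hg z Hz). eexists. apply cd_plus; eauto. Qed.
Lemma hol_minus f g Rd : hol f Rd -> hol g Rd -> hol (fun z => f z - g z)%C Rd.
Proof. intros Hf Hg z Hz. destruct (Hf z Hz), (Hg z Hz). eexists. apply cd_minus; eauto. Qed.
Lemma hol_mult f g Rd : hol f Rd -> hol g Rd -> hol (fun z => f z * g z)%C Rd.
Proof. intros Hf Hg z Hz. destruct (Hf z Hz), (Hg z Hz). eexists. apply cd_mult; eauto. Qed.
Lemma hol_scal c f Rd : hol f Rd -> hol (fun z => c * f z)%C Rd.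
Proof. apply hol_mult, hol_const. Qed.
Lemma hol_div f g Rd : hol f Rd -> hol g Rd -> (forall z, disc Rd z -> g z <> RtoC 0) ->
  hol (fun z => f z / g z)%C Rd.
Proof. intros Hf Hg H z Hz. destruct (Hf z Hz), (Hg z Hz). eexists. apply cd_div; eauto. Qed.
Lemma hol_pown f n Rd : hol f Rd -> hol (fun z => Cpown (f z) n) Rd.
Proof. intros Hf. induction n; simpl; [apply hol_const|apply hol_mult; auto]. Qed.
Lemma hol_ext f g Rd : (forall z, disc Rd z -> f z = g z) -> hol f Rd -> hol g Rd.
Proof.
  intros H Hf z Hz. destruct (Hf z Hz) as [l Hl]. exists l. eapply cd_ext_disc; eauto.
Qed.

Lemma exp_le_mono x y : x <= y -> exp x <= exp y.
Proof. intros [H| ->]; [left; apply exp_increasing; auto|lra]. Qed.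

(** Euler's product over n >= 1: [cprodn N] multiplies the factors of index 1 to N, so the factor of
    index 0, which is zero, does not occur. *)
Definition phi (q : C) : C := cprod_inf (fun n => 1 - Cpown q n)%C.

Definition phin (n : nat) (q : C) : C := cprodn n (fun n => 1 - Cpown q n)%C.

(** From |1 - q^n| <= 1 + r^n <= exp(r^n); the exponent is the geometric sum r + ... + r^n. *)
Lemma phin_bound r q n : 0 <= r < 1 -> Cmod q <= r ->
  Cmod (phin n q) <= exp ((1 - r ^ n) * (r / (1 - r))).
Proof.
  intros Hr Hq. induction n.
  - unfold phin. simpl. rewrite Cmod_1. replace ((1 - 1) * (r / (1 - r))) with 0 by ring. rewrite exp_0. lra.
  - change (phin (S n) q) with (phin n q * (1 - Cpown q (S n)))%C. rewrite Cmod_mult.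
    replace ((1 - r ^ S n) * (r / (1 - r))) with ((1 - r ^ n) * (r / (1 - r)) + r ^ S n) by (simpl; field; lra).
    rewrite exp_plus. apply Rmult_le_compat; [apply Cmod_ge_0|apply Cmod_ge_0|auto|].
    eapply Rle_trans; [apply Cmod_triangle|]. rewrite Cmod_1, Cmod_opp, Cmod_pown.
    eapply Rle_trans; [|apply exp_ineq1_le]. apply Rplus_le_compat_l.
    apply pow_incr. split; [apply Cmod_ge_0|auto].
Qed.

Lemma phi_hol_clim : hol phi 1 /\ forall q, disc 1 q -> clim (fun n => phin n q) (phi q).
Proof.
  destruct (uniform_limit phin) as [f [Hf Hl]].
  - induction n; [apply hol_const|].
    apply (hol_mult (phin n)); [auto|]. apply hol_minus; [apply hol_const|apply hol_pown, hol_id].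
  - intros r Hr. exists (exp (r / (1 - r))), r. split; [left; apply exp_pos|]. split; [auto|].
    intros n q Hq. change (phin (S n) q) with (phin n q * (1 - Cpown q (S n)))%C.
    replace (phin n q * (1 - Cpown q (S n)) - phin n q)%C with (- (phin n q * Cpown q (S n)))%C by ring.
    rewrite Cmod_opp, Cmod_mult, Cmod_pown.
    assert (Hrn : 0 <= r ^ n <= 1) by (split; [apply pow_le; lra|rewrite <- (pow1 n); apply pow_incr; lra]).
    assert (Hq0 : 0 <= r / (1 - r)) by (apply Rmult_le_pos; [lra|left; apply Rinv_0_lt_compat; lra]).
    apply Rmult_le_compat; [apply Cmod_ge_0|apply pow_le, Cmod_ge_0| |].
    + eapply Rle_trans; [apply (phin_bound r); auto|]. apply exp_le_mono. nra.
    + apply Rle_trans with (r ^ S n); [apply pow_incr; split; [apply Cmod_ge_0|auto]|]. simpl. nra.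
  - assert (E : forall q, disc 1 q -> f q = phi q).
    { intros q Hq. symmetry. apply cprod_clim. apply Hl; auto. }
    split; [apply (hol_ext f); auto|]. intros q Hq. rewrite <- E by auto. auto.
Qed.

Lemma pown_neq1 q n : Cmod q < 1 -> (1 - Cpown q (S n))%C <> RtoC 0.
Proof.
  intros Hq E. assert (X : Cpown q (S n) = RtoC 1).
  { transitivity (1 - (1 - Cpown q (S n)))%C; [ring|rewrite E; ring]. }
  apply (f_equal Cmod) in X. rewrite Cmod_pown, Cmod_1 in X.
  pose proof (Cmod_ge_0 q). assert (Cmod q ^ n <= 1) by (rewrite <- (pow1 n); apply pow_incr; lra).
  assert (0 <= Cmod q ^ n) by (apply pow_le; auto). simpl in X. nra.
Qed.

Lemma phin_neq0 n q : Cmod q < 1 -> phin n q <> RtoC 0.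
Proof.
  intros Hq. induction n; [exact (RtoC_neq_0 1 R1_neq_R0)|].
  apply Cmult_neq_0; [auto|apply pown_neq1; auto].
Qed.

(** Choose N with s = r^(N+1)/(1 - r) <= 1/2. A product of factors 1 - r^n is at least 1 minus the
    sum of the r^n, so the part beyond N has modulus at least 1/2, and the first N factors are
    nonzero. *)
Lemma phi_neq0 q : disc 1 q -> phi q <> RtoC 0.
Proof.
  intros Hq. unfold disc in Hq. set (r := Cmod q) in *. assert (Hr0 : 0 <= r) by apply Cmod_ge_0.
  destruct (pow_lim0 r ((1 - r) / 2)) as [N HN]; [lra|lra|].
  specialize (HN (S N) ltac:(lia)).
  assert (HS0 : 0 <= r ^ S N) by (apply pow_le; lra).
  assert (Hs : r ^ S N / (1 - r) <= 1 / 2).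
  { apply (Rmult_le_reg_r (1 - r)); [lra|]. unfold Rdiv at 1. rewrite Rmult_assoc, Rinv_l by lra. lra. }
  set (s := r ^ S N / (1 - r)) in *.
  assert (Hs0 : 0 <= s) by (unfold s; apply Rmult_le_pos; [auto|left; apply Rinv_0_lt_compat; lra]).
  assert (B : forall k, Cmod (phin N q) * (1 - s * (1 - r ^ k)) <= Cmod (phin (N + k) q)).
  { induction k.
    - rewrite Nat.add_0_r. simpl. lra.
    - rewrite Nat.add_succ_r.
      change (phin (S (N + k)) q) with (phin (N + k) q * (1 - Cpown q (S (N + k))))%C.
      rewrite Cmod_mult.
      assert (Hf : 1 - r ^ S (N + k) <= Cmod (1 - Cpown q (S (N + k)))).
      { assert (Cmod (RtoC 1) <= Cmod (1 - Cpown q (S (N + k))) + Cmod (Cpown q (S (N + k)))).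
        { replace (RtoC 1) with ((1 - Cpown q (S (N + k))) + Cpown q (S (N + k)))%C at 1 by ring.
          apply Cmod_triangle. }
        rewrite Cmod_1, Cmod_pown in H. fold r in H. lra. }
      assert (Ex : s * (1 - r ^ S k) = s * (1 - r ^ k) + r ^ S (N + k)).
      { unfold s. replace (S (N + k)) with (S N + k)%nat by lia. rewrite pow_add. simpl. field. lra. }
      rewrite Ex.
      assert (Hk : 0 <= r ^ k <= 1) by (split; [apply pow_le; lra|rewrite <- (pow1 k); apply pow_incr; lra]).
      assert (Hx : 0 <= r ^ S (N + k) <= 1) by (split; [apply pow_le; lra|rewrite <- (pow1 (S (N + k))); apply pow_incr; lra]).
      set (x := r ^ S (N + k)) in *. set (p := Cmod (phin N q)) in *. assert (Hp : 0 <= p) by apply Cmod_ge_0.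
      set (y := s * (1 - r ^ k)) in *. assert (0 <= y) by (unfold y; nra).
      assert (Hpxy : 0 <= p * (x * y)) by (apply Rmult_le_pos; [auto|apply Rmult_le_pos; lra]).
      apply Rle_trans with (p * (1 - y) * (1 - x)); [lra|].
      assert (0 <= 1 - y) by (unfold y; nra).
      apply Rmult_le_compat; [nra|lra|auto|auto]. }
  intros E0.
  assert (Hp : 0 < Cmod (phin N q)) by (apply (proj1 (Cmod_gt_0 _)), phin_neq0; auto).
  destruct (proj2 phi_hol_clim q Hq (Cmod (phin N q) / 4)) as [M HM]; [lra|].
  specialize (HM (N + M)%nat ltac:(lia)). rewrite E0 in HM.
  replace (phin (N + M) q - 0)%C with (phin (N + M) q) in HM by ring.
  specialize (B M). assert (0 <= r ^ M <= 1) by (split; [apply pow_le; lra|rewrite <- (pow1 M); apply pow_incr; lra]).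
  assert (s * (1 - r ^ M) <= 1 / 2) by nra. nra.
Qed.

Lemma phi_hol : hol phi 1. Proof. apply phi_hol_clim. Qed.

Lemma etaE z : eta z = (ee (z / 24) * phi (qq z))%C.
Proof. reflexivity. Qed.

Lemma cprodn_pown a m N : cprodn N (fun n => Cpown (a n) m) = Cpown (cprodn N a) m.
Proof.
  assert (M : forall x y m, Cpown (x * y)%C m = (Cpown x m * Cpown y m)%C).
  { intros x y k. induction k; simpl; [ring|rewrite IHk; ring]. }
  induction N; simpl.
  - induction m; simpl; [auto|rewrite <- IHm; ring].
  - rewrite M, IHN. reflexivity.
Qed.

Lemma Delta_qE z : upper z -> Delta_q z = (qq z * Cpown (phi (qq z)) 24)%C.
Proof.
  intros Hz. unfold Delta_q. f_equal. apply cprod_clim.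
  intros e He.
  destruct (clim_cont (fun w => Cpown w 24) (fun n => phin n (qq z)) (phi (qq z))) with (e := e) as [N HN].
  - assert (H : hol (fun w => Cpown w 24) (Cmod (phi (qq z)) + 1)) by apply hol_pown, hol_id.
    apply (hol_cont _ _ H). unfold disc. lra.
  - apply phi_hol_clim. apply qq_disc; auto.
  - auto.
  - exists N. intros n Hn. rewrite cprodn_pown. apply HN. auto.
Qed.

(** Bernoulli's inequality for the powers of 1/y, with y strictly between t and 1. *)
Lemma nat_geom t : 0 <= t < 1 -> exists K, forall n, INR n * t ^ n <= K.
Proof.
  intros Ht. set (y := (1 + t) / 2). assert (Hy : 0 < y < 1) by (unfold y; lra).
  assert (Hty : t <= y) by (unfold y; lra).
  set (h := / y - 1). assert (Hh : 0 < h).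
  { unfold h. apply Rmult_lt_reg_l with y; [lra|]. rewrite Rmult_0_r, Rmult_minus_distr_l, Rinv_r by lra. lra. }
  exists (/ h). intros n.
  pose proof (pos_INR n) as Hn.
  assert (B : 1 + INR n * h <= (1 + h) ^ n).
  { clear Hn. induction n; [simpl; lra|]. rewrite S_INR. simpl.
    pose proof (pos_INR n). apply Rle_trans with ((1 + h) * (1 + INR n * h)); [nra|].
    apply Rmult_le_compat_l; lra. }
  replace (1 + h) with (/ y) in B by (unfold h; ring). rewrite pow_inv in B.
  assert (Hyn : 0 < y ^ n) by (apply pow_lt; lra).
  assert (t ^ n <= y ^ n) by (apply pow_incr; lra).
  apply Rle_trans with (INR n * y ^ n); [apply Rmult_le_compat_l; auto|].
  apply Rmult_le_reg_l with h; [auto|]. rewrite Rinv_r by lra.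
  apply Rmult_le_compat_r with (r := y ^ n) in B; [|lra]. rewrite Rinv_l in B by lra. lra.
Qed.

Lemma poly_geom s t : 0 <= t < 1 -> exists K, 0 <= K /\ forall n, INR n ^ s * t ^ n <= K.
Proof.
  revert t. induction s; intros t Ht.
  - exists 1. split; [lra|]. intros n. simpl. rewrite Rmult_1_l, <- (pow1 n). apply pow_incr. lra.
  - set (y := (1 + t) / 2). assert (Hy : 0 <= y < 1) by (unfold y; lra).
    assert (Hty : t <= y * y) by (unfold y; nra).
    destruct (IHs y Hy) as [K1 [HK1 B1]]. destruct (nat_geom y Hy) as [K2 B2].
    assert (HK2 : 0 <= K2) by (specialize (B2 0%nat); simpl in B2; lra).
    exists (K2 * K1). split; [nra|]. intros n.
    assert (t ^ n <= y ^ n * y ^ n) by (rewrite <- Rpow_mult_distr; apply pow_incr; lra).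
    pose proof (pos_INR n) as Hn. assert (Hns : 0 <= INR n ^ s) by (apply pow_le; auto).
    assert (0 <= y ^ n) by (apply pow_le; lra). simpl.
    apply Rle_trans with ((INR n * y ^ n) * (INR n ^ s * y ^ n)).
    + replace (INR n * y ^ n * (INR n ^ s * y ^ n)) with (INR n * INR n ^ s * (y ^ n * y ^ n)) by ring.
      apply Rmult_le_compat_l; [nra|auto].
    + apply Rmult_le_compat; auto; nra.
Qed.


Lemma sigma_bound s n : 0 <= sigma s n <= INR n ^ S s.
Proof.
  unfold sigma.
  assert (H : forall l, (forall d, In d l -> (d <= n)%nat) ->
    0 <= fold_right Rplus 0 (map (fun d => if Nat.eqb (Nat.modulo n d) 0 then INR d ^ s else 0) l)
      <= INR (length l) * INR n ^ s).
  { induction l as [|d l IH]; intros Hl.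
    - simpl. lra.
    - cbn [map fold_right length]. rewrite S_INR.
      assert (Hd : 0 <= (if Nat.eqb (Nat.modulo n d) 0 then INR d ^ s else 0) <= INR n ^ s).
      { pose proof (pos_INR d). pose proof (pos_INR n). destruct Nat.eqb.
        - split; [apply pow_le; auto|]. apply pow_incr. split; [auto|]. apply le_INR, Hl. left; auto.
        - split; [lra|apply pow_le; auto]. }
      specialize (IH (fun d Hd => Hl d (or_intror Hd))). lra. }
  specialize (H (seq 1 n)). rewrite length_seq in H. apply H.
  intros d Hd. apply in_seq in Hd. lia.
Qed.

Definition eis_term (k : nat) (q : C) (n : nat) : C :=
  match n with O => 0%C | S _ => (RtoC (sigma (k - 1) n) * Cpown q n)%C end.

Definition eisq (k : nat) (q : C) : C :=
  (1 - RtoC (2 * INR k / bernoulli k) * cseries (eis_term k q))%C.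

Lemma EisE k z : Eis k z = eisq k (qq z).
Proof. reflexivity. Qed.

Lemma eis_series k : hol (fun q => cseries (eis_term k q)) 1.
Proof.
  destruct (uniform_limit (fun n q => sum_n (G := C_AbelianGroup) (eis_term k q) n)) as [f [Hf Hl]].
  - assert (T : forall n, hol (fun q => eis_term k q n) 1).
    { intros [|n]; unfold eis_term; [apply hol_const|]. apply hol_scal, hol_pown, hol_id. }
    induction n.
    + apply (hol_ext (fun q => eis_term k q 0)); [|apply T]. intros q _. rewrite sum_O. reflexivity.
    + apply (hol_ext (fun q => sum_n (G := C_AbelianGroup) (eis_term k q) n + eis_term k q (S n))%C).
      * intros q _. rewrite sum_Sn. reflexivity.
      * apply hol_plus; auto.
  (* As r <= y^2, one factor y^n absorbs the polynomial growth of sigma and the other supplies the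
     geometric decay. *)
  - intros r Hr. set (y := (1 + r) / 2). assert (Hy : 0 <= y < 1) by (unfold y; lra).
    assert (Hry : r <= y * y) by (unfold y; nra).
    destruct (poly_geom (S (k - 1)) y Hy) as [K [HK B]].
    exists K, y. split; [auto|]. split; [auto|]. intros n q Hq. rewrite sum_Sn.
    change (plus (sum_n (eis_term k q) n) (eis_term k q (S n)))
      with (sum_n (G := C_AbelianGroup) (eis_term k q) n + eis_term k q (S n))%C.
    replace (sum_n (G := C_AbelianGroup) (eis_term k q) n + eis_term k q (S n)
      - sum_n (G := C_AbelianGroup) (eis_term k q) n)%C with (eis_term k q (S n)) by ring.
    unfold eis_term. rewrite Cmod_mult, Cmod_pown.
    pose proof (sigma_bound (k - 1) (S n)) as Hs. rewrite Cmod_RtoC_pos by lra.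
    assert (Cmod q ^ S n <= y ^ S n * y ^ S n).
    { rewrite <- Rpow_mult_distr. apply pow_incr. split; [apply Cmod_ge_0|lra]. }
    assert (Hyn : 0 <= y ^ S n) by (apply pow_le; lra).
    apply Rle_trans with (INR (S n) ^ S (k - 1) * (y ^ S n * y ^ S n)).
    + apply Rmult_le_compat; [lra|apply pow_le, Cmod_ge_0|lra|auto].
    + rewrite <- Rmult_assoc. apply Rmult_le_compat; [|auto|auto|].
      * apply Rmult_le_pos; [apply pow_le, pos_INR|auto].
      * simpl. assert (0 <= y ^ n) by (apply pow_le; lra). nra.
  - apply (hol_ext f); [|auto]. intros q Hq. symmetry. apply cseries_clim. apply Hl. auto.
Qed.

Lemma eisq_hol k : hol (eisq k) 1.
Proof. apply hol_minus; [apply hol_const|]. apply hol_scal, eis_series. Qed.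

Lemma eisq_0 k : eisq k 0%C = RtoC 1.
Proof.
  unfold eisq. rewrite (cseries_clim _ 0%C); [ring|].
  intros e He. exists 0%nat. intros n _.
  assert (E : sum_n (G := C_AbelianGroup) (eis_term k 0%C) n = RtoC 0).
  { induction n; [rewrite sum_O; reflexivity|]. rewrite sum_Sn, IHn. unfold eis_term.
    change (0 + RtoC (sigma (k - 1) (S n)) * (0 * Cpown 0 n) = 0)%C. ring. }
  rewrite E. replace (RtoC 0 - RtoC 0)%C with (RtoC 0) by ring. rewrite Cmod_0. lra.
Qed.

(** This is -E_2/12 as a function of q: eta = q^(1/24) phi(q), and the prefactor is (i/pi)(2 pi i) =
    -2. *)
Definition pq (q : C) : C := (- (1 / 12) - 2 * (q * cderiv phi q / phi q))%C.

Lemma pq_hol : hol pq 1.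
Proof.
  apply hol_minus; [apply hol_const|]. apply hol_scal. apply hol_div; [|apply phi_hol|apply phi_neq0].
  apply hol_mult; [apply hol_id|apply hol_deriv, phi_hol].
Qed.

Lemma pq_0 : pq 0%C = (- (1 / 12))%C.
Proof.
  unfold pq. assert (phi 0 <> RtoC 0) by (apply phi_neq0; unfold disc; rewrite Cmod_0; lra).
  field. auto.
Qed.

Lemma cd_comp_qq h z : hol h 1 -> upper z -> cd (fun z => h (qq z)) z (tpi * (qq z * cderiv h (qq z)))%C.
Proof.
  intros Hh Hz. eapply cd_to; [apply (cd_comp h); [exact (hol_chol h 1 Hh _ (qq_disc z Hz))|apply cd_qq]|].
  ring.
Qed.

Lemma CiCi : (Ci * Ci)%C = (- (1))%C.
Proof. unfold Ci, Cmult, Copp, RtoC. simpl. f_equal; ring. Qed.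

Lemma PfunE z : upper z -> Pfun z = pq (qq z).
Proof.
  intros Hz. unfold Pfun, pq.
  pose proof (phi_neq0 _ (qq_disc z Hz)) as H0. pose proof (ee_neq0 (z / 24)%C) as H1.
  assert (Hp : RtoC PI <> RtoC 0) by (apply RtoC_neq_0; pose proof PI_RGT_0; lra).
  rewrite (cderiv_eq eta z (tpi * (1 / 24) * ee (z / 24) * phi (qq z)
     + ee (z / 24) * (tpi * (qq z * cderiv phi (qq z))))%C).
  - rewrite etaE.
    transitivity ((Ci * Ci) * (2 * (1 / 24 + qq z * cderiv phi (qq z) / phi (qq z))))%C.
    + unfold tpi. field. repeat split; auto.
    + rewrite CiCi. field. auto.
  - change eta with (fun z => ee (z / 24) * phi (qq z))%C.
    apply (cd_mult (fun z => ee (z / 24)%C) (fun z => phi (qq z))); [|apply (cd_comp_qq phi); [apply phi_hol|auto]].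
    replace (fun w : C => ee (w / 24)) with (fun w : C => ee (1 / 24 * w)).
    + eapply cd_to; [apply cd_ee|]. do 2 f_equal. field.
    + apply functional_extensionality. intros w. f_equal. field.
Qed.

Lemma hol_qq_holo h : hol h 1 -> holo_H (fun z => h (qq z)).
Proof. intros H z Hz. eexists. apply cd_comp_qq; auto. Qed.

Lemma Pfun_holo : holo_H Pfun.
Proof.
  apply (holo_ext (fun z => pq (qq z))); [intros; symmetry; apply PfunE; auto|].
  apply hol_qq_holo, pq_hol.
Qed.

Lemma Eis_holo k : holo_H (Eis k).
Proof. apply (hol_qq_holo (eisq k)), eisq_hol. Qed.

Lemma deltaq_hol : hol (fun q => q * Cpown (phi q) 24)%C 1.
Proof. apply hol_mult; [apply hol_id|apply hol_pown, phi_hol]. Qed.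

Lemma Delta_holo : holo_H Delta_q.
Proof.
  apply (holo_ext (fun z => qq z * Cpown (phi (qq z)) 24)%C).
  - intros. symmetry. apply Delta_qE; auto.
  - apply (hol_qq_holo (fun q => q * Cpown (phi q) 24)%C), deltaq_hol.
Qed.

Lemma pown_neq0 w n : w <> RtoC 0 -> Cpown w n <> RtoC 0.
Proof. intros H. induction n; simpl; [exact (RtoC_neq_0 1 R1_neq_R0)|apply Cmult_neq_0; auto]. Qed.

Lemma Delta_neq0 z : upper z -> Delta_q z <> RtoC 0.
Proof.
  intros Hz. rewrite Delta_qE by auto. apply Cmult_neq_0; [apply qq_neq0|].
  apply pown_neq0, phi_neq0, qq_disc; auto.
Qed.

(** * Linear differential equations on the upper half-plane *)

Lemma rcont_bounded f : rcont_on f 0 1 -> exists M, 0 <= M /\ forall t, 0 <= t <= 1 -> Cmod (f t) <= M.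
Proof.
  intros H. destruct (continuity_ab_maj (fun t => Cmod (f t)) 0 1 Rle_0_1) as [x [Hx _]].
  - intros t Ht. intros e He. destruct (H t Ht e He) as [d [Hd K]]. exists d. split; [auto|].
    intros s [_ Hs]. unfold dist in *. simpl in *. unfold Rdist in *. specialize (K s Hs).
    eapply Rle_lt_trans; [|exact K]. apply Rabs_le. split.
    + assert (Cmod (f t) <= Cmod (f s) + Cmod (f s - f t)); [|lra].
      replace (f t) with (f s + - (f s - f t))%C at 1 by ring. eapply Rle_trans; [apply Cmod_triangle|].
      rewrite Cmod_opp. lra.
    + assert (Cmod (f s) <= Cmod (f t) + Cmod (f s - f t)); [|lra].
      replace (f s) with (f t + (f s - f t))%C at 1 by ring. apply Cmod_triangle.
  - exists (Cmod (f x)). split; [apply Cmod_ge_0|]. intros t Ht. apply (Hx t Ht).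
Qed.

Lemma csum_bound n f b : (forall i, (i < n)%nat -> Cmod (f i) <= b) -> Cmod (csum n f) <= INR n * b.
Proof.
  induction n; intros H.
  - simpl. rewrite Cmod_0. lra.
  - cbn [csum]. rewrite S_INR. eapply Rle_trans; [apply Cmod_triangle|].
    specialize (IHn (fun i Hi => H i (Nat.lt_lt_succ_r _ _ Hi))). specialize (H n (Nat.lt_succ_diag_r n)). lra.
Qed.

Lemma bounded_family n (f : nat -> R -> C) : (forall i, (i < n)%nat -> rcont_on (f i) 0 1) ->
  exists M, 0 <= M /\ forall i t, (i < n)%nat -> 0 <= t <= 1 -> Cmod (f i t) <= M.
Proof.
  induction n; intros H.
  - exists 0. split; [lra|]. intros; lia.
  - destruct IHn as [M [HM B]]; [intros; apply H; lia|].
    destruct (rcont_bounded (f n)) as [M' [HM' B']]; [apply H; lia|].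
    exists (M + M'). split; [lra|]. intros i t Hi Ht.
    destruct (Nat.eq_dec i n) as [->|Hn]; [specialize (B' t Ht); lra|].
    specialize (B i t ltac:(lia) Ht). lra.
Qed.

Lemma rcont_csum n (f : nat -> R -> C) t : (forall i, (i < n)%nat -> rcont (f i) t) ->
  rcont (fun s => csum n (fun i => f i s)) t.
Proof.
  induction n; intros H; simpl; [apply rcont_const|]. apply rcont_plus; auto.
Qed.

Lemma upper_seg a b t : upper a -> upper b -> 0 <= t <= 1 -> upper (seg a b t).
Proof.
  unfold upper, seg. destruct a as [x y], b as [u w]. simpl. intros. nra.
Qed.

(** Picard iteration along the segment from z0 to z. On a piece of length 1/N with L/N <= 1/2 the
    integral equation halves any bound, so a solution that vanishes at the start of the piece
    vanishes on all of it; N pieces lead to z. *)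
Lemma linear_ode_zero n (Y : nat -> C -> C) (A : nat -> nat -> C -> C) z0 :
  (forall i j, (i < n)%nat -> (j < n)%nat -> holo_H (A i j)) ->
  (forall i z, (i < n)%nat -> upper z -> cd (Y i) z (csum n (fun j => A i j z * Y j z)%C)) ->
  upper z0 -> (forall i, (i < n)%nat -> Y i z0 = RtoC 0) ->
  forall i z, (i < n)%nat -> upper z -> Y i z = RtoC 0.
Proof.
  intros HA HY Hz0 H0 i0 z Hi0 Hz.
  set (g := seg z0 z).
  assert (Hg : forall t, 0 <= t <= 1 -> upper (g t)) by (intros; apply upper_seg; auto).
  assert (CA : forall i j, (i < n)%nat -> (j < n)%nat -> rcont_on (fun t => A i j (g t)) 0 1).
  { intros i j Hi Hj t Ht. apply rcont_comp.
    - eapply cd_cont. apply holo_cd; auto.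
    - eapply rd_cont, seg_rd. }
  assert (CY : forall i, (i < n)%nat -> rcont_on (fun t => Y i (g t)) 0 1).
  { intros i Hi t Ht. apply rcont_comp; [eapply cd_cont; apply HY; auto|eapply rd_cont, seg_rd]. }
  assert (BA : exists M, 0 <= M /\ forall i j t, (i < n)%nat -> (j < n)%nat -> 0 <= t <= 1 -> Cmod (A i j (g t)) <= M).
  { assert (X : forall m, (m <= n)%nat -> exists M, 0 <= M /\ forall i j t, (i < m)%nat -> (j < n)%nat -> 0 <= t <= 1 -> Cmod (A i j (g t)) <= M).
    { induction m; intros Hm; [exists 0; split; [lra|intros; lia]|].
      destruct IHm as [M [HM B]]; [lia|].
      destruct (bounded_family n (fun j t => A m j (g t))) as [M' [HM' B']]; [intros; apply CA; lia|].
      exists (M + M'). split; [lra|]. intros i j t Hi Hj Ht.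
      destruct (Nat.eq_dec i m) as [->|Hne]; [specialize (B' j t Hj Ht); cbv beta in B'; lra|].
      specialize (B i j t ltac:(lia) Hj Ht). lra. }
    apply X. lia. }
  destruct BA as [M [HM BA]].
  destruct (bounded_family n (fun i t => Y i (g t)) CY) as [B [HB BY]]. cbv beta in BY.
  set (L := Cmod (z - z0) * (INR n * M)).
  assert (HL : 0 <= L).
  { unfold L. apply Rmult_le_pos; [apply Cmod_ge_0|]. apply Rmult_le_pos; [apply pos_INR|auto]. }
  destruct (archimed_cor1 (/ (2 * (L + 1)))) as [N [HN HN0]]; [apply Rinv_0_lt_compat; lra|].
  assert (HNR : 0 < INR N) by (apply lt_0_INR; lia).
  assert (HLN : L * / INR N <= 1 / 2).
  { apply Rle_trans with (L * / (2 * (L + 1))); [apply Rmult_le_compat_l; lra|].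
    apply (Rmult_le_reg_r (2 * (L + 1))); [lra|].
    rewrite Rmult_assoc, Rinv_l by lra. lra. }
  assert (Step : forall s0, 0 <= s0 -> (forall i, (i < n)%nat -> Y i (g s0) = RtoC 0) ->
    forall t, s0 <= t <= s0 + / INR N -> t <= 1 -> forall i, (i < n)%nat -> Y i (g t) = RtoC 0).
  { intros s0 Hs0 Hz0'.
    assert (J : forall j t, s0 <= t <= s0 + / INR N -> t <= 1 -> forall i, (i < n)%nat ->
      Cmod (Y i (g t)) <= B * (1 / 2) ^ j).
    { induction j; intros t Ht Ht1 i Hi; [simpl; specialize (BY i t Hi ltac:(lra)); lra|].
      set (dY := fun s => ((z - z0) * csum n (fun j => A i j (g s) * Y j (g s)))%C).
      assert (CdY : rcont_on dY s0 t).
      { intros s Hs. apply rcont_scal. apply rcont_csum. intros l Hl.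
        apply rcont_mult; [apply CA|apply CY]; auto; lra. }
      assert (E : cint dY s0 t = (Y i (g t) - Y i (g s0))%C).
      { apply (cint_ftc (fun s => Y i (g s))); [lra| |auto].
        intros s Hs. apply rd_comp; [apply HY; [auto|apply Hg; lra]|apply seg_rd]. }
      rewrite Hz0' in E by auto.
      replace (Y i (g t)) with (cint dY s0 t) by (rewrite E; ring).
      eapply Rle_trans.
      - apply cint_bound with (M := L * (B * (1 / 2) ^ j)); [lra|auto|].
        intros s Hs. unfold dY. rewrite Cmod_mult. unfold L. rewrite Rmult_assoc.
        apply Rmult_le_compat_l; [apply Cmod_ge_0|]. rewrite Rmult_assoc.
        apply csum_bound. intros l Hl. rewrite Cmod_mult.
        apply Rmult_le_compat; try apply Cmod_ge_0; [apply BA; auto; lra|apply IHj; auto; lra].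
      - assert (HBj : 0 <= B * (1 / 2) ^ j) by (apply Rmult_le_pos; [auto|apply pow_le; lra]).
        apply Rle_trans with (L * (B * (1 / 2) ^ j) * / INR N).
        + apply Rmult_le_compat_l; [nra|lra].
        + simpl. replace (L * (B * (1 / 2) ^ j) * / INR N) with ((L * / INR N) * (B * (1 / 2) ^ j)) by ring.
          nra. }
    intros t Ht Ht1 i Hi. apply Cmod_eq_0.
    assert (Cmod (Y i (g t)) <= 0); [|pose proof (Cmod_ge_0 (Y i (g t))); lra].
    apply le_eps. intros e He. rewrite Rplus_0_l.
    destruct (pow_lim0 (1 / 2) (e / (B + 1))) as [j Hj]; [lra|apply Rdiv_lt_0_compat; lra|].
    specialize (Hj j (le_n j)). eapply Rle_trans; [apply (J j); auto|].
    assert (0 < (1 / 2) ^ j) by (apply pow_lt; lra).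
    apply (Rmult_lt_compat_r (B + 1)) in Hj; [|lra].
    replace (e / (B + 1) * (B + 1)) with e in Hj by (field; lra). nra. }
  assert (All : forall m, (m <= N)%nat -> forall i, (i < n)%nat -> Y i (g (INR m / INR N)) = RtoC 0).
  { induction m; intros Hm i Hi.
    - replace (g (INR 0 / INR N)) with z0; [auto|]. unfold g, seg.
      change (INR 0) with 0. replace (0 / INR N) with 0 by (field; lra). ring.
    - pose proof (pos_INR m). assert (Hle : INR (S m) <= INR N) by (apply le_INR; lia).
      apply (Step (INR m / INR N)); auto.
      + apply Rmult_le_pos; [auto|left; apply Rinv_0_lt_compat; auto].
      + intros; apply IHm; auto; lia.
      + rewrite S_INR. unfold Rdiv. assert (0 < / INR N) by (apply Rinv_0_lt_compat; auto). lra.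
      + apply (Rmult_le_reg_r (INR N)); [auto|]. unfold Rdiv. rewrite Rmult_assoc, Rinv_l by lra. lra. }
  specialize (All N (le_n N) i0 Hi0).
  replace (g (INR N / INR N)) with z in All; [auto|].
  unfold g, seg. replace (INR N / INR N) with 1 by (field; lra). ring.
Qed.

(** * Finite sums and 5 x 5 matrices acting on vectors *)

Lemma csum_ext n f g : (forall i, (i < n)%nat -> f i = g i) -> csum n f = csum n g.
Proof. induction n; intros H; simpl; [auto|]. rewrite IHn, H by auto. reflexivity. Qed.

Lemma csum_0 n f : (forall i, (i < n)%nat -> f i = RtoC 0) -> csum n f = RtoC 0.
Proof. induction n; intros H; simpl; [auto|]. rewrite IHn, H by auto. ring. Qed.

Lemma csum_plus n f g : csum n (fun i => f i + g i)%C = (csum n f + csum n g)%C.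
Proof. induction n; simpl; [ring|rewrite IHn; ring]. Qed.

Lemma csum_scal n c f : csum n (fun i => c * f i)%C = (c * csum n f)%C.
Proof. induction n; simpl; [ring|rewrite IHn; ring]. Qed.

Lemma mat_vec_mul (M N : mat) v i : mat_vec M (mat_vec N v) i = mat_vec (mat_mul M N) v i.
Proof. unfold mat_vec, mat_mul, dim5. simpl. ring. Qed.

Lemma mat_id_vec v i : (i < 5)%nat -> mat_vec mat_id v i = v i.
Proof.
  intros H. unfold mat_vec, mat_id, dim5. do 5 (destruct i as [|i]; [simpl; ring|]). lia.
Qed.

Lemma mat_vec_ext (M N : mat) (v w : vec) i : (i < 5)%nat -> meq M N -> veq v w ->
  mat_vec M v i = mat_vec N w i.
Proof. intros Hi H1 H2. apply csum_ext. intros j Hj. rewrite H1, H2; auto. Qed.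

Lemma mat_vec_scal M c v i : mat_vec M (fun j => c * v j)%C i = (c * mat_vec M v i)%C.
Proof. unfold mat_vec, dim5. simpl. ring. Qed.

Lemma mat_vec_plus M v w i : mat_vec M (fun j => v j + w j)%C i = (mat_vec M v i + mat_vec M w i)%C.
Proof. unfold mat_vec, dim5. simpl. ring. Qed.

Lemma mat_vec_0 M v i : veq v vzero -> mat_vec M v i = RtoC 0.
Proof. intros H. apply csum_0. intros j Hj. rewrite H by auto. unfold vzero. ring. Qed.

Lemma adj5_solve M v i : (i < 5)%nat -> mat_vec (adj5 M) (mat_vec M v) i = (det5 M * v i)%C.
Proof.
  intros Hi. rewrite mat_vec_mul.
  transitivity (mat_vec (fun i j => if Nat.eqb i j then det5 M else RtoC 0) v i).
  - apply mat_vec_ext; [auto| |intros j _; reflexivity]. intros a b Ha Hb. apply adj5_mat_mul; auto.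
  - unfold mat_vec, dim5. do 5 (destruct i as [|i]; [simpl; ring|]). lia.
Qed.

Lemma adj5_inverse M v i : (i < 5)%nat -> mat_vec M (mat_vec (adj5 M) v) i = (det5 M * v i)%C.
Proof.
  intros Hi. rewrite mat_vec_mul.
  transitivity (mat_vec (fun i j => if Nat.eqb i j then det5 M else RtoC 0) v i).
  - apply mat_vec_ext; [auto| |intros j _; reflexivity]. intros a b Ha Hb. apply mat_mul_adj5; auto.
  - unfold mat_vec, dim5. do 5 (destruct i as [|i]; [simpl; ring|]). lia.
Qed.

Lemma det5_injective M v : det5 M <> RtoC 0 -> veq (mat_vec M v) vzero -> veq v vzero.
Proof.
  intros Hd H i Hi.
  transitivity (/ det5 M * (det5 M * v i))%C; [field; auto|].
  rewrite <- adj5_solve, mat_vec_0 by auto. unfold vzero. ring.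
Qed.

Lemma invertible_injective M v : invertible M -> veq (mat_vec M v) vzero -> veq v vzero.
Proof.
  intros [N [_ H]] Hv i Hi.
  rewrite <- mat_id_vec by auto.
  transitivity (mat_vec (mat_mul N M) v i); [symmetry; apply mat_vec_ext; auto; intros j _; reflexivity|].
  rewrite <- mat_vec_mul. apply mat_vec_0. auto.
Qed.

Lemma Dk_cd k f z : holo_H f -> upper z -> cd f z (tpi * (Dk k f z - RtoC k * Pfun z * f z))%C.
Proof.
  intros Hf Hz. eapply cd_to; [apply holo_cd; eauto|]. unfold Dk. fold tpi. pose proof tpi_neq0. field. auto.
Qed.

Lemma Dk_holo k f : holo_H f -> holo_H (Dk k f).
Proof.
  intros Hf. apply holo_plus; [apply holo_scal, holo_deriv; auto|].
  apply holo_mult; [apply holo_scal, Pfun_holo|auto].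
Qed.

Lemma Dn_holo n k f : holo_H f -> holo_H (Dn n k f).
Proof. intros Hf. induction n; [auto|]. apply Dk_holo. auto. Qed.

Lemma Dk_ext k f g z : (forall w, upper w -> f w = g w) -> upper z -> holo_H f -> Dk k f z = Dk k g z.
Proof. intros H Hz Hf. unfold Dk. rewrite (cderiv_ext f g), H by auto. reflexivity. Qed.

Lemma Dn_ext n k f g z : (forall w, upper w -> f w = g w) -> upper z -> holo_H f -> Dn n k f z = Dn n k g z.
Proof.
  intros H Hz Hf. revert z Hz. induction n; intros z Hz; [auto|].
  apply Dk_ext; [auto|auto|apply Dn_holo; auto].
Qed.

Lemma Dk_plus k f g z : upper z -> holo_H f -> holo_H g -> Dk k (fun w => f w + g w)%C z = (Dk k f z + Dk k g z)%C.
Proof.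
  intros Hz Hf Hg. unfold Dk. rewrite (cderiv_eq _ _ _ (cd_plus f g z _ _ (holo_cd f z Hf Hz) (holo_cd g z Hg Hz))).
  ring.
Qed.

Lemma Dk_mult k l f g z : upper z -> holo_H f -> holo_H g ->
  Dk (k + l) (fun w => f w * g w)%C z = (Dk k f z * g z + f z * Dk l g z)%C.
Proof.
  intros Hz Hf Hg. unfold Dk. rewrite (cderiv_eq _ _ _ (cd_mult f g z _ _ (holo_cd f z Hf Hz) (holo_cd g z Hg Hz))).
  rewrite RtoC_plus. ring.
Qed.

Lemma Dk_scal k c f z : upper z -> holo_H f -> Dk k (fun w => c * f w)%C z = (c * Dk k f z)%C.
Proof.
  intros Hz Hf. unfold Dk. rewrite (cderiv_eq _ _ _ (cd_scal c f z _ (holo_cd f z Hf Hz))). ring.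
Qed.

Lemma Dk_csum k n (f : nat -> C -> C) z : upper z -> (forall i, (i < n)%nat -> holo_H (f i)) ->
  Dk k (fun w => csum n (fun i => f i w)) z = csum n (fun i => Dk k (f i) z).
Proof.
  intros Hz. induction n; intros H; simpl.
  - unfold Dk. rewrite (cderiv_eq _ _ 0%C (cd_const 0%C z)). ring.
  - rewrite Dk_plus, IHn; auto. apply holo_csum; auto.
Qed.

Lemma Dn_comb m k n c (F : nat -> C -> C) z : upper z -> (forall i, (i < n)%nat -> holo_H (F i)) ->
  Dn m k (fun w => csum n (fun i => c i * F i w)%C) z = csum n (fun i => c i * Dn m k (F i) z)%C.
Proof.
  intros Hz H. revert z Hz. induction m; intros z Hz; [reflexivity|].
  change (Dk (k + 2 * INR m) (Dn m k (fun w => csum n (fun i => c i * F i w)%C)) z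
    = csum n (fun i => c i * Dk (k + 2 * INR m) (Dn m k (F i)) z)%C).
  rewrite (Dk_ext _ _ (fun w => csum n (fun i => c i * Dn m k (F i) w)%C)); [|auto|auto|].
  - rewrite (Dk_csum _ _ (fun i w => c i * Dn m k (F i) w)%C); [|auto|].
    + apply csum_ext. intros i Hi. apply Dk_scal; [auto|]. apply Dn_holo; auto.
    + intros i Hi. apply holo_scal, Dn_holo; auto.
  - apply Dn_holo. apply (holo_csum n (fun i w => c i * F i w)%C). intros i Hi. apply holo_scal; auto.
Qed.

Lemma monos_holo l : holo_H (monos l).
Proof.
  unfold monos. induction l as [|[[c a] b] l IH]; simpl; [apply holo_const|].
  apply (holo_plus (fun z => c * Cpown (Eis 4 z) a * Cpown (Eis 6 z) b)%C); [|exact IH].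
  apply holo_mult; [apply holo_scal|]; apply holo_pown, Eis_holo.
Qed.

Lemma inMw_holo w f : inMw w f -> holo_H f.
Proof. intros [l [_ H]]. apply (holo_ext (monos l)); [intros; symmetry; auto|apply monos_holo]. Qed.

Section MLDE.
Variables (k : R) (M4 M6 M8 M10 : C -> C).
Hypotheses (H4 : holo_H M4) (H6 : holo_H M6) (H8 : holo_H M8) (H10 : holo_H M10).

Lemma mlde5_eq f z : mlde5 k M4 M6 M8 M10 f z = RtoC 0 ->
  Dn 5 k f z = (- (M4 z * Dn 3 k f z + M6 z * Dn 2 k f z + M8 z * Dn 1 k f z + M10 z * Dn 0 k f z))%C.
Proof.
  unfold mlde5. intros H. change (Dn 0 k f z) with (f z).
  match type of H with ?L = _ => transitivity (L - (M4 z * Dn 3 k f z + M6 z * Dn 2 k f z + M8 z * Dn 1 k f z + M10 z * f z))%C end.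
  - ring.
  - rewrite H. ring.
Qed.

Lemma mlde_zero f z0 : holo_H f -> (forall z, upper z -> mlde5 k M4 M6 M8 M10 f z = RtoC 0) ->
  upper z0 -> (forall m, (m < 5)%nat -> Dn m k f z0 = RtoC 0) ->
  forall z, upper z -> f z = RtoC 0.
Proof.
  intros Hf Hm Hz0 H0 z Hz.
  (* Companion system of the MLDE: (D^i f)' = 2 pi i (D^(i+1) f - (k + 2i) P D^i f), where the last
     row eliminates D^5 f. *)
  set (A := fun i j w =>
    (tpi * ((if Nat.eqb j (S i) then 1 else if Nat.eqb j i then - (RtoC (k + 2 * INR i) * Pfun w) else 0)
      + (if Nat.eqb i 4 then match j with 0%nat => - M10 w | 1%nat => - M8 w | 2%nat => - M6 w
            | 3%nat => - M4 w | _ => 0 end else 0)))%C).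
  apply (linear_ode_zero 5 (fun m => Dn m k f) A z0) with (i := 0%nat); auto; [| |lia].
  - intros i j Hi Hj. unfold A. apply holo_scal. apply holo_plus.
    + destruct Nat.eqb; [apply holo_const|]. destruct Nat.eqb; [|apply holo_const].
      apply (holo_ext (fun w => (-1) * (RtoC (k + 2 * INR i) * Pfun w))%C); [intros; ring|].
      do 2 apply holo_scal. apply Pfun_holo.
    + assert (Hn : forall g, holo_H g -> holo_H (fun w => - g w)%C).
      { intros g Hg. apply (holo_ext (fun w => (-1) * g w)%C); [intros; ring|]. apply holo_scal; auto. }
      destruct Nat.eqb; [|apply holo_const].
      do 4 (destruct j as [|j]; [apply Hn; auto|]). apply holo_const.
  - intros i w Hi Hw. eapply cd_to; [apply (Dk_cd (k + 2 * INR i)); [apply Dn_holo; auto|auto]|].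
    change (Dk (k + 2 * INR i) (Dn i k f) w) with (Dn (S i) k f w). unfold A.
    do 4 (destruct i as [|i]; [cbn [csum Nat.eqb]; ring|]).
    destruct i as [|i]; [|lia]. rewrite mlde5_eq by auto. cbn [csum Nat.eqb]. ring.
Qed.

Variable F : vfun.
Hypotheses (HF : forall i, (i < 5)%nat -> holo_H (F i))
  (Hode : forall i z, (i < 5)%nat -> upper z -> mlde5 k M4 M6 M8 M10 (F i) z = RtoC 0)
  (Hind : forall c : nat -> C, (forall z, upper z -> csum 5 (fun i => (c i * F i z)%C) = RtoC 0) ->
     forall i, (i < 5)%nat -> c i = RtoC 0).

Definition wronsk (z : C) : mat := fun j m => Dn m k (F j) z.

(** A kernel vector of the transposed matrix gives a combination of the components whose D^0, ...,
    D^4 vanish at z. By uniqueness it vanishes identically, against independence. *)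
Lemma wronsk_det z : upper z -> det5 (wronsk z) <> RtoC 0.
Proof.
  intros Hz E. rewrite <- det5_tr in E. destruct (det5_0_kernel E) as [c [Hc H]].
  apply Hc. intros i Hi. revert i Hi. apply Hind.
  set (f := fun w => csum 5 (fun i => (c i * F i w)%C)).
  assert (Hf : holo_H f).
  { apply (holo_csum 5 (fun i w => c i * F i w)%C). intros i Hi. apply holo_scal. auto. }
  apply (mlde_zero f z); auto.
  - intros w Hw.
    transitivity (csum 5 (fun i => c i * mlde5 k M4 M6 M8 M10 (F i) w)%C).
    + unfold mlde5, f. rewrite !Dn_comb by auto. simpl. ring.
    + apply csum_0. intros i Hi. rewrite Hode by auto. ring.
  - intros m Hm. unfold f. rewrite Dn_comb by auto.
    transitivity (mat_vec (fun i j => wronsk z j i) c m); [|exact (H m Hm)].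
    apply csum_ext. intros i Hi. unfold wronsk. ring.
Qed.

Lemma wronsk_indep z (x : nat -> C) : upper z ->
  (forall j, (j < 5)%nat -> csum 5 (fun m => x m * Dn m k (F j) z)%C = RtoC 0) ->
  forall m, (m < 5)%nat -> x m = RtoC 0.
Proof.
  intros Hz H. apply (det5_injective (wronsk z) x (wronsk_det z Hz)).
  intros j Hj. transitivity (csum 5 (fun m => x m * Dn m k (F j) z)%C); [|apply H; auto].
  apply csum_ext. intros m Hm. unfold wronsk. ring.
Qed.
End MLDE.

(** * The slash action and the transformation law of P *)

Lemma jfac_neq0 g z : upper z -> jfac g z <> RtoC 0.
Proof.
  intros Hz E. destruct g as [a b c d e]. unfold jfac in E. simpl in E. destruct z as [x y].
  unfold upper in Hz. simpl in Hz.
  pose proof (f_equal fst E) as E1. pose proof (f_equal snd E) as E2.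
  unfold Cmult, Cplus, RtoC in E1, E2. simpl in E1, E2.
  assert (Hc : IZR c = 0) by nra. rewrite Hc in E1. assert (Hd : IZR d = 0) by lra.
  apply eq_IZR in Hc, Hd. subst. lia.
Qed.

Lemma mdet_R g : IZR (ma g) * IZR (md g) - IZR (mb g) * IZR (mc g) = 1.
Proof. rewrite <- !mult_IZR, <- minus_IZR, mdet. reflexivity. Qed.

Lemma Im_mobius g z : upper z -> Im (mobius g z) = Im z / (Cmod (jfac g z)) ^ 2.
Proof.
  intros Hz. pose proof (jfac_neq0 g z Hz) as Hj. rewrite Cmod2_alt.
  pose proof (mdet_R g) as E. unfold mobius, jfac in *.
  set (a := IZR (ma g)) in *. set (b := IZR (mb g)) in *. set (c := IZR (mc g)) in *. set (d := IZR (md g)) in *.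
  destruct z as [x y]. unfold Cdiv, Cinv, Cmult, Cplus, RtoC. simpl.
  set (D := (c * x - 0 * y + d) * ((c * x - 0 * y + d) * 1) + (c * y + 0 * x + 0) * ((c * y + 0 * x + 0) * 1)).
  assert (HD : D <> 0).
  { intros HD. apply Hj. unfold Cmult, Cplus, RtoC. simpl. unfold D in HD.
    assert (S : forall u w, u * (u * 1) + w * (w * 1) = 0 -> u = 0 /\ w = 0) by (intros; split; nra).
    apply S in HD. destruct HD. apply injective_projections; assumption. }
  apply (Rmult_eq_reg_r D); [|auto].
  transitivity ((a * d - b * c) * y); [field; exact HD|]. rewrite E. field. exact HD.
Qed.

Lemma mobius_upper g z : upper z -> upper (mobius g z).
Proof.
  intros Hz. unfold upper. rewrite Im_mobius by auto.
  apply Rdiv_lt_0_compat; [exact Hz|]. apply pow_lt. apply (proj1 (Cmod_gt_0 _)). apply jfac_neq0; auto.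
Qed.

Lemma cd_jfac g z : cd (jfac g) z (RtoC (IZR (mc g))).
Proof.
  unfold jfac. eapply cd_to; [apply cd_plus; [apply cd_scal, cd_id|apply cd_const]|]. ring.
Qed.

Lemma cd_mobius g z : upper z -> cd (mobius g) z (/ (jfac g z * jfac g z))%C.
Proof.
  intros Hz. pose proof (jfac_neq0 g z Hz) as Hj. unfold mobius. fold (jfac g z).
  eapply cd_to.
  - apply (cd_div (fun z => RtoC (IZR (ma g)) * z + RtoC (IZR (mb g)))%C (jfac g)); [auto| |apply cd_jfac].
    apply cd_plus; [apply cd_scal, cd_id|apply cd_const].
  - transitivity (RtoC (IZR (ma g) * IZR (md g) - IZR (mb g) * IZR (mc g)) / (jfac g z * jfac g z))%C.
    + rewrite RtoC_minus, !RtoC_mult. unfold jfac in *. field. auto.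
    + rewrite mdet_R. field. auto.
Qed.

(** If c = 0 the factor is a constant that may lie on the branch cut, where the power is not
    differentiable; if c <> 0 then cz + d is not real. *)
Lemma cd_Cpow_jfac g z (a : C) : upper z ->
  cd (fun w => Cpow (jfac g w) a) z (a * RtoC (IZR (mc g)) / jfac g z * Cpow (jfac g z) a)%C.
Proof.
  intros Hz. pose proof (jfac_neq0 g z Hz) as Hj.
  destruct (Z.eq_dec (mc g) 0) as [Hc|Hc].
  - rewrite Hc. eapply cd_to.
    + apply (cd_ext (fun _ => Cpow (RtoC (IZR (md g))) a)); [|apply cd_const].
      intros w. unfold jfac. rewrite Hc. f_equal. ring.
    + field. auto.
  - eapply cd_to; [apply (cd_comp (fun w => Cpow w a) (jfac g)); [apply cd_Cpow|apply cd_jfac]|].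
    + right. unfold jfac. destruct z as [x y]. unfold upper in Hz. simpl in *.
      intros E. assert (E' : IZR (mc g) * y = 0) by lra.
      apply Rmult_integral in E'. destruct E' as [E'|E']; [apply Hc, eq_IZR; auto|lra].
    + field. auto.
Qed.

(* The paper's slash operator without the multiplier. *)
Definition slash (k : R) (g : SL2Z) (f : C -> C) (z : C) : C :=
  (Cpow (jfac g z) (RtoC (- k)) * f (mobius g z))%C.

Lemma slash_shift k l g f z : upper z ->
  slash (k + l) g f z = (Cpow (jfac g z) (RtoC (- l)) * slash k g f z)%C.
Proof.
  intros Hz. unfold slash. replace (- (k + l)) with (- l + - k) by ring.
  rewrite Cpow_plus by (apply jfac_neq0; auto). ring.
Qed.

Lemma Cpow_m2 w : w <> RtoC 0 -> Cpow w (RtoC (- (2))) = (/ (w * w))%C.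
Proof.
  intros H. rewrite Cpow_opp by auto. f_equal. change 2 with (INR 2). rewrite Cpow_INR by auto. simpl. ring.
Qed.

Lemma slash_cd k g f z : holo_H f -> upper z ->
  cd (slash k g f) z (- (RtoC k * RtoC (IZR (mc g)) / jfac g z) * slash k g f z + slash (k + 2) g (cderiv f) z)%C.
Proof.
  intros Hf Hz. pose proof (jfac_neq0 g z Hz) as Hj. eapply cd_to.
  - apply (cd_mult (fun w => Cpow (jfac g w) (RtoC (- k))) (fun w => f (mobius g w))).
    + apply cd_Cpow_jfac; auto.
    + apply (cd_comp f); [apply holo_cd; [auto|apply mobius_upper; auto]|apply cd_mobius; auto].
  - rewrite slash_shift, Cpow_m2 by auto. unfold slash. rewrite RtoC_opp. field. auto.
Qed.

Lemma slash_holo k g f : holo_H f -> holo_H (slash k g f).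
Proof. intros Hf z Hz. eexists. apply slash_cd; auto. Qed.

(** The expected law of P = -E_2/12 is P|_2 g = P - c / (2 pi i (cz + d)); this is the failure of
    that law. *)
Definition P_defect (g : SL2Z) (z : C) : C :=
  (slash 2 g Pfun z + RtoC (IZR (mc g)) / (tpi * jfac g z) - Pfun z)%C.

Lemma P_defect_holo g : holo_H (P_defect g).
Proof.
  apply holo_minus; [|apply Pfun_holo]. apply holo_plus; [apply slash_holo, Pfun_holo|].
  apply holo_div; [apply holo_const| |].
  - apply holo_scal. intros z Hz. eexists. apply cd_jfac.
  - intros z Hz. apply Cmult_neq_0; [apply tpi_neq0|apply jfac_neq0; auto].
Qed.

Lemma Dk_slash k g f z : holo_H f -> upper z ->
  slash (k + 2) g (Dk k f) z = (Dk k (slash k g f) z + RtoC k * P_defect g z * slash k g f z)%C.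
Proof.
  intros Hf Hz. pose proof (jfac_neq0 g z Hz) as Hj. pose proof tpi_neq0 as Ht.
  unfold Dk at 2. rewrite (cderiv_eq _ _ _ (slash_cd k g f z Hf Hz)). fold tpi.
  unfold P_defect. replace (slash 2 g Pfun z) with (slash (0 + 2) g Pfun z) by (f_equal; ring).
  rewrite !(slash_shift k), !(slash_shift 0), Cpow_m2 by auto.
  unfold slash. rewrite Ropp_0, Cpow_0 by auto. unfold Dk. fold tpi. field. auto.
Qed.

Definition unitv (v : SL2Z -> C) := forall g, v g <> RtoC 0.

Lemma transforms_slash k rho v F : unitv v ->
  (transforms k rho v F <-> forall g z i, upper z -> (i < 5)%nat ->
     slash k g (F i) z = (v g * csum 5 (fun j => rho g i j * F j z))%C).
Proof.
  intros Hv. split; intros H g z i Hz Hi.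
  - pose proof (H g z i Hz Hi) as E. change dim5 with 5%nat in E. rewrite <- E.
    unfold slash. field. apply Hv.
  - transitivity (/ v g * slash k g (F i) z)%C; [unfold slash; ring|].
    rewrite H by auto. transitivity (csum 5 (fun j => rho g i j * F j z)%C); [field; apply Hv|reflexivity].
Qed.

Lemma transforms_D_gen k rho v F : unitv v -> (forall i, (i < 5)%nat -> holo_H (F i)) ->
  transforms k rho v F -> forall g z i, upper z -> (i < 5)%nat ->
  slash (k + 2) g (Dk k (F i)) z
   = (v g * csum 5 (fun j => rho g i j * (Dk k (F j) z + RtoC k * P_defect g z * F j z)))%C.
Proof.
  intros Hv HF HT g z i Hz Hi. rewrite transforms_slash in HT by auto.
  rewrite Dk_slash by auto.
  rewrite (Dk_ext k (slash k g (F i)) (fun w => v g * csum 5 (fun j => rho g i j * F j w))%C);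
    [|intros; apply HT; auto|auto|apply slash_holo; auto].
  assert (Hr : forall j, (j < 5)%nat -> holo_H (fun w => rho g i j * F j w)%C) by (intros; apply holo_scal; auto).
  rewrite Dk_scal; [|auto|apply (holo_csum 5 (fun j w => rho g i j * F j w)%C); auto].
  rewrite (Dk_csum k 5 (fun j w => rho g i j * F j w)%C) by auto.
  rewrite HT by auto.
  transitivity (v g * (csum 5 (fun j => Dk k (fun w => rho g i j * F j w) z)
    + RtoC k * P_defect g z * csum 5 (fun j => rho g i j * F j z)))%C; [ring|].
  f_equal. rewrite <- csum_scal, <- csum_plus. apply csum_ext. intros j Hj.
  rewrite Dk_scal by auto. ring.
Qed.

Section PLaw.
Variables (k : R) (M4 M6 M8 M10 : C -> C) (F : vfun) (rho : SL2Z -> mat) (v : SL2Z -> C).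
Hypotheses (H4 : holo_H M4) (H6 : holo_H M6) (H8 : holo_H M8) (H10 : holo_H M10)
  (HF : forall i, (i < 5)%nat -> holo_H (F i))
  (Hode : forall i z, (i < 5)%nat -> upper z -> mlde5 k M4 M6 M8 M10 (F i) z = RtoC 0)
  (Hind : forall c : nat -> C, (forall z, upper z -> csum 5 (fun i => (c i * F i z)%C) = RtoC 0) ->
     forall i, (i < 5)%nat -> c i = RtoC 0)
  (Hv : unitv v) (Hrho : forall g, invertible (rho g)) (HT : transforms k rho v F).

Let Y (m : nat) (j : nat) := Dn m k (F j).

(** Passing D through the slash costs the current weight times [P_defect], so the coefficient next
    to the top one collects k + (k + 2) + ... + (k + 2(l - 1)) = l k + l(l - 1). *)
Lemma slash_Dn_expand g l : (l < 6)%nat -> exists x : nat -> C -> C,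
  (forall m, holo_H (x m)) /\ (forall m z, (l < m)%nat -> x m z = RtoC 0) /\
  (forall z, x l z = RtoC 1) /\
  (forall z, match l with O => True | S l' =>
      x l' z = (RtoC (INR l * k + INR l * (INR l - 1)) * P_defect g z)%C end) /\
  forall i z, (i < 5)%nat -> upper z ->
    slash (k + 2 * INR l) g (Y l i) z = (v g * csum 5 (fun j => rho g i j * csum 6 (fun m => x m z * Y m j z)))%C.
Proof.
  induction l; intros Hl.
  - exists (fun m _ => match m with O => 1%C | _ => 0%C end). split; [|split; [|split; [|split]]].
    + intros [|m]; apply holo_const.
    + intros [|m] z H; [lia|auto].
    + auto.
    + auto.
    + intros i z Hi Hz. pose proof (proj1 (transforms_slash k rho v F Hv) HT g z i Hz Hi) as E.
      replace (k + 2 * INR 0) with k by (simpl; ring). change (Y 0 i) with (F i). rewrite E. f_equal.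
      apply csum_ext. intros j Hj. unfold Y. simpl. ring.
  - destruct IHl as (x & Hx & Hx0 & Hx1 & Hx2 & E); [lia|].
    set (kl := k + 2 * INR l).
    (* Leibniz rule for D on x_m D^m F, where x_m is given the weight 2(l - m); that weight is the
       origin of the term in P. *)
    set (x' := fun m z => (/ tpi * cderiv (x m) z + match m with O => 0 | S m' => x m' z end
       + (RtoC (2 * (INR l - INR m)) * Pfun z + RtoC kl * P_defect g z) * x m z)%C).
    assert (Hdc : forall m c, (forall z, x m z = c) -> forall z, cderiv (x m) z = RtoC 0).
    { intros m c Hc z. apply cderiv_eq. apply (cd_ext (fun _ => c)); [intros; symmetry; auto|apply cd_const]. }
    exists x'. split; [|split; [|split; [|split]]].
    + intros m. unfold x'. apply holo_plus; [apply holo_plus|].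
      * apply holo_scal, holo_deriv, Hx.
      * destruct m; [apply holo_const|apply Hx].
      * apply holo_mult; [|apply Hx]. apply holo_plus; apply holo_scal; [apply Pfun_holo|apply P_defect_holo].
    + intros m z Hm. unfold x'. rewrite (Hdc m 0%C) by (intros; apply Hx0; lia).
      rewrite (Hx0 m) by lia. destruct m; [lia|]. rewrite (Hx0 m) by lia. ring.
    + intros z. unfold x'. rewrite (Hdc (S l) 0%C) by (intros; apply Hx0; lia).
      rewrite (Hx0 (S l)), Hx1 by lia. ring.
    + intros z. unfold x'. rewrite (Hdc l 1%C), Hx1 by (intros; apply Hx1).
      replace (2 * (INR l - INR l)) with 0 by ring.
      destruct l.
      * unfold kl. replace (INR 1 * k + INR 1 * (INR 1 - 1)) with (k + 2 * INR 0) by (simpl; ring). ring.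
      * rewrite (Hx2 z). unfold kl. rewrite !S_INR.
        replace ((INR l + 1 + 1) * k + (INR l + 1 + 1) * (INR l + 1 + 1 - 1))
          with (((INR l + 1) * k + (INR l + 1) * (INR l + 1 - 1)) + (k + 2 * (INR l + 1))) by ring.
        rewrite (RtoC_plus _ (k + 2 * (INR l + 1))). ring.
    + intros i z Hi Hz.
      replace (k + 2 * INR (S l)) with (kl + 2) by (unfold kl; rewrite S_INR; ring).
      change (Y (S l) i) with (Dk kl (Y l i)).
      assert (HY : forall m j, (j < 5)%nat -> holo_H (Y m j)) by (intros; apply Dn_holo; auto).
      set (V := fun j w => csum 6 (fun m => x m w * Y m j w)%C).
      assert (HV : forall j, (j < 5)%nat -> holo_H (V j)).
      { intros j Hj. apply (holo_csum 6 (fun m w => x m w * Y m j w)%C). intros m Hm.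
        apply holo_mult; auto. }
      rewrite Dk_slash by auto.
      rewrite (Dk_ext kl _ (fun w => v g * csum 5 (fun j => rho g i j * V j w))%C);
        [|intros; apply E; auto|auto|apply slash_holo; auto].
      rewrite Dk_scal; [|auto|apply (holo_csum 5 (fun j w => rho g i j * V j w)%C); intros; apply holo_scal; auto].
      rewrite (Dk_csum kl 5 (fun j w => rho g i j * V j w)%C) by (intros; auto; apply holo_scal; auto).
      unfold kl at 2. rewrite E by auto. fold kl.
      transitivity (v g * (csum 5 (fun j => Dk kl (fun w => rho g i j * V j w) z)
        + RtoC kl * P_defect g z * csum 5 (fun j => rho g i j * V j z)))%C; [unfold V; ring|].
      f_equal. rewrite <- csum_scal, <- csum_plus. apply csum_ext. intros j Hj.
      rewrite Dk_scal by auto.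
      assert (DV : Dk kl (V j) z = csum 6 (fun m => / tpi * cderiv (x m) z * Y m j z + x m z * Y (S m) j z
          + RtoC (2 * (INR l - INR m)) * Pfun z * x m z * Y m j z)%C).
      { unfold V. rewrite (Dk_csum kl 6 (fun m w => x m w * Y m j w)%C) by (intros; auto; apply holo_mult; auto).
        apply csum_ext. intros m Hm.
        replace kl with ((2 * (INR l - INR m)) + (k + 2 * INR m)) by (unfold kl; ring).
        rewrite Dk_mult by auto. change (Dk (k + 2 * INR m) (Y m j) z) with (Y (S m) j z).
        unfold Dk. fold tpi. ring. }
      rewrite DV. unfold V, x'. cbn [csum].
      rewrite (Hx0 5%nat z) by lia. ring.
Qed.

(* Expand slash g (D^5 F) in the basis D^m F twice: directly, and through the MLDE. The coefficients of D^4 F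
   differ by (5k + 20) P_defect. *)
Lemma P_defect_zero g z : 5 * k + 20 <> 0 -> upper z -> P_defect g z = RtoC 0.
Proof.
  intros Hk Hz.
  destruct (slash_Dn_expand g 5) as (x5 & _ & _ & X51 & X52 & E5); [lia|].
  destruct (slash_Dn_expand g 3) as (x3 & _ & X30 & _ & _ & E3); [lia|].
  destruct (slash_Dn_expand g 2) as (x2 & _ & X20 & _ & _ & E2); [lia|].
  destruct (slash_Dn_expand g 1) as (x1 & _ & X10 & _ & _ & E1); [lia|].
  destruct (slash_Dn_expand g 0) as (x0 & _ & X00 & _ & _ & E0); [lia|].
  pose proof (mobius_upper g z Hz) as Hgz.
  set (J := fun a => Cpow (jfac g z) (RtoC (- a))).
  (* The M_{2j} stay evaluated at gz, as no transformation law is known for them yet; they do not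
     enter the coefficient of D^4, which is the one that decides. *)
  set (u := fun m => (x5 m z + M4 (mobius g z) * J 4 * x3 m z + M6 (mobius g z) * J 6 * x2 m z
     + M8 (mobius g z) * J 8 * x1 m z + M10 (mobius g z) * J 10 * x0 m z)%C).
  assert (Z : forall i, (i < 5)%nat ->
     (v g * csum 5 (fun j => rho g i j * csum 6 (fun m => u m * Y m j z)))%C = RtoC 0).
  { intros i Hi.
    transitivity (slash (k + 2 * INR 5) g (Y 5 i) z + M4 (mobius g z) * J 4 * slash (k + 2 * INR 3) g (Y 3 i) z
      + M6 (mobius g z) * J 6 * slash (k + 2 * INR 2) g (Y 2 i) z
      + M8 (mobius g z) * J 8 * slash (k + 2 * INR 1) g (Y 1 i) z
      + M10 (mobius g z) * J 10 * slash (k + 2 * INR 0) g (Y 0 i) z)%C.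
    - rewrite E5, E3, E2, E1, E0 by auto. unfold u. cbn [csum]. ring.
    - assert (S : forall m a f, 2 * INR m + a = 10 ->
        (J a * slash (k + 2 * INR m) g f z)%C = (Cpow (jfac g z) (RtoC (- (k + 10))) * f (mobius g z))%C).
      { intros m a f Ha. unfold J. rewrite <- slash_shift by auto. unfold slash. do 4 f_equal. lra. }
      rewrite <- !(Cmult_assoc _ (J _)).
      rewrite (S 3%nat 4), (S 2%nat 6), (S 1%nat 8), (S 0%nat 10) by (simpl; ring).
      unfold slash. replace (k + 2 * INR 5) with (k + 10) by (simpl; ring).
      unfold Y. rewrite (mlde5_eq k M4 M6 M8 M10) by auto. ring. }
  assert (U : forall j, (j < 5)%nat -> csum 6 (fun m => u m * Y m j z)%C = RtoC 0).
  { apply (invertible_injective (rho g) (fun j => csum 6 (fun m => u m * Y m j z)%C) (Hrho g)).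
    intros i Hi. specialize (Z i Hi). unfold vzero.
    destruct (Ceq_dec (mat_vec (rho g) (fun j => csum 6 (fun m => u m * Y m j z)%C) i) 0) as [|Hn]; [auto|].
    exfalso. revert Z. apply Cmult_neq_0; [apply Hv|exact Hn]. }
  set (w := fun m => (match m with 0%nat => u 0%nat - u 5%nat * M10 z | 1%nat => u 1%nat - u 5%nat * M8 z
     | 2%nat => u 2%nat - u 5%nat * M6 z | 3%nat => u 3%nat - u 5%nat * M4 z | _ => u m end)%C).
  assert (W : forall m, (m < 5)%nat -> w m = RtoC 0).
  { apply (wronsk_indep k M4 M6 M8 M10 H4 H6 H8 H10 F HF Hode Hind z w Hz).
    intros j Hj. rewrite <- (U j Hj). cbn [csum]. unfold Y.
    rewrite (mlde5_eq k M4 M6 M8 M10 (F j) z) by auto. unfold w. ring. }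
  specialize (W 4%nat ltac:(lia)). unfold w, u in W.
  rewrite X30, X20, X10, X00, (X52 z) in W by lia.
  assert (W' : (RtoC (5 * k + 20) * P_defect g z)%C = RtoC 0).
  { rewrite <- W. replace (INR 5 * k + INR 5 * (INR 5 - 1)) with (5 * k + 20) by (simpl; ring). ring. }
  destruct (Ceq_dec (P_defect g z) 0) as [|Hn]; [auto|]. exfalso. revert W'.
  apply Cmult_neq_0; [apply RtoC_neq_0; auto|exact Hn].
Qed.
End PLaw.

Lemma SL2Z_eq g h : ma g = ma h -> mb g = mb h -> mc g = mc h -> md g = md h -> g = h.
Proof.
  destruct g as [a b c d e], h as [a' b' c' d' e']. simpl. intros -> -> -> ->.
  f_equal. apply UIP_dec. apply Z.eq_dec.
Qed.

Definition Smat : SL2Z := mkSL2Z 0 (-1) 1 0 eq_refl.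
Lemma Tpow_det n : (1 * 1 - n * 0 = 1)%Z. Proof. lia. Qed.
Definition Tpow (n : Z) : SL2Z := mkSL2Z 1 n 0 1 (Tpow_det n).

(** Q is closed under products only, so inverses have to come from torsion: S^4 = 1, and T^(-1) = S
    U^5 for U = TS, as U^6 = 1. The rest is Euclid's algorithm on the lower row. *)
Lemma SL2Z_generated (Q : SL2Z -> Prop) :
  (forall g h, Q g -> Q h -> Q (SL2Z_mul g h)) -> Q Smat -> Q Tmat -> forall g, Q g.
Proof.
  intros Hm HS HT.
  assert (H1 : Q (Tpow 0)).
  { replace (Tpow 0) with (SL2Z_mul (SL2Z_mul Smat Smat) (SL2Z_mul Smat Smat)); [auto|].
    apply SL2Z_eq; reflexivity. }
  assert (HTi : Q (Tpow (-1))).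
  { set (U := SL2Z_mul Tmat Smat). assert (HU : Q U) by (apply Hm; auto).
    replace (Tpow (-1)) with (SL2Z_mul Smat (SL2Z_mul U (SL2Z_mul (SL2Z_mul U U) (SL2Z_mul U U)))).
    - repeat apply Hm; auto.
    - apply SL2Z_eq; reflexivity. }
  assert (HTn : forall n, Q (Tpow n)).
  { apply Z.peano_ind; [auto| |]; intros n Hn.
    - replace (Tpow (Z.succ n)) with (SL2Z_mul (Tpow n) Tmat); [auto|].
      apply SL2Z_eq; cbn [SL2Z_mul Tpow Tmat ma mb mc md]; lia.
    - replace (Tpow (Z.pred n)) with (SL2Z_mul (Tpow n) (Tpow (-1))); [auto|].
      apply SL2Z_eq; cbn [SL2Z_mul Tpow Tmat ma mb mc md]; lia. }
  assert (Ind : forall N g, (Z.abs_nat (mc g) <= N)%nat -> Q g).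
  { induction N; intros g HN.
    - assert (Hc : mc g = 0%Z) by lia. pose proof (mdet g) as E. rewrite Hc in E.
      assert (Ead : (ma g * md g = 1)%Z) by lia.
      destruct (Z.eq_mul_1 (ma g) (md g) Ead) as [Ha|Ha]; rewrite Ha in Ead.
      + replace g with (Tpow (mb g)); [auto|]. apply SL2Z_eq; simpl; lia.
      + replace g with (SL2Z_mul (SL2Z_mul Smat Smat) (Tpow (- mb g))); [auto|].
        apply SL2Z_eq; cbn [SL2Z_mul Tpow Smat ma mb mc md]; lia.
    - destruct (Z.eq_dec (mc g) 0) as [Hc|Hc]; [apply IHN; lia|].
      (* Right multiplication by T^n S with this n replaces the entry c by d mod c. *)
      set (n := (- (md g / mc g))%Z).
      set (g2 := SL2Z_mul (SL2Z_mul g (Tpow n)) Smat).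
      assert (Eg : g = SL2Z_mul (SL2Z_mul g2 (SL2Z_mul Smat (SL2Z_mul Smat Smat))) (Tpow (- n))).
      { apply SL2Z_eq; unfold g2; cbn [SL2Z_mul Tpow Smat ma mb mc md]; ring. }
      assert (Hg2 : Q g2).
      { apply IHN. unfold g2. cbn [SL2Z_mul Tpow Smat ma mb mc md].
        pose proof (Z.div_mod (md g) (mc g) Hc) as D.
        assert (R : (Z.abs (md g mod mc g) < Z.abs (mc g))%Z).
        { destruct (Z.lt_ge_cases 0 (mc g)); [pose proof (Z.mod_pos_bound (md g) (mc g) ltac:(lia))|
            pose proof (Z.mod_neg_bound (md g) (mc g) ltac:(lia))]; lia. }
        replace ((mc g * 1 + md g * 0) * 0 + (mc g * n + md g * 1) * 1)%Z with (md g mod mc g)%Z.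
        - clear - HN R. set (x := (md g mod mc g)%Z) in *. lia.
        - unfold n. rewrite Z.mod_eq by auto. ring. }
      rewrite Eg. clear Eg. clearbody g2. repeat apply Hm; auto. }
  intros g. apply (Ind (Z.abs_nat (mc g))). lia.
Qed.

Lemma jfac_mul g h z : upper z -> jfac (SL2Z_mul g h) z = (jfac g (mobius h z) * jfac h z)%C.
Proof.
  intros Hz. pose proof (jfac_neq0 h z Hz) as Hj. unfold mobius. fold (jfac h z).
  transitivity (RtoC (IZR (mc g)) * (RtoC (IZR (ma h)) * z + RtoC (IZR (mb h))) + RtoC (IZR (md g)) * jfac h z)%C.
  - unfold jfac, SL2Z_mul. cbn [ma mb mc md]. rewrite !plus_IZR, !mult_IZR, !RtoC_plus, !RtoC_mult. ring.
  - unfold jfac at 2. field. auto.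
Qed.

Lemma mobius_mul g h z : upper z -> mobius (SL2Z_mul g h) z = mobius g (mobius h z).
Proof.
  intros Hz. pose proof (jfac_neq0 h z Hz) as Hj. pose proof (jfac_neq0 g _ (mobius_upper h z Hz)) as Hj'.
  pose proof (jfac_mul g h z Hz) as E.
  unfold mobius at 1. fold (jfac (SL2Z_mul g h) z). rewrite E.
  unfold mobius at 2. fold (jfac g (mobius h z)).
  assert (N : (RtoC (IZR (ma (SL2Z_mul g h))) * z + RtoC (IZR (mb (SL2Z_mul g h))))%C
    = ((RtoC (IZR (ma g)) * mobius h z + RtoC (IZR (mb g))) * jfac h z)%C).
  { unfold mobius. fold (jfac h z).
    transitivity (RtoC (IZR (ma g)) * (RtoC (IZR (ma h)) * z + RtoC (IZR (mb h))) + RtoC (IZR (mb g)) * jfac h z)%C.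
    - unfold jfac, SL2Z_mul. cbn [ma mb mc md]. rewrite !plus_IZR, !mult_IZR, !RtoC_plus, !RtoC_mult. ring.
    - field. auto. }
  rewrite N. field. auto.
Qed.

(** Integer weights are written with [Cpown], so that no branch of a power enters. *)
Definition weight_law (n : nat) (g : SL2Z) (f : C -> C) :=
  forall z, upper z -> f (mobius g z) = (Cpown (jfac g z) n * f z)%C.

Lemma pown_mult x y m : Cpown (x * y)%C m = (Cpown x m * Cpown y m)%C.
Proof. induction m; simpl; [ring|rewrite IHm; ring]. Qed.

Lemma weight_law_mul n g h f : weight_law n g f -> weight_law n h f -> weight_law n (SL2Z_mul g h) f.
Proof.
  intros Hg Hh z Hz. rewrite mobius_mul, Hg, Hh, jfac_mul, pown_mult by (auto; apply mobius_upper; auto). ring.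
Qed.

Lemma slash_INR_eq n g f z : upper z ->
  f (mobius g z) = (Cpown (jfac g z) n * slash (INR n) g f z)%C.
Proof.
  intros Hz. pose proof (jfac_neq0 g z Hz) as Hj. unfold slash.
  rewrite Cpow_opp, Cpow_INR by auto. field. apply pown_neq0. auto.
Qed.

Lemma weight_law_slash n g f : weight_law n g f <-> forall z, upper z -> slash (INR n) g f z = f z.
Proof.
  split; intros H z Hz; pose proof (jfac_neq0 g z Hz) as Hj.
  - unfold slash. rewrite H, Cpow_opp, Cpow_INR by auto. field. apply pown_neq0. auto.
  - rewrite (slash_INR_eq n), H by auto. reflexivity.
Qed.

Lemma zero_deriv_const f z0 : (forall z, upper z -> cd f z 0%C) -> upper z0 -> forall z, upper z -> f z = f z0.
Proof.
  intros H Hz0 z Hz.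
  assert (E : (f z - f z0)%C = RtoC 0).
  { apply (linear_ode_zero 1 (fun _ w => f w - f z0)%C (fun _ _ _ => RtoC 0) z0) with (i := 0%nat); auto.
    - intros; apply holo_const.
    - intros i w _ Hw. eapply cd_to; [apply cd_minus; [apply H; auto|apply cd_const]|]. simpl. ring.
    - intros. ring. }
  transitivity ((f z - f z0) + f z0)%C; [ring|]. rewrite E. ring.
Qed.

Lemma cd_pown f z l n : cd f z l -> cd (fun w => Cpown (f w) (S n)) z (RtoC (INR (S n)) * Cpown (f z) n * l)%C.
Proof.
  intros H. induction n.
  - eapply cd_to; [apply (cd_mult f (fun w => Cpown (f w) 0)); [exact H|exact (cd_const (RtoC 1) z)]|]. simpl. ring.
  - eapply cd_to; [apply (cd_mult f (fun w => Cpown (f w) (S n))); [exact H|exact IHn]|].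
    rewrite (S_INR (S n)), RtoC_plus. simpl Cpown. ring.
Qed.

(** Delta = eta^24, so its logarithmic derivative divided by 2 pi i is 24/(2 pi i) eta'/eta = -12
    P. *)
Lemma Dk_Delta z : upper z -> Dk 12 Delta_q z = RtoC 0.
Proof.
  intros Hz. pose proof tpi_neq0 as Ht. pose proof (phi_neq0 _ (qq_disc z Hz)) as Hp.
  rewrite (Dk_ext 12 _ (fun z => qq z * Cpown (phi (qq z)) 24)%C); [|intros; apply Delta_qE; auto|auto|apply Delta_holo].
  unfold Dk. rewrite PfunE by auto. fold tpi.
  erewrite cderiv_eq;
    [|apply (cd_mult qq (fun z => Cpown (phi (qq z)) 24)); [apply cd_qq|
       apply (cd_pown (fun z => phi (qq z))); apply (cd_comp_qq phi); [apply phi_hol|auto]]].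
  unfold pq. change (INR 24) with (1+1+1+1+1+1+1+1+1+1+1+1+1+1+1+1+1+1+1+1+1+1+1+1).
  replace (1+1+1+1+1+1+1+1+1+1+1+1+1+1+1+1+1+1+1+1+1+1+1+1) with 24 by ring.
  simpl Cpown. field. auto.
Qed.

Lemma mobius_S z : upper z -> mobius Smat z = (- / z)%C.
Proof.
  intros Hz. unfold mobius. simpl. assert (z <> RtoC 0) by (intros ->; unfold upper in Hz; simpl in Hz; lra).
  field. replace (1 * z + 0)%C with z by ring. auto.
Qed.

Lemma jfac_S z : jfac Smat z = z.
Proof. unfold jfac. simpl. ring. Qed.

Lemma mobius_T z : mobius Tmat z = (z + 1)%C.
Proof. unfold mobius. simpl. field. Qed.

Lemma jfac_T z : jfac Tmat z = RtoC 1.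
Proof. unfold jfac. simpl. ring. Qed.

Lemma pown_1 n : Cpown 1 n = RtoC 1.
Proof. induction n; simpl; [auto|rewrite IHn; ring]. Qed.

Lemma upper_i : upper Ci.
Proof. unfold upper, Ci. simpl. lra. Qed.

Lemma inv_i : (- / Ci)%C = Ci.
Proof.
  assert (H : Ci <> RtoC 0) by (intros X; apply (f_equal snd) in X; simpl in X; lra).
  transitivity (- / Ci * (Ci * Ci) * - (1))%C; [rewrite CiCi; ring|]. field. auto.
Qed.

Lemma pown_i4 n : Cpown Ci (4 * n) = RtoC 1.
Proof.
  induction n; [reflexivity|]. replace (4 * S n)%nat with (S (S (S (S (4 * n))))) by lia.
  cbn [Cpown]. rewrite IHn.
  transitivity ((Ci * Ci) * (Ci * Ci))%C; [ring|]. rewrite CiCi. ring.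
Qed.

Section WithPLaw.
Hypothesis HP : forall g z, upper z -> P_defect g z = RtoC 0.

Lemma Dk_slash0 k g f z : holo_H f -> upper z -> slash (k + 2) g (Dk k f) z = Dk k (slash k g f) z.
Proof. intros Hf Hz. rewrite Dk_slash, HP by auto. ring. Qed.

(** As D now commutes with the slash, D_12 kills both Delta and Delta|S. Their ratio is constant,
    and it is 1 at the fixed point i of S because i^12 = 1. The case of T is periodicity. *)
Lemma Delta_law g : weight_law 12 g Delta_q.
Proof.
  apply SL2Z_generated with (Q := fun g => weight_law 12 g Delta_q).
  - intros g1 g2. apply weight_law_mul.
  - clear g. set (f := slash 12 Smat Delta_q).
    assert (Hf : holo_H f) by apply slash_holo, Delta_holo.
    assert (D0 : forall z, upper z -> Dk 12 f z = RtoC 0).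
    { intros z Hz. unfold f. rewrite <- Dk_slash0 by (auto; apply Delta_holo).
      unfold slash. rewrite Dk_Delta by (apply mobius_upper; auto). ring. }
    assert (C : forall z, upper z -> (f z / Delta_q z)%C = (f Ci / Delta_q Ci)%C).
    { apply (zero_deriv_const (fun z => f z / Delta_q z)%C); [|apply upper_i].
      intros z Hz. pose proof (Delta_neq0 z Hz) as Hd. eapply cd_to.
      - apply cd_div; [auto|apply (Dk_cd 12); auto|apply (Dk_cd 12); [apply Delta_holo|auto]].
      - rewrite D0, Dk_Delta by auto. field. auto. }
    assert (Hi : (f Ci / Delta_q Ci)%C = RtoC 1).
    { pose proof (Delta_neq0 Ci upper_i). unfold f.
      pose proof (slash_INR_eq 12 Smat Delta_q Ci upper_i) as E.
      rewrite mobius_S, inv_i, jfac_S in E by apply upper_i.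
      change 12%nat with (4 * 3)%nat in E at 1. rewrite pown_i4 in E. replace (INR 12) with 12 in E by (simpl; ring).
      replace (slash 12 Smat Delta_q Ci) with (Delta_q Ci) by (rewrite E at 1; ring).
      field. auto. }
    apply weight_law_slash. intros z Hz. replace (INR 12) with 12 by (simpl; ring).
    fold f. pose proof (Delta_neq0 z Hz).
    transitivity (f z / Delta_q z * Delta_q z)%C; [field; auto|]. rewrite C, Hi by auto. ring.
  - intros z Hz. rewrite mobius_T, jfac_T, pown_1.
    rewrite !Delta_qE by (auto; apply (upper_plus_real z 1); auto). rewrite qq_plus1. ring.
Qed.

Lemma transforms_D k rho v F : unitv v -> (forall i, (i < 5)%nat -> holo_H (F i)) ->
  transforms k rho v F -> transforms (k + 2) rho v (fun i => Dk k (F i)).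
Proof.
  intros Hv HF HT. apply transforms_slash; [auto|]. intros g z i Hz Hi.
  rewrite (transforms_D_gen k rho v F) by auto. f_equal. apply csum_ext. intros j Hj. rewrite HP by auto. ring.
Qed.
End WithPLaw.

(** * Newton interpolation and eigenvectors of rho(T) *)

(** Iterated D acts on the leading term of q^x through such a product of linear factors, so symbols
    of operators come naturally in the Newton basis. *)
Fixpoint newton (b : nat -> C) (n : nat) (x : C) : C :=
  match n with O => 1%C | S n' => (newton b n' x * (x - b n'))%C end.

Lemma newton_diff b n y : exists kap : nat -> C,
  forall x, (newton b (S n) x - newton b (S n) y)%C
    = ((x - y) * (newton b n x + csum n (fun i => kap i * newton b i x)))%C.
Proof.
  induction n.
  - exists (fun _ => 0%C). intros x. simpl. ring.
  - destruct IHn as [kap H].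
    exists (fun i => (if Nat.eqb i n then (y - b (S n)) else (y - b (S n)) * kap i)%C).
    intros x.
    transitivity ((x - y) * newton b (S n) x + (y - b (S n)) * (newton b (S n) x - newton b (S n) y))%C;
      [simpl; ring|].
    rewrite H. cbn [csum]. rewrite Nat.eqb_refl.
    rewrite (csum_ext n (fun i => (if Nat.eqb i n then y - b (S n) else (y - b (S n)) * kap i) * newton b i x)%C
      (fun i => (y - b (S n)) * (kap i * newton b i x))%C).
    + rewrite csum_scal. simpl. ring.
    + intros i Hi. destruct (Nat.eqb_spec i n); [lia|ring].
Qed.

(** Division by x - y inside the Newton basis. That the top coefficient survives is what lets
    [newton_zero] recover it from the induction hypothesis. *)
Lemma newton_comb_diff b mu y n : exists mu' : nat -> C, (forall n', n = S n' -> mu' n' = mu n) /\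
  forall x, (csum (S n) (fun i => mu i * newton b i x) - csum (S n) (fun i => mu i * newton b i y))%C
    = ((x - y) * csum n (fun i => mu' i * newton b i x))%C.
Proof.
  induction n.
  - exists (fun _ => 0%C). split; [intros; lia|]. intros x. simpl. ring.
  - destruct IHn as [mu' [_ H]]. destruct (newton_diff b n y) as [kap Hk].
    exists (fun i => (if Nat.eqb i n then mu (S n) else mu' i + mu (S n) * kap i)%C). split.
    + intros n' E. injection E as <-. rewrite Nat.eqb_refl. reflexivity.
    + intros x.
      change (csum (S (S n)) (fun i => mu i * newton b i x))%C
        with (csum (S n) (fun i => mu i * newton b i x) + mu (S n) * newton b (S n) x)%C.
      change (csum (S (S n)) (fun i => mu i * newton b i y))%C
        with (csum (S n) (fun i => mu i * newton b i y) + mu (S n) * newton b (S n) y)%C.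
      transitivity ((csum (S n) (fun i => mu i * newton b i x) - csum (S n) (fun i => mu i * newton b i y))
        + mu (S n) * (newton b (S n) x - newton b (S n) y))%C; [ring|].
      rewrite H, Hk. cbn [csum]. rewrite Nat.eqb_refl.
      rewrite (csum_ext n (fun i => (if Nat.eqb i n then mu (S n) else mu' i + mu (S n) * kap i) * newton b i x)%C
        (fun i => mu' i * newton b i x + mu (S n) * (kap i * newton b i x))%C).
      * rewrite csum_plus, csum_scal. ring.
      * intros i Hi. destruct (Nat.eqb_spec i n); [lia|ring].
Qed.

Lemma C_integral (a b : C) : (a * b)%C = RtoC 0 -> a = RtoC 0 \/ b = RtoC 0.
Proof.
  intros H. destruct (Ceq_dec a 0) as [|Ha]; [auto|]. destruct (Ceq_dec b 0) as [|Hb]; [auto|].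
  exfalso. revert H. apply Cmult_neq_0; auto.
Qed.

Lemma C_minus_neq0 (a b : C) : a <> b -> (a - b)%C <> RtoC 0.
Proof. intros H E. apply H. transitivity ((a - b) + b)%C; [ring|]. rewrite E. ring. Qed.

Lemma newton_zero b n : forall (mu x : nat -> C),
  (forall i j, (i < n)%nat -> (j < n)%nat -> x i = x j -> i = j) ->
  (forall j, (j < n)%nat -> csum n (fun i => mu i * newton b i (x j))%C = RtoC 0) ->
  forall i, (i < n)%nat -> mu i = RtoC 0.
Proof.
  induction n; intros mu x Hd H i Hi; [lia|].
  destruct (newton_comb_diff b mu (x n) n) as [mu' [Htop E]].
  assert (Hmu' : forall i, (i < n)%nat -> mu' i = RtoC 0).
  { apply (IHn mu' x); [intros; apply Hd; auto|]. intros j Hj. specialize (E (x j)).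
    rewrite !H in E by lia. replace (0 - 0)%C with (RtoC 0) in E by ring. symmetry in E.
    apply C_integral in E. destruct E as [E|E]; [|exact E]. exfalso. revert E. apply C_minus_neq0.
    intros X. apply Hd in X; lia. }
  assert (Hn : mu n = RtoC 0).
  { destruct n as [|n'].
    - specialize (H 0%nat ltac:(lia)). simpl in H. rewrite <- H. ring.
    - rewrite <- (Htop n' eq_refl). apply Hmu'. lia. }
  destruct (Nat.eq_dec i n) as [->|Hne]; [auto|].
  apply (IHn mu x); [intros; apply Hd; auto| |lia].
  intros j Hj. specialize (H j ltac:(lia)). cbn [csum] in H. rewrite Hn in H. rewrite <- H. ring.
Qed.

(* The third divided difference of [sum_i c_i p_i] at the four points. *)
Lemma newton4_top (b c : nat -> C) (x : nat -> C) :
  (forall i j, (i < 4)%nat -> (j < 4)%nat -> x i = x j -> i = j) ->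
  (forall j, (j < 4)%nat -> csum 5 (fun i => c i * newton b i (x j))%C = RtoC 0) ->
  (c 3%nat + c 4%nat * ((x 0%nat + x 1%nat + x 2%nat + x 3%nat)
     - (b 0%nat + b 1%nat + b 2%nat + b 3%nat)))%C = RtoC 0.
Proof.
  intros Hd H.
  destruct (newton_comb_diff b c (x 3%nat) 4) as [c3 [T3 E3]].
  set (x0 := x 0%nat) in *. set (x1 := x 1%nat) in *. set (x2 := x 2%nat) in *. set (x3 := x 3%nat) in *.
  assert (D : forall i j, (i < 4)%nat -> (j < 4)%nat -> i <> j -> (x i - x j)%C <> RtoC 0).
  { intros i j Hi Hj Hn. apply C_minus_neq0. intros X. apply Hn. apply Hd; auto. }
  pose proof (D 0%nat 1%nat ltac:(lia) ltac:(lia) ltac:(lia)) as D01.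
  pose proof (D 0%nat 2%nat ltac:(lia) ltac:(lia) ltac:(lia)) as D02.
  pose proof (D 0%nat 3%nat ltac:(lia) ltac:(lia) ltac:(lia)) as D03.
  pose proof (D 1%nat 2%nat ltac:(lia) ltac:(lia) ltac:(lia)) as D12.
  pose proof (D 1%nat 3%nat ltac:(lia) ltac:(lia) ltac:(lia)) as D13.
  pose proof (D 2%nat 3%nat ltac:(lia) ltac:(lia) ltac:(lia)) as D23.
  fold x0 x1 x2 x3 in D01, D02, D03, D12, D13, D23.
  set (f := fun y => csum 5 (fun i => c i * newton b i y)%C).
  transitivity (f x0 / ((x0 - x1) * (x0 - x2) * (x0 - x3)) - f x1 / ((x0 - x1) * (x1 - x2) * (x1 - x3))
     + f x2 / ((x0 - x2) * (x1 - x2) * (x2 - x3)) - f x3 / ((x0 - x3) * (x1 - x3) * (x2 - x3)))%C.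
  - unfold f. simpl. clear - D01 D02 D03 D12 D13 D23.
    set (b0 := b 0%nat). set (b1 := b 1%nat). set (b2 := b 2%nat). set (b3 := b 3%nat).
    clearbody b0 b1 b2 b3 x0 x1 x2 x3. field. repeat split; auto.
  - unfold f, x0, x1, x2, x3. rewrite !H by lia. unfold Cdiv. ring.
Qed.

(** Vandermonde: with all nodes equal to 0 the Newton basis consists of the monomials. *)
Lemma powers_independent (x : nat -> C) :
  (forall i j, (i < 5)%nat -> (j < 5)%nat -> x i = x j -> i = j) ->
  forall a : nat -> C, (forall m, (m < 5)%nat -> csum 5 (fun j => a j * Cpown (x j) m)%C = RtoC 0) ->
  forall j, (j < 5)%nat -> a j = RtoC 0.
Proof.
  intros Hd a Ha.
  assert (N : forall m y, newton (fun _ => 0%C) m y = Cpown y m).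
  { induction m; intros y; simpl; [auto|]. rewrite IHm. ring. }
  set (V := fun j m => Cpown (x j) m).
  assert (HV : det5 V <> RtoC 0).
  { intros E. destruct (det5_0_kernel E) as [w [Hw K]]. apply Hw. intros i Hi.
    apply (newton_zero (fun _ => 0%C) 5 w x Hd); [|auto].
    intros j Hj. transitivity (mat_vec V w j); [|exact (K j Hj)]. apply csum_ext. intros m Hm. rewrite N. unfold V. ring. }
  rewrite <- det5_tr in HV.
  apply (det5_injective _ a HV). intros m Hm. unfold vzero. rewrite <- (Ha m Hm).
  apply csum_ext. intros j Hj. unfold V. ring.
Qed.

Lemma left_eigenvector M lam : eigenvalue M lam ->
  exists l : vec, ~ veq l vzero /\ forall i, (i < 5)%nat -> csum 5 (fun a => l a * M a i)%C = (lam * l i)%C.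
Proof.
  intros [v [Hv E]].
  set (N := fun i j => (M i j - lam * mat_id i j)%C).
  assert (HN : forall (w : vec) i, (i < 5)%nat -> mat_vec N w i = (mat_vec M w i - lam * w i)%C).
  { intros w i Hi. rewrite <- (mat_id_vec w i Hi). unfold N, mat_vec, dim5. simpl. ring. }
  assert (HD : det5 N = RtoC 0).
  { destruct (Ceq_dec (det5 N) 0) as [|Hn]; [auto|]. exfalso. apply Hv.
    apply (det5_injective N v Hn). intros i Hi. rewrite HN, E by auto. unfold vzero. ring. }
  rewrite <- det5_tr in HD. destruct (det5_0_kernel HD) as [l [Hl K]].
  exists l. split; [auto|]. intros i Hi.
  specialize (K i Hi). unfold mat_vec, vzero, N, dim5 in K.
  transitivity (csum 5 (fun a => (M a i - lam * mat_id a i) * l a) + lam * csum 5 (fun a => mat_id a i * l a))%C.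
  - simpl. ring.
  - rewrite K. replace (csum 5 (fun a => mat_id a i * l a)%C) with (l i); [ring|].
    do 5 (destruct i as [|i]; [unfold mat_id; simpl; ring|]). lia.
Qed.

(** Applying M^m to a linear relation among the rows multiplies its j-th term by lam_j^m; as the
    eigenvalues are distinct, Vandermonde makes every term vanish. *)
Lemma left_eigenbasis_det M (lam : nat -> C) (L : mat) :
  (forall i j, (i < 5)%nat -> (j < 5)%nat -> lam i = lam j -> i = j) ->
  (forall j, (j < 5)%nat -> ~ veq (L j) vzero) ->
  (forall j i, (j < 5)%nat -> (i < 5)%nat -> csum 5 (fun a => L j a * M a i)%C = (lam j * L j i)%C) ->
  det5 L <> RtoC 0.
Proof.
  intros Hd Hn HL E. rewrite <- det5_tr in E. destruct (det5_0_kernel E) as [c [Hc K]].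
  assert (P : forall m i, (i < 5)%nat -> csum 5 (fun j => (c j * L j i) * Cpown (lam j) m)%C = RtoC 0).
  { induction m; intros i Hi.
    - specialize (K i Hi). unfold mat_vec, vzero, dim5 in K. rewrite <- K. simpl. ring.
    - transitivity (csum 5 (fun a => csum 5 (fun j => (c j * L j a) * Cpown (lam j) m) * M a i)%C).
      + transitivity (csum 5 (fun j => (c j * Cpown (lam j) m) * csum 5 (fun a => L j a * M a i))%C).
        * apply csum_ext. intros j Hj. rewrite HL by auto. simpl. ring.
        * cbn [csum]. ring.
      + apply csum_0. intros a Ha. rewrite IHm by auto. ring. }
  apply Hc. intros j Hj. unfold vzero.
  destruct (Ceq_dec (c j) 0) as [|Hcj]; [auto|]. exfalso. apply (Hn j Hj). intros i Hi. unfold vzero.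
  assert (X : (c j * L j i)%C = RtoC 0).
  { apply (powers_independent lam Hd (fun j => c j * L j i)%C); [|auto]. intros m Hm. apply P; auto. }
  apply C_integral in X. destruct X; [contradiction|auto].
Qed.

(** * Components in an eigenbasis of rho(T) and their exponents *)

(* Row j of L is a left eigenvector of rho(T), so [ev L F j] is an eigenfunction of z -> z + 1. *)
Definition ev (L : mat) (F : vfun) (j : nat) (z : C) : C := csum 5 (fun i => L j i * F i z)%C.

(** Substitute for moderate growth at the cusp that is stable under D, sums and multiplication by
    functions holomorphic in q; moderate growth itself is awkward to carry through D. *)
Definition admissible (L : mat) (lam : nat -> R) (F : vfun) : Prop :=
  forall j, (j < 5)%nat -> exists h, hol h 1 /\
    forall z, upper z -> ev L F j z = (ee (RtoC (lam j) * z) * h (qq z))%C.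

Lemma ev_holo L F j : (forall i, (i < 5)%nat -> holo_H (F i)) -> holo_H (ev L F j).
Proof. intros H. apply (holo_csum 5 (fun i z => L j i * F i z)%C). intros. apply holo_scal; auto. Qed.

Lemma ev_Dn L F n k j z : (forall i, (i < 5)%nat -> holo_H (F i)) -> upper z ->
  Dn n k (ev L F j) z = ev L (fun i => Dn n k (F i)) j z.
Proof. intros H Hz. apply (Dn_comb n k 5 (L j) F); auto. Qed.

Lemma ev_Dk L F k j z : (forall i, (i < 5)%nat -> holo_H (F i)) -> upper z ->
  Dk k (ev L F j) z = ev L (fun i => Dk k (F i)) j z.
Proof.
  intros H Hz. unfold ev. rewrite (Dk_csum k 5 (fun i w => L j i * F i w)%C) by (intros; auto; apply holo_scal; auto).
  apply csum_ext. intros i Hi. apply Dk_scal; auto.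
Qed.

Lemma ev_recover L F z i : det5 L <> RtoC 0 -> (i < 5)%nat ->
  F i z = (/ det5 L * csum 5 (fun j => adj5 L i j * ev L F j z))%C.
Proof.
  intros HL Hi.
  pose proof (adj5_solve L (fun i => F i z) i Hi) as E.
  unfold mat_vec at 1 in E. transitivity (/ det5 L * (det5 L * F i z))%C; [field; auto|].
  rewrite <- E. reflexivity.
Qed.

Lemma Cmod_ee (x : R) z : Cmod (ee (RtoC x * z)) = exp (- (2 * PI * x * Im z)).
Proof.
  unfold ee. fold tpi. rewrite Cmod_cexp, Re_tpi_mult. f_equal.
  destruct z as [a b]. simpl. ring.
Qed.

Lemma exp_ge_pow n a y : 0 < a -> 0 < y -> (a * y / INR (S n)) ^ S n <= exp (a * y).
Proof.
  intros Ha Hy. assert (Hn : 0 < INR (S n)) by (apply lt_0_INR; lia).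
  replace (exp (a * y)) with (exp (a * y / INR (S n)) ^ S n).
  - apply pow_incr. assert (0 < a * y / INR (S n)) by (apply Rdiv_lt_0_compat; nra).
    pose proof (exp_ineq1 (a * y / INR (S n))). lra.
  - rewrite <- Rpower_pow by apply exp_pos. unfold Rpower. rewrite ln_exp. f_equal. field. lra.
Qed.

(** Rests on exp(x) >= (x/(n+1))^(n+1), one power more than the polynomial to be beaten. *)
Lemma poly_exp_small n a e : 0 < a -> 0 < e -> exists c, 0 < c /\
  forall y, c < y -> y ^ n * exp (- (a * y)) <= e.
Proof.
  intros Ha He. set (K := (INR (S n) / a) ^ S n).
  assert (Hn : 0 < INR (S n)) by (apply lt_0_INR; lia).
  assert (HK : 0 < K) by (apply pow_lt, Rdiv_lt_0_compat; auto).
  exists (K / e). split; [apply Rdiv_lt_0_compat; auto|]. intros y Hy.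
  assert (Hy0 : 0 < y) by (assert (0 < K / e) by (apply Rdiv_lt_0_compat; auto); lra).
  pose proof (exp_ge_pow n a y Ha Hy0) as B.
  rewrite exp_Ropp. pose proof (exp_pos (a * y)) as Hp.
  apply (Rmult_le_reg_r (exp (a * y))); [auto|].
  rewrite Rmult_assoc, Rinv_l, Rmult_1_r by lra.
  apply Rle_trans with (e * (a * y / INR (S n)) ^ S n); [|apply Rmult_le_compat_l; lra].
  replace (e * (a * y / INR (S n)) ^ S n) with (y ^ n * (e * y / K)).
  - rewrite <- (Rmult_1_r (y ^ n)) at 1. apply Rmult_le_compat_l; [apply pow_le; lra|].
    apply (Rmult_le_reg_r K); [auto|]. replace (e * y / K * K) with (e * y) by (field; lra).
    apply (Rmult_lt_compat_r e) in Hy; [|auto]. replace (K / e * e) with K in Hy by (field; lra). lra.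
  - unfold K, Rdiv. clear - Ha Hn. set (d := INR (S n)) in *. clearbody d.
    rewrite !Rpow_mult_distr, !pow_inv. cbn [pow]. field.
    repeat split; try (apply pow_nonzero); lra.
Qed.

Lemma transforms_T k rho v F : unitv v -> transforms k rho v F -> forall z i, upper z -> (i < 5)%nat ->
  F i (z + 1)%C = (v Tmat * csum 5 (fun j => rho Tmat i j * F j z))%C.
Proof.
  intros Hv H z i Hz Hi. rewrite transforms_slash in H by auto. rewrite <- H by auto.
  unfold slash. rewrite mobius_T, jfac_T.
  replace (Cpow 1 (RtoC (- k))) with (RtoC 1); [ring|].
  rewrite Cpow_neq0 by (apply RtoC_neq_0; lra).
  replace (Clog 1) with (RtoC 0).
  - replace (RtoC (- k) * 0)%C with (RtoC 0) by ring. rewrite cexp_0. reflexivity.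
  - unfold Clog. rewrite Cmod_1, ln_1. unfold Carg, RtoC. simpl. destruct Rlt_dec; [|lra].
    replace (0 / 1) with 0 by field. rewrite atan_0. reflexivity.
Qed.

Lemma moderate_bound F L j : (forall i, (i < 5)%nat -> moderate_growth (F i)) ->
  exists (N : nat) K c, 0 <= K /\ forall x y, c < y -> 1 < y -> Cmod (ev L F j (x, y)) <= K * y ^ N.
Proof.
  intros H.
  assert (X : forall n, (n <= 5)%nat -> exists (N : nat) K c, 0 <= K /\
    forall x y, c < y -> 1 < y -> Cmod (csum n (fun i => L j i * F i (x, y))%C) <= K * y ^ N).
  { induction n; intros Hn.
    - exists 0%nat, 0, 0. split; [lra|]. intros. simpl. rewrite Cmod_0. lra.
    - destruct IHn as (N & K & c & HK & B); [lia|]. destruct (H n) as (N' & c' & B'); [lia|].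
      exists (N + N')%nat, (K + Cmod (L j n)), (Rmax c c'). pose proof (Cmod_ge_0 (L j n)) as HL.
      split; [lra|]. intros x y Hy Hy1. cbn [csum].
      eapply Rle_trans; [apply Cmod_triangle|]. rewrite Cmod_mult.
      specialize (B x y (Rle_lt_trans _ _ _ (Rmax_l _ _) Hy) Hy1).
      specialize (B' x y (Rle_lt_trans _ _ _ (Rmax_r _ _) Hy) ltac:(lra)).
      rewrite pow_add.
      assert (1 <= y ^ N) by (apply pow_R1_Rle; lra). assert (1 <= y ^ N') by (apply pow_R1_Rle; lra).
      rewrite Rmult_plus_distr_r. apply Rplus_le_compat.
      + eapply Rle_trans; [exact B|]. apply Rmult_le_compat_l; [auto|]. nra.
      + apply Rmult_le_compat_l; [auto|]. eapply Rle_trans; [exact B'|]. nra. }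
  apply X. lia.
Qed.

Section Basis.
Variables (rho : SL2Z -> mat) (v : SL2Z -> C) (m : R) (r lam : nat -> R) (L : mat).
Hypotheses (Hv : unitv v) (HvT : v Tmat = ee (RtoC (m / 12)))
  (HL : forall j i, (j < 5)%nat -> (i < 5)%nat ->
     csum 5 (fun a => L j a * rho Tmat a i)%C = (ee (RtoC (r j)) * L j i)%C)
  (Hdet : det5 L <> RtoC 0)
  (Hlam : forall j, 0 <= lam j < 1)
  (Heq : forall j, ee (RtoC (lam j)) = (ee (RtoC (m / 12)) * ee (RtoC (r j)))%C).

Lemma ev_T k F j z : transforms k rho v F -> upper z -> (j < 5)%nat ->
  ev L F j (z + 1)%C = (ee (RtoC (lam j)) * ev L F j z)%C.
Proof.
  intros HT Hz Hj. unfold ev.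
  transitivity (csum 5 (fun i => L j i * (v Tmat * csum 5 (fun a => rho Tmat i a * F a z)))%C).
  - apply csum_ext. intros i Hi. rewrite (transforms_T k rho v F) by auto. reflexivity.
  - transitivity (v Tmat * csum 5 (fun i => csum 5 (fun a => L j a * rho Tmat a i) * F i z))%C.
    + cbn [csum]. ring.
    + rewrite (csum_ext 5 (fun i => csum 5 (fun a => L j a * rho Tmat a i) * F i z)%C
        (fun i => ee (RtoC (r j)) * (L j i * F i z))%C).
      * rewrite csum_scal, Heq, HvT. ring.
      * intros i Hi. rewrite HL by auto. ring.
Qed.

(** The component times e(-lam z) has period 1 and is O(y^N |q|^(-lam)). Since lam < 1, its product
    with q tends to 0, which is the criterion of [q_expansion]. *)
Lemma Hk_admissible k F : Hk k rho v F -> admissible L lam F.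
Proof.
  intros [HF HT] j Hj.
  set (f := fun z => (ee (RtoC (- lam j) * z) * ev L F j z)%C).
  assert (Hee : forall z, (ee (RtoC (lam j) * z) * ee (RtoC (- lam j) * z))%C = RtoC 1).
  { intros z. rewrite <- ee_plus, RtoC_opp. replace (RtoC (lam j) * z + - RtoC (lam j) * z)%C with (RtoC 0) by ring.
    apply ee_0. }
  assert (Hf : holo_H f).
  { apply holo_mult; [|apply ev_holo; intros; apply HF; auto]. intros z _. eexists. apply cd_ee. }
  destruct (q_expansion f Hf) as [h [Hh E]].
  - intros z Hz. unfold f. rewrite (ev_T k) by auto.
    replace (RtoC (- lam j) * (z + 1))%C with (RtoC (- lam j) * z + - RtoC (lam j))%C by (rewrite RtoC_opp; ring).
    rewrite ee_plus, ee_opp. field. apply ee_neq0.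
  - intros e He. destruct (moderate_bound F L j) as (N & K & c & HK & B); [intros; apply HF; auto|].
    specialize (Hlam j).
    destruct (poly_exp_small N (2 * PI * (1 - lam j)) (e / (K + 1))) as [c' [Hc' B']].
    + pose proof PI_RGT_0. nra.
    + apply Rdiv_lt_0_compat; lra.
    + exists (Rmax 1 (Rmax c c')). intros z Hz Hcz.
      assert (Z1 : 1 < Im z) by (eapply Rle_lt_trans; [apply Rmax_l|exact Hcz]).
      assert (Z2 : Rmax c c' < Im z) by (eapply Rle_lt_trans; [apply Rmax_r|exact Hcz]).
      assert (Z3 : c < Im z) by (eapply Rle_lt_trans; [apply Rmax_l|exact Z2]).
      assert (Z4 : c' < Im z) by (eapply Rle_lt_trans; [apply Rmax_r|exact Z2]).
      unfold f. rewrite Cmod_mult, Cmod_ee, Cmod_qq.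
      specialize (B (Re z) (Im z) Z3 Z1). rewrite <- C_eta in B. specialize (B' (Im z) Z4).
      rewrite Rmult_assoc, (Rmult_comm (Cmod _)), <- Rmult_assoc, <- exp_plus.
      replace (- (2 * PI * - lam j * Im z) + - (2 * PI * Im z)) with (- (2 * PI * (1 - lam j) * Im z)) by ring.
      set (E := exp (- (2 * PI * (1 - lam j) * Im z))) in *. assert (HE : 0 < E) by apply exp_pos.
      apply Rle_trans with (E * (K * Im z ^ N)); [apply Rmult_le_compat_l; lra|].
      apply Rle_trans with (K * (e / (K + 1))).
      * replace (E * (K * Im z ^ N)) with (K * (Im z ^ N * E)) by ring. apply Rmult_le_compat_l; auto.
      * apply (Rmult_le_reg_r (K + 1)); [lra|]. replace (K * (e / (K + 1)) * (K + 1)) with (K * e) by (field; lra). nra.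
  - exists h. split; [auto|]. intros z Hz. rewrite <- E by auto. unfold f.
    rewrite Cmult_assoc, Hee. ring.
Qed.

Lemma admissible_growth F : admissible L lam F -> forall i, (i < 5)%nat -> moderate_growth (F i).
Proof.
  intros HA i Hi.
  assert (B : forall j, (j < 5)%nat -> exists M, 0 <= M /\ forall z, 1 < Im z -> Cmod (ev L F j z) <= M).
  { intros j Hj. destruct (HA j Hj) as [h [Hh E]]. specialize (Hlam j).
    destruct (disc_bounded h 1 (exp (- (2 * PI))) (hol_cont _ _ Hh)) as [M [HM K]].
    - rewrite <- exp_0. apply exp_increasing. pose proof PI_RGT_0. lra.
    - exists M. split; [lra|]. intros z Hz. assert (Hz' : upper z) by (unfold upper; lra).
      rewrite E by auto. rewrite Cmod_mult, Cmod_ee.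
      assert (Hq : Cmod (h (qq z)) <= M).
      { apply K. rewrite Cmod_qq. apply exp_le_mono. pose proof PI_RGT_0. nra. }
      assert (He : exp (- (2 * PI * lam j * Im z)) <= 1).
      { rewrite <- exp_0. apply exp_le_mono. pose proof PI_RGT_0.
        assert (0 <= PI * lam j) by nra. nra. }
      pose proof (exp_pos (- (2 * PI * lam j * Im z))). pose proof (Cmod_ge_0 (h (qq z))). nra. }
  assert (BS : forall n, (n <= 5)%nat -> exists M, 0 <= M /\ forall z, 1 < Im z ->
     Cmod (csum n (fun j => adj5 L i j * ev L F j z)%C) <= M).
  { induction n; intros Hn.
    - exists 0. split; [lra|]. intros. simpl. rewrite Cmod_0. lra.
    - destruct IHn as [M [HM K]]; [lia|]. destruct (B n) as [M' [HM' K']]; [lia|].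
      pose proof (Cmod_ge_0 (adj5 L i n)).
      exists (M + Cmod (adj5 L i n) * M'). split; [nra|]. intros z Hz. cbn [csum].
      eapply Rle_trans; [apply Cmod_triangle|]. apply Rplus_le_compat; [auto|].
      rewrite Cmod_mult. apply Rmult_le_compat_l; auto. }
  destruct (BS 5%nat (le_n 5)) as [M [HM K]].
  pose proof (Cmod_ge_0 (/ det5 L)) as Hd.
  (* For y > 1 the function is bounded, because every lam is nonnegative. Moderate growth allows no
     constant factor, so the bound is absorbed by y^1 once y exceeds it. *)
  exists 1%nat, (Rmax 1 (Cmod (/ det5 L) * M)). intros x y Hy Hy0.
  assert (Y1 : 1 < y) by (eapply Rle_lt_trans; [apply Rmax_l|exact Hy]).
  assert (Y2 : Cmod (/ det5 L) * M < y) by (eapply Rle_lt_trans; [apply Rmax_r|exact Hy]).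
  rewrite (ev_recover L F (x, y) i Hdet Hi), Cmod_mult. specialize (K (x, y) Y1).
  rewrite pow_1. eapply Rle_trans; [apply Rmult_le_compat_l; [auto|exact K]|]. lra.
Qed.
End Basis.

(* D_k acting on e(lam z) h(q), expressed on h. *)
Definition dq (k : R) (lam : R) (h : C -> C) (q : C) : C :=
  ((RtoC lam + RtoC k * pq q) * h q + q * cderiv h q)%C.

Fixpoint dqn (n : nat) (k lam : R) (h : C -> C) : C -> C :=
  match n with O => h | S n' => dq (k + 2 * INR n') lam (dqn n' k lam h) end.

Lemma dq_hol k lam h : hol h 1 -> hol (dq k lam h) 1.
Proof.
  intros H. apply hol_plus; apply hol_mult; auto; [|apply hol_id|apply hol_deriv; auto].
  apply hol_plus; [apply hol_const|]. apply hol_scal, pq_hol.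
Qed.

Lemma dqn_hol n k lam h : hol h 1 -> hol (dqn n k lam h) 1.
Proof. intros H. induction n; [auto|]. apply dq_hol. auto. Qed.

Lemma eeq_holo (lam : R) h : hol h 1 -> holo_H (fun z => ee (RtoC lam * z) * h (qq z))%C.
Proof.
  intros H. apply holo_mult; [|apply hol_qq_holo; auto]. intros z _. eexists. apply cd_ee.
Qed.

Lemma Dk_eeq k (lam : R) h z : hol h 1 -> upper z ->
  Dk k (fun z => ee (RtoC lam * z) * h (qq z))%C z = (ee (RtoC lam * z) * dq k lam h (qq z))%C.
Proof.
  intros H Hz. unfold Dk. rewrite PfunE by auto. fold tpi.
  rewrite (cderiv_eq _ _ _ (cd_mult (fun z => ee (RtoC lam * z)) (fun z => h (qq z)) z _ _ (cd_ee (RtoC lam) z) (cd_comp_qq h z H Hz))).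
  unfold dq. pose proof tpi_neq0. field. auto.
Qed.

Lemma Dn_eeq n k (lam : R) h z : hol h 1 -> upper z ->
  Dn n k (fun z => ee (RtoC lam * z) * h (qq z))%C z = (ee (RtoC lam * z) * dqn n k lam h (qq z))%C.
Proof.
  intros H Hz. revert z Hz. induction n; intros z Hz; [reflexivity|].
  change (Dk (k + 2 * INR n) (Dn n k (fun z => ee (RtoC lam * z) * h (qq z))%C) z = (ee (RtoC lam * z) * dq (k + 2 * INR n) lam (dqn n k lam h) (qq z))%C).
  rewrite (Dk_ext _ _ (fun z => ee (RtoC lam * z) * dqn n k lam h (qq z))%C); [|auto|auto|apply Dn_holo, eeq_holo; auto].
  apply Dk_eeq; [apply dqn_hol; auto|auto].
Qed.

(** P equals -1/12 at q = 0, so D_{k+2l} multiplies the leading coefficient of q^x by x - (k +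
    2l)/12. *)
Definition newton_node (k : R) (l : nat) : C := RtoC ((k + 2 * INR l) / 12).

Lemma dqn_0 n k lam h : dqn n k lam h 0%C = (newton (newton_node k) n (RtoC lam) * h 0%C)%C.
Proof.
  induction n; [simpl; ring|]. cbn [dqn newton]. unfold dq. rewrite IHn, pq_0. unfold newton_node.
  rewrite RtoC_div by lra. field.
Qed.

Lemma admissible_D L lam F k : (forall i, (i < 5)%nat -> holo_H (F i)) -> admissible L lam F ->
  admissible L lam (fun i => Dk k (F i)).
Proof.
  intros HF HA j Hj. destruct (HA j Hj) as [h [Hh E]].
  exists (dq k (lam j) h). split; [apply dq_hol; auto|]. intros z Hz.
  rewrite <- ev_Dk by auto. rewrite (Dk_ext _ _ _ z E Hz (ev_holo L F j HF)). apply Dk_eeq; auto.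
Qed.

Definition q_holo (f : C -> C) : Prop := exists h, hol h 1 /\ forall z, upper z -> f z = h (qq z).

Lemma monos_q_holo l : q_holo (monos l).
Proof.
  exists (fun q => fold_right Cplus 0%C (map (fun t => let '(c, a, b) := t in
     (c * Cpown (eisq 4 q) a * Cpown (eisq 6 q) b)%C) l)).
  split; [|reflexivity].
  induction l as [|[[c a] b] l IH]; simpl; [apply hol_const|].
  apply (hol_plus (fun q => c * Cpown (eisq 4 q) a * Cpown (eisq 6 q) b)%C); [|exact IH].
  apply hol_mult; [apply hol_scal|]; apply hol_pown, eisq_hol.
Qed.

Lemma inMw_q_holo w f : inMw w f -> q_holo f.
Proof.
  intros [l [_ H]]. destruct (monos_q_holo l) as [h [Hh E]]. exists h. split; [auto|].
  intros z Hz. rewrite H by auto. apply E; auto.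
Qed.

Lemma disc_0 : disc 1 0%C.
Proof. unfold disc. rewrite Cmod_0. lra. Qed.

(** [qq] never takes the value 0, so identities on the half-plane reach the cusp only by
    continuity. *)
Lemma hol_zero_at_0 f : hol f 1 -> (forall z, upper z -> f (qq z) = RtoC 0) -> f 0%C = RtoC 0.
Proof.
  intros Hf H. destruct (Ceq_dec (f 0%C) 0) as [|Hn]; [auto|]. exfalso.
  assert (Hp : 0 < Cmod (f 0%C)) by (apply (proj1 (Cmod_gt_0 _)); auto).
  destruct (hol_cont f 1 Hf 0%C disc_0 _ Hp) as [d [Hd K]].
  set (x := Rmin d 1 / 2). assert (Hx : 0 < Rmin d 1) by (apply Rmin_pos; lra).
  pose proof (Rmin_l d 1). pose proof (Rmin_r d 1).
  assert (Hx0 : RtoC x <> RtoC 0) by (apply RtoC_neq_0; unfold x; lra).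
  assert (Hxd : disc 1 (RtoC x)) by (unfold disc; rewrite Cmod_RtoC_pos; unfold x; lra).
  specialize (K (RtoC x)). specialize (H (zq (RtoC x)) (zq_upper _ Hx0 Hxd)). rewrite qq_zq in H by auto.
  rewrite H in K. replace (0 - f 0)%C with (- f 0)%C in K by ring. rewrite Cmod_opp in K.
  replace (RtoC x - 0)%C with (RtoC x) in K by ring. rewrite Cmod_RtoC_pos in K by (unfold x; lra).
  assert (Cmod (f 0%C) < Cmod (f 0%C)) by (apply K; unfold x; lra). lra.
Qed.

Lemma hol_qq_ext_0 f g : hol f 1 -> hol g 1 -> (forall z, upper z -> f (qq z) = g (qq z)) -> f 0%C = g 0%C.
Proof.
  intros Hf Hg H. transitivity ((f 0 - g 0) + g 0)%C; [ring|].
  rewrite (hol_zero_at_0 (fun q => f q - g q)%C); [ring|apply hol_minus; auto|].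
  intros z Hz. rewrite H by auto. ring.
Qed.

Lemma qq_imag_small d : 0 < d -> exists Y, forall y, Y < y -> Cmod (qq (0, y)) < d.
Proof.
  intros Hd. exists (- (ln d / (2 * PI))). intros y Hy. rewrite Cmod_qq. simpl.
  rewrite <- (exp_ln d Hd) at 1. apply exp_increasing. pose proof PI_RGT_0.
  apply (Rmult_lt_compat_l (2 * PI)) in Hy; [|lra].
  replace (2 * PI * - (ln d / (2 * PI))) with (- ln d) in Hy by (field; lra). lra.
Qed.

(** [indicial_value] takes its limit along the imaginary axis; for a function holomorphic in q this
    already fixes the value at q = 0. *)
Lemma limit_at_infinity S f p : hol S 1 ->
  (forall y, 0 < y -> f y = S (qq (0, y))) ->
  filterlim f (Rbar_locally p_infty) (locally (T := C_UniformSpace) p) -> S 0%C = p.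
Proof.
  intros HS Hf HL.
  assert (E : Cmod (S 0%C - p) <= 0).
  { apply le_eps. intros e He. rewrite Rplus_0_l.
    destruct (HL (fun w => Cmod (w - p) < e / 2)) as [Y1 K1].
    { apply (locally_C p). exists (e / 2). split; [lra|auto]. }
    destruct (hol_cont S 1 HS 0%C disc_0 (e / 2)) as [d [Hd K2]]; [lra|].
    destruct (qq_imag_small d Hd) as [Y2 K3].
    set (y := Rmax 0 (Rmax Y1 Y2) + 1).
    assert (A0 : 0 <= Rmax 0 (Rmax Y1 Y2)) by apply Rmax_l.
    assert (A : Rmax Y1 Y2 <= Rmax 0 (Rmax Y1 Y2)) by apply Rmax_r.
    pose proof (Rmax_l Y1 Y2). pose proof (Rmax_r Y1 Y2).
    specialize (K1 y ltac:(unfold y; lra)). specialize (K3 y ltac:(unfold y; lra)).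
    rewrite Hf in K1 by (unfold y; lra).
    specialize (K2 (qq (0, y))). replace (qq (0, y) - 0)%C with (qq (0, y)) in K2 by ring.
    specialize (K2 K3). pose proof (Cmod_sub_triangle (S 0%C) (S (qq (0, y))) p) as T.
    rewrite (Cmod_sub_sym (S 0%C) (S _)) in T. lra. }
  pose proof (Cmod_ge_0 (S 0%C - p)).
  transitivity ((S 0 - p) + p)%C; [ring|]. rewrite (Cmod_eq_0 (S 0%C - p)) by lra. ring.
Qed.

Lemma ee_pown n z : ee (RtoC (INR n) * z)%C = Cpown (qq z) n.
Proof.
  induction n; [simpl; replace (0 * z)%C with (RtoC 0) by ring; apply ee_0|].
  rewrite S_INR, RtoC_plus. replace ((RtoC (INR n) + 1) * z)%C with (RtoC (INR n) * z + z)%C by ring.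
  rewrite ee_plus, IHn. simpl. unfold qq. ring.
Qed.

(** * The indicial polynomial and leading exponents *)

Section Leading.
Variables (k : R) (M4 M6 M8 M10 : C -> C) (m4 m6 m8 m10 : C -> C).
Hypotheses (h4 : hol m4 1) (h6 : hol m6 1) (h8 : hol m8 1) (h10 : hol m10 1)
  (E4 : forall z, upper z -> M4 z = m4 (qq z)) (E6 : forall z, upper z -> M6 z = m6 (qq z))
  (E8 : forall z, upper z -> M8 z = m8 (qq z)) (E10 : forall z, upper z -> M10 z = m10 (qq z)).

(** The MLDE applied to e(lam z) h(q), with e(lam z) divided out; at q = 0 it becomes the indicial
    polynomial at lam times h(0). *)
Definition indq (lam : R) (h : C -> C) (q : C) : C :=
  (dqn 5 k lam h q + m4 q * dqn 3 k lam h q + m6 q * dqn 2 k lam h q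
   + m8 q * dqn 1 k lam h q + m10 q * dqn 0 k lam h q)%C.

Lemma indq_hol lam h : hol h 1 -> hol (indq lam h) 1.
Proof.
  intros H. assert (D : forall n, hol (dqn n k lam h) 1) by (intros; apply dqn_hol; auto).
  exact (hol_plus _ _ 1 (hol_plus _ _ 1 (hol_plus _ _ 1 (hol_plus _ _ 1 (D 5%nat)
    (hol_mult _ _ 1 h4 (D 3%nat))) (hol_mult _ _ 1 h6 (D 2%nat))) (hol_mult _ _ 1 h8 (D 1%nat)))
    (hol_mult _ _ 1 h10 (D 0%nat))).
Qed.

Lemma mlde5_eeq (lam : R) h f z : hol h 1 ->
  (forall z, upper z -> f z = (ee (RtoC lam * z) * h (qq z))%C) -> upper z ->
  mlde5 k M4 M6 M8 M10 f z = (ee (RtoC lam * z) * indq lam h (qq z))%C.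
Proof.
  intros Hh Hf Hz.
  assert (Hff : holo_H f).
  { apply (holo_ext (fun z => ee (RtoC lam * z) * h (qq z))%C); [intros; symmetry; auto|apply eeq_holo; auto]. }
  assert (D : forall n, Dn n k f z = (ee (RtoC lam * z) * dqn n k lam h (qq z))%C).
  { intros n. rewrite (Dn_ext n k f _ z Hf Hz Hff). apply Dn_eeq; auto. }
  unfold mlde5, indq. rewrite !D, E4, E6, E8, E10 by auto.
  change (f z) with (Dn 0 k f z). rewrite D. ring.
Qed.

Lemma indq_scale lam h : indq lam h 0%C = (indq lam (fun _ => RtoC 1) 0 * h 0)%C.
Proof. unfold indq. rewrite !dqn_0. ring. Qed.

Variable rts : nat -> R.
Hypothesis Hroots : has_indicial_roots k M4 M6 M8 M10 rts.

Lemma indicial_value_eq (lam : R) : indq lam (fun _ => RtoC 1) 0%C =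
  ((RtoC lam - RtoC (rts 0%nat)) * (RtoC lam - RtoC (rts 1%nat)) * (RtoC lam - RtoC (rts 2%nat))
     * (RtoC lam - RtoC (rts 3%nat)) * (RtoC lam - RtoC (rts 4%nat)))%C.
Proof.
  apply (limit_at_infinity _ _ _ (indq_hol lam _ (hol_const 1%C 1))) with (2 := Hroots (RtoC lam)).
  intros y Hy. assert (Hz : upper (0, y)) by exact Hy.
  rewrite (mlde5_eeq lam (fun _ => RtoC 1)); [|apply hol_const|intros; ring|auto].
  field. apply ee_neq0.
Qed.

Lemma leading_exponent (lam : R) g f : hol g 1 -> g 0%C <> RtoC 0 ->
  (forall z, upper z -> f z = (ee (RtoC lam * z) * g (qq z))%C) ->
  (forall z, upper z -> mlde5 k M4 M6 M8 M10 f z = RtoC 0) ->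
  exists j, (j < 5)%nat /\ lam = rts j.
Proof.
  intros Hg Hg0 Hf Hm.
  assert (I0 : indq lam g 0%C = RtoC 0).
  { apply hol_zero_at_0; [apply indq_hol; auto|]. intros z Hz. specialize (Hm z Hz).
    rewrite (mlde5_eeq lam g) in Hm by auto. apply C_integral in Hm.
    destruct Hm as [Hm|Hm]; [|auto]. exfalso. revert Hm. apply ee_neq0. }
  rewrite indq_scale, indicial_value_eq in I0.
  apply C_integral in I0. destruct I0 as [I0|I0]; [|contradiction].
  assert (X : forall j, (RtoC lam - RtoC (rts j))%C = RtoC 0 -> lam = rts j).
  { intros j E. apply (f_equal fst) in E. simpl in E. lra. }
  apply C_integral in I0. destruct I0 as [I0|I0]; [|exists 4%nat; split; [lia|auto]].
  apply C_integral in I0. destruct I0 as [I0|I0]; [|exists 3%nat; split; [lia|auto]].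
  apply C_integral in I0. destruct I0 as [I0|I0]; [|exists 2%nat; split; [lia|auto]].
  apply C_integral in I0. destruct I0 as [I0|I0]; [exists 0%nat; split; [lia|auto]|exists 1%nat; split; [lia|auto]].
Qed.
End Leading.

Lemma leading_form (lam : R) h f z0 : hol h 1 ->
  (forall z, upper z -> f z = (ee (RtoC lam * z) * h (qq z))%C) -> upper z0 -> f z0 <> RtoC 0 ->
  exists (n : nat) g, hol g 1 /\ g 0%C <> RtoC 0 /\
    forall z, upper z -> f z = (ee (RtoC (lam + INR n) * z) * g (qq z))%C.
Proof.
  intros Hh Hf Hz0 H0.
  destruct (hol_leading h 1 (qq z0) Rlt_0_1 Hh (qq_disc z0 Hz0)) as (n & g & Hg & Hg0 & E).
  { intros X. apply H0. rewrite Hf, X by auto. ring. }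
  exists n, g. split; [auto|]. split; [auto|]. intros z Hz. rewrite Hf, E by (auto; apply qq_disc; auto).
  rewrite RtoC_plus. replace ((RtoC lam + RtoC (INR n)) * z)%C with (RtoC lam * z + RtoC (INR n) * z)%C by ring.
  rewrite ee_plus, ee_pown. ring.
Qed.

(** Taking fractional parts changes r_i - r_j by an integer only, and 0 is the only integer that
    such a difference can be, as it lies strictly between -1 and 1. *)
Lemma frac_distinct (r : nat -> R) (m : R) :
  0 <= r 0%nat -> (forall j, (j < 4)%nat -> r j < r (S j)) -> r 4%nat < 1 ->
  forall i j (n : Z), (i < 5)%nat -> (j < 5)%nat ->
    frac_part (r i + m / 12) - frac_part (r j + m / 12) = IZR n -> i = j.
Proof.
  intros H0 Hinc H4 i j n Hi Hj E. unfold frac_part in E.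
  set (a := Int_part (r i + m / 12)) in *. set (b := Int_part (r j + m / 12)) in *.
  assert (E' : r i - r j = IZR (n + a - b)) by (rewrite minus_IZR, plus_IZR; lra).
  pose proof (Hinc 0%nat ltac:(lia)). pose proof (Hinc 1%nat ltac:(lia)).
  pose proof (Hinc 2%nat ltac:(lia)). pose proof (Hinc 3%nat ltac:(lia)).
  assert (Hb : -1 < r i - r j < 1).
  { do 5 (destruct i as [|i]; [do 5 (destruct j as [|j]; [lra|]); lia|]). lia. }
  rewrite E' in Hb. destruct Hb as [Hb1 Hb2]. apply lt_IZR in Hb1, Hb2.
  replace (n + a - b)%Z with 0%Z in E' by lia.
  do 5 (destruct i as [|i]; [do 5 (destruct j as [|j]; [try reflexivity; exfalso; lra|]); lia|]). lia.
Qed.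

Lemma ee_IZR n : ee (RtoC (IZR n)) = RtoC 1.
Proof.
  replace (RtoC (IZR n)) with (0 + RtoC (IZR n))%C by ring. rewrite <- ee_0.
  apply (f_equal (fun x => x)).
  assert (P : forall k : nat, ee (RtoC (INR k)) = RtoC 1).
  { induction k; [apply ee_0|]. rewrite S_INR, RtoC_plus, ee_plus, IHk, ee_1. ring. }
  rewrite ee_plus, ee_0, Cmult_1_l.
  destruct (Z_le_dec 0 n).
  - rewrite <- (Z2Nat.id n), <- INR_IZR_INZ by auto. apply P.
  - replace n with (- (- n))%Z by lia. rewrite opp_IZR, RtoC_opp, ee_opp.
    rewrite <- (Z2Nat.id (- n)), <- INR_IZR_INZ by lia. rewrite P. field.
Qed.

Lemma ee_frac x : ee (RtoC (frac_part x)) = ee (RtoC x).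
Proof.
  unfold frac_part, Rminus. rewrite RtoC_plus, ee_plus, <- opp_IZR, ee_IZR. ring.
Qed.

Lemma multiplier_unit k v : multiplier_system k v -> unitv v.
Proof. intros [H _] g E. specialize (H g). rewrite E, Cmod_0 in H. lra. Qed.

Definition increasing01 (r : nat -> R) :=
  0 <= r 0%nat /\ (forall j, (j < 4)%nat -> r j < r (S j)) /\ r 4%nat < 1.

Lemma ee_int_diff (a b : R) : ee (RtoC a) = ee (RtoC b) -> exists n : Z, a - b = IZR n.
Proof.
  intros E. destruct (ee_eq_1 (RtoC (a - b))) as [n Hn].
  - rewrite RtoC_minus. replace (RtoC a - RtoC b)%C with (RtoC a + - RtoC b)%C by ring.
    rewrite ee_plus, ee_opp, E. field. apply ee_neq0.
  - exists n. exact (f_equal fst Hn).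
Qed.

Lemma left_eigenbasis rho (r : nat -> R) : increasing01 r ->
  (forall l : C, eigenvalue (rho Tmat) l <-> exists j, (j < 5)%nat /\ l = ee (RtoC (r j))) ->
  exists L : mat, det5 L <> RtoC 0 /\ (forall j, (j < 5)%nat -> ~ veq (L j) vzero) /\
    forall j i, (j < 5)%nat -> (i < 5)%nat ->
      csum 5 (fun a => L j a * rho Tmat a i)%C = (ee (RtoC (r j)) * L j i)%C.
Proof.
  intros [H0 [Hinc H4]] Heig.
  assert (X : forall j, exists l : vec, (j < 5)%nat -> ~ veq l vzero /\ forall i, (i < 5)%nat ->
     csum 5 (fun a => l a * rho Tmat a i)%C = (ee (RtoC (r j)) * l i)%C).
  { intros j. destruct (classic (j < 5)%nat) as [Hj|Hj]; [|exists vzero; intros; contradiction].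
    destruct (left_eigenvector (rho Tmat) (ee (RtoC (r j)))) as [l Hl].
    - apply Heig. exists j. auto.
    - exists l. auto. }
  set (L := fun j => proj1_sig (constructive_indefinite_description _ (X j))).
  assert (HL : forall j, (j < 5)%nat -> ~ veq (L j) vzero /\ forall i, (i < 5)%nat ->
     csum 5 (fun a => L j a * rho Tmat a i)%C = (ee (RtoC (r j)) * L j i)%C).
  { intros j. unfold L. destruct constructive_indefinite_description as [l Hl]. exact Hl. }
  exists L. split; [|split; [intros; apply HL; auto|intros; apply HL; auto]].
  apply (left_eigenbasis_det (rho Tmat) (fun j => ee (RtoC (r j))) L).
  - intros i j Hi Hj E. destruct (ee_int_diff _ _ E) as [n Hn].
    apply (frac_distinct r 0 H0 Hinc H4 i j (n - Int_part (r i + 0 / 12) + Int_part (r j + 0 / 12)) Hi Hj).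
    rewrite plus_IZR, minus_IZR, <- Hn. unfold frac_part. lra.
  - intros; apply HL; auto.
  - intros; apply HL; auto.
Qed.

Section LeadingExponents.
Variables (rho : SL2Z -> mat) (v : SL2Z -> C) (m k1 : R) (r lamt : nat -> R) (L : mat) (F1 : vfun)
  (M4 M6 M8 M10 : C -> C).
Hypotheses (Hr : increasing01 r) (Hv : unitv v) (HvT : v Tmat = ee (RtoC (m / 12)))
  (HLe : forall j i, (j < 5)%nat -> (i < 5)%nat ->
     csum 5 (fun a => L j a * rho Tmat a i)%C = (ee (RtoC (r j)) * L j i)%C)
  (HLn : forall j, (j < 5)%nat -> ~ veq (L j) vzero)
  (Hlt : forall j, lamt j = frac_part (r j + m / 12))
  (HF1 : Hk k1 rho v F1)
  (Q4 : q_holo M4) (Q6 : q_holo M6) (Q8 : q_holo M8) (Q10 : q_holo M10)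
  (Hroots : has_indicial_roots k1 M4 M6 M8 M10
        (fun j => match j with O => lamt 0%nat + 1 | _ => lamt j end))
  (Hode : forall i z, (i < 5)%nat -> upper z -> mlde5 k1 M4 M6 M8 M10 (F1 i) z = RtoC 0)
  (Hind : forall c : nat -> C, (forall z, upper z -> csum 5 (fun i => (c i * F1 i z)%C) = RtoC 0) ->
     forall i, (i < 5)%nat -> c i = RtoC 0).

Lemma lamt_range j : 0 <= lamt j < 1.
Proof. rewrite Hlt. destruct (base_fp (r j + m / 12)). lra. Qed.

Lemma lamt_ee j : ee (RtoC (lamt j)) = (ee (RtoC (m / 12)) * ee (RtoC (r j)))%C.
Proof. rewrite Hlt, ee_frac, RtoC_plus, ee_plus. ring. Qed.

Lemma lamt_distinct i j n : (i < 5)%nat -> (j < 5)%nat -> lamt i - lamt j = IZR n -> i = j.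
Proof. destruct Hr as [H0 [Hinc H4]]. intros Hi Hj. rewrite !Hlt. apply frac_distinct; auto. Qed.

Definition lead (j : nat) : R := match j with O => lamt 0%nat + 1 | _ => lamt j end.

(** The component is not zero, since L_j is nonzero and the components of F1 are independent. Its
    leading exponent lies in lamt_j + Z and is an indicial root; the roots are pairwise incongruent
    mod Z, so it is the root of index j. *)
Lemma F1_leading j : (j < 5)%nat -> exists g, hol g 1 /\ g 0%C <> RtoC 0 /\
  forall z, upper z -> ev L F1 j z = (ee (RtoC (lead j) * z) * g (qq z))%C.
Proof.
  intros Hj.
  assert (HFh : forall i, (i < 5)%nat -> holo_H (F1 i)) by (intros; apply HF1; auto).
  assert (HA := Hk_admissible rho v m r lamt L Hv HvT HLe lamt_range lamt_ee k1 F1 HF1 j Hj).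
  destruct HA as [h [Hh E]].
  assert (Hz0 : exists z0, upper z0 /\ ev L F1 j z0 <> RtoC 0).
  { apply NNPP. intros Hno. apply (HLn j Hj). intros i Hi. unfold vzero. revert i Hi.
    apply Hind. intros z Hz. apply NNPP. intros Hn. apply Hno. exists z. auto. }
  destruct Hz0 as [z0 [Hz0 Hnz]].
  destruct (leading_form (lamt j) h (ev L F1 j) z0 Hh E Hz0 Hnz) as (n & g & Hg & Hg0 & E').
  exists g. split; [auto|]. split; [auto|].
  destruct Q4 as [m4 [h4 e4]]. destruct Q6 as [m6 [h6 e6]]. destruct Q8 as [m8 [h8 e8]]. destruct Q10 as [m10 [h10 e10]].
  destruct (leading_exponent k1 M4 M6 M8 M10 m4 m6 m8 m10 h4 h6 h8 h10 e4 e6 e8 e10 _ Hroots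
     (lamt j + INR n) g (ev L F1 j) Hg Hg0 E') as [j' [Hj' El]].
  - intros z Hz.
    transitivity (csum 5 (fun i => L j i * mlde5 k1 M4 M6 M8 M10 (F1 i) z)%C).
    + unfold mlde5. rewrite !ev_Dn by auto. unfold ev. cbn [csum]. ring.
    + apply csum_0. intros i Hi. rewrite Hode by auto. ring.
  - assert (Ej : j = j').
    { destruct j' as [|j'].
      - apply (lamt_distinct j 0 (1 - Z.of_nat n)); auto. rewrite minus_IZR, <- INR_IZR_INZ. lra.
      - apply (lamt_distinct j (S j') (- Z.of_nat n)); auto. rewrite opp_IZR, <- INR_IZR_INZ. lra. }
    subst j'. unfold lead. cbv beta in El. rewrite <- El. exact E'.
Qed.

Variables (G : vfun) (c : nat -> C).
Hypotheses (HG : Hk k1 rho v G) (HGnz : ~ vfeqH G vfzero)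
  (HDG : vfeqH (vscale Delta_q G)
        (fun i z => (c 0%nat * Eis 4 z * vDn 4 k1 F1 i z
                   + c 1%nat * Eis 6 z * vDn 3 k1 F1 i z
                   + c 2%nat * Eis 8 z * vDn 2 k1 F1 i z
                   + c 3%nat * Eis 10 z * vDn 1 k1 F1 i z
                   + c 4%nat * Eis 12 z * F1 i z)%C)).

(** [c (4 - i)] belongs to D^i F1, and every E_k is 1 at q = 0. For j >= 1 the leading exponent of
    F1 is lamt_j itself while the factor q of Delta raises that of Delta G, so the coefficient of
    q^(lamt_j) gives the equation. At j = 0 the exponent is already lamt_0 + 1 and no condition
    arises. *)
Lemma symbol_roots j : (1 <= j < 5)%nat ->
  csum 5 (fun i => c (4 - i)%nat * newton (newton_node k1) i (RtoC (lamt j)))%C = RtoC 0.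
Proof.
  intros Hj. assert (Hj5 : (j < 5)%nat) by lia.
  assert (HFh : forall i, (i < 5)%nat -> holo_H (F1 i)) by (intros; apply HF1; auto).
  destruct (F1_leading j Hj5) as (g & Hg & Hg0 & E).
  replace (lead j) with (lamt j) in E by (destruct j; [lia|reflexivity]).
  destruct (Hk_admissible rho v m r lamt L Hv HvT HLe lamt_range lamt_ee k1 G HG j Hj5) as (b & Hb & Eb).
  set (S := fun q => (c 0%nat * eisq 4 q * dqn 4 k1 (lamt j) g q + c 1%nat * eisq 6 q * dqn 3 k1 (lamt j) g q
     + c 2%nat * eisq 8 q * dqn 2 k1 (lamt j) g q + c 3%nat * eisq 10 q * dqn 1 k1 (lamt j) g q
     + c 4%nat * eisq 12 q * dqn 0 k1 (lamt j) g q)%C).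
  assert (HT : forall a k n, hol (fun q => a * eisq k q * dqn n k1 (lamt j) g q)%C 1).
  { intros a k n. apply hol_mult; [apply hol_scal, eisq_hol|apply dqn_hol; auto]. }
  assert (HS : hol S 1).
  { exact (hol_plus _ _ 1 (hol_plus _ _ 1 (hol_plus _ _ 1 (hol_plus _ _ 1 (HT _ 4 4)%nat (HT _ 6 3)%nat)
      (HT _ 8 2)%nat) (HT _ 10 1)%nat) (HT _ 12 0)%nat). }
  assert (E0 : S 0%C = (0 * Cpown (phi 0) 24 * b 0)%C).
  { apply (hol_qq_ext_0 S (fun q => q * Cpown (phi q) 24 * b q)%C HS).
    - apply hol_mult; [apply deltaq_hol|auto].
    - intros z Hz.
      assert (X : (Delta_q z * ev L G j z)%C = (ee (RtoC (lamt j) * z) * S (qq z))%C).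
      { assert (D : forall n, ev L (fun i => Dn n k1 (F1 i)) j z = (ee (RtoC (lamt j) * z) * dqn n k1 (lamt j) g (qq z))%C).
        { intros n. rewrite <- ev_Dn by auto. rewrite (Dn_ext n k1 _ _ z E Hz (ev_holo L F1 j HFh)).
          apply Dn_eeq; auto. }
        transitivity (c 0%nat * Eis 4 z * ev L (fun i => Dn 4 k1 (F1 i)) j z
          + c 1%nat * Eis 6 z * ev L (fun i => Dn 3 k1 (F1 i)) j z
          + c 2%nat * Eis 8 z * ev L (fun i => Dn 2 k1 (F1 i)) j z
          + c 3%nat * Eis 10 z * ev L (fun i => Dn 1 k1 (F1 i)) j z
          + c 4%nat * Eis 12 z * ev L (fun i => Dn 0 k1 (F1 i)) j z)%C.
        - transitivity (csum 5 (fun i => L j i * (vscale Delta_q G i z))%C).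
          + unfold ev, vscale. cbn [csum]. ring.
          + rewrite (csum_ext 5 (fun i => L j i * vscale Delta_q G i z)%C
              (fun i => L j i * (c 0%nat * Eis 4 z * vDn 4 k1 F1 i z + c 1%nat * Eis 6 z * vDn 3 k1 F1 i z
                 + c 2%nat * Eis 8 z * vDn 2 k1 F1 i z + c 3%nat * Eis 10 z * vDn 1 k1 F1 i z
                 + c 4%nat * Eis 12 z * F1 i z))%C) by (intros i Hi; rewrite HDG by auto; reflexivity).
            change (fun i => Dn 0 k1 (F1 i)) with F1.
            unfold ev, vDn. cbn [csum]. ring.
        - rewrite !D, !EisE. unfold S. ring. }
      rewrite Eb, Delta_qE in X by auto. pose proof (ee_neq0 (RtoC (lamt j) * z)%C) as Hne.
      transitivity (/ ee (RtoC (lamt j) * z) * (ee (RtoC (lamt j) * z) * S (qq z)))%C; [field; auto|].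
      rewrite <- X. field. auto. }
  unfold S in E0. rewrite !eisq_0, !dqn_0 in E0.
  assert (E1 : (csum 5 (fun i => c (4 - i)%nat * newton (newton_node k1) i (RtoC (lamt j))) * g 0)%C = RtoC 0).
  { transitivity (0 * Cpown (phi 0) 24 * b 0)%C; [|ring]. rewrite <- E0. cbn [csum Nat.sub]. ring. }
  apply C_integral in E1. destruct E1; [auto|contradiction].
Qed.

Lemma lamt_shift_distinct i j : (i < 4)%nat -> (j < 4)%nat ->
  RtoC (lamt (S i)) = RtoC (lamt (S j)) -> i = j.
Proof.
  intros Hi Hj E. apply (f_equal fst) in E. simpl in E.
  assert (S i = S j); [|lia]. apply (lamt_distinct _ _ 0); try lia. lra.
Qed.

(** Without its top term the symbol would have degree at most 3 and four distinct roots; all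
    coefficients would be 0, and Delta G with them. *)
Lemma c0_neq0 : c 0%nat <> RtoC 0.
Proof.
  intros E. apply HGnz. intros z i Hz Hi.
  assert (Z : forall l, (l < 4)%nat -> c (4 - l)%nat = RtoC 0).
  { apply (newton_zero (newton_node k1) 4 (fun l => c (4 - l)%nat) (fun j => RtoC (lamt (S j)))); [apply lamt_shift_distinct|].
    intros j Hj. rewrite <- (symbol_roots (S j)) by lia. cbn [csum Nat.sub]. rewrite E. ring. }
  pose proof (HDG z i Hz Hi) as X. unfold vscale in X.
  pose proof (Z 3%nat ltac:(lia)) as Z1. pose proof (Z 2%nat ltac:(lia)) as Z2.
  pose proof (Z 1%nat ltac:(lia)) as Z3. pose proof (Z 0%nat ltac:(lia)) as Z4.
  cbn [Nat.sub] in Z1, Z2, Z3, Z4. rewrite E, Z1, Z2, Z3, Z4 in X.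
  assert (X' : (Delta_q z * G i z)%C = RtoC 0) by (rewrite X; ring).
  apply C_integral in X'. destruct X' as [X'|X']; [exfalso; revert X'; apply Delta_neq0; auto|exact X'].
Qed.

(** Vieta for the symbol of degree 4: its roots have sum lambda_0 - lambda_1, the four nodes have
    sum k_1/3 + 1, and the choice of k_1 says lambda_0 = 5 k_1/12 + 2/3. *)
Lemma c1_formula : k1 = 12 / 5 * (lamt 0%nat + lamt 1%nat + lamt 2%nat + lamt 3%nat + lamt 4%nat + 1) - 4 ->
  c 1%nat = (c 0%nat * RtoC (lamt 0%nat - k1 / 12 + 1 / 3))%C.
Proof.
  intros Hk.
  pose proof (newton4_top (newton_node k1) (fun l => c (4 - l)%nat) (fun j => RtoC (lamt (S j)))
    lamt_shift_distinct (fun j Hj => symbol_roots (S j) ltac:(lia))) as E.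
  cbn [Nat.sub] in E. unfold newton_node in E. rewrite <- !RtoC_plus, <- RtoC_minus in E.
  match type of E with (_ + _ * RtoC ?x)%C = _ => replace x with (- (lamt 0%nat - k1 / 12 + 1 / 3)) in E end.
  - rewrite RtoC_opp in E. transitivity (c 1%nat - (c 1%nat + c 0%nat * - RtoC (lamt 0%nat - k1 / 12 + 1 / 3)))%C.
    + rewrite E. ring.
    + ring.
  - simpl INR. lra.
Qed.
End LeadingExponents.

(** * The elliptic points *)

(* The fixed point e^{i pi/3} of TS. *)
Definition omega : C := (1 / 2, sqrt 3 / 2).

Lemma omega_ce : omega = ce 1 (PI / 3).
Proof. unfold omega, ce. rewrite cos_PI3, sin_PI3. f_equal; field. Qed.

Lemma upper_omega : upper omega.
Proof. unfold upper, omega. simpl. assert (0 < sqrt 3) by (apply sqrt_lt_R0; lra). lra. Qed.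

Lemma omega_neq0 : omega <> RtoC 0.
Proof. intros E. pose proof upper_omega as H. rewrite E in H. unfold upper in H. simpl in H. lra. Qed.

Lemma omega_eq : (omega * omega)%C = (omega - 1)%C.
Proof.
  pose proof (sqrt_sqrt 3 ltac:(lra)) as H. unfold omega, Cmult, Cminus, Cplus, Copp, RtoC. simpl. f_equal; lra.
Qed.

Lemma Clog_omega : Clog omega = (0, PI / 3).
Proof.
  unfold Clog. f_equal.
  - rewrite omega_ce, Cmod_ce, ln_1 by lra. reflexivity.
  - rewrite omega_ce. unfold ce. rewrite !Rmult_1_l, Carg_pos by (rewrite cos_PI3; lra).
    change (sin (PI / 3) / cos (PI / 3)) with (tan (PI / 3)). apply atan_tan. pose proof PI_RGT_0. lra.
Qed.

Lemma Clog_Ci : Clog Ci = (0, PI / 2).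
Proof.
  unfold Clog. f_equal.
  - replace (Cmod Ci) with 1; [apply ln_1|]. change Ci with (0, 1). unfold Cmod. simpl.
    rewrite !Rmult_0_l, !Rmult_1_l, Rplus_0_l. symmetry. apply sqrt_1.
  - unfold Ci. rewrite Carg_upper by lra. replace (0 / 1) with 0 by field. rewrite atan_0. ring.
Qed.

Lemma Cpow_omega (a : R) : Cpow omega (RtoC a) = ee (RtoC (a / 6)).
Proof.
  rewrite Cpow_neq0 by apply omega_neq0. rewrite Clog_omega. unfold ee. f_equal.
  unfold Cmult, RtoC, Ci. simpl. f_equal; field.
Qed.

Lemma Ci_neq0 : Ci <> RtoC 0.
Proof. intros E. apply (f_equal snd) in E. simpl in E. lra. Qed.

Lemma Cpow_Ci (a : R) : Cpow Ci (RtoC a) = ee (RtoC (a / 4)).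
Proof.
  rewrite Cpow_neq0 by apply Ci_neq0. rewrite Clog_Ci. unfold ee. f_equal.
  unfold Cmult, RtoC, Ci. simpl. f_equal; field.
Qed.

Definition Umat : SL2Z := SL2Z_mul Tmat Smat.

Lemma mobius_U_omega : mobius Umat omega = omega.
Proof.
  pose proof omega_neq0 as H. unfold Umat. rewrite mobius_mul, mobius_S, mobius_T by apply upper_omega.
  transitivity ((omega - 1) / omega)%C; [field; auto|]. rewrite <- omega_eq. field. auto.
Qed.

Lemma jfac_U z : upper z -> jfac Umat z = z.
Proof. intros Hz. unfold Umat. rewrite jfac_mul, jfac_T, jfac_S by auto. ring. Qed.

(** The cocycle condition is read at z = i; as T has automorphy factor 1, the powers on both sides
    are the same and cancel. *)
Lemma multiplier_U k v : multiplier_system k v -> v Umat = (v Tmat * v Smat)%C.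
Proof.
  intros [_ H]. specialize (H Tmat Smat Ci upper_i). unfold nu in H.
  fold Umat in H. rewrite jfac_U, jfac_S, jfac_T in H by apply upper_i.
  assert (C1 : Cpow 1 (RtoC k) = RtoC 1).
  { rewrite Cpow_neq0 by (apply RtoC_neq_0; lra). replace (Clog 1) with (RtoC 0).
    - replace (RtoC k * 0)%C with (RtoC 0) by ring. apply cexp_0.
    - unfold Clog. rewrite Cmod_1, ln_1. unfold Carg, RtoC. simpl. destruct Rlt_dec; [|lra].
      replace (0 / 1) with 0 by field. rewrite atan_0. reflexivity. }
  rewrite C1 in H. pose proof (Cpow_nz Ci (RtoC k) Ci_neq0) as Hn.
  transitivity (v Umat * Cpow Ci (RtoC k) * / Cpow Ci (RtoC k))%C; [field; auto|].
  rewrite H. field. auto.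
Qed.

(* S and TS generate SL(2,Z). *)
Lemma line_invariant rho (w : vec) : representation rho -> irreducible rho ->
  (exists a, veq (mat_vec (rho Smat) w) (fun i => a * w i)%C) ->
  (exists a, veq (mat_vec (rho Umat) w) (fun i => a * w i)%C) -> veq w vzero.
Proof.
  intros [_ Hrep] Hirr HS HU.
  set (Q := fun g => exists a, veq (mat_vec (rho g) w) (fun i => a * w i)%C).
  assert (Qm : forall g h, Q g -> Q h -> Q (SL2Z_mul g h)).
  { intros g h [a Ha] [b Hb]. exists (b * a)%C. intros i Hi.
    transitivity (mat_vec (mat_mul (rho g) (rho h)) w i); [apply mat_vec_ext; auto; intros j _; reflexivity|].
    rewrite <- mat_vec_mul. transitivity (mat_vec (rho g) (fun j => b * w j)%C i).
    - apply mat_vec_ext; auto. intros x y _ _. reflexivity.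
    - rewrite mat_vec_scal, Ha by auto. ring. }
  assert (QT : Q Tmat).
  { replace Tmat with (SL2Z_mul Umat (SL2Z_mul Smat (SL2Z_mul Smat Smat))); [auto|].
    apply SL2Z_eq; reflexivity. }
  pose proof (SL2Z_generated Q Qm HS QT) as QA.
  set (W := fun v : vec => exists a, veq v (fun i => a * w i)%C).
  assert (HW : subspace W).
  { split; [|split; [|split]].
    - exists 0%C. intros i _. unfold vzero. ring.
    - intros x y Hxy [a Ha]. exists a. intros i Hi. rewrite <- Hxy, Ha by auto. reflexivity.
    - intros x y [a Ha] [b Hb]. exists (a + b)%C. intros i Hi. rewrite Ha, Hb by auto. ring.
    - intros b x [a Ha]. exists (b * a)%C. intros i Hi. rewrite Ha by auto. ring. }
  assert (HWi : invariant rho W).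
  { intros g x [a Ha]. destruct (QA g) as [b Hb]. exists (a * b)%C. intros i Hi.
    transitivity (mat_vec (rho g) (fun j => a * w j)%C i).
    - apply mat_vec_ext; auto. intros u y _ _. reflexivity.
    - rewrite mat_vec_scal, Hb by auto. ring. }
  destruct (Hirr W HW HWi) as [Ht|Hf].
  - apply Ht. exists 1%C. intros i _. ring.
  (* A line cannot contain two of the standard basis vectors. *)
  - exfalso. destruct (Hf (fun i => if Nat.eqb i 0 then 1%C else 0%C)) as [a Ha].
    destruct (Hf (fun i => if Nat.eqb i 1 then 1%C else 0%C)) as [b Hb].
    pose proof (Ha 0%nat ltac:(unfold dim5; lia)) as A0. pose proof (Ha 1%nat ltac:(unfold dim5; lia)) as A1.
    pose proof (Hb 1%nat ltac:(unfold dim5; lia)) as B1. simpl in A0, A1, B1.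
    assert (X : (RtoC 1 * RtoC 1)%C = RtoC 0).
    { rewrite A0 at 1. rewrite B1. transitivity ((a * w 1%nat) * (b * w 0%nat))%C; [ring|]. rewrite <- A1. ring. }
    revert X. apply Cmult_neq_0; apply RtoC_neq_0; lra.
Qed.

(** An eigenfunctional of rho(S) and rho(T) is one of the whole group, so its kernel is an invariant
    subspace. This kernel is never zero, and irreducibility makes it everything. *)
Lemma functional_invariant rho (l : vec) : representation rho -> irreducible rho ->
  (exists a, forall i, (i < 5)%nat -> csum 5 (fun b => l b * rho Smat b i)%C = (a * l i)%C) ->
  (exists a, forall i, (i < 5)%nat -> csum 5 (fun b => l b * rho Tmat b i)%C = (a * l i)%C) -> veq l vzero.
Proof.
  intros [_ Hrep] Hirr HS HT.
  set (Q := fun g => exists a, forall i, (i < 5)%nat -> csum 5 (fun b => l b * rho g b i)%C = (a * l i)%C).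
  assert (QA : forall g, Q g).
  { apply SL2Z_generated; auto. intros g h [a Ha] [b Hb]. exists (a * b)%C. intros i Hi.
    transitivity (csum 5 (fun x => csum 5 (fun y => l y * rho g y x) * rho h x i)%C).
    - transitivity (csum 5 (fun x => l x * mat_mul (rho g) (rho h) x i)%C).
      + apply csum_ext. intros x Hx. rewrite Hrep by auto. reflexivity.
      + unfold mat_mul, dim5. cbn [csum]. ring.
    - transitivity (a * csum 5 (fun x => l x * rho h x i))%C.
      + rewrite <- csum_scal. apply csum_ext. intros x Hx. rewrite Ha by auto. ring.
      + rewrite Hb by auto. ring. }
  set (W := fun v : vec => csum 5 (fun i => l i * v i)%C = RtoC 0).
  assert (HW : subspace W).
  { split; [|split; [|split]]; unfold W.
    - apply csum_0. intros. unfold vzero. ring.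
    - intros x y Hxy H. rewrite <- H. apply csum_ext. intros i Hi. rewrite Hxy by auto. reflexivity.
    - intros x y Hx Hy. transitivity (csum 5 (fun i => l i * x i) + csum 5 (fun i => l i * y i))%C.
      + rewrite <- csum_plus. apply csum_ext. intros. ring.
      + rewrite Hx, Hy. ring.
    - intros b x Hx. transitivity (b * csum 5 (fun i => l i * x i))%C.
      + rewrite <- csum_scal. apply csum_ext. intros. ring.
      + rewrite Hx. ring. }
  assert (HWi : invariant rho W).
  { intros g x Hx. destruct (QA g) as [a Ha]. unfold W.
    transitivity (csum 5 (fun i => csum 5 (fun b => l b * rho g b i) * x i)%C).
    - unfold mat_vec, dim5. cbn [csum]. ring.
    - transitivity (a * csum 5 (fun i => l i * x i))%C.
      + rewrite <- csum_scal. apply csum_ext. intros i Hi. rewrite Ha by auto. ring.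
      + rewrite Hx. ring. }
  destruct (Hirr W HW HWi) as [Ht|Hf].
  (* The kernel contains l_1 e_0 - l_0 e_1, and if this vector is 0 then it contains e_1. *)
  - exfalso. set (x := fun i => match i with 0%nat => l 1%nat | 1%nat => (- l 0%nat)%C | _ => 0%C end).
    assert (Hx : W x) by (unfold W, x; cbn [csum]; ring).
    pose proof (Ht x Hx 0%nat ltac:(unfold dim5; lia)) as X0. unfold x, vzero in X0.
    pose proof (Ht x Hx 1%nat ltac:(unfold dim5; lia)) as X1. unfold x, vzero in X1.
    set (y := fun i : nat => if Nat.eqb i 1 then 1%C else 0%C).
    assert (Hy : W y) by (unfold W, y; cbn [csum Nat.eqb]; rewrite X0; ring).
    pose proof (Ht y Hy 1%nat ltac:(unfold dim5; lia)) as Y1. unfold y, vzero in Y1. simpl in Y1.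
    revert Y1. apply RtoC_neq_0. lra.
  - intros i Hi. unfold vzero.
    assert (X := Hf (fun j => if Nat.eqb i j then 1%C else 0%C)). unfold W in X. rewrite <- X.
    unfold dim5 in Hi. do 5 (destruct i as [|i]; [cbn [csum Nat.eqb]; ring|]). lia.
Qed.

Section Exclusion.
Variables (rho : SL2Z -> mat) (v : SL2Z -> C) (k0 m k1 r0 : R) (l : vec) (Y : nat -> vfun).
Hypotheses (Hrep : representation rho) (Hirr : irreducible rho) (Hmult : multiplier_system k0 v)
  (HvT : v Tmat = ee (RtoC (m / 12)))
  (HY : forall n, (n < 5)%nat -> transforms (k1 + 2 * INR n) rho v (Y n))
  (Hindep : forall z (x : nat -> C), upper z ->
    (forall j, (j < 5)%nat -> csum 5 (fun n => x n * Y n j z)%C = RtoC 0) ->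
    forall n, (n < 5)%nat -> x n = RtoC 0)
  (Hl0 : ~ veq l vzero)
  (Hl : forall i, (i < 5)%nat -> csum 5 (fun a => l a * rho Tmat a i)%C = (ee (RtoC r0) * l i)%C).

(** The eigenvalue of rho(S) on F(i) for F of weight k_1, because i^(-k_1) = e(-k_1/4); [sU] is the
    analogue for rho(TS) at e^{i pi/3}. *)
Definition sS : C := (/ v Smat * ee (RtoC (- k1 / 4)))%C.
Definition sU : C := (/ v Umat * ee (RtoC (- k1 / 6)))%C.

Lemma Y_at_i n i : (n < 5)%nat -> (i < 5)%nat ->
  mat_vec (rho Smat) (fun j => Y n j Ci) i = (sS * Cpown (- (1)) n * Y n i Ci)%C.
Proof.
  intros Hn Hi. pose proof (multiplier_unit _ _ Hmult) as Hv.
  pose proof (HY n Hn Smat Ci i upper_i Hi) as E.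
  rewrite mobius_S, inv_i, jfac_S in E by apply upper_i.
  unfold mat_vec, dim5 in *. rewrite <- E. unfold sS.
  replace (- (k1 + 2 * INR n)) with (- k1 + - INR (2 * n)) by (rewrite mult_INR; simpl; ring).
  rewrite Cpow_plus, Cpow_Ci, Cpow_opp, Cpow_INR by apply Ci_neq0.
  replace (/ Cpown Ci (2 * n))%C with (Cpown (- (1)) n); [ring|].
  clear. induction n; [simpl; field; apply RtoC_neq_0; lra|].
  replace (2 * S n)%nat with (S (S (2 * n))) by lia. cbn [Cpown].
  rewrite IHn. rewrite Cmult_assoc, CiCi. field. apply pown_neq0, Ci_neq0.
Qed.

Lemma Y_at_omega n i : (n < 5)%nat -> (i < 5)%nat ->
  mat_vec (rho Umat) (fun j => Y n j omega) i = (sU * ee (RtoC (- INR n / 3)) * Y n i omega)%C.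
Proof.
  intros Hn Hi. pose proof (HY n Hn Umat omega i upper_omega Hi) as E.
  rewrite mobius_U_omega, jfac_U in E by apply upper_omega.
  unfold mat_vec, dim5 in *. rewrite <- E. unfold sU. rewrite Cpow_omega.
  replace (- (k1 + 2 * INR n) / 6) with (- k1 / 6 + - INR n / 3) by field.
  rewrite RtoC_plus, ee_plus. ring.
Qed.

(* At i the D^n F with n even are eigenvectors of rho(S) for one eigenvalue, and at e^{i pi/3} the D^n F with
   n = a, a + 3 are eigenvectors of rho(TS). Resonance makes u = l rho(S) - s l annihilate all five of them;
   they are independent, since a common vector of the two spans would generate an invariant line. *)
Lemma resonance_impossible (a : nat) (lam : R) : (a < 2)%nat ->
  ee (RtoC lam) = (ee (RtoC (m / 12)) * ee (RtoC r0))%C -> lam - k1 / 12 = - INR a / 3 -> False.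
Proof.
  intros Ha Elam Hres. pose proof (multiplier_unit _ _ Hmult) as Hv.
  (* The resonance in multiplicative form: the eigenvalue of rho(TS) on D^a F at e^{i pi/3} is that
     of rho(T) on l times that of rho(S) on F at i. *)
  assert (Ht : (sU * ee (RtoC (- INR a / 3)))%C = (sS * ee (RtoC r0))%C).
  { unfold sU, sS. rewrite (multiplier_U k0) by auto. rewrite HvT.
    assert (X : (ee (RtoC (- k1 / 6)) * ee (RtoC (- INR a / 3)))%C
      = (ee (RtoC (- k1 / 4)) * ee (RtoC r0) * ee (RtoC (m / 12)))%C).
    { transitivity (ee (RtoC (- k1 / 4)) * (ee (RtoC (m / 12)) * ee (RtoC r0)))%C; [|ring].
      rewrite <- Elam, <- !ee_plus, <- !RtoC_plus. do 2 f_equal. lra. }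
    pose proof (Hv Smat) as Hs. pose proof (ee_neq0 (RtoC (m / 12))) as He.
    transitivity (/ (ee (RtoC (m / 12)) * v Smat) * (ee (RtoC (- k1 / 6)) * ee (RtoC (- INR a / 3))))%C; [ring|].
    rewrite X. field. auto. }
  (* Three more derivatives raise the weight by 6, and the sixth power of e^{i pi/3} is 1. *)
  assert (Ht3 : ee (RtoC (- INR (a + 3) / 3)) = ee (RtoC (- INR a / 3))).
  { replace (- INR (a + 3) / 3) with (- INR a / 3 + - (1)) by (rewrite plus_INR; simpl; field).
    rewrite RtoC_plus, ee_plus, RtoC_opp, ee_opp, ee_1. field. }
  set (t := (sU * ee (RtoC (- INR a / 3)))%C) in *.
  assert (SY : forall n i, (n < 5)%nat -> Nat.even n = true -> (i < 5)%nat ->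
     mat_vec (rho Smat) (fun j => Y n j Ci) i = (sS * Y n i Ci)%C).
  { intros n i Hn He Hi. rewrite Y_at_i by auto.
    do 5 (destruct n as [|n]; [try discriminate; simpl; ring|]). lia. }
  assert (UY : forall n i, (n < 5)%nat -> n = a \/ n = (a + 3)%nat -> (i < 5)%nat ->
     mat_vec (rho Umat) (fun j => Y n j omega) i = (t * Y n i omega)%C).
  { intros n i Hn [->| ->] Hi; rewrite Y_at_omega by auto; [unfold t; ring|]. rewrite Ht3. unfold t. ring. }
  set (N := fun (b col : nat) => match col with
     | 0%nat => Y 0%nat b Ci | 1%nat => Y 2%nat b Ci | 2%nat => Y 4%nat b Ci
     | 3%nat => Y a b omega | _ => Y (a + 3)%nat b omega end).
  assert (HN : det5 N <> RtoC 0).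
  { intros E. destruct (det5_0_kernel E) as [x [Hx K]]. apply Hx.
    set (w := fun b => (x 0%nat * Y 0%nat b Ci + (x 1%nat * Y 2%nat b Ci + x 2%nat * Y 4%nat b Ci))%C).
    set (w' := fun b => (- x 3%nat * Y a b omega + - x 4%nat * Y (a + 3)%nat b omega)%C).
    assert (Ew : veq w w').
    { intros b Hb. specialize (K b Hb). unfold mat_vec, vzero, N, dim5 in K. cbn [csum] in K.
      unfold w, w'. match type of K with ?A = _ => transitivity (A + (- x 3%nat * Y a b omega + - x 4%nat * Y (a + 3)%nat b omega))%C end.
      - ring.
      - rewrite K. ring. }
    assert (Hw : veq w vzero).
    { apply (line_invariant rho w Hrep Hirr).
      - exists sS. intros i Hi. unfold w. rewrite !mat_vec_plus, !mat_vec_scal, !SY by (try reflexivity; auto; lia). ring.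
      - exists t. intros i Hi. rewrite Ew by auto.
        transitivity (mat_vec (rho Umat) w' i); [apply mat_vec_ext; auto; intros ? ? _ _; reflexivity|].
        unfold w'. rewrite !mat_vec_plus, !mat_vec_scal, !UY by (auto; lia). ring. }
    pose proof (Hindep Ci (fun n => match n with 0%nat => x 0%nat | 2%nat => x 1%nat | 4%nat => x 2%nat | _ => 0%C end) upper_i) as I1.
    pose proof (Hindep omega (fun n => if Nat.eqb n a then - x 3%nat else if Nat.eqb n (a + 3) then - x 4%nat else 0)%C upper_omega) as I2.
    assert (J1 : forall n, (n < 5)%nat -> (match n with 0%nat => x 0%nat | 2%nat => x 1%nat | 4%nat => x 2%nat | _ => 0%C end) = RtoC 0).
    { apply I1. intros j Hj. transitivity (w j); [|exact (Hw j Hj)]. unfold w. cbn [csum]. ring. }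
    assert (J2 : forall n, (n < 5)%nat -> (if Nat.eqb n a then - x 3%nat else if Nat.eqb n (a + 3) then - x 4%nat else 0)%C = RtoC 0).
    { apply I2. intros j Hj. transitivity (w' j); [|rewrite <- (Ew j Hj); exact (Hw j Hj)]. unfold w'.
      destruct a as [|[|a']]; [cbn [csum Nat.eqb Nat.add]; ring|cbn [csum Nat.eqb Nat.add]; ring|lia]. }
    intros i Hi. unfold vzero, dim5 in *.
    destruct i as [|[|[|[|[|i]]]]]; [exact (J1 0%nat Hi)|exact (J1 2%nat ltac:(lia))|exact (J1 4%nat ltac:(lia))| | |lia].
    - specialize (J2 a ltac:(lia)). cbv beta in J2. rewrite Nat.eqb_refl in J2.
      transitivity (- - x 3%nat)%C; [ring|]. rewrite J2. ring.
    - specialize (J2 (a + 3)%nat ltac:(lia)). cbv beta in J2. rewrite Nat.eqb_refl in J2.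
      replace (Nat.eqb (a + 3) a) with false in J2 by (symmetry; apply Nat.eqb_neq; lia).
      transitivity (- - x 4%nat)%C; [ring|]. rewrite J2. ring. }
  set (u := fun b => (csum 5 (fun x => l x * rho Smat x b) - sS * l b)%C).
  assert (Pair : forall M (y : vec), csum 5 (fun b => csum 5 (fun x => l x * M x b) * y b)%C
     = csum 5 (fun x => l x * mat_vec M y x)%C).
  { intros M y. unfold mat_vec, dim5. cbn [csum]. ring. }
  (* Since l rho(T) = e(r0) l, the same u also measures how far l is from being an eigenfunctional
     of rho(TS). *)
  assert (Uu : forall b, (b < 5)%nat -> (ee (RtoC r0) * u b)%C
     = (csum 5 (fun x => l x * rho Umat x b) - t * l b)%C).
  { intros b Hb. rewrite Ht. unfold u.
    assert (X : csum 5 (fun x => l x * rho Umat x b)%C = (ee (RtoC r0) * csum 5 (fun x => l x * rho Smat x b))%C).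
    { transitivity (csum 5 (fun y => csum 5 (fun x => l x * rho Tmat x y) * rho Smat y b)%C).
      - destruct Hrep as [_ Hr]. transitivity (csum 5 (fun x => l x * mat_mul (rho Tmat) (rho Smat) x b)%C).
        + apply csum_ext. intros x Hx. unfold Umat. rewrite Hr by auto. reflexivity.
        + unfold mat_mul, dim5. cbn [csum]. ring.
      - rewrite <- csum_scal. apply csum_ext. intros y Hy. rewrite Hl by auto. ring. }
    rewrite X. ring. }
  assert (U1 : forall n, (n < 5)%nat -> Nat.even n = true -> csum 5 (fun b => u b * Y n b Ci)%C = RtoC 0).
  { intros n Hn He. transitivity (csum 5 (fun b => csum 5 (fun x => l x * rho Smat x b) * Y n b Ci)
      - sS * csum 5 (fun b => l b * Y n b Ci))%C; [unfold u; cbn [csum]; ring|].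
    rewrite (Pair (rho Smat) (fun b => Y n b Ci)). rewrite <- csum_scal.
    rewrite (csum_ext 5 _ (fun i => sS * (l i * Y n i Ci))%C); [ring|].
    intros i Hi. rewrite SY by auto. ring. }
  assert (U2 : forall n, (n < 5)%nat -> n = a \/ n = (a + 3)%nat -> csum 5 (fun b => u b * Y n b omega)%C = RtoC 0).
  { intros n Hn He.
    assert (X : (ee (RtoC r0) * csum 5 (fun b => u b * Y n b omega))%C = RtoC 0).
    { rewrite <- csum_scal.
      rewrite (csum_ext 5 _ (fun b => csum 5 (fun x => l x * rho Umat x b) * Y n b omega - t * (l b * Y n b omega))%C).
      - transitivity (csum 5 (fun b => csum 5 (fun x => l x * rho Umat x b) * Y n b omega)
          - t * csum 5 (fun b => l b * Y n b omega))%C; [cbn [csum]; ring|].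
        rewrite (Pair (rho Umat) (fun b => Y n b omega)). rewrite <- csum_scal.
        rewrite (csum_ext 5 _ (fun i => t * (l i * Y n i omega))%C); [ring|].
        intros i Hi. rewrite UY by auto. ring.
      - intros b Hb. rewrite Cmult_assoc, Uu by auto. ring. }
    apply C_integral in X. destruct X as [X|X]; [exfalso; revert X; apply ee_neq0|auto]. }
  assert (Hu : veq u vzero).
  { rewrite <- det5_tr in HN. apply (det5_injective _ u HN). intros col Hcol. unfold mat_vec, vzero, dim5.
    transitivity (csum 5 (fun b => u b * N b col)%C); [apply csum_ext; intros; ring|].
    unfold dim5 in Hcol. destruct col as [|[|[|[|[|col]]]]]; [apply U1|apply U1|apply U1|apply U2|apply U2|]; auto; lia. }
  apply Hl0. apply (functional_invariant rho l Hrep Hirr).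
  - exists sS. intros i Hi. specialize (Hu i Hi). unfold u, vzero in Hu.
    transitivity ((csum 5 (fun b => l b * rho Smat b i) - sS * l i) + sS * l i)%C; [ring|]. rewrite Hu. ring.
  - exists (ee (RtoC r0)). auto.
Qed.
End Exclusion.

(** * Modular forms of level one *)

Lemma upper_neq0 z : upper z -> z <> RtoC 0.
Proof. intros H ->. unfold upper in H. simpl in H. lra. Qed.

Lemma upper_S z : upper z -> upper (- / z)%C.
Proof. intros Hz. rewrite <- mobius_S by auto. apply mobius_upper; auto. Qed.

Lemma Im_S z : upper z -> Im (- / z)%C = Im z / Cmod z ^ 2.
Proof. intros Hz. rewrite <- mobius_S, Im_mobius, jfac_S by auto. reflexivity. Qed.

Lemma q_holo_const c : q_holo (fun _ => c).
Proof. exists (fun _ => c). split; [apply hol_const|auto]. Qed.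
Lemma q_holo_plus f g : q_holo f -> q_holo g -> q_holo (fun z => f z + g z)%C.
Proof.
  intros [h [Hh E]] [h' [Hh' E']]. exists (fun q => h q + h' q)%C. split; [apply hol_plus; auto|].
  intros z Hz. rewrite E, E' by auto. reflexivity.
Qed.
Lemma q_holo_mult f g : q_holo f -> q_holo g -> q_holo (fun z => f z * g z)%C.
Proof.
  intros [h [Hh E]] [h' [Hh' E']]. exists (fun q => h q * h' q)%C. split; [apply hol_mult; auto|].
  intros z Hz. rewrite E, E' by auto. reflexivity.
Qed.
Lemma q_holo_Eis k : q_holo (Eis k).
Proof. exists (eisq k). split; [apply eisq_hol|reflexivity]. Qed.
Lemma q_holo_ext f g : (forall z, upper z -> f z = g z) -> q_holo f -> q_holo g.
Proof. intros H [h [Hh E]]. exists h. split; [auto|]. intros z Hz. rewrite <- H by auto. auto. Qed.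
Lemma q_holo_holo f : q_holo f -> holo_H f.
Proof.
  intros [h [Hh E]]. apply (holo_ext (fun z => h (qq z))); [intros; symmetry; auto|]. apply hol_qq_holo; auto.
Qed.
Lemma q_holo_period f z n : q_holo f -> upper z -> f (z + RtoC (IZR n))%C = f z.
Proof.
  intros [h [Hh E]] Hz. apply period_Z; auto. intros w Hw.
  rewrite !E by (auto; apply (upper_plus_real w 1); auto). rewrite qq_plus1. reflexivity.
Qed.

Lemma q_holo_bounded f : q_holo f -> exists M, 0 <= M /\ forall z, 1 / 2 <= Im z -> Cmod (f z) <= M.
Proof.
  intros [h [Hh E]]. destruct (disc_bounded h 1 (exp (- PI)) (hol_cont _ _ Hh)) as [M [HM K]].
  - rewrite <- exp_0. apply exp_increasing. pose proof PI_RGT_0. lra.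
  - exists M. split; [lra|]. intros z Hz. rewrite E by (unfold upper; lra). apply K.
    rewrite Cmod_qq. apply exp_le_mono. pose proof PI_RGT_0. nra.
Qed.

(** Two generators suffice: [q_holo] covers T and the cusp. The weight is a real number because
    coefficients of vectors of weight w come with weight w - k - 2 s_i for arbitrary w;
    [modular_even] shows afterwards that only even integers carry nonzero forms. *)
Definition modular (w : R) (f : C -> C) : Prop :=
  q_holo f /\ forall z, upper z -> f (- / z)%C = (Cpow z (RtoC w) * f z)%C.

Lemma modular_mult a b f g : modular a f -> modular b g -> modular (a + b) (fun z => f z * g z)%C.
Proof.
  intros [Hf Sf] [Hg Sg]. split; [apply q_holo_mult; auto|]. intros z Hz.
  rewrite Sf, Sg, Cpow_plus by (auto; apply upper_neq0; auto). ring.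
Qed.
Lemma modular_plus a f g : modular a f -> modular a g -> modular a (fun z => f z + g z)%C.
Proof. intros [Hf Sf] [Hg Sg]. split; [apply q_holo_plus; auto|]. intros z Hz. rewrite Sf, Sg by auto. ring. Qed.
Lemma modular_scal a c f : modular a f -> modular a (fun z => c * f z)%C.
Proof.
  intros [Hf Sf]. split; [apply q_holo_mult; [apply q_holo_const|auto]|]. intros z Hz. rewrite Sf by auto. ring.
Qed.
Lemma modular_ext a f g : (forall z, upper z -> f z = g z) -> modular a f -> modular a g.
Proof.
  intros H [Hf Sf]. split; [eapply q_holo_ext; eauto|]. intros z Hz. rewrite <- !H by (auto; apply upper_S; auto). auto.
Qed.
Lemma modular_one : modular 0 (fun _ => RtoC 1).
Proof. split; [apply q_holo_const|]. intros z Hz. rewrite Cpow_0 by (apply upper_neq0; auto). ring. Qed.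

Lemma weight_law_modular n f : q_holo f -> weight_law n Smat f -> modular (INR n) f.
Proof.
  intros Hf Hl. split; [auto|]. intros z Hz.
  rewrite <- mobius_S, Hl, jfac_S by auto. rewrite Cpow_INR by (apply upper_neq0; auto). reflexivity.
Qed.

Lemma Rpower_neg_le a b w : 0 < a <= b -> w < 0 -> Rpower b w <= Rpower a w.
Proof.
  intros [Ha Hab] Hw. unfold Rpower. apply exp_le_mono.
  assert (ln a <= ln b) by (destruct Hab as [H| ->]; [left; apply ln_increasing; auto|lra]). nra.
Qed.

(* |f|^2 y^w is invariant, and z -> -1/(z + N) at least doubles Im z while Im z < 1/2. *)
Lemma hecke_bound w f : modular w f -> w < 0 -> exists M, 0 <= M /\
  forall z, upper z -> Cmod (f z) ^ 2 * Rpower (Im z) w <= M.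
Proof.
  intros [Hf HS] Hw. destruct (q_holo_bounded f Hf) as [M [HM B]].
  exists (M ^ 2 * Rpower (1 / 2) w).
  assert (Hp : 0 < Rpower (1 / 2) w) by apply exp_pos.
  split; [apply Rmult_le_pos; [apply pow_le; auto|lra]|].
  assert (Ind : forall n z, upper z -> (1 / 2) ^ (S n) <= Im z ->
     Cmod (f z) ^ 2 * Rpower (Im z) w <= M ^ 2 * Rpower (1 / 2) w).
  { assert (Big : forall z, 1 / 2 <= Im z -> Cmod (f z) ^ 2 * Rpower (Im z) w <= M ^ 2 * Rpower (1 / 2) w).
    { intros z Hz. apply Rmult_le_compat; [apply pow_le, Cmod_ge_0|left; apply exp_pos| |].
      - apply pow_incr. split; [apply Cmod_ge_0|auto].
      - apply Rpower_neg_le; auto. lra. }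
    induction n; intros z Hz Hn.
    - apply Big. simpl in Hn. lra.
    - destruct (Rle_dec (1 / 2) (Im z)) as [Hb|Hb]; [auto|]. apply Rnot_le_lt in Hb.
      (* The translation that brings the real part into [-1/2, 1/2]; together with Im z < 1/2 this
         gives |u|^2 <= 1/2. *)
      set (N := (- up (Re z - 1 / 2))%Z).
      set (u := (z + RtoC (IZR N))%C).
      assert (Hu : upper u) by (apply upper_plus_real; auto).
      assert (Fu : f u = f z) by (apply q_holo_period; auto).
      assert (Iu : Im u = Im z) by (unfold u; destruct z; simpl; ring).
      assert (Ru : Rabs (Re u) <= 1 / 2).
      { unfold u. destruct (archimed (Re z - 1 / 2)) as [A1 A2].
        replace (Re (z + RtoC (IZR N))%C) with (Re z - IZR (up (Re z - 1 / 2)))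
          by (unfold N; rewrite opp_IZR; destruct z; simpl; ring).
        apply Rabs_le. lra. }
      assert (Hm : Cmod u ^ 2 <= 1 / 2).
      { rewrite Cmod2_alt, Iu. assert (Re u ^ 2 <= 1 / 4).
        { rewrite <- pow2_abs. replace (1 / 4) with ((1 / 2) ^ 2) by field. apply pow_incr. split; [apply Rabs_pos|auto]. }
        assert (Im z ^ 2 <= 1 / 4).
        { replace (1 / 4) with ((1 / 2) ^ 2) by field. apply pow_incr. unfold upper in Hz. lra. }
        lra. }
      assert (Hm0 : 0 < Cmod u ^ 2) by (apply pow_lt, (proj1 (Cmod_gt_0 _)), upper_neq0; auto).
      specialize (IHn (- / u)%C (upper_S u Hu)). rewrite Im_S, Iu in IHn by auto.
      assert (Hy : Im z * 2 <= Im z / Cmod u ^ 2).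
      { unfold Rdiv. apply Rmult_le_compat_l; [unfold upper in Hz; lra|].
        replace 2 with (/ (1 / 2)) by field. apply Rinv_le_contravar; auto. }
      assert (E : Cmod (f (- / u)%C) ^ 2 * Rpower (Im z / Cmod u ^ 2) w = Cmod (f z) ^ 2 * Rpower (Im z) w).
      { rewrite HS, Cmod_mult, Cmod_Cpow, Fu by (auto; apply upper_neq0; auto).
        assert (Hcu : 0 < Cmod u) by (apply (proj1 (Cmod_gt_0 _)), upper_neq0; auto).
        unfold Rdiv. rewrite Rpow_mult_distr.
        assert (R1 : Rpower (Im z * / Cmod u ^ 2) w * Rpower (Cmod u) w ^ 2 = Rpower (Im z) w).
        { unfold Rpower. simpl pow. rewrite !Rmult_1_r, <- !exp_plus.
          f_equal. simpl pow in Hm0. rewrite Rmult_1_r in Hm0.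
          rewrite ln_mult, ln_Rinv, ln_mult by (auto; apply Rinv_0_lt_compat; auto). ring. }
        rewrite <- R1. ring. }
      rewrite <- E. apply IHn. simpl in *. lra. }
  intros z Hz. destruct (pow_lim0 (1 / 2) (Im z)) as [n Hn]; [lra|exact Hz|].
  apply (Ind n z Hz). left. apply Hn. lia.
Qed.

(** On |q| = e^(-2 pi y) Hecke's bound reads |h|^2 <= M y^(-w), which tends to 0 as the circle
    approaches the unit circle; the circle bound then forces h = 0 inside. The square of h is used
    because the invariant quantity is |f|^2 y^w. *)
Lemma modular_negative w f : modular w f -> w < 0 -> forall z, upper z -> f z = RtoC 0.
Proof.
  intros HM Hw z0 Hz0. destruct (hecke_bound w f HM Hw) as [M [HM0 B]].
  destruct HM as [[h [Hh E]] _]. rewrite E by auto.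
  pose proof (qq_disc z0 Hz0) as Hq. set (q := qq z0) in *. unfold disc in Hq.
  pose proof (Cmod_ge_0 q) as Hq0. pose proof PI_RGT_0 as HPI.
  assert (G : Cmod (h q * h q) <= 0).
  { apply le_eps. intros e He. rewrite Rplus_0_l.
    set (a := - w). assert (Ha : 0 < a) by (unfold a; lra).
    set (D := 2 / (1 - Cmod q)). assert (HD : 0 < D) by (apply Rdiv_lt_0_compat; lra).
    set (e' := e / ((M + 1) * D)). assert (He' : 0 < e') by (apply Rdiv_lt_0_compat; [auto|apply Rmult_lt_0_compat; lra]).
    (* The height at which the radius is (1 + |q|)/2; staying below it keeps the circle away from
       q. *)
    set (y1 := - ln ((1 + Cmod q) / 2) / (2 * PI)).
    assert (Hln : ln ((1 + Cmod q) / 2) < 0) by (rewrite <- ln_1; apply ln_increasing; lra).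
    assert (Hy1 : 0 < y1) by (apply Rdiv_lt_0_compat; lra).
    set (y := Rmin y1 (Rpower e' (/ a))). assert (Hy : 0 < y) by (apply Rmin_pos; [auto|apply exp_pos]).
    set (r := exp (- (2 * PI * y))).
    assert (Hr1 : r < 1) by (unfold r; rewrite <- exp_0; apply exp_increasing; nra).
    assert (Hrq : (1 + Cmod q) / 2 <= r).
    { unfold r. rewrite <- (exp_ln ((1 + Cmod q) / 2)) by lra. apply exp_le_mono.
      assert (y <= y1) by apply Rmin_l. assert (2 * PI * y <= 2 * PI * y1) by (apply Rmult_le_compat_l; lra).
      replace (2 * PI * y1) with (- ln ((1 + Cmod q) / 2)) in H0 by (unfold y1; field; lra). lra. }
    assert (Hya : Rpower y a <= e').
    { apply Rle_trans with (Rpower (Rpower e' (/ a)) a).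
      - apply Rle_Rpower_l; [lra|]. split; [auto|apply Rmin_r].
      - rewrite Rpower_mult, Rinv_l, Rpower_1 by lra. lra. }
    assert (Bd : Cmod (h q * h q) <= (M * e') * r / (r - Cmod q)).
    { apply (hol_circle_bound (fun q => h q * h q)%C 1 r q); [apply hol_mult; auto|auto|lra|].
      intros t. assert (Hc : Cmod (ce r t) = r) by (apply Cmod_ce; left; apply exp_pos).
      assert (Hc0 : ce r t <> RtoC 0) by (intros X; rewrite X, Cmod_0 in Hc; assert (0 < r) by apply exp_pos; lra).
      assert (Hcd : disc 1 (ce r t)) by (unfold disc; lra).
      pose proof (zq_upper _ Hc0 Hcd) as Hu. specialize (B _ Hu).
      rewrite E, qq_zq in B by auto.
      assert (Iy : Im (zq (ce r t)) = y).
      { pose proof (Cmod_qq (zq (ce r t))) as X. rewrite qq_zq, Hc in X by auto.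
        apply exp_inv in X. apply (Rmult_eq_reg_l (2 * PI)); lra. }
      rewrite Iy in B. rewrite Cmod_mult. replace (Cmod (h (ce r t)) * Cmod (h (ce r t))) with (Cmod (h (ce r t)) ^ 2) by ring.
      apply Rle_trans with (M * Rpower y a); [|apply Rmult_le_compat_l; auto].
      unfold a. rewrite Rpower_Ropp. pose proof (exp_pos (w * ln y)) as Hp. fold (Rpower y w) in Hp.
      apply (Rmult_le_reg_r (Rpower y w)); [auto|]. rewrite Rmult_assoc, Rinv_l by lra. lra. }
    eapply Rle_trans; [exact Bd|].
    assert (Hrr : r / (r - Cmod q) <= D).
    { unfold D. apply Rle_trans with (1 / ((1 - Cmod q) / 2)).
      - apply Rmult_le_compat; [left; apply exp_pos|left; apply Rinv_0_lt_compat; lra|lra|].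
        apply Rinv_le_contravar; lra.
      - right. field. lra. }
    apply Rle_trans with (M * e' * D).
    - unfold Rdiv. rewrite Rmult_assoc. apply Rmult_le_compat_l; [apply Rmult_le_pos; lra|exact Hrr].
    - replace e with ((M + 1) * e' * D) by (unfold e'; field; split; lra).
      apply Rmult_le_compat_r; [lra|]. apply Rmult_le_compat_r; lra. }
  assert (H0 : (h q * h q)%C = RtoC 0) by (apply Cmod_eq_0; pose proof (Cmod_ge_0 (h q * h q)); lra).
  apply C_integral in H0. destruct H0; auto.
Qed.

Lemma Clog_S z : upper z -> (Clog (- / z) + Clog z)%C = (0, PI).
Proof.
  intros Hz. destruct z as [x y]. unfold upper in Hz. simpl in Hz.
  assert (Hz' : upper (x, y)) by exact Hz.
  assert (Hm : 0 < Cmod (x, y)) by (apply (proj1 (Cmod_gt_0 _)), upper_neq0; auto).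
  unfold Clog, Cplus. simpl. f_equal.
  - rewrite Cmod_opp, Cmod_inv, ln_Rinv by (auto; apply upper_neq0; auto). ring.
  - assert (HD : 0 < x ^ 2 + y ^ 2) by nra.
    replace (- / (x, y))%C with (- x / (x ^ 2 + y ^ 2), y / (x ^ 2 + y ^ 2)).
    + rewrite !Carg_upper by (auto; apply Rdiv_lt_0_compat; auto).
      replace (- x / (x ^ 2 + y ^ 2) / (y / (x ^ 2 + y ^ 2))) with (- (x / y)) by (field; split; lra).
      rewrite atan_opp. lra.
    + unfold Cinv, Copp. simpl. f_equal; field; nra.
Qed.

(** Applying S twice gives the factor (-1/z)^w z^w = e^(i pi w), which has to be 1 wherever f is
    nonzero. *)
Lemma modular_even w f z : modular w f -> upper z -> f z <> RtoC 0 -> exists n : Z, w = 2 * IZR n.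
Proof.
  intros [_ HS] Hz H0. pose proof (upper_S z Hz) as Hz'.
  assert (Hn : z <> RtoC 0) by (apply upper_neq0; auto).
  pose proof (HS _ Hz') as E. rewrite (HS z Hz) in E.
  replace (- / - / z)%C with z in E by (field; auto).
  rewrite !Cpow_neq0 in E by (apply upper_neq0; auto).
  assert (X : ee (RtoC (w / 2)) = RtoC 1).
  { transitivity (cexp (RtoC w * Clog (- / z)) * cexp (RtoC w * Clog z))%C.
    - rewrite <- cexp_plus. unfold ee. f_equal.
      transitivity (RtoC w * (Clog (- / z) + Clog z))%C; [|ring]. rewrite Clog_S by auto.
      unfold Cmult, RtoC, Ci. simpl. f_equal; field.
    - transitivity (f z / f z)%C; [|field; auto].
      transitivity (cexp (RtoC w * Clog (- / z)) * (cexp (RtoC w * Clog z) * f z) / f z)%C; [field; auto|].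
      rewrite <- E. reflexivity. }
  destruct (ee_eq_1 _ X) as [n Hn']. exists n. apply (f_equal fst) in Hn'. simpl in Hn'. lra.
Qed.

Section ModularForms.
Hypotheses (HDel : weight_law 12 Smat Delta_q) (HE4 : weight_law 4 Smat (Eis 4)) (HE6 : weight_law 6 Smat (Eis 6))
  (HP : forall g z, upper z -> P_defect g z = RtoC 0).

Lemma modular_E4 : modular 4 (Eis 4).
Proof. replace 4 with (INR 4) at 1 by (simpl; ring). apply weight_law_modular; [apply q_holo_Eis|auto]. Qed.
Lemma modular_E6 : modular 6 (Eis 6).
Proof. replace 6 with (INR 6) at 1 by (simpl; ring). apply weight_law_modular; [apply q_holo_Eis|auto]. Qed.

(** Delta = q phi^24 has a simple zero at q = 0 and no other zero in the disc, so dividing by it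
    costs exactly one factor q. *)
Lemma modular_cusp w f h : modular w f -> hol h 1 -> (forall z, upper z -> f z = h (qq z)) -> h 0%C = RtoC 0 ->
  exists f', modular (w - 12) f' /\ forall z, upper z -> f z = (Delta_q z * f' z)%C.
Proof.
  intros [_ HS] Hh E H0. destruct (hol_divide h 1 Rlt_0_1 Hh H0) as [h1 [Hh1 E1]].
  exists (fun z => f z / Delta_q z)%C. split; [split|].
  - exists (fun q => h1 q / Cpown (phi q) 24)%C. split.
    + apply hol_div; [auto|apply hol_pown, phi_hol|intros; apply pown_neq0, phi_neq0; auto].
    + intros z Hz. rewrite E, E1, Delta_qE by (auto; apply qq_disc; auto).
      field. split; [apply pown_neq0, phi_neq0, qq_disc; auto|apply qq_neq0].
  - intros z Hz. rewrite HS by auto. rewrite <- mobius_S, HDel, jfac_S by auto.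
    assert (Hz0 : z <> RtoC 0) by (apply upper_neq0; auto).
    unfold Rminus. rewrite Cpow_plus, Cpow_opp by auto.
    replace 12 with (INR 12) by (simpl; ring). rewrite Cpow_INR by auto.
    field. split; [apply Delta_neq0; auto|apply pown_neq0; auto].
  - intros z Hz. field. apply Delta_neq0; auto.
Qed.

Lemma modular_decompose w f e he : modular w f -> modular w e -> hol he 1 -> (forall z, upper z -> e z = he (qq z)) ->
  he 0%C = RtoC 1 ->
  exists c f', modular (w - 12) f' /\ forall z, upper z -> f z = (c * e z + Delta_q z * f' z)%C.
Proof.
  intros Hf He Hhe Ee He0. destruct Hf as [[h [Hh E]] HS].
  destruct (modular_cusp w (fun z => f z + (- h 0) * e z)%C (fun q => h q + (- h 0) * he q)%C) as [f' [Hf' E']].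
  - apply modular_plus; [split; [exists h; auto|auto]|apply modular_scal; auto].
  - apply hol_plus; [auto|apply hol_scal; auto].
  - intros z Hz. rewrite E, Ee by auto. reflexivity.
  - rewrite He0. ring.
  - exists (h 0%C), f'. split; [auto|]. intros z Hz. rewrite <- E' by auto. ring.
Qed.

(** After a multiple of e is subtracted, the quotient by Delta has negative weight. *)
Lemma modular_line w f e he : w < 12 -> modular w f -> modular w e -> hol he 1 -> (forall z, upper z -> e z = he (qq z)) ->
  he 0%C = RtoC 1 -> exists c, forall z, upper z -> f z = (c * e z)%C.
Proof.
  intros Hw Hf He Hhe Ee He0. destruct (modular_decompose w f e he Hf He Hhe Ee He0) as (c & f' & Hf' & E).
  exists c. intros z Hz. rewrite E, (modular_negative _ _ Hf' ltac:(lra) z Hz) by auto. ring.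
Qed.

Lemma modular_const f : modular 0 f -> exists c, forall z, upper z -> f z = c.
Proof.
  intros Hf. destruct (modular_line 0 f (fun _ => RtoC 1) (fun _ => RtoC 1)) as [c Hc]; auto; [lra|apply modular_one|apply hol_const|].
  exists c. intros z Hz. rewrite Hc by auto. ring.
Qed.

(** S sends omega to omega - 1, and a function of period 1 has the same value there. *)
Lemma modular_at_omega w f (n : nat) : modular (INR n) f -> w = INR n -> Cpown omega n <> RtoC 1 -> f omega = RtoC 0.
Proof.
  intros [Hf HS] _ Hn. specialize (HS omega upper_omega). rewrite Cpow_INR in HS by apply omega_neq0.
  replace (- / omega)%C with (omega + RtoC (IZR (-1)))%C in HS.
  - rewrite q_holo_period in HS by (auto; apply upper_omega).
    assert (X : ((1 - Cpown omega n) * f omega)%C = RtoC 0) by (transitivity (f omega - Cpown omega n * f omega)%C; [ring|rewrite <- HS; ring]).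
    apply C_integral in X. destruct X as [X|X]; [|auto]. exfalso. apply Hn.
    transitivity (1 - (1 - Cpown omega n))%C; [ring|]. rewrite X. ring.
  - pose proof omega_neq0. transitivity ((omega * omega + RtoC (IZR (-1)) * omega) / omega)%C; [field; auto|].
    rewrite omega_eq. field. auto.
Qed.

Lemma omega_cube : (omega * (omega * omega))%C = (- (1))%C.
Proof. rewrite omega_eq. transitivity (omega * omega - omega)%C; [ring|]. rewrite omega_eq. ring. Qed.

Lemma E4_omega : Eis 4 omega = RtoC 0.
Proof.
  apply (modular_at_omega 4 (Eis 4) 4); [|simpl; ring|].
  - replace (INR 4) with 4 by (simpl; ring). apply modular_E4.
  - cbn [Cpown]. intros E. assert (X : omega = (- (1))%C).
    { transitivity (- (omega * (omega * (omega * omega))))%C; [rewrite omega_cube; ring|].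
      transitivity (- (omega * (omega * (omega * (omega * 1)))))%C; [ring|]. rewrite E. reflexivity. }
    apply (f_equal fst) in X. simpl in X. lra.
Qed.

Lemma Dk_modular n f h : q_holo f -> hol h 1 -> (forall z, upper z -> f z = h (qq z)) -> weight_law n Smat f ->
  modular (INR n + 2) (Dk (INR n) f) /\ (forall z, upper z -> Dk (INR n) f z = dq (INR n) 0 h (qq z)).
Proof.
  intros Hf Hh E Hl. pose proof (q_holo_holo f Hf) as Hfh.
  assert (ED : forall z, upper z -> Dk (INR n) f z = dq (INR n) 0 h (qq z)).
  (* Writing f with the trivial factor e(0 z) makes the calculus of [dq] available with exponent
     0. *)
  { intros z Hz. rewrite (Dk_ext _ f (fun z => ee (RtoC 0 * z) * h (qq z))%C); auto.
    - rewrite Dk_eeq by auto. replace (0 * z)%C with (RtoC 0) by ring. rewrite ee_0. ring.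
    - intros w Hw. rewrite E by auto. replace (0 * w)%C with (RtoC 0) by ring. rewrite ee_0. ring. }
  split; [|auto]. split; [exists (dq (INR n) 0 h); split; [apply dq_hol; auto|auto]|].
  intros z Hz. assert (Hz0 : z <> RtoC 0) by (apply upper_neq0; auto).
  pose proof (Dk_slash0 HP (INR n) Smat f z Hfh Hz) as X.
  rewrite (Dk_ext _ (slash (INR n) Smat f) f) in X; [|apply weight_law_slash; auto|auto|apply slash_holo; auto].
  rewrite <- X. unfold slash. rewrite mobius_S, jfac_S, Cpow_opp by auto. field. apply Cpow_nz; auto.
Qed.

(** Ramanujan's identity: D E4 has weight 6, where every form is a multiple of E6, and its value at
    q = 0 is 4 P(0) = -4/12. *)
Lemma DE4 z : upper z -> Dk 4 (Eis 4) z = (RtoC (- (1 / 3)) * Eis 6 z)%C.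
Proof.
  intros Hz. destruct (Dk_modular 4 (Eis 4) (eisq 4) (q_holo_Eis 4) (eisq_hol 4) (fun z _ => EisE 4 z) HE4) as [HM HE].
  replace (INR 4) with 4 in * by (simpl; ring). replace (4 + 2) with 6 in HM by ring.
  destruct (modular_line 6 _ (Eis 6) (eisq 6) ltac:(lra) HM modular_E6 (eisq_hol 6) (fun z _ => EisE 6 z) (eisq_0 6)) as [c Hc].
  rewrite Hc by auto. f_equal.
  assert (X : dq 4 0 (eisq 4) 0%C = (c * eisq 6 0)%C).
  { apply (hol_qq_ext_0 _ (fun q => c * eisq 6 q)%C); [apply dq_hol, eisq_hol|apply hol_scal, eisq_hol|].
    intros w Hw. rewrite <- HE, Hc by auto. reflexivity. }
  unfold dq in X. rewrite !eisq_0, pq_0 in X. transitivity (c * 1)%C; [ring|]. rewrite <- X.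
  rewrite RtoC_opp, RtoC_div by lra. field.
Qed.

Lemma DE6 z : upper z -> Dk 6 (Eis 6) z = (RtoC (- (1 / 2)) * (Eis 4 z * Eis 4 z))%C.
Proof.
  intros Hz. destruct (Dk_modular 6 (Eis 6) (eisq 6) (q_holo_Eis 6) (eisq_hol 6) (fun z _ => EisE 6 z) HE6) as [HM HE].
  replace (INR 6) with 6 in * by (simpl; ring). replace (6 + 2) with (4 + 4) in HM by ring.
  assert (H44 : hol (fun q => eisq 4 q * eisq 4 q)%C 1) by (apply hol_mult; apply eisq_hol).
  destruct (modular_line (4 + 4) _ (fun z => Eis 4 z * Eis 4 z)%C (fun q => eisq 4 q * eisq 4 q)%C ltac:(lra) HM
    (modular_mult _ _ _ _ modular_E4 modular_E4) H44 (fun z _ => eq_refl)) as [c Hc].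
  { rewrite eisq_0. ring. }
  rewrite Hc by auto. f_equal.
  assert (X : dq 6 0 (eisq 6) 0%C = (c * (eisq 4 0 * eisq 4 0))%C).
  { apply (hol_qq_ext_0 _ (fun q => c * (eisq 4 q * eisq 4 q))%C); [apply dq_hol, eisq_hol|apply hol_scal; auto|].
    intros w Hw. rewrite <- HE, Hc by auto. reflexivity. }
  unfold dq in X. rewrite !eisq_0, pq_0 in X. transitivity (c * (1 * 1))%C; [ring|]. rewrite <- X.
  rewrite RtoC_opp, RtoC_div by lra. field.
Qed.

(** Ramanujan's identities form a linear system for (E4, E6) once one factor of E4^2 is read as a
    coefficient. If both vanished at omega, E4 would vanish identically, against its constant term
    1. *)
Lemma E6_omega : Eis 6 omega <> RtoC 0.
Proof.
  intros E.
  assert (Z : forall z, upper z -> Eis 4 z = RtoC 0).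
  { set (A := fun i j (z : C) => match i, j with
       | 0%nat, 0%nat => (tpi * - (4 * Pfun z))%C | 0%nat, _ => (tpi * RtoC (- (1 / 3)))%C
       | _, 0%nat => (tpi * (RtoC (- (1 / 2)) * Eis 4 z))%C | _, _ => (tpi * - (6 * Pfun z))%C end).
    assert (X : forall i z, (i < 2)%nat -> upper z -> (match i with 0%nat => Eis 4 z | _ => Eis 6 z end) = RtoC 0).
    { intros i z Hi Hz.
      assert (Y := linear_ode_zero 2 (fun i => match i with 0%nat => Eis 4 | _ => Eis 6 end) A omega).
      assert (Hn : forall a, holo_H (fun z => - (a * Pfun z))%C).
      { intros a. apply (holo_ext (fun z => (- a) * Pfun z)%C); [intros; ring|]. apply holo_scal, Pfun_holo. }
      assert (HA : forall i j, (i < 2)%nat -> (j < 2)%nat -> holo_H (A i j)).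
      { intros [|[|i']] [|[|j']] Hi' Hj'; try lia; unfold A.
        - apply holo_scal, Hn.
        - apply holo_const.
        - apply holo_scal, holo_scal, Eis_holo.
        - apply holo_scal, Hn. }
      specialize (Y HA).
      specialize (Y ltac:(intros [|[|i']] w Hi' Hw; [| |lia];
        [eapply cd_to; [apply (Dk_cd 4); [apply Eis_holo|auto]|]; rewrite DE4 by auto; unfold A; cbn [csum]; ring
        |eapply cd_to; [apply (Dk_cd 6); [apply Eis_holo|auto]|]; rewrite DE6 by auto; unfold A; cbn [csum]; ring])).
      specialize (Y upper_omega ltac:(intros [|[|i']] Hi'; [apply E4_omega|exact E|lia]) i z Hi Hz).
      destruct i; exact Y. }
    intros z Hz. exact (X 0%nat z ltac:(lia) Hz). }
  pose proof (hol_zero_at_0 (eisq 4) (eisq_hol 4) (fun z Hz => Z z Hz)) as X. rewrite eisq_0 in X.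
  revert X. apply RtoC_neq_0. lra.
Qed.

(** The left side vanishes at the cusp, hence is a constant times Delta; at omega only E6^2
    survives, so the constant is not 0. *)
Lemma Delta_E4E6 : exists kap, kap <> RtoC 0 /\ forall z, upper z ->
  (Eis 4 z * (Eis 4 z * Eis 4 z) - Eis 6 z * Eis 6 z)%C = (kap * Delta_q z)%C.
Proof.
  pose proof (modular_mult _ _ _ _ modular_E4 (modular_mult _ _ _ _ modular_E4 modular_E4)) as A.
  pose proof (modular_mult _ _ _ _ modular_E6 modular_E6) as B.
  replace (4 + (4 + 4)) with 12 in A by ring. replace (6 + 6) with 12 in B by ring.
  destruct (modular_cusp 12 (fun z => Eis 4 z * (Eis 4 z * Eis 4 z) + (-1) * (Eis 6 z * Eis 6 z))%C
    (fun q => eisq 4 q * (eisq 4 q * eisq 4 q) + (-1) * (eisq 6 q * eisq 6 q))%C) as [f' [Hf' E]].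
  - apply modular_plus; [auto|apply modular_scal; auto].
  - apply (hol_plus (fun q => eisq 4 q * (eisq 4 q * eisq 4 q))%C (fun q => (-1) * (eisq 6 q * eisq 6 q))%C).
    + apply (hol_mult (eisq 4)); [apply eisq_hol|apply (hol_mult (eisq 4)); apply eisq_hol].
    + apply (hol_scal (-1)%C), (hol_mult (eisq 6)); apply eisq_hol.
  - reflexivity.
  - rewrite !eisq_0. ring.
  - replace (12 - 12) with 0 in Hf' by ring. destruct (modular_const f' Hf') as [c Hc].
    exists c. assert (E2 : forall z, upper z ->
       (Eis 4 z * (Eis 4 z * Eis 4 z) - Eis 6 z * Eis 6 z)%C = (c * Delta_q z)%C).
    { intros z Hz. rewrite <- (Hc z Hz), (Cmult_comm (f' z)), <- E by auto. ring. }
    split; [|exact E2]. intros ->. specialize (E2 omega upper_omega). rewrite E4_omega in E2.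
    assert (X : (Eis 6 omega * Eis 6 omega)%C = RtoC 0).
    { transitivity (- (0 * (0 * 0) - Eis 6 omega * Eis 6 omega))%C; [ring|]. rewrite E2. ring. }
    revert X. apply Cmult_neq_0; apply E6_omega.
Qed.

(* f^2 = c E4 and f^3 = d E6, evaluated at the zero of E4. *)
Lemma modular_2 f : modular 2 f -> forall z, upper z -> f z = RtoC 0.
Proof.
  intros Hf.
  pose proof (modular_mult _ _ _ _ Hf Hf) as H2. replace (2 + 2) with 4 in H2 by ring.
  pose proof (modular_mult _ _ _ _ Hf H2) as H3. replace (2 + 4) with 6 in H3 by ring.
  destruct (modular_line 4 _ _ _ ltac:(lra) H2 modular_E4 (eisq_hol 4) (fun z _ => EisE 4 z) (eisq_0 4)) as [c Hc].
  destruct (modular_line 6 _ _ _ ltac:(lra) H3 modular_E6 (eisq_hol 6) (fun z _ => EisE 6 z) (eisq_0 6)) as [d Hd].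
  cbv beta in Hc, Hd.
  assert (F0 : f omega = RtoC 0).
  { pose proof (Hc omega upper_omega) as X. rewrite E4_omega in X. replace (c * 0)%C with (RtoC 0) in X by ring.
    apply C_integral in X. destruct X; auto. }
  assert (D0 : d = RtoC 0).
  { pose proof (Hd omega upper_omega) as X. rewrite F0 in X. symmetry in X.
    replace (0 * (0 * 0))%C with (RtoC 0) in X by ring. apply C_integral in X.
    destruct X as [X|X]; [auto|exfalso; revert X; apply E6_omega]. }
  intros z Hz. specialize (Hd z Hz). rewrite D0 in Hd. replace (0 * Eis 6 z)%C with (RtoC 0) in Hd by ring.
  apply C_integral in Hd. destruct Hd as [|Hd]; [auto|]. apply C_integral in Hd. destruct Hd; auto.
Qed.
End ModularForms.

(** * The ring M and its monomials *)

Lemma inM_ext f g : (forall z, upper z -> f z = g z) -> inM f -> inM g.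
Proof. intros H [l Hl]. exists l. intros z Hz. rewrite <- H by auto. auto. Qed.
Lemma inM_zero : inM (fun _ => RtoC 0).
Proof. exists nil. reflexivity. Qed.
Lemma monos_app l l' z : monos (l ++ l') z = (monos l z + monos l' z)%C.
Proof.
  unfold monos. induction l as [|t l IH]; cbn [app map fold_right]; [ring|]. rewrite IH. ring.
Qed.
Lemma inM_plus f g : inM f -> inM g -> inM (fun z => f z + g z)%C.
Proof. intros [l Hl] [l' Hl']. exists (l ++ l'). intros z Hz. rewrite monos_app, Hl, Hl' by auto. reflexivity. Qed.
Lemma inM_monomial c a b : inM (fun z => c * Cpown (Eis 4 z) a * Cpown (Eis 6 z) b)%C.
Proof. exists ((c, a, b) :: nil). intros z Hz. unfold monos. cbn [map fold_right]. ring. Qed.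
Lemma Cpown_add w a b : Cpown w (a + b) = (Cpown w a * Cpown w b)%C.
Proof. induction a; cbn [Cpown Nat.add]; [ring|]. rewrite IHa. ring. Qed.
Lemma inM_monomial_mult c a b f : inM f -> inM (fun z => c * Cpown (Eis 4 z) a * Cpown (Eis 6 z) b * f z)%C.
Proof.
  intros [l Hl]. revert f Hl. induction l as [|[[c' a'] b'] l IH]; intros f Hl.
  - apply (inM_ext (fun _ => RtoC 0)); [|apply inM_zero]. intros z Hz. rewrite Hl by auto. unfold monos. simpl. ring.
  - apply (inM_ext (fun z => (c * c') * Cpown (Eis 4 z) (a + a') * Cpown (Eis 6 z) (b + b')
                      + c * Cpown (Eis 4 z) a * Cpown (Eis 6 z) b * monos l z)%C).
    + intros z Hz. rewrite Hl by auto. rewrite !Cpown_add. unfold monos. cbn [map fold_right]. ring.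
    + apply inM_plus; [apply inM_monomial|apply IH; reflexivity].
Qed.
Lemma inM_mult f g : inM f -> inM g -> inM (fun z => f z * g z)%C.
Proof.
  intros [l Hl] Hg. revert f Hl. induction l as [|[[c a] b] l IH]; intros f Hl.
  - apply (inM_ext (fun _ => RtoC 0)); [|apply inM_zero]. intros z Hz. rewrite Hl by auto. unfold monos. simpl. ring.
  - apply (inM_ext (fun z => c * Cpown (Eis 4 z) a * Cpown (Eis 6 z) b * g z + monos l z * g z)%C).
    + intros z Hz. rewrite Hl by auto. unfold monos. cbn [map fold_right]. ring.
    + apply inM_plus; [apply inM_monomial_mult; auto|apply (IH (monos l)); reflexivity].
Qed.

(* A monomial in E4, E6 of weight 2k; it exists for every k except 1, where this is junk. *)
Definition mono_exp (k : nat) : nat * nat :=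
  if Nat.even k then (k / 2, 0)%nat else ((k - 3) / 2, 1)%nat.
Definition mono (k : nat) (z : C) : C :=
  (Cpown (Eis 4 z) (fst (mono_exp k)) * Cpown (Eis 6 z) (snd (mono_exp k)))%C.
Definition monoq (k : nat) (q : C) : C :=
  (Cpown (eisq 4 q) (fst (mono_exp k)) * Cpown (eisq 6 q) (snd (mono_exp k)))%C.

Lemma mono_weight k : k <> 1%nat -> (4 * fst (mono_exp k) + 6 * snd (mono_exp k) = 2 * k)%nat.
Proof.
  intros H. unfold mono_exp. destruct (Nat.even k) eqn:E.
  - apply Nat.even_spec in E. destruct E as [p ->]. cbn [fst snd]. rewrite (Nat.mul_comm 2 p), Nat.div_mul by lia. lia.
  - assert (O : Nat.odd k = true) by (unfold Nat.odd; rewrite E; reflexivity).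
    apply Nat.odd_spec in O. destruct O as [p ->]. cbn [fst snd].
    replace (2 * p + 1 - 3)%nat with ((p - 1) * 2)%nat by lia. rewrite Nat.div_mul by lia. lia.
Qed.
Lemma monoq_hol k : hol (monoq k) 1.
Proof. apply hol_mult; apply hol_pown, eisq_hol. Qed.
Lemma monoq_0 k : monoq k 0%C = RtoC 1.
Proof.
  unfold monoq. rewrite !eisq_0. assert (H : forall n, Cpown 1 n = RtoC 1).
  { induction n; cbn [Cpown]; [reflexivity|]. rewrite IHn. ring. }
  rewrite !H. ring.
Qed.
Lemma mono_E k z : mono k z = monoq k (qq z).
Proof. unfold mono, monoq. rewrite !EisE. reflexivity. Qed.
Lemma modular_pown w f n : modular w f -> modular (INR n * w) (fun z => Cpown (f z) n).
Proof.
  intros Hf. induction n.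
  - simpl. rewrite Rmult_0_l. apply modular_one.
  - replace (INR (S n) * w) with (w + INR n * w) by (rewrite S_INR; ring). apply modular_mult; auto.
Qed.

Section Structure.
Hypotheses (HDel : weight_law 12 Smat Delta_q) (HE4 : weight_law 4 Smat (Eis 4)) (HE6 : weight_law 6 Smat (Eis 6))
  (HP : forall g z, upper z -> P_defect g z = RtoC 0).

Lemma modular_mono k : k <> 1%nat -> modular (2 * INR k) (mono k).
Proof.
  intros Hk. pose proof (mono_weight k Hk) as H.
  replace (2 * INR k) with (INR (fst (mono_exp k)) * 4 + INR (snd (mono_exp k)) * 6).
  - apply modular_mult; apply modular_pown; [apply modular_E4|apply modular_E6]; auto.
  - apply (f_equal INR) in H. rewrite plus_INR, !mult_INR in H. simpl in H. lra.
Qed.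

Lemma inM_Delta : inM Delta_q.
Proof.
  destruct (Delta_E4E6 HDel HE4 HE6 HP) as (kap & Hk & E).
  apply (inM_ext (fun z => (/ kap) * Cpown (Eis 4 z) 3 * Cpown (Eis 6 z) 0 + (- / kap) * Cpown (Eis 4 z) 0 * Cpown (Eis 6 z) 2)%C).
  - intros z Hz. transitivity (/ kap * (kap * Delta_q z))%C; [|field; auto].
    rewrite <- E by auto. cbn [Cpown]. field. auto.
  - apply inM_plus; apply inM_monomial.
Qed.

(** Induction on an upper bound for the weight: subtract a multiple of a monomial of the same
    weight, divide by Delta, and use that Delta lies in M. Weight 2, which has no monomial, carries
    no nonzero form. *)
Theorem modular_inM w f : modular w f -> inM f.
Proof.
  assert (Ind : forall N w f, w < 2 * INR N -> modular w f -> inM f).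
  { clear w f. induction N; intros w f Hw Hf.
    - apply (inM_ext (fun _ => RtoC 0)); [|apply inM_zero]. intros z Hz. symmetry.
      apply (modular_negative w); auto. simpl in Hw. lra.
    - destruct (classic (exists z, upper z /\ f z <> RtoC 0)) as [[z [Hz Hn]]|Hn].
      + destruct (modular_even w f z Hf Hz Hn) as [n En].
        destruct (Z_lt_le_dec n 0) as [Hneg|Hpos].
        { exfalso. apply Hn, (modular_negative w f Hf); auto. apply IZR_lt in Hneg. lra. }
        destruct (IZN n Hpos) as [k ->]. rewrite <- INR_IZR_INZ in En. subst w.
        destruct (Nat.eq_dec k 1) as [->|Hk].
        { exfalso. apply Hn, (modular_2 HDel HE4 HE6 HP); auto. replace 2 with (2 * INR 1) by (simpl; ring). auto. }
        destruct (modular_decompose HDel (2 * INR k) f (mono k) (monoq k) Hf (modular_mono k Hk) (monoq_hol k)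
          (fun z _ => mono_E k z) (monoq_0 k)) as (c & f' & Hf' & E).
        apply (inM_ext (fun z => c * mono k z + Delta_q z * f' z)%C); [intros; symmetry; auto|].
        apply inM_plus; [|apply inM_mult; [apply inM_Delta|]].
        * apply (inM_ext (fun z => c * Cpown (Eis 4 z) (fst (mono_exp k)) * Cpown (Eis 6 z) (snd (mono_exp k)))%C);
            [intros; unfold mono; ring|apply inM_monomial].
        * apply (IHN (2 * INR k - 12) f'); [rewrite S_INR in Hw; lra|auto].
      + apply (inM_ext (fun _ => RtoC 0)); [|apply inM_zero]. intros z Hz. symmetry.
        apply NNPP. intros X. apply Hn. exists z. auto. }
  intros Hf. destruct (archimed_cor1 (/ (Rmax w 1))) as [N [H1 H2]].
  { apply Rinv_0_lt_compat. pose proof (Rmax_r w 1). lra. }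
  apply (Ind N w f); [|auto].
  assert (HN : 0 < INR N) by (apply lt_0_INR; lia).
  apply Rinv_lt_cancel in H1; [|auto]. pose proof (Rmax_l w 1). lra.
Qed.
End Structure.

(** * The basis *)

Lemma transforms_at w rho v F g z i : unitv v -> transforms w rho v F -> upper z -> (i < 5)%nat ->
  F i (mobius g z) = (v g * Cpow (jfac g z) (RtoC w) * mat_vec (rho g) (fun j => F j z) i)%C.
Proof.
  intros Hv HF Hz Hi. unfold mat_vec. rewrite <- (HF g z i Hz Hi). rewrite Cpow_opp by (apply jfac_neq0; auto).
  field. split; [apply Cpow_nz, jfac_neq0; auto|apply Hv].
Qed.

Lemma transforms_of w rho v F : unitv v -> (forall g z i, upper z -> (i < 5)%nat ->
  F i (mobius g z) = (v g * Cpow (jfac g z) (RtoC w) * mat_vec (rho g) (fun j => F j z) i)%C) ->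
  transforms w rho v F.
Proof.
  intros Hv H g z i Hz Hi. rewrite H by auto. rewrite Cpow_opp by (apply jfac_neq0; auto).
  unfold mat_vec, dim5. field. split; [apply Cpow_nz, jfac_neq0; auto|apply Hv].
Qed.

Lemma mat_vec_csum M n (x : nat -> C) (Y : nat -> vec) i :
  mat_vec M (fun j => csum n (fun l => x l * Y l j)%C) i = csum n (fun l => (x l * mat_vec M (Y l) i)%C).
Proof.
  unfold mat_vec. induction n; cbn [csum].
  - unfold dim5. cbn [csum]. ring.
  - rewrite <- IHn. unfold dim5. cbn [csum]. ring.
Qed.

Lemma transforms_mult w n rho v f F : unitv v -> (forall g, weight_law n g f) -> transforms w rho v F ->
  transforms (w + INR n) rho v (vscale f F).
Proof.
  intros Hv Hf HF. apply transforms_of; [auto|]. intros g z i Hz Hi. unfold vscale.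
  rewrite (Hf g z Hz), (transforms_at w rho v F g z i Hv HF Hz Hi).
  rewrite Cpow_plus, Cpow_INR by (apply jfac_neq0; auto).
  unfold mat_vec, dim5. cbn [csum]. ring.
Qed.

Lemma transforms_plus w rho v F F' : transforms w rho v F -> transforms w rho v F' ->
  transforms w rho v (fun i z => F i z + F' i z)%C.
Proof.
  intros H H' g z i Hz Hi. rewrite Cmult_plus_distr_l, H, H' by auto. cbn [csum dim5]. unfold dim5. cbn [csum]. ring.
Qed.
Lemma transforms_scal w rho v c F : transforms w rho v F -> transforms w rho v (fun i z => c * F i z)%C.
Proof.
  intros H g z i Hz Hi. transitivity (c * (/ v g * Cpow (jfac g z) (RtoC (- w)) * F i (mobius g z)))%C; [ring|].
  rewrite H by auto. unfold dim5. cbn [csum]. ring.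
Qed.
Lemma transforms_ext w rho v F F' : vfeqH F F' -> transforms w rho v F -> transforms w rho v F'.
Proof.
  intros E H g z i Hz Hi. rewrite <- E by (auto; apply mobius_upper; auto). rewrite H by auto.
  apply csum_ext. intros j Hj. rewrite E by auto. reflexivity.
Qed.

(* The two expansions of H(gz) in the pointwise basis rho(g) Y_n(z) are compared. *)
Lemma coefficient_law rho v w (wn : nat -> R) (Y : nat -> vfun) (H : vfun) (e : nat -> C -> C) :
  unitv v -> (forall g, invertible (rho g)) ->
  (forall n, (n < 5)%nat -> transforms (wn n) rho v (Y n)) -> transforms w rho v H ->
  (forall z (x : nat -> C), upper z ->
     (forall i, (i < 5)%nat -> csum 5 (fun n => x n * Y n i z)%C = RtoC 0) -> forall n, (n < 5)%nat -> x n = RtoC 0) ->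
  (forall z i, upper z -> (i < 5)%nat -> H i z = csum 5 (fun n => e n z * Y n i z)%C) ->
  forall g z n, upper z -> (n < 5)%nat -> e n (mobius g z) = (Cpow (jfac g z) (RtoC (w - wn n)) * e n z)%C.
Proof.
  intros Hv Hrho HY HH Hind HE g z n Hz Hn.
  assert (Hj : jfac g z <> RtoC 0) by (apply jfac_neq0; auto).
  set (J := jfac g z) in *.
  set (x := fun n => (Cpow J (RtoC w) * e n z - Cpow J (RtoC (wn n)) * e n (mobius g z))%C).
  assert (X : forall n, (n < 5)%nat -> x n = RtoC 0).
  { apply (Hind z x Hz). apply (invertible_injective (rho g) (fun i => csum 5 (fun n => x n * Y n i z)%C) (Hrho g)).
    intros i Hi. rewrite (mat_vec_csum (rho g) 5 x (fun n j => Y n j z)).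
    pose proof (transforms_at w rho v H g z i Hv HH Hz Hi) as A. fold J in A.
    rewrite (HE (mobius g z) i) in A by (auto; apply mobius_upper; auto).
    rewrite (csum_ext 5 _ (fun n => (v g * (Cpow J (RtoC (wn n)) * e n (mobius g z)) * mat_vec (rho g) (fun j => Y n j z) i)%C)) in A.
    2: { intros l Hl. rewrite (transforms_at (wn l) rho v (Y l) g z i Hv (HY l Hl) Hz Hi). fold J. ring. }
    rewrite (mat_vec_ext (rho g) (rho g) (fun j => H j z) (fun j => csum 5 (fun n => e n z * Y n j z)%C) i Hi) in A;
      [|intros a b _ _; reflexivity|intros j Hj'; apply HE; auto].
    rewrite (mat_vec_csum (rho g) 5 (fun n => e n z) (fun n j => Y n j z)) in A.
    cbn [csum] in A. unfold x, vzero. cbn [csum].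
    pose proof (Hv g) as Hvg.
    match type of A with (?l = ?r)%C => transitivity ((r - l) / v g)%C; [field; auto|rewrite A; field; auto] end. }
  specialize (X n Hn). unfold x in X. unfold Rminus. rewrite Cpow_plus, Cpow_opp by auto.
  assert (Hp : Cpow J (RtoC (wn n)) <> RtoC 0) by (apply Cpow_nz; auto).
  transitivity ((Cpow J (RtoC w) * e n z - (Cpow J (RtoC w) * e n z - Cpow J (RtoC (wn n)) * e n (mobius g z))) / Cpow J (RtoC (wn n)))%C;
    [field; auto|]. rewrite X. field. auto.
Qed.

Lemma transforms_Dn k rho v F n : (forall g z, upper z -> P_defect g z = RtoC 0) -> unitv v ->
  (forall i, (i < 5)%nat -> holo_H (F i)) -> transforms k rho v F -> transforms (k + 2 * INR n) rho v (vDn n k F).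
Proof.
  intros HP Hv HF HT. induction n.
  - simpl. replace (k + 2 * 0) with k by ring. exact HT.
  - replace (k + 2 * INR (S n)) with (k + 2 * INR n + 2) by (rewrite S_INR; ring).
    apply (transforms_D HP (k + 2 * INR n) rho v (vDn n k F) Hv); [|auto].
    intros i Hi. apply Dn_holo, HF; auto.
Qed.

(** The equation 4a + 6b = 4 has the single solution (1, 0). *)
Lemma inMw4_E4 f : inMw 4 f -> exists a, forall z, upper z -> f z = (a * Eis 4 z)%C.
Proof.
  intros [l [Hl E]].
  assert (X : exists a, forall z, monos l z = (a * Eis 4 z)%C).
  { clear E. induction l as [|[[a p] q] l IH].
    - exists (RtoC 0). intros z. unfold monos. simpl. ring.
    - destruct IH as [b Hb]; [intros t Ht; apply Hl; right; auto|].
      pose proof (Hl _ (or_introl eq_refl)) as W. cbv beta iota in W.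
      assert (p = 1%nat) by lia. assert (q = 0%nat) by lia. subst.
      exists (a + b)%C. intros z. specialize (Hb z). unfold monos in *. cbn [map fold_right]. rewrite Hb.
      cbn [Cpown]. ring. }
  destruct X as [a Ha]. exists a. intros z Hz. rewrite E by auto. apply Ha.
Qed.

Lemma det5_hol (M : nat -> nat -> C -> C) Rd : (forall i j, (i < 5)%nat -> (j < 5)%nat -> hol (M i j) Rd) ->
  hol (fun q => det5 (fun i j => M i j q)) Rd.
Proof.
  apply (@det5_closed C (fun f => hol f Rd)).
  - intros a. apply hol_const.
  - intros f h. apply hol_plus.
  - intros f h. apply hol_mult.
Qed.
Lemma adj5_hol (M : nat -> nat -> C -> C) Rd a b : (forall i j, (i < 5)%nat -> (j < 5)%nat -> hol (M i j) Rd) ->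
  hol (fun q => adj5 (fun i j => M i j q) a b) Rd.
Proof.
  apply (@adj5_closed C (fun f => hol f Rd)).
  - intros x. apply hol_const.
  - intros f h. apply hol_plus.
  - intros f h. apply hol_mult.
Qed.

Lemma finite_choice {A : Type} (n : nat) (P : nat -> A -> Prop) : inhabited A ->
  (forall j, (j < n)%nat -> exists a, P j a) -> exists f : nat -> A, forall j, (j < n)%nat -> P j (f j).
Proof.
  intros [a0] H. exists (fun j => epsilon (inhabits a0) (P j)). intros j Hj.
  apply epsilon_spec, H; auto.
Qed.

Section Setup.
Variables (rho : SL2Z -> mat) (v : SL2Z -> C) (k0 m k1 : R) (r lamt : nat -> R) (L : mat) (F1 G : vfun)
  (M4 M6 M8 M10 : C -> C) (c : nat -> C).
Hypotheses (Hrep : representation rho) (Hirr : irreducible rho) (Hmult : multiplier_system k0 v)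
  (Hr : increasing01 r) (HvT : v Tmat = ee (RtoC (m / 12)))
  (HLd : det5 L <> RtoC 0)
  (HLn : forall j, (j < 5)%nat -> ~ veq (L j) vzero)
  (HLe : forall j i, (j < 5)%nat -> (i < 5)%nat ->
     csum 5 (fun a => L j a * rho Tmat a i)%C = (ee (RtoC (r j)) * L j i)%C)
  (Hlt : forall j, lamt j = frac_part (r j + m / 12))
  (Hk1 : k1 = 12 / 5 * (lamt 0%nat + lamt 1%nat + lamt 2%nat + lamt 3%nat + lamt 4%nat + 1) - 4)
  (HF1 : Hk k1 rho v F1)
  (H4 : inMw 4 M4) (H6 : inMw 6 M6) (H8 : inMw 8 M8) (H10 : inMw 10 M10)
  (Hroots : has_indicial_roots k1 M4 M6 M8 M10
        (fun j => match j with O => lamt 0%nat + 1 | _ => lamt j end))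
  (Hode : forall i z, (i < 5)%nat -> upper z -> mlde5 k1 M4 M6 M8 M10 (F1 i) z = RtoC 0)
  (Hind : forall c : nat -> C, (forall z, upper z -> csum 5 (fun i => (c i * F1 i z)%C) = RtoC 0) ->
     forall i, (i < 5)%nat -> c i = RtoC 0)
  (HG : Hk k1 rho v G) (HGnz : ~ vfeqH G vfzero)
  (HDG : vfeqH (vscale Delta_q G)
        (fun i z => (c 0%nat * Eis 4 z * vDn 4 k1 F1 i z
                   + c 1%nat * Eis 6 z * vDn 3 k1 F1 i z
                   + c 2%nat * Eis 8 z * vDn 2 k1 F1 i z
                   + c 3%nat * Eis 10 z * vDn 1 k1 F1 i z
                   + c 4%nat * Eis 12 z * F1 i z)%C)).

Let Hv : unitv v.
Proof. apply (multiplier_unit k0). exact Hmult. Qed.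
Let HF1h : forall i, (i < 5)%nat -> holo_H (F1 i).
Proof. intros i Hi. apply (proj1 HF1 i Hi). Qed.
Let HGh : forall i, (i < 5)%nat -> holo_H (G i).
Proof. intros i Hi. apply (proj1 HG i Hi). Qed.

Lemma weight_pos : 0 < 5 * k1 + 20.
Proof.
  pose proof (lamt_range m r lamt Hlt). rewrite Hk1.
  pose proof (H 0%nat); pose proof (H 1%nat); pose proof (H 2%nat); pose proof (H 3%nat); pose proof (H 4%nat). lra.
Qed.

Lemma P_quasimodular g z : upper z -> P_defect g z = RtoC 0.
Proof.
  intros Hz. pose proof weight_pos as Hw.
  apply (P_defect_zero k1 M4 M6 M8 M10 F1 rho v); eauto using inMw_holo.
  - apply (proj1 Hrep).
  - apply (proj2 HF1).
  - lra.
Qed.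

Lemma Y_transforms n : transforms (k1 + 2 * INR n) rho v (vDn n k1 F1).
Proof. apply transforms_Dn; auto. exact P_quasimodular. apply (proj2 HF1). Qed.

Lemma Y_independent z (x : nat -> C) : upper z ->
  (forall i, (i < 5)%nat -> csum 5 (fun n => x n * vDn n k1 F1 i z)%C = RtoC 0) ->
  forall n, (n < 5)%nat -> x n = RtoC 0.
Proof.
  intros Hz Hx. apply (wronsk_indep k1 M4 M6 M8 M10) with (F := F1) (z := z); eauto using inMw_holo.
Qed.

Lemma c_lead : c 0%nat <> RtoC 0.
Proof. apply (c0_neq0 rho v m k1 r lamt L F1 M4 M6 M8 M10) with (G := G); eauto using inMw_q_holo. Qed.

Lemma c_ratio : c 1%nat = (c 0%nat * RtoC (lamt 0%nat - k1 / 12 + 1 / 3))%C.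
Proof. apply (c1_formula rho v m k1 r lamt L F1 M4 M6 M8 M10) with (G := G); eauto using inMw_q_holo. Qed.

Lemma no_resonance a : (a < 2)%nat -> lamt 0%nat - k1 / 12 = - INR a / 3 -> False.
Proof.
  intros Ha E. apply (resonance_impossible rho v k0 m k1 (r 0%nat) (L 0%nat) (fun n => vDn n k1 F1)) with (a := a) (lam := lamt 0%nat); auto.
  - intros n _. apply Y_transforms.
  - apply Y_independent.
  - apply HLn. lia.
  - intros i Hi. apply HLe; [lia|auto].
  - apply (lamt_ee m r lamt Hlt).
Qed.

Lemma c1_neq0 : c 1%nat <> RtoC 0.
Proof.
  rewrite c_ratio. apply Cmult_neq_0; [apply c_lead|]. apply RtoC_neq_0. intros E.
  apply (no_resonance 1); [lia|]. simpl. lra.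
Qed.

Lemma c1_neq_third : (c 1%nat - c 0%nat * RtoC (1 / 3))%C <> RtoC 0.
Proof.
  rewrite c_ratio. intros E. assert (X : (c 0%nat * RtoC (lamt 0%nat - k1 / 12))%C = RtoC 0).
  { rewrite <- E. rewrite RtoC_plus. ring. }
  apply C_integral in X. destruct X as [X|X]; [revert X; apply c_lead|].
  apply (no_resonance 0); [lia|]. apply RtoC_inj in X. simpl. lra.
Qed.

Definition ecoef (n : nat) (z : C) : C :=
  match n with
  | 0 => c 4%nat * Eis 12 z | 1 => c 3%nat * Eis 10 z | 2 => c 2%nat * Eis 8 z
  | 3 => c 1%nat * Eis 6 z | _ => c 0%nat * Eis 4 z end%C%nat.

Lemma DeltaG_expansion z i : upper z -> (i < 5)%nat ->
  vscale Delta_q G i z = csum 5 (fun n => ecoef n z * vDn n k1 F1 i z)%C.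
Proof.
  intros Hz Hi. rewrite HDG by auto. cbn [csum ecoef]. change (vDn 0 k1 F1 i z) with (F1 i z). ring.
Qed.

Lemma ecoef_law g n z : upper z -> (n < 5)%nat ->
  ecoef n (mobius g z) = (Cpow (jfac g z) (RtoC (12 - 2 * INR n)) * ecoef n z)%C.
Proof.
  intros Hz Hn.
  rewrite (coefficient_law rho v (k1 + INR 12) (fun n => k1 + 2 * INR n) (fun n => vDn n k1 F1) (vscale Delta_q G) ecoef); auto.
  - f_equal. f_equal. f_equal. simpl. ring.
  - apply (proj1 Hrep).
  - intros n' _. apply Y_transforms.
  - apply transforms_mult; [auto|apply Delta_law, P_quasimodular|apply (proj2 HG)].
  - apply Y_independent.
  - apply DeltaG_expansion.
Qed.

Lemma ecoef_weight_law n w g : (n < 5)%nat -> 12 - 2 * INR n = INR w -> weight_law w g (ecoef n).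
Proof.
  intros Hn E z Hz. rewrite ecoef_law by auto. rewrite E, Cpow_INR by (apply jfac_neq0; auto). reflexivity.
Qed.

Lemma weight_law_unscale w g a f : a <> RtoC 0 -> weight_law w g (fun z => a * f z)%C -> weight_law w g f.
Proof.
  intros Ha H z Hz. pose proof (H z Hz) as X. cbv beta in X.
  transitivity (/ a * (a * f (mobius g z)))%C; [field; auto|]. rewrite X. field. auto.
Qed.

Lemma E4_law g : weight_law 4 g (Eis 4).
Proof. apply (weight_law_unscale 4 g (c 0%nat)); [apply c_lead|]. apply (ecoef_weight_law 4); [lia|simpl; ring]. Qed.
Lemma E6_law g : weight_law 6 g (Eis 6).
Proof. apply (weight_law_unscale 6 g (c 1%nat)); [apply c1_neq0|]. apply (ecoef_weight_law 3); [lia|simpl; ring]. Qed.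
(** c_2 may be 0, so the law is kept for the product rather than for E8 alone. *)
Lemma E8_law g : weight_law 8 g (fun z => c 2%nat * Eis 8 z)%C.
Proof. apply (ecoef_weight_law 2); [lia|simpl; ring]. Qed.


(* Coefficients of Delta DG on D^n F1, the term D^5 F1 being eliminated by the MLDE. *)
Definition fcoef (n : nat) (z : C) : C :=
  (Dk (12 - 2 * INR n) (ecoef n) z +
   match n with
   | 0 => - (M10 z * ecoef 4 z)
   | 1 => ecoef 0 z - M8 z * ecoef 4 z
   | 2 => ecoef 1 z - M6 z * ecoef 4 z
   | 3 => ecoef 2 z - M4 z * ecoef 4 z
   | _ => ecoef 3 z end)%C%nat.

Lemma ecoef_holo n : holo_H (ecoef n).
Proof. destruct n as [|[|[|[|n]]]]; apply holo_scal, Eis_holo. Qed.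

(** D_12 kills Delta, so Delta DG is D applied to the expansion of Delta G. D^5 F1 then arises from
    the D^4 F1 term only. *)
Lemma DeltaDG_expansion z i : upper z -> (i < 5)%nat ->
  (Delta_q z * Dk k1 (G i) z)%C = csum 5 (fun n => fcoef n z * vDn n k1 F1 i z)%C.
Proof.
  intros Hz Hi.
  assert (HY : forall n, holo_H (fun w => vDn n k1 F1 i w)) by (intros n; apply Dn_holo; auto).
  transitivity (Dk (12 + k1) (fun w => csum 5 (fun n => ecoef n w * vDn n k1 F1 i w))%C z).
  - rewrite <- (Dk_ext (12 + k1) (fun w => Delta_q w * G i w)%C).
    + rewrite Dk_mult by (auto; apply Delta_holo). rewrite Dk_Delta by auto. ring.
    + intros w Hw. apply DeltaG_expansion; auto.
    + auto.
    + apply holo_mult; [apply Delta_holo|auto].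
  - assert (HeY : forall n, (n < 5)%nat -> holo_H (fun w => ecoef n w * vDn n k1 F1 i w)%C)
      by (intros n _; exact (holo_mult (ecoef n) _ (ecoef_holo n) (HY n))).
    rewrite (Dk_csum (12 + k1) 5 (fun n w => ecoef n w * vDn n k1 F1 i w)%C z Hz HeY).
    rewrite (csum_ext 5 _ (fun n => Dk (12 - 2 * INR n) (ecoef n) z * vDn n k1 F1 i z + ecoef n z * vDn (S n) k1 F1 i z)%C).
    + pose proof (mlde5_eq k1 M4 M6 M8 M10 (F1 i) z (Hode i z Hi Hz)) as E5.
      change (vDn 5 k1 F1 i z = - (M4 z * vDn 3 k1 F1 i z + M6 z * vDn 2 k1 F1 i z
        + M8 z * vDn 1 k1 F1 i z + M10 z * vDn 0 k1 F1 i z))%C in E5.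
      cbn [csum]. rewrite E5. unfold fcoef. ring.
    + intros n Hn. replace (12 + k1) with ((12 - 2 * INR n) + (k1 + 2 * INR n)) by ring.
      rewrite (Dk_mult (12 - 2 * INR n) (k1 + 2 * INR n) (ecoef n) (fun w => vDn n k1 F1 i w)) by (auto; apply ecoef_holo).
      reflexivity.
Qed.

(** The minor on the rows of D^3 F1 and D^4 F1. The columns of F1, DF1 and D^2 F1 are unit vectors,
    so the determinant of the candidate basis reduces to it. *)
Definition Theta (z : C) : C := (ecoef 3 z * fcoef 4 z - fcoef 3 z * ecoef 4 z)%C.

(** c_2 E8 is a multiple of E4^2 by one-dimensionality in weight 8, and M4 is a multiple of E4;
    hence every term other than E6^2 is a multiple of E4^3, which vanishes at omega. *)
Lemma Theta_form : exists b, forall z, upper z -> Theta z =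
  (c 1%nat * (c 1%nat - c 0%nat * RtoC (1 / 3)) * (Eis 6 z * Eis 6 z) + b * (Eis 4 z * (Eis 4 z * Eis 4 z)))%C.
Proof.
  destruct (inMw4_E4 M4 H4) as [a Ha].
  pose proof (weight_law_modular 8 (fun z => c 2%nat * Eis 8 z)%C) as X8.
  replace (INR 8) with (4 + 4) in X8 by (simpl; ring).
  destruct (modular_line (Delta_law P_quasimodular Smat) (4 + 4) (fun z => c 2%nat * Eis 8 z)%C (fun z => Eis 4 z * Eis 4 z)%C
    (fun q => eisq 4 q * eisq 4 q)%C) as [b Hb].
  - lra.
  - apply X8; [apply q_holo_mult; [apply q_holo_const|apply q_holo_Eis]|apply E8_law].
  - apply modular_mult; apply modular_E4, E4_law.
  - apply (hol_mult (eisq 4)); apply eisq_hol.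
  - reflexivity.
  - rewrite !eisq_0. ring.
  - exists (c 0%nat * (c 1%nat * RtoC (1 / 2) - b + c 0%nat * a))%C. intros z Hz.
    pose proof (DE4 (Delta_law P_quasimodular Smat) (E4_law Smat) (E6_law Smat) P_quasimodular z Hz) as D4.
    pose proof (DE6 (Delta_law P_quasimodular Smat) (E4_law Smat) (E6_law Smat) P_quasimodular z Hz) as D6.
    unfold Theta, fcoef. replace (12 - 2 * INR 4) with 4 by (simpl; ring). replace (12 - 2 * INR 3) with 6 by (simpl; ring).
    change (ecoef 4) with (fun z => c 0%nat * Eis 4 z)%C. change (ecoef 3) with (fun z => c 1%nat * Eis 6 z)%C.
    change (ecoef 2) with (fun z => c 2%nat * Eis 8 z)%C. cbv beta.
    rewrite (Dk_scal 4 _ (Eis 4) z Hz (Eis_holo 4)), (Dk_scal 6 _ (Eis 6) z Hz (Eis_holo 6)).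
    rewrite D4, D6, Ha, Hb, !RtoC_opp by auto. ring.
Qed.

Lemma Theta_modular : modular 12 Theta.
Proof.
  destruct Theta_form as [b Hb].
  apply (modular_ext 12 (fun z => c 1%nat * (c 1%nat - c 0%nat * RtoC (1 / 3)) * (Eis 6 z * Eis 6 z)
                     + b * (Eis 4 z * (Eis 4 z * Eis 4 z)))%C); [intros; symmetry; auto|].
  pose proof (modular_E4 (E4_law Smat)) as A4. pose proof (modular_E6 (E6_law Smat)) as A6.
  apply modular_plus; apply modular_scal.
  - replace 12 with (6 + 6) by ring. apply modular_mult; auto.
  - replace 12 with (4 + (4 + 4)) by ring. apply modular_mult; [auto|apply modular_mult; auto].
Qed.

Lemma Theta_omega : Theta omega <> RtoC 0.
Proof.
  destruct Theta_form as [b Hb]. rewrite Hb by apply upper_omega.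
  pose proof (Delta_law P_quasimodular Smat) as HD. pose proof (E4_law Smat) as X4. pose proof (E6_law Smat) as X6.
  rewrite E4_omega by auto. replace (_ + _)%C with (c 1%nat * (c 1%nat - c 0%nat * RtoC (1 / 3)) * (Eis 6 omega * Eis 6 omega))%C by ring.
  pose proof (E6_omega HD X4 X6 P_quasimodular) as N6.
  repeat apply Cmult_neq_0; auto using c1_neq0, c1_neq_third.
Qed.

(** The derivatives of F1 come first, so that the coordinate matrix [Xmat] starts with a unit block;
    the order of the theorem is restored at the end. *)
Definition Bfun (i : nat) : vfun :=
  match i with
  | 0 => F1 | 1 => vDn 1 k1 F1 | 2 => vDn 2 k1 F1 | 3 => G | _ => vDn 1 k1 G end%nat.
Definition Xmat (z : C) : mat := fun n i =>
  if Nat.ltb i 3 then mat_id n i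
  else if Nat.eqb i 3 then (ecoef n z / Delta_q z)%C else (fcoef n z / Delta_q z)%C.

Lemma Bfun_Y i a z : (i < 5)%nat -> (a < 5)%nat -> upper z ->
  Bfun i a z = csum 5 (fun n => vDn n k1 F1 a z * Xmat z n i)%C.
Proof.
  intros Hi Ha Hz. pose proof (Delta_neq0 z Hz) as Hd.
  destruct i as [|[|[|[|[|i]]]]]; [| | | | |lia].
  - cbn. unfold vDn. cbn [Dn]. ring.
  - cbn [Bfun csum Xmat Nat.ltb Nat.leb]. unfold mat_id. cbn [Nat.eqb]. ring.
  - cbn [Bfun csum Xmat Nat.ltb Nat.leb]. unfold mat_id. cbn [Nat.eqb]. ring.
  - cbn [Bfun]. transitivity (vscale Delta_q G a z / Delta_q z)%C; [unfold vscale; field; auto|].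
    rewrite DeltaG_expansion by auto. cbn [csum Xmat Nat.ltb Nat.leb Nat.eqb]. field. auto.
  - cbn [Bfun]. transitivity (Delta_q z * Dk k1 (G a) z / Delta_q z)%C.
    { unfold vDn. cbn [Dn]. replace (k1 + 2 * INR 0) with k1 by (simpl; ring). field. auto. }
    rewrite DeltaDG_expansion by auto. cbn [csum Xmat Nat.ltb Nat.leb Nat.eqb]. field. auto.
Qed.

Lemma Xmat_det z : upper z -> det5 (Xmat z) = (Theta z / (Delta_q z * Delta_q z))%C.
Proof.
  intros Hz. pose proof (Delta_neq0 z Hz) as Hd. unfold Xmat.
  rewrite (det5_bordered (fun n => ecoef n z / Delta_q z)%C (fun n => fcoef n z / Delta_q z)%C).
  unfold Theta. field. auto.
Qed.

Lemma Bfun_admissible i : (i < 5)%nat -> admissible L lamt (Bfun i).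
Proof.
  intros Hi. pose proof (lamt_range m r lamt Hlt) as Hrng. pose proof (lamt_ee m r lamt Hlt) as Hee.
  pose proof (Hk_admissible rho v m r lamt L Hv HvT HLe Hrng Hee k1 F1 HF1) as A.
  pose proof (Hk_admissible rho v m r lamt L Hv HvT HLe Hrng Hee k1 G HG) as B.
  assert (A1 : admissible L lamt (vDn 1 k1 F1)) by (apply (admissible_D L lamt F1); auto).
  destruct i as [|[|[|[|i]]]]; cbn [Bfun]; auto.
  - apply (admissible_D L lamt (vDn 1 k1 F1)); [|auto]. intros a Ha. apply Dn_holo; auto.
  - apply (admissible_D L lamt G); auto.
Qed.

Definition Bweight (i : nat) : nat := match i with 0 | 3 => 0 | 2 => 2 | _ => 1 end%nat.

Lemma Bfun_Hk i : (i < 5)%nat -> Hk (k1 + 2 * INR (Bweight i)) rho v (Bfun i).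
Proof.
  intros Hi. split.
  - intros a Ha. split; [|apply (admissible_growth lamt L HLd (lamt_range m r lamt Hlt) _ (Bfun_admissible i Hi) a Ha)].
    destruct i as [|[|[|[|i]]]]; cbn [Bfun]; try apply Dn_holo; auto.
  - destruct i as [|[|[|[|i]]]]; cbn [Bfun Bweight].
    + replace (k1 + 2 * INR 0) with k1 by (simpl; ring). apply HF1.
    + apply Y_transforms.
    + apply Y_transforms.
    + replace (k1 + 2 * INR 0) with k1 by (simpl; ring). apply HG.
    + apply transforms_Dn; auto. exact P_quasimodular. apply HG.
Qed.

(* The first exponent of F1 exceeds lamt 0 by 1, whence the factor q in the first row. *)
Definition ybar (g : nat -> C -> C) (q : C) : mat := fun j n =>
  if Nat.eqb j 0 then (q * dqn n k1 (lead lamt j) (g j) q)%C else dqn n k1 (lead lamt j) (g j) q.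

Lemma ev_Y g j n z : (forall j, (j < 5)%nat -> hol (g j) 1 /\ g j 0%C <> RtoC 0 /\
    forall z, upper z -> ev L F1 j z = (ee (RtoC (lead lamt j) * z) * g j (qq z))%C) ->
  (j < 5)%nat -> upper z -> ev L (vDn n k1 F1) j z = (ee (RtoC (lamt j) * z) * ybar g (qq z) j n)%C.
Proof.
  intros Hg Hj Hz. destruct (Hg j Hj) as (Gh & _ & GE).
  change (vDn n k1 F1) with (fun i => Dn n k1 (F1 i)). rewrite <- ev_Dn by auto.
  rewrite (Dn_ext n k1 _ _ z GE Hz) by (apply ev_holo; auto). rewrite Dn_eeq by auto.
  unfold ybar. destruct j as [|j]; cbn [Nat.eqb].
  - unfold lead. rewrite RtoC_plus, Cmult_plus_distr_r, ee_plus.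
    replace (1 * z)%C with z by ring. unfold qq. ring.
  - reflexivity.
Qed.

(** Balance of powers of q: the first row of [ybar] brings one q, Theta = K Delta another, and
    Delta^2 in the denominator removes both. What is left is K det(yhat) / phi^24, without zeros in
    the disc. *)
Lemma normalized_basis : exists bhat : nat -> nat -> C -> C,
  (forall j i, (j < 5)%nat -> (i < 5)%nat -> hol (bhat j i) 1) /\
  (forall j i z, (j < 5)%nat -> (i < 5)%nat -> upper z ->
     ev L (Bfun i) j z = (ee (RtoC (lamt j) * z) * bhat j i (qq z))%C) /\
  (forall q, disc 1 q -> det5 (fun j i => bhat j i q) <> RtoC 0).
Proof.
  destruct (finite_choice 5 (fun j (b : nat -> C -> C) => forall i, (i < 5)%nat -> hol (b i) 1 /\
     forall z, upper z -> ev L (Bfun i) j z = (ee (RtoC (lamt j) * z) * b i (qq z))%C)) as [bhat Hb].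
  { constructor. exact (fun _ z => z). }
  { intros j Hj. apply (finite_choice 5 (fun i (h : C -> C) => hol h 1 /\
     forall z, upper z -> ev L (Bfun i) j z = (ee (RtoC (lamt j) * z) * h (qq z))%C)); [constructor; exact (fun z => z)|].
    intros i Hi. apply (Bfun_admissible i Hi j Hj). }
  destruct (finite_choice 5 (fun j (g : C -> C) => hol g 1 /\ g 0%C <> RtoC 0 /\
     forall z, upper z -> ev L F1 j z = (ee (RtoC (lead lamt j) * z) * g (qq z))%C)) as [g Hg].
  { constructor. exact (fun z => z). }
  { intros j Hj. apply (F1_leading rho v m k1 r lamt L F1 M4 M6 M8 M10); eauto using inMw_q_holo. }
  exists bhat.
  assert (BH : forall j i, (j < 5)%nat -> (i < 5)%nat -> hol (bhat j i) 1) by (intros j i Hj Hi; apply (Hb j Hj i Hi)).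
  split; [exact BH|]. split; [intros j i z Hj Hi; apply (Hb j Hj i Hi)|].
  set (yhat := fun (q : C) j n => dqn n k1 (lead lamt j) (g j) q).
  assert (YH : hol (fun q => det5 (yhat q)) 1).
  { apply (det5_hol (fun j n q => yhat q j n)). intros j n Hj Hn. apply dqn_hol, (Hg j Hj). }
  assert (DH : hol (fun q => det5 (fun j i => bhat j i q)) 1) by (apply det5_hol; exact BH).
  (* At q = 0 row j is g_j(0) times the Newton polynomials at the j-th leading exponent, and the
     five exponents are distinct. *)
  assert (Y0 : det5 (yhat 0%C) <> RtoC 0).
  { intros E. destruct (det5_0_kernel E) as [x [Hx Hk]]. apply Hx. intros n Hn.
    apply (newton_zero (newton_node k1) 5 x (fun j => RtoC (lead lamt j))).
    - intros i j Hi Hj Eij. apply RtoC_inj in Eij.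
      pose proof (lamt_distinct m r lamt Hr Hlt) as Hd.
      destruct i as [|i], j as [|j]; cbn [lead] in Eij; auto.
      + apply (Hd _ _ (-1)%Z); auto. simpl. lra.
      + apply (Hd _ _ 1%Z); auto. simpl. lra.
      + apply (Hd _ _ 0%Z); auto. simpl. lra.
    - intros j Hj. destruct (Hg j Hj) as (_ & G0 & _).
      pose proof (Hk j Hj) as X. unfold mat_vec, yhat, vzero in X.
      assert (X' : (g j 0 * csum 5 (fun i => x i * newton (newton_node k1) i (RtoC (lead lamt j))))%C = RtoC 0).
      { refine (eq_trans _ X). unfold dim5. cbn [csum]. rewrite !dqn_0. ring. }
      apply C_integral in X'. destruct X' as [X'|X']; [contradiction|exact X'].
    - exact Hn. }
  assert (Hyb : forall q, det5 (ybar g q) = (q * det5 (yhat q))%C) by (intros q; apply (det5_scale_row0 q (yhat q))).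
  (* Away from the cusp, [ybar] is the Wronskian matrix in the eigenbasis with the nonzero factors
     e(lamt_j z) removed. *)
  assert (Yn : forall z, upper z -> det5 (ybar g (qq z)) <> RtoC 0).
  { intros z Hz E. destruct (det5_0_kernel E) as [x [Hx Hk]]. apply Hx.
    intros n Hn. unfold vzero. apply (Y_independent z x Hz); [|exact Hn].
    apply (det5_injective L (fun i => csum 5 (fun n => x n * vDn n k1 F1 i z)%C) HLd).
    intros j Hj. rewrite (mat_vec_csum L 5 x (fun n i => vDn n k1 F1 i z)).
    transitivity (ee (RtoC (lamt j) * z) * mat_vec (ybar g (qq z)) x j)%C.
    - transitivity (csum 5 (fun n => x n * ev L (vDn n k1 F1) j z)%C); [reflexivity|].
      rewrite (csum_ext 5 _ (fun n => x n * (ee (RtoC (lamt j) * z) * ybar g (qq z) j n))%C)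
        by (intros a Ha; rewrite (ev_Y g j a z Hg Hj Hz); reflexivity).
      unfold mat_vec, dim5. cbn [csum]. ring.
    - rewrite (Hk j Hj). unfold vzero. ring. }
  assert (Fac : forall z, upper z ->
     det5 (fun j i => bhat j i (qq z)) = (qq z * det5 (yhat (qq z)) * (Theta z / (Delta_q z * Delta_q z)))%C).
  { intros z Hz. rewrite <- Hyb, <- Xmat_det, <- det5_mul by auto. apply det5_ext. intros j i Hj Hi.
    assert (N : ee (RtoC (lamt j) * z) <> RtoC 0) by apply ee_neq0.
    assert (X : (ee (RtoC (lamt j) * z) * bhat j i (qq z))%C = (ee (RtoC (lamt j) * z) * mat_mul (ybar g (qq z)) (Xmat z) j i)%C).
    { rewrite <- (proj2 (Hb j Hj i Hi) z Hz). unfold ev.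
      rewrite (csum_ext 5 _ (fun a => L j a * csum 5 (fun n => vDn n k1 F1 a z * Xmat z n i))%C)
        by (intros a Ha; rewrite Bfun_Y by auto; reflexivity).
      transitivity (csum 5 (fun n => ev L (vDn n k1 F1) j z * Xmat z n i)%C).
      - unfold ev. cbn [csum]. ring.
      - rewrite (csum_ext 5 _ (fun n => ee (RtoC (lamt j) * z) * ybar g (qq z) j n * Xmat z n i)%C)
          by (intros a Ha; rewrite (ev_Y g j a z Hg Hj Hz); reflexivity).
        unfold mat_mul, dim5. cbn [csum]. ring. }
    transitivity (/ ee (RtoC (lamt j) * z) * (ee (RtoC (lamt j) * z) * bhat j i (qq z)))%C; [field; auto|].
    rewrite X. field. auto. }
  destruct Theta_modular as [[th [Hth Eth]] HthS].
  assert (P24h : hol (fun q => Cpown (phi q) 24) 1) by (apply hol_pown, phi_hol).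
  assert (P0 : forall q, disc 1 q -> Cpown (phi q) 24 <> RtoC 0) by (intros q Hq; apply pown_neq0, phi_neq0; auto).
  (* Cleared of denominators the identity reads det(bhat) q phi^48 = det(yhat) Theta; at q = 0 the
     left side vanishes and det(yhat) does not. *)
  assert (th0 : th 0%C = RtoC 0).
  { pose proof (hol_qq_ext_0
      (fun q => (det5 (fun j i => bhat j i q) * (q * (Cpown (phi q) 24 * Cpown (phi q) 24))))%C
      (fun q => det5 (yhat q) * th q)%C) as X. cbv beta in X.
    assert (X' : (det5 (yhat 0%C) * th 0)%C = RtoC 0).
    { rewrite <- X.
      - ring.
      - apply hol_mult; [exact DH|]. apply hol_mult; [apply hol_id|apply hol_mult; exact P24h].
      - apply hol_mult; [exact YH|exact Hth].
      - intros z Hz. rewrite Fac, Delta_qE, Eth by auto. pose proof (qq_neq0 z). pose proof (P0 _ (qq_disc z Hz)). field. auto. }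
    apply C_integral in X'. destruct X'; [contradiction|auto]. }
  destruct (modular_cusp (Delta_law P_quasimodular Smat) 12 Theta th Theta_modular Hth Eth th0) as [f' [Hf' Ef']].
  replace (12 - 12) with 0 in Hf' by ring. destruct (modular_const (Delta_law P_quasimodular Smat) f' Hf') as [K HK].
  assert (K0 : K <> RtoC 0).
  { intros ->. apply Theta_omega. rewrite Ef', HK by apply upper_omega. ring. }
  assert (Fac2 : forall z, upper z ->
     (det5 (fun j i => bhat j i (qq z)) * Cpown (phi (qq z)) 24)%C = (K * det5 (yhat (qq z)))%C).
  { intros z Hz. rewrite Fac, Ef', HK, Delta_qE by auto.
    pose proof (qq_neq0 z). pose proof (P0 _ (qq_disc z Hz)). field. auto. }
  (* At the cusp the distinct exponents give nonvanishing, by continuity of the identity [Fac2];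
     elsewhere the Wronskian does. *)
  intros q Hq E. destruct (Ceq_dec q (RtoC 0)) as [->|Hq0].
  - pose proof (hol_qq_ext_0 (fun q => det5 (fun j i => bhat j i q) * Cpown (phi q) 24)%C (fun q => K * det5 (yhat q))%C
      (hol_mult _ _ _ DH P24h) (hol_scal K _ _ YH) Fac2) as X. cbv beta in X. rewrite E in X.
    assert (X' : (K * det5 (yhat 0%C))%C = RtoC 0) by (rewrite <- X; ring).
    apply C_integral in X'. destruct X'; contradiction.
  - pose proof (zq_upper q Hq0 Hq) as Hz. pose proof (Fac2 _ Hz) as X. rewrite qq_zq, E in X by auto.
    assert (X' : (K * det5 (yhat q))%C = RtoC 0) by (rewrite <- X; ring).
    apply C_integral in X'. destruct X' as [X'|X']; [contradiction|].
    apply (Yn _ Hz). rewrite qq_zq, Hyb, X' by auto. ring.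
Qed.
End Setup.

(** * Dimensions *)

Definition linclosed (S : vfun -> Prop) : Prop :=
  (forall F F', vfeqH F F' -> S F -> S F') /\ S vfzero /\
  (forall (a : C) F F', S F -> S F' -> S (fun i z => F i z + a * F' i z)%C).

Lemma has_dimension_equiv (S S' : vfun -> Prop) d : (forall F, S F <-> S' F) -> has_dimension S d -> has_dimension S' d.
Proof.
  intros H (b & Hb & Hi & Hs). exists b. split; [intros; apply H; auto|]. split; [auto|]. intros F HF. apply Hs, H; auto.
Qed.

Lemma linclosed_csum S n (b : nat -> vfun) c : linclosed S -> (forall l, (l < n)%nat -> S (b l)) ->
  S (fun i z => csum n (fun l => c l * b l i z)%C).
Proof.
  intros (He & H0 & Hp). induction n; intros Hb.
  - apply (He vfzero); [|auto]. intros z i _ _. reflexivity.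
  - apply (Hp (c n) (fun i z => csum n (fun l => c l * b l i z)%C) (b n)); auto.
Qed.

Definition adjoin (S : vfun -> Prop) (b : vfun) : vfun -> Prop := fun F =>
  exists (a : C) F', S F' /\ vfeqH F (fun i z => F' i z + a * b i z)%C.

Lemma adjoin_closed S b : linclosed S -> linclosed (adjoin S b).
Proof.
  intros (He & H0 & Hp). split; [|split].
  - intros F F' E (a & F0 & HF & E'). exists a, F0. split; [auto|]. intros z i Hz Hi. rewrite <- E by auto. auto.
  - exists (RtoC 0), vfzero. split; [auto|]. intros z i _ _. unfold vfzero. ring.
  - intros a F F' (x & F0 & HF & E) (x' & F0' & HF' & E').
    exists (x + a * x')%C, (fun i z => F0 i z + a * F0' i z)%C. split; [auto|].
    intros z i Hz Hi. rewrite E, E' by auto. ring.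
Qed.

Lemma adjoin_dim S b d : linclosed S -> has_dimension S d ->
  (forall a F', S F' -> vfeqH (fun i z => F' i z + a * b i z)%C vfzero -> a = RtoC 0) ->
  has_dimension (adjoin S b) (d + 1).
Proof.
  intros HS (b' & Hb & Hi & Hs) Hind. replace (d + 1)%nat with (Datatypes.S d) by lia.
  exists (fun l => if Nat.eqb l d then b else b' l).
  assert (Split : forall (c : nat -> C) i z, csum (Datatypes.S d) (fun l => c l * (if Nat.eqb l d then b else b' l) i z)%C
    = (csum d (fun l => c l * b' l i z) + c d * b i z)%C).
  { intros c i z. cbn [csum]. rewrite Nat.eqb_refl. f_equal. apply csum_ext. intros l Hl.
    destruct (Nat.eqb_spec l d); [lia|reflexivity]. }
  split; [|split].
  - intros l Hl. destruct (Nat.eqb_spec l d).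
    + exists (RtoC 1), vfzero. split; [apply HS|]. intros z i _ _. unfold vfzero. ring.
    + exists (RtoC 0), (b' l). split; [apply Hb; lia|]. intros z i _ _. ring.
  - intros c E.
    assert (Hd : c d = RtoC 0).
    { apply (Hind (c d) (fun i z => csum d (fun l => c l * b' l i z)%C)); [apply linclosed_csum; auto|].
      intros z i Hz Hi'. rewrite <- Split. apply E; auto. }
    intros l Hl. destruct (Nat.eq_dec l d) as [->|Hn]; [auto|]. apply Hi; [|lia].
    intros z i Hz Hi'. rewrite <- (E z i Hz Hi'), Split, Hd. ring.
  - intros F (a & F' & HF' & E). destruct (Hs F' HF') as [c Hc].
    exists (fun l => if Nat.eqb l d then a else c l). intros z i Hz Hi'. rewrite E, Hc, Split by auto.
    rewrite Nat.eqb_refl. f_equal. apply csum_ext. intros l Hl. destruct (Nat.eqb_spec l d); [lia|reflexivity].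
Qed.

(** Successive extension of S0 by the active vectors among the b_i; under independence modulo S0
    each one raises the dimension by 1, and [nactive] counts them. *)
Fixpoint chain (S0 : vfun -> Prop) (act : nat -> bool) (b : nat -> vfun) (j : nat) : vfun -> Prop :=
  match j with
  | O => S0
  | S j' => if act j' then adjoin (chain S0 act b j') (b j') else chain S0 act b j' end.
Fixpoint nactive (act : nat -> bool) (j : nat) : nat :=
  match j with O => 0 | S j' => nactive act j' + (if act j' then 1 else 0) end%nat.

Lemma chain_closed S0 act b j : linclosed S0 -> linclosed (chain S0 act b j).
Proof. intros H. induction j; cbn [chain]; [auto|]. destruct (act j); [apply adjoin_closed|]; auto. Qed.

Lemma chain_char S0 act b j F : linclosed S0 -> (chain S0 act b j F <->
  exists (c : nat -> C) F0, S0 F0 /\ (forall i, (i < j)%nat -> act i = false -> c i = RtoC 0) /\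
    vfeqH F (fun i z => F0 i z + csum j (fun l => c l * b l i z))%C).
Proof.
  intros HS. revert F. induction j; intros F; cbn [chain].
  - split.
    + intros HF. exists (fun _ => RtoC 0), F. split; [auto|]. split; [lia|]. intros z i _ _. cbn [csum]. ring.
    + intros (c & F0 & H0 & _ & E). apply (proj1 HS F0); [|auto]. intros z i Hz Hi. rewrite E by auto. cbn [csum]. ring.
  - destruct (act j) eqn:Ea.
    + split.
      * intros (a & F' & HF' & E). apply IHj in HF'. destruct HF' as (c & F0 & H0 & Hc & E').
        exists (fun l => if Nat.eqb l j then a else c l), F0. split; [auto|]. split.
        -- intros i Hi Hai. destruct (Nat.eqb_spec i j); [subst; congruence|]. apply Hc; [lia|auto].
        -- intros z i Hz Hi. rewrite E, E' by auto. cbn [csum]. rewrite Nat.eqb_refl, Cplus_assoc. f_equal. f_equal.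
           apply csum_ext. intros l Hl. destruct (Nat.eqb_spec l j); [lia|reflexivity].
      * intros (c & F0 & H0 & Hc & E). exists (c j), (fun i z => F0 i z + csum j (fun l => c l * b l i z))%C. split.
        -- apply IHj. exists c, F0. split; [auto|]. split; [intros; apply Hc; [lia|auto]|intros z i _ _; reflexivity].
        -- intros z i Hz Hi. rewrite E by auto. cbn [csum]. ring.
    + rewrite IHj. split; intros (c & F0 & H0 & Hc & E).
      * exists (fun l => if Nat.eqb l j then RtoC 0 else c l), F0. split; [auto|]. split.
        -- intros i Hi Hai. destruct (Nat.eqb_spec i j); [auto|]. apply Hc; [lia|auto].
        -- intros z i Hz Hi. rewrite E by auto. cbn [csum]. rewrite Nat.eqb_refl, Cplus_assoc.
           transitivity (F0 i z + csum j (fun l => c l * b l i z) + 0 * b j i z)%C; [ring|]. f_equal. f_equal.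
           apply csum_ext. intros l Hl. destruct (Nat.eqb_spec l j); [lia|reflexivity].
      * exists c, F0. split; [auto|]. split; [intros; apply Hc; [lia|auto]|].
        intros z i Hz Hi. rewrite E by auto. cbn [csum]. rewrite (Hc j) by (auto; lia). ring.
Qed.

Lemma chain_dim S0 act b d n : linclosed S0 -> has_dimension S0 d ->
  (forall c F0, S0 F0 -> (forall i, (i < n)%nat -> act i = false -> c i = RtoC 0) ->
     vfeqH (fun i z => F0 i z + csum n (fun l => c l * b l i z))%C vfzero -> forall i, (i < n)%nat -> c i = RtoC 0) ->
  has_dimension (chain S0 act b n) (d + nactive act n).
Proof.
  intros HS Hd Hind.
  assert (X : forall j, (j <= n)%nat -> has_dimension (chain S0 act b j) (d + nactive act j)).
  { induction j; intros Hj; cbn [chain nactive]; [rewrite Nat.add_0_r; auto|].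
    destruct (act j) eqn:Ea; [|rewrite Nat.add_0_r; apply IHj; lia].
    rewrite Nat.add_assoc. apply adjoin_dim; [apply chain_closed; auto|apply IHj; lia|].
    intros a F' HF' E. apply chain_char in HF'; [|auto]. destruct HF' as (c & F0 & H0 & Hc & E').
    (* A relation found at stage j is continued by zeros to all n indices, the form in which
       independence is assumed. *)
    set (c' := fun l => if Nat.ltb l j then c l else if Nat.eqb l j then a else RtoC 0).
    assert (Hc'j : c' j = a) by (unfold c'; rewrite Nat.ltb_irrefl, Nat.eqb_refl; reflexivity).
    assert (Hc'lt : forall l, (l < j)%nat -> c' l = c l) by (intros l Hl; unfold c'; destruct (Nat.ltb_spec l j); [reflexivity|lia]).
    assert (Hc'gt : forall l, (j < l)%nat -> c' l = RtoC 0).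
    { intros l Hl; unfold c'. destruct (Nat.ltb_spec l j); [lia|]. destruct (Nat.eqb_spec l j); [lia|reflexivity]. }
    clearbody c'. rewrite <- Hc'j. apply (Hind c' F0); auto.
    - intros i Hi Hai. destruct (lt_eq_lt_dec i j) as [[Hl| ->]|Hl]; [rewrite Hc'lt by auto; apply Hc; auto|congruence|auto].
    - intros z i Hz Hi. rewrite <- (E z i Hz Hi), E' by auto.
      assert (Y : forall p, csum (p + S j) (fun l => c' l * b l i z)%C = (csum j (fun l => c l * b l i z) + a * b j i z)%C).
      { induction p.
        - cbn [csum Nat.add]. rewrite Hc'j. f_equal. apply csum_ext. intros l Hl. rewrite Hc'lt by auto. reflexivity.
        - cbn [csum Nat.add]. cbn [csum Nat.add] in IHp. rewrite IHp, Hc'gt by lia. ring. }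
      replace n with ((n - S j) + S j)%nat by lia. rewrite Y. ring. }
  apply X. lia.
Qed.

Lemma weight_law_mult a b g f h : weight_law a g f -> weight_law b g h -> weight_law (a + b) g (fun z => f z * h z)%C.
Proof. intros Hf Hh z Hz. rewrite Hf, Hh, Cpown_add by auto. ring. Qed.
Lemma weight_law_pown a g f n : weight_law a g f -> weight_law (a * n) g (fun z => Cpown (f z) n).
Proof.
  intros Hf. induction n.
  - rewrite Nat.mul_0_r. intros z Hz. cbn [Cpown]. ring.
  - rewrite Nat.mul_succ_r, Nat.add_comm. apply (weight_law_mult a (a * n) g f _ Hf IHn).
Qed.
Lemma q_holo_pown f n : q_holo f -> q_holo (fun z => Cpown (f z) n).
Proof. intros Hf. induction n; cbn [Cpown]; [apply q_holo_const|apply q_holo_mult; auto]. Qed.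
Lemma q_holo_Delta : q_holo Delta_q.
Proof.
  exists (fun q => q * Cpown (phi q) 24)%C. split; [apply deltaq_hol|]. intros z Hz. apply Delta_qE; auto.
Qed.

(** Freeness criterion in general form: five vectors of weights k + 2 s_i whose determinant,
    stripped of the factors e(lam_j z), has no zero in |q| < 1, the cusp included. *)
Section FreeBasis.
Variables (rho : SL2Z -> mat) (v : SL2Z -> C) (k : R) (lam : nat -> R) (L : mat) (B : nat -> vfun) (s : nat -> nat)
  (bhat : nat -> nat -> C -> C).
Hypotheses (Hv : unitv v) (Hrho : forall g, invertible (rho g)) (HLd : det5 L <> RtoC 0)
  (Hlam : forall j, 0 <= lam j < 1)
  (Hadm : forall w F, Hk w rho v F -> admissible L lam F)
  (HP : forall g z, upper z -> P_defect g z = RtoC 0)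
  (HE4 : forall g, weight_law 4 g (Eis 4)) (HE6 : forall g, weight_law 6 g (Eis 6))
  (HB : forall i, (i < 5)%nat -> Hk (k + 2 * INR (s i)) rho v (B i))
  (Hbh : forall j i, (j < 5)%nat -> (i < 5)%nat -> hol (bhat j i) 1)
  (HbE : forall j i z, (j < 5)%nat -> (i < 5)%nat -> upper z ->
     ev L (B i) j z = (ee (RtoC (lam j) * z) * bhat j i (qq z))%C)
  (Hbd : forall q, disc 1 q -> det5 (fun j i => bhat j i q) <> RtoC 0).

Lemma ev_csum n (x : nat -> C -> C) (Y : nat -> vfun) j z :
  ev L (fun a z => csum n (fun i => x i z * Y i a z)%C) j z = csum n (fun i => x i z * ev L (Y i) j z)%C.
Proof. apply (mat_vec_csum L n (fun i => x i z) (fun i a => Y i a z)). Qed.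

Lemma ev_injective F F' z : (forall j, (j < 5)%nat -> ev L F j z = ev L F' j z) ->
  forall i, (i < 5)%nat -> F i z = F' i z.
Proof.
  intros H i Hi. rewrite (ev_recover L F z i HLd Hi), (ev_recover L F' z i HLd Hi). f_equal.
  apply csum_ext. intros j Hj. rewrite H by auto. reflexivity.
Qed.

Lemma B_independent z (x : nat -> C) : upper z ->
  (forall i, (i < 5)%nat -> csum 5 (fun n => x n * B n i z)%C = RtoC 0) -> forall n, (n < 5)%nat -> x n = RtoC 0.
Proof.
  intros Hz Hx. apply (det5_injective (fun j i => bhat j i (qq z))); [apply Hbd, qq_disc; auto|].
  intros j Hj. unfold vzero.
  assert (N : ee (RtoC (lam j) * z) <> RtoC 0) by apply ee_neq0.
  assert (X : (ee (RtoC (lam j) * z) * mat_vec (fun j i => bhat j i (qq z)) x j)%C = RtoC 0).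
  { transitivity (csum 5 (fun n => x n * ev L (B n) j z)%C).
    - rewrite (csum_ext 5 _ (fun n => x n * (ee (RtoC (lam j) * z) * bhat j n (qq z)))%C)
        by (intros a Ha; rewrite HbE by auto; reflexivity).
      unfold mat_vec, dim5. cbn [csum]. ring.
    - rewrite <- (ev_csum 5 (fun n _ => x n) B). unfold ev.
      rewrite (csum_ext 5 _ (fun i => L j i * 0)%C) by (intros a Ha; cbv beta; rewrite Hx by auto; reflexivity).
      cbn [csum]. ring. }
  apply C_integral in X. destruct X; [contradiction|auto].
Qed.

Lemma Hk_coefficients w F : Hk w rho v F -> exists mf : nat -> C -> C,
  (forall i, (i < 5)%nat -> modular (w - (k + 2 * INR (s i))) (mf i)) /\
  vfeqH F (fun a z => csum 5 (fun i => mf i z * B i a z)%C).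
Proof.
  intros HF.
  destruct (finite_choice 5 (fun j (h : C -> C) => hol h 1 /\
     forall z, upper z -> ev L F j z = (ee (RtoC (lam j) * z) * h (qq z))%C)) as [h Hh].
  { constructor. exact (fun z => z). }
  { exact (Hadm w F HF). }
  set (M := fun q : C => (fun j i => bhat j i q) : mat).
  (* Cramer's rule. As the determinant is nonzero at q = 0 too, the coefficients are holomorphic at
     the cusp. *)
  set (mq := fun i (q : C) => (mat_vec (adj5 (M q)) (fun j => h j q) i / det5 (M q))%C).
  assert (Hmq : forall i, (i < 5)%nat -> hol (mq i) 1).
  { intros i Hi. apply hol_div; [|apply det5_hol; auto|intros; apply Hbd; auto].
    assert (Hij : forall j, (j < 5)%nat -> hol (fun q => adj5 (M q) i j * h j q)%C 1).
    { intros j Hj. apply hol_mult; [apply (adj5_hol bhat); auto|apply (Hh j Hj)]. }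
    unfold mat_vec, dim5. cbn [csum].
    repeat (match goal with |- hol (fun q => (@?f q + @?g q)%C) 1 => apply (hol_plus f g) end; [|apply Hij; lia]).
    apply hol_const. }
  assert (EF : vfeqH F (fun a z => csum 5 (fun i => mq i (qq z) * B i a z)%C)).
  { intros z i Hz Hi. apply (ev_injective F (fun a z => csum 5 (fun i => mq i (qq z) * B i a z)%C) z); [|auto].
    intros j Hj. rewrite (ev_csum 5 (fun i z => mq i (qq z)) B). rewrite (proj2 (Hh j Hj) z Hz).
    rewrite (csum_ext 5 _ (fun n => mq n (qq z) * (ee (RtoC (lam j) * z) * bhat j n (qq z)))%C)
        by (intros a Ha; rewrite HbE by auto; reflexivity).
    assert (Hd : det5 (M (qq z)) <> RtoC 0) by (apply Hbd, qq_disc; auto).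
    pose proof (adj5_inverse (M (qq z)) (fun j => h j (qq z)) j Hj) as X.
    transitivity (ee (RtoC (lam j) * z) * (det5 (M (qq z)) * h j (qq z) / det5 (M (qq z))))%C; [field; auto|].
    rewrite <- X. unfold mq. set (u := mat_vec (adj5 (M (qq z))) (fun j => h j (qq z))).
    unfold mat_vec, dim5, M. fold (M (qq z)). cbn [csum]. field. auto. }
  exists (fun i z => mq i (qq z)). split; [|exact EF].
  intros i Hi. split; [exists (mq i); split; auto|].
  intros z Hz.
  pose proof (coefficient_law rho v w (fun n => k + 2 * INR (s n)) B F (fun i z => mq i (qq z)) Hv Hrho
    (fun n Hn => proj2 (HB n Hn)) (proj2 HF) B_independent EF Smat z i Hz Hi) as X.
  cbv beta in X. rewrite mobius_S, jfac_S in X by auto. exact X.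
Qed.

Lemma Hk_holo w F i : Hk w rho v F -> (i < 5)%nat -> holo_H (F i).
Proof. intros H Hi. apply (proj1 H i Hi). Qed.

Lemma Hk_of w F : (forall i, (i < 5)%nat -> holo_H (F i)) -> admissible L lam F -> transforms w rho v F -> Hk w rho v F.
Proof.
  intros Hh Ha Ht. split; [|exact Ht]. intros i Hi. split; [auto|]. apply (admissible_growth lam L HLd Hlam F Ha i Hi).
Qed.

Lemma admissible_mult f F : q_holo f -> admissible L lam F -> admissible L lam (vscale f F).
Proof.
  intros [h [Hh E]] Ha j Hj. destruct (Ha j Hj) as [h' [Hh' E']].
  exists (fun q => h q * h' q)%C. split; [apply hol_mult; auto|]. intros z Hz.
  transitivity (f z * ev L F j z)%C; [unfold ev, vscale; cbn [csum]; ring|].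
  rewrite E, E' by auto. ring.
Qed.
Lemma admissible_plus F F' : admissible L lam F -> admissible L lam F' -> admissible L lam (fun i z => F i z + F' i z)%C.
Proof.
  intros Ha Ha' j Hj. destruct (Ha j Hj) as [h [Hh E]]. destruct (Ha' j Hj) as [h' [Hh' E']].
  exists (fun q => h q + h' q)%C. split; [apply hol_plus; auto|]. intros z Hz.
  transitivity (ev L F j z + ev L F' j z)%C; [unfold ev; cbn [csum]; ring|].
  rewrite E, E' by auto. ring.
Qed.
Lemma admissible_ext F F' : vfeqH F F' -> admissible L lam F -> admissible L lam F'.
Proof.
  intros E Ha j Hj. destruct (Ha j Hj) as [h [Hh E']]. exists h. split; [auto|]. intros z Hz. rewrite <- E' by auto.
  unfold ev. apply csum_ext. intros i Hi. rewrite E by auto. reflexivity.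
Qed.

Lemma Hk_mult w n f F : q_holo f -> (forall g, weight_law n g f) -> Hk w rho v F -> Hk (w + INR n) rho v (vscale f F).
Proof.
  intros Hf Hl HF. apply Hk_of.
  - intros i Hi. apply holo_mult; [apply q_holo_holo; auto|apply (Hk_holo w F); auto].
  - apply admissible_mult; eauto.
  - apply transforms_mult; auto. apply (proj2 HF).
Qed.
Lemma Hk_plus w F F' : Hk w rho v F -> Hk w rho v F' -> Hk w rho v (fun i z => F i z + F' i z)%C.
Proof.
  intros H H'. apply Hk_of.
  - intros i Hi. apply holo_plus; eapply Hk_holo; eauto.
  - apply admissible_plus; eauto.
  - apply transforms_plus; [apply (proj2 H)|apply (proj2 H')].
Qed.
Lemma Hk_scal w c F : Hk w rho v F -> Hk w rho v (fun i z => c * F i z)%C.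
Proof.
  intros H. apply Hk_of.
  - intros i Hi. apply holo_scal; eapply Hk_holo; eauto.
  - apply (admissible_mult (fun _ => c)); [apply q_holo_const|eauto].
  - apply transforms_scal, (proj2 H).
Qed.
Lemma Hk_ext w F F' : vfeqH F F' -> Hk w rho v F -> Hk w rho v F'.
Proof.
  intros E H. apply Hk_of.
  - intros i Hi. apply (holo_ext (F i)); [intros; apply E; auto|eapply Hk_holo; eauto].
  - apply (admissible_ext F); eauto.
  - apply (transforms_ext w rho v F); [auto|apply (proj2 H)].
Qed.
Lemma Hk_zero w : Hk w rho v vfzero.
Proof.
  apply Hk_of.
  - intros i _. apply holo_const.
  - intros j Hj. exists (fun _ => RtoC 0). split; [apply hol_const|]. intros z Hz.
    unfold ev, vfzero. cbn [csum]. ring.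
  - intros g z i Hz Hi. unfold vfzero. unfold dim5. cbn [csum]. ring.
Qed.
Lemma Hk_div_Delta w F F' : (forall i, (i < 5)%nat -> holo_H (F' i)) -> admissible L lam F' ->
  vfeqH F (vscale Delta_q F') -> Hk w rho v F -> Hk (w - 12) rho v F'.
Proof.
  intros Hh Ha E HF. apply Hk_of; auto. apply transforms_of; auto. intros g z i Hz Hi.
  pose proof (transforms_at w rho v F g z i Hv (proj2 HF) Hz Hi) as X.
  rewrite (E (mobius g z) i) in X by (auto; apply mobius_upper; auto). unfold vscale in X.
  rewrite (Delta_law HP g z Hz) in X.
  rewrite (mat_vec_ext (rho g) (rho g) (fun j => F j z) (fun j => Delta_q z * F' j z)%C i Hi) in X;
    [|intros a b _ _; reflexivity|intros j Hj; apply E; auto].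
  assert (Hj : jfac g z <> RtoC 0) by (apply jfac_neq0; auto).
  pose proof (Delta_neq0 z Hz) as Hd.
  assert (Hp : Cpown (jfac g z) 12 <> RtoC 0) by (apply pown_neq0; auto).
  unfold Rminus. rewrite Cpow_plus, Cpow_opp by auto. replace 12 with (INR 12) by (simpl; ring). rewrite Cpow_INR by auto.
  transitivity (Cpown (jfac g z) 12 * Delta_q z * F' i (mobius g z) / (Cpown (jfac g z) 12 * Delta_q z))%C; [field; auto|].
  rewrite X. unfold mat_vec, dim5. cbn [csum]. field. auto.
Qed.

Lemma Hsum_plus F F' : Hsum k rho v F -> Hsum k rho v F' -> Hsum k rho v (fun i z => F i z + F' i z)%C.
Proof.
  intros [l [Hl E]] [l' [Hl' E']]. exists (l ++ l'). split.
  - intros p Hp. apply in_app_or in Hp. destruct Hp; auto.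
  - intros z i Hz Hi. rewrite E, E' by auto. clear. induction l as [|p l IH]; cbn [app map fold_right]; [ring|].
    rewrite <- IH. ring.
Qed.
Lemma Hsum_ext F F' : vfeqH F F' -> Hsum k rho v F -> Hsum k rho v F'.
Proof.
  intros E [l [Hl E']]. exists l. split; [auto|]. intros z i Hz Hi. rewrite <- E by auto. auto.
Qed.
Lemma Hsum_Hk n F : Hk (k + IZR n) rho v F -> Hsum k rho v F.
Proof.
  intros H. exists ((n, F) :: nil). split.
  - intros p [<-|[]]. exact H.
  - intros z i Hz Hi. cbn [map fold_right snd]. ring.
Qed.

Lemma monomial_law a b g : weight_law (4 * a + 6 * b) g (fun z => Cpown (Eis 4 z) a * Cpown (Eis 6 z) b)%C.
Proof. apply weight_law_mult; apply weight_law_pown; auto. Qed.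
Lemma monomial_q_holo a b : q_holo (fun z => Cpown (Eis 4 z) a * Cpown (Eis 6 z) b)%C.
Proof. apply q_holo_mult; apply q_holo_pown, q_holo_Eis. Qed.

(** Done one monomial at a time, because a monomial shifts every homogeneous component by the same
    integer 4a + 6b. *)
Lemma Hsum_mult f F : inM f -> Hsum k rho v F -> Hsum k rho v (vscale f F).
Proof.
  intros [t Ht] [l [Hl E]].
  assert (Mono : forall c a b, Hsum k rho v (vscale (fun z => c * (Cpown (Eis 4 z) a * Cpown (Eis 6 z) b))%C F)).
  { intros c a b. set (f0 := (fun z => Cpown (Eis 4 z) a * Cpown (Eis 6 z) b)%C).
    exists (map (fun p => (fst p + Z.of_nat (4 * a + 6 * b), vscale (fun z => c * f0 z)%C (snd p))%Z) l). split.
    - intros p Hp. apply in_map_iff in Hp. destruct Hp as [p' [<- Hp']]. cbn [fst snd].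
      rewrite plus_IZR, <- INR_IZR_INZ, <- Rplus_assoc.
      apply (Hk_ext _ (fun i z => c * vscale f0 (snd p') i z)%C).
      + intros z i Hz Hi. unfold vscale. ring.
      + apply Hk_scal, Hk_mult; [apply monomial_q_holo|intros g; apply monomial_law|apply Hl; auto].
    - intros z i Hz Hi. unfold vscale at 1. rewrite E by auto. clear. induction l as [|p l IH]; cbn [map fold_right snd]; [ring|].
      rewrite <- IH. apply Cmult_plus_distr_l. }
  apply (Hsum_ext (vscale (monos t) F)).
  - intros z i Hz Hi. unfold vscale. rewrite Ht by auto. reflexivity.
  - clear Ht. induction t as [|[[c a] b] t IH].
    + exists nil. split; [intros p []|]. intros z i Hz Hi. unfold vscale, monos. cbn [map fold_right]. ring.
    + apply (Hsum_ext (fun i z => vscale (fun z => c * (Cpown (Eis 4 z) a * Cpown (Eis 6 z) b))%C F i z + vscale (monos t) F i z)%C).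
      * intros z i Hz Hi. unfold vscale, monos. cbn [map fold_right]. ring.
      * apply Hsum_plus; auto.
Qed.

Lemma Hsum_span F : Hsum k rho v F -> exists mf : nat -> C -> C,
  (forall i, (i < 5)%nat -> inM (mf i)) /\ vfeqH F (fun a z => csum 5 (fun i => mf i z * B i a z)%C).
Proof.
  intros [l [Hl E]]. revert F E. induction l as [|p l IH]; intros F E.
  - exists (fun _ _ => RtoC 0). split; [intros; apply inM_zero|]. intros z i Hz Hi. rewrite E by auto.
    cbn [map fold_right csum]. ring.
  - destruct (IH (fun p Hp => Hl p (or_intror Hp)) _ (fun z i _ _ => eq_refl)) as [mf [Hm Em]].
    destruct (Hk_coefficients _ _ (Hl p (or_introl eq_refl))) as [mf' [Hm' Em']].
    exists (fun i z => mf' i z + mf i z)%C. split.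
    + intros i Hi. apply inM_plus; [|auto]. eapply modular_inM; eauto. apply Delta_law; auto.
    + intros z i Hz Hi. rewrite E by auto. cbn [map fold_right].
      refine (eq_trans (f_equal2 Cplus (Em' z i Hz Hi) (Em z i Hz Hi)) _). cbn [csum]. ring.
Qed.

Lemma Hsum_basis i : (i < 5)%nat -> Hsum k rho v (B i).
Proof.
  intros Hi. apply (Hsum_Hk (2 * Z.of_nat (s i))). rewrite mult_IZR, <- INR_IZR_INZ. auto.
Qed.

(** Every coefficient in the basis would have negative weight. *)
Lemma Hk_zero_below w F : w < k -> Hk w rho v F -> vfeqH F vfzero.
Proof.
  intros Hw HF. destruct (Hk_coefficients w F HF) as (mf & Hm & E). intros z i Hz Hi. rewrite E by auto.
  assert (Z : forall j, (j < 5)%nat -> mf j z = RtoC 0).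
  { intros j Hj. apply (modular_negative _ _ (Hm j Hj)); auto. pose proof (pos_INR (s j)). lra. }
  unfold vfzero. cbn [csum]. rewrite !Z by lia. ring.
Qed.

Lemma Hk_dim_below w : w < k -> has_dimension (Hk w rho v) 0.
Proof.
  intros Hw. exists (fun _ => vfzero). split; [lia|]. split; [lia|]. intros F HF. exists (fun _ => RtoC 0).
  intros z i Hz Hi. cbn [csum]. apply (Hk_zero_below w F Hw HF); auto.
Qed.

Definition DeltaHk (w : R) : vfun -> Prop := fun F => exists F', Hk w rho v F' /\ vfeqH F (vscale Delta_q F').

Lemma DeltaHk_closed w : linclosed (DeltaHk w).
Proof.
  split; [|split].
  - intros F F' E (F0 & H0 & E'). exists F0. split; [auto|]. intros z i Hz Hi. rewrite <- E by auto. auto.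
  - exists vfzero. split; [apply Hk_zero|]. intros z i _ _. unfold vscale, vfzero. ring.
  - intros a F F' (F0 & H0 & E) (F0' & H0' & E'). exists (fun i z => F0 i z + a * F0' i z)%C.
    split; [apply Hk_plus; [auto|apply Hk_scal; auto]|].
    intros z i Hz Hi. rewrite E, E' by auto. unfold vscale. ring.
Qed.

Lemma DeltaHk_dim w d : has_dimension (Hk w rho v) d -> has_dimension (DeltaHk w) d.
Proof.
  intros (b & Hb & Hi & Hs). exists (fun l => vscale Delta_q (b l)).
  assert (Sc : forall (c : nat -> C) i z, csum d (fun l => c l * vscale Delta_q (b l) i z)%C
     = (Delta_q z * csum d (fun l => c l * b l i z))%C).
  { intros c i z. unfold vscale. clear. induction d; cbn [csum]; [ring|]. rewrite IHd. ring. }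
  split; [|split].
  - intros l Hl. exists (b l). split; [auto|]. intros z i _ _. reflexivity.
  - intros c E. apply Hi. intros z i Hz Hi'. pose proof (E z i Hz Hi') as X. cbv beta in X. rewrite Sc in X.
    apply C_integral in X. destruct X as [X|X]; [|exact X]. exfalso. revert X. apply Delta_neq0; auto.
  - intros F (F' & HF' & E). destruct (Hs F' HF') as [c Hc]. exists c. intros z i Hz Hi'.
    rewrite Sc, E by auto. unfold vscale. rewrite Hc by auto. reflexivity.
Qed.

(* There is no modular form of weight 2, so B_i does not contribute when n = s i + 1. *)
Definition active (n i : nat) : bool := Nat.leb (s i) n && negb (Nat.eqb n (S (s i))).
Definition top (n i : nat) : vfun := vscale (mono (n - s i)) (B i).

Lemma active_spec n i : active n i = true <-> (s i <= n /\ n - s i <> 1)%nat.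
Proof.
  unfold active. rewrite Bool.andb_true_iff, Nat.leb_le, Bool.negb_true_iff, Nat.eqb_neq. lia.
Qed.

Lemma top_Hk n i : (i < 5)%nat -> active n i = true -> Hk (k + 2 * INR n) rho v (top n i).
Proof.
  intros Hi Ha. apply active_spec in Ha. destruct Ha as [H1 H2].
  replace (k + 2 * INR n) with (k + 2 * INR (s i) + INR (2 * (n - s i))).
  - apply Hk_mult; auto.
    + exists (monoq (n - s i)). split; [apply monoq_hol|]. intros z _. apply mono_E.
    + intros g. rewrite <- (mono_weight (n - s i)) by auto. apply monomial_law.
  - rewrite mult_INR, minus_INR by auto. simpl (INR 2). ring.
Qed.

Lemma top_coefficient n i f : modular (k + 2 * INR n - (k + 2 * INR (s i))) f -> exists (c : C) f', q_holo f' /\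
  (active n i = false -> c = RtoC 0) /\
  forall z, upper z -> f z = (c * mono (n - s i) z + Delta_q z * f' z)%C.
Proof.
  intros Hf. replace (k + 2 * INR n - (k + 2 * INR (s i))) with (2 * (INR n - INR (s i))) in Hf by ring.
  assert (Zero : (forall z, upper z -> f z = RtoC 0) -> exists (c : C) f', q_holo f' /\
    (active n i = false -> c = RtoC 0) /\ forall z, upper z -> f z = (c * mono (n - s i) z + Delta_q z * f' z)%C).
  { intros Z. exists (RtoC 0), (fun _ => RtoC 0). split; [apply q_holo_const|]. split; [auto|].
    intros z Hz. rewrite Z by auto. ring. }
  destruct (le_lt_dec (s i) n) as [H1|H1].
  - rewrite <- minus_INR in Hf by auto. destruct (Nat.eq_dec (n - s i) 1) as [H2|H2].
    + apply Zero. apply (modular_2 (Delta_law HP Smat) (HE4 Smat) (HE6 Smat) HP).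
      replace 2 with (2 * INR (n - s i)) by (rewrite H2; simpl; ring). auto.
    + destruct (modular_decompose (Delta_law HP Smat) _ f (mono (n - s i)) (monoq (n - s i)) Hf
        (modular_mono (HE4 Smat) (HE6 Smat) (n - s i) H2)
        (monoq_hol (n - s i)) (fun z _ => mono_E (n - s i) z) (monoq_0 (n - s i))) as (c & f' & Hf' & E).
      exists c, f'. split; [apply Hf'|]. split; [|auto].
      intros Ha. assert (X : active n i = true) by (apply active_spec; auto). congruence.
  - apply Zero. apply (modular_negative _ f Hf). apply lt_INR in H1. lra.
Qed.

(** Each coefficient of F splits into a multiple of a monomial and Delta times a q-series. The Delta
    parts assemble to a vector of weight lower by 12: its transformation law comes from dividing by
    Delta, its growth from admissibility. *)
Lemma Hk_decompose n F : Hk (k + 2 * INR n) rho v F <->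
  chain (DeltaHk (k + 2 * INR n - 12)) (active n) (top n) 5 F.
Proof.
  rewrite chain_char by apply DeltaHk_closed. split.
  - intros HF. destruct (Hk_coefficients _ F HF) as (mf & Hm & E).
    destruct (finite_choice 5 (fun i (p : C * (C -> C)) => q_holo (snd p) /\ (active n i = false -> fst p = RtoC 0) /\
       forall z, upper z -> mf i z = (fst p * mono (n - s i) z + Delta_q z * snd p z)%C)) as [p Hp].
    { constructor. exact (RtoC 0, fun z => z). }
    { intros i Hi. destruct (top_coefficient n i (mf i) (Hm i Hi)) as (c & f' & H). exists (c, f'). exact H. }
    set (F' := (fun a z => csum 5 (fun i => snd (p i) z * B i a z)%C) : vfun).
    assert (E' : vfeqH F (fun i z => vscale Delta_q F' i z + csum 5 (fun l => fst (p l) * top n l i z))%C).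
    { intros z a Hz Ha. rewrite E by auto. unfold F', vscale, top. cbn [csum].
      rewrite !(fun i Hi => proj2 (proj2 (Hp i Hi)) z Hz) by lia. unfold vscale. ring. }
    (* An inactive [top n l] need not have weight k + 2n, because of truncated subtraction or the
       junk monomial. Its coefficient is 0, so the zero vector is put in its place. *)
    assert (HS : Hk (k + 2 * INR n) rho v (fun i z => csum 5 (fun l => fst (p l) * top n l i z))%C).
    { apply (Hk_ext _ (fun i z => csum 5 (fun l => fst (p l) * (if active n l then top n l else vfzero) i z))%C).
      - intros z i Hz Hi. apply csum_ext. intros l Hl. destruct (active n l) eqn:Ea; [reflexivity|].
        rewrite (proj1 (proj2 (Hp l Hl)) Ea). ring.
      - apply linclosed_csum.
        + split; [apply Hk_ext|]. split; [apply Hk_zero|]. intros a G G' HG HG'. apply Hk_plus; [auto|apply Hk_scal; auto].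
        + intros l Hl. destruct (active n l) eqn:Ea; [apply top_Hk; auto|apply Hk_zero]. }
    exists (fun i => fst (p i)), (vscale Delta_q F'). split; [|split; [|exact E']].
    + exists F'. split; [|intros z i _ _; reflexivity].
      apply (Hk_div_Delta _ (fun i z => F i z + (-1) * csum 5 (fun l => fst (p l) * top n l i z))%C).
      * intros a Ha. unfold F'. cbn [csum].
        assert (Hh : forall i, (i < 5)%nat -> holo_H (fun z => snd (p i) z * B i a z)%C).
        { intros i Hi. apply (holo_mult (snd (p i))); [apply q_holo_holo, (Hp i Hi)|]. apply (Hk_holo _ (B i) a (HB i Hi) Ha). }
        repeat (match goal with |- holo_H (fun q => (@?f q + @?g q)%C) => apply (holo_plus f g) end; [|apply Hh; lia]).
        apply holo_const.
      * assert (Ad : forall i, (i < 5)%nat -> admissible L lam (vscale (snd (p i)) (B i))).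
        { intros i Hi. apply admissible_mult; [apply (Hp i Hi)|]. apply (Hadm _ _ (HB i Hi)). }
        apply (admissible_ext (fun a z => vfzero a z + vscale (snd (p 0%nat)) (B 0%nat) a z + vscale (snd (p 1%nat)) (B 1%nat) a z
           + vscale (snd (p 2%nat)) (B 2%nat) a z + vscale (snd (p 3%nat)) (B 3%nat) a z + vscale (snd (p 4%nat)) (B 4%nat) a z)%C).
        { intros z a _ _. unfold F', vscale, vfzero. cbn [csum]. ring. }
        repeat (match goal with |- admissible _ _ (fun a z => (@?f a z + @?g a z)%C) => apply (admissible_plus f g) end; [|apply Ad; lia]).
        apply (Hadm 0), Hk_zero.
      * intros z i Hz Hi. rewrite E' by auto. ring.
      * apply Hk_plus; [auto|apply Hk_scal; auto].
    + intros i Hi. apply (Hp i Hi).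
  - intros (c & F0 & (F' & HF' & E') & Hc & E).
    apply (Hk_ext _ (fun i z => vscale Delta_q F' i z + csum 5 (fun l => c l * (if active n l then top n l else vfzero) i z))%C).
    + intros z i Hz Hi. rewrite E, E' by auto. f_equal. apply csum_ext. intros l Hl.
      destruct (active n l) eqn:Ea; [reflexivity|]. rewrite (Hc l Hl Ea). ring.
    + apply Hk_plus.
      * replace (k + 2 * INR n) with (k + 2 * INR n - 12 + INR 12) by (simpl; ring).
        apply Hk_mult; [apply q_holo_Delta|apply Delta_law; auto|auto].
      * apply linclosed_csum.
        -- split; [apply Hk_ext|]. split; [apply Hk_zero|]. intros a G G' HG HG'. apply Hk_plus; [auto|apply Hk_scal; auto].
        -- intros l Hl. destruct (active n l) eqn:Ea; [apply top_Hk; auto|apply Hk_zero].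
Qed.

(** By independence of the B_i the total coefficient c_i e_i + Delta m_i of each B_i is 0, and its
    value at q = 0 is c_i. *)
Lemma top_independent n (c : nat -> C) F0 : DeltaHk (k + 2 * INR n - 12) F0 ->
  vfeqH (fun i z => F0 i z + csum 5 (fun l => c l * top n l i z))%C vfzero -> forall i, (i < 5)%nat -> c i = RtoC 0.
Proof.
  intros (F' & HF' & E') E i Hi. destruct (Hk_coefficients _ F' HF') as (mf & Hm & Em).
  assert (X : forall z, upper z -> (c i * mono (n - s i) z + Delta_q z * mf i z)%C = RtoC 0).
  { intros z Hz. apply (B_independent z (fun i => c i * mono (n - s i) z + Delta_q z * mf i z)%C Hz); [|auto].
    intros a Ha. pose proof (E z a Hz Ha) as Y. cbv beta in Y. rewrite E' in Y by auto. unfold vscale in Y.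
    rewrite (Em z a Hz Ha) in Y. unfold vfzero in Y. refine (eq_trans _ Y). unfold top, vscale. cbn [csum]. ring. }
  destruct (Hm i Hi) as [[h [Hh Eh]] _].
  pose proof (hol_zero_at_0 (fun q => c i * monoq (n - s i) q + (q * Cpown (phi q) 24) * h q)%C) as Z. cbv beta in Z.
  rewrite monoq_0 in Z. transitivity (c i * 1 + 0 * Cpown (phi 0) 24 * h 0)%C; [ring|]. apply Z.
  - apply (hol_plus (fun q => c i * monoq (n - s i) q)%C (fun q => (q * Cpown (phi q) 24) * h q)%C).
    + apply hol_scal, monoq_hol.
    + apply (hol_mult (fun q => q * Cpown (phi q) 24)%C); [apply deltaq_hol|auto].
  - intros z Hz. rewrite <- mono_E, <- Delta_qE, <- Eh by auto. auto.
Qed.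

Lemma Hk_dim_step n d : has_dimension (Hk (k + 2 * INR n - 12) rho v) d ->
  has_dimension (Hk (k + 2 * INR n) rho v) (d + nactive (active n) 5).
Proof.
  intros Hd. apply (has_dimension_equiv (chain (DeltaHk (k + 2 * INR n - 12)) (active n) (top n) 5)).
  - intros F. symmetry. apply Hk_decompose.
  - apply chain_dim; [apply DeltaHk_closed|apply DeltaHk_dim; auto|].
    intros c F0 H0 _ E. apply (top_independent n c F0); auto.
Qed.
End FreeBasis.

Theorem theorem4p27
  (rho : SL2Z -> mat) (v : SL2Z -> C) (k0 m : R) (r : nat -> R)
  (Hrep : representation rho)
  (HTu : T_unitarizable rho)
  (HTd : T_determined rho)
  (Hmult : multiplier_system k0 v)
  (Hcusp : cusp_parameter v m)
  (* eigenvalues of rho(T) are e(r_1) .. e(r_5), 0 <= r_1 < ... < r_5 < 1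
     (indexed 0..4 here) *)
  (Hr0 : 0 <= r 0%nat) (Hrinc : forall j, (j < 4)%nat -> r j < r (S j))
  (Hr4 : r 4%nat < 1)
  (Heig : forall l : C, eigenvalue (rho Tmat) l <->
            exists j, (j < 5)%nat /\ l = ee (RtoC (r j)))
  (lamt : nat -> R) (Hlt : forall j, lamt j = frac_part (r j + m / 12))
  (lam0 : R) (Hlam0 : lam0 = lamt 0%nat + lamt 1%nat + lamt 2%nat + lamt 3%nat + lamt 4%nat)
  (Hint : exists n : Z, 12 * (lam0 + 1) / 5 - m = IZR n)
  (k1 : R) (Hk1 : k1 = 12 / 5 * (lam0 + 1) - 4)
  (F1 : vfun) (HF1 : Hk k1 rho v F1)
  (HF1mlde : exists M4 M6 M8 M10 : C -> C,
      inMw 4 M4 /\ inMw 6 M6 /\ inMw 8 M8 /\ inMw 10 M10 /\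
      has_indicial_roots k1 M4 M6 M8 M10
        (fun j => match j with O => lamt 0%nat + 1 | _ => lamt j end) /\
      fundamental_system k1 M4 M6 M8 M10 F1)
  (G : vfun) (HG : Hk k1 rho v G) (HGnz : ~ vfeqH G vfzero)
  (HDG : exists c : nat -> C,
      vfeqH (vscale Delta_q G)
        (fun i z => (c 0%nat * Eis 4 z * vDn 4 k1 F1 i z
                   + c 1%nat * Eis 6 z * vDn 3 k1 F1 i z
                   + c 2%nat * Eis 8 z * vDn 2 k1 F1 i z
                   + c 3%nat * Eis 10 z * vDn 1 k1 F1 i z
                   + c 4%nat * Eis 12 z * F1 i z)%C)) :
  let B : nat -> vfun := fun i =>
    match i with
    | O => F1 | 1%nat => G | 2%nat => vDn 1 k1 F1 | 3%nat => vDn 1 k1 G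
    | _ => vDn 2 k1 F1 end in
  (* (i) H(rho,v) is a free M-module of rank 5 with basis B *)
  ((forall F F', Hsum k1 rho v F -> Hsum k1 rho v F' ->
       Hsum k1 rho v (fun i z => (F i z + F' i z)%C)) /\
   (forall f F, inM f -> Hsum k1 rho v F -> Hsum k1 rho v (vscale f F)) /\
   (forall i, (i < 5)%nat -> Hsum k1 rho v (B i)) /\
   (forall F, Hsum k1 rho v F ->
      exists mf : nat -> C -> C, (forall i, (i < 5)%nat -> inM (mf i)) /\
        vfeqH F (fun c z => csum 5 (fun i => (mf i z * B i c z)%C))) /\
   (forall mf : nat -> C -> C, (forall i, (i < 5)%nat -> inM (mf i)) ->
      vfeqH (fun c z => csum 5 (fun i => (mf i z * B i c z)%C)) vfzero ->
      forall i z, (i < 5)%nat -> upper z -> mf i z = 0%C)) /\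
  (* (ii) dimension formula *)
  (forall k : nat,
     has_dimension (Hk (k1 + 2 * INR k) rho v)
       (if Nat.eqb (Nat.modulo k 6) 5 then (5 * k / 6 + 1)%nat
        else (5 * k / 6 + 2)%nat)).
Proof.
  intros B.
  destruct HF1mlde as (M4 & M6 & M8 & M10 & H4 & H6 & H8 & H10 & Hroots & HFode & Hind & _).
  destruct HDG as [c Hc].
  assert (Hode : forall i z, (i < 5)%nat -> upper z -> mlde5 k1 M4 M6 M8 M10 (F1 i) z = RtoC 0)
    by (intros i z Hi; apply (HFode i Hi)).
  assert (Hr : increasing01 r) by (split; [exact Hr0|split; [exact Hrinc|exact Hr4]]).
  destruct (left_eigenbasis rho r Hr Heig) as (L & HLd & HLn & HLe).
  destruct HTd as [Hirr _]. destruct Hcusp as [_ HvT].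
  subst lam0.
  pose proof (multiplier_unit k0 v Hmult) as Hv.
  pose proof (lamt_range m r lamt Hlt) as Hrng. pose proof (lamt_ee m r lamt Hlt) as Hee.
  assert (HP : forall g z, upper z -> P_defect g z = RtoC 0)
    by (intros g z; eapply (P_quasimodular rho v k0 m k1 r lamt F1 M4 M6 M8 M10); eauto).
  assert (HE4 : forall g, weight_law 4 g (Eis 4))
    by (intros g; eapply (E4_law rho v k0 m k1 r lamt L F1 G M4 M6 M8 M10 c); eauto).
  assert (HE6 : forall g, weight_law 6 g (Eis 6))
    by (intros g; eapply (E6_law rho v k0 m k1 r lamt L F1 G M4 M6 M8 M10 c); eauto).
  assert (HB : forall i, (i < 5)%nat -> Hk (k1 + 2 * INR (Bweight i)) rho v (Bfun k1 F1 G i))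
    by (intros i; eapply (Bfun_Hk rho v k0 m k1 r lamt L F1 G M4 M6 M8 M10); eauto).
  destruct (normalized_basis rho v k0 m k1 r lamt L F1 G M4 M6 M8 M10 c) as (bhat & Hbh & HbE & Hbd); auto.
  assert (Hadm : forall w F, Hk w rho v F -> admissible L lamt F)
    by (intros w F; apply (Hk_admissible rho v m r lamt L Hv HvT HLe Hrng Hee w F)).
  pose proof (proj1 Hrep) as Hrho.
  set (Bf := Bfun k1 F1 G) in *.
  (* Position in [Bf] of the i-th vector of the list in the theorem; [inv] below is the inverse
     permutation. *)
  set (perm := fun i => match i with 0 => 0 | 1 => 3 | 2 => 1 | 3 => 4 | _ => 2 end%nat).
  assert (HBp : forall i, B i = Bf (perm i)) by (intros [|[|[|[|i]]]]; reflexivity).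
  assert (Hperm : forall i, (perm i < 5)%nat) by (intros [|[|[|[|i]]]]; cbn; lia).
  split; [split; [|split; [|split; [|split]]]|].
  - apply Hsum_plus.
  - intros f F. eapply Hsum_mult; eauto.
  - intros i _. rewrite HBp. eapply (Hsum_basis rho v k1 Bf Bweight); eauto.
  - intros F HF. destruct (Hsum_span rho v k1 lamt L Bf Bweight bhat Hv Hrho HLd Hadm HP HE4 HE6 HB Hbh HbE Hbd F HF)
      as (mf & Hm & E).
    exists (fun i => mf (perm i)). split; [intros i _; apply Hm, Hperm|].
    intros z i Hz Hi. rewrite E by auto. cbn [csum]. rewrite !HBp. cbn [perm]. ring.
  - intros mf _ E i z Hi Hz.
    set (inv := fun i => match i with 0 => 0 | 1 => 2 | 2 => 4 | 3 => 1 | _ => 3 end%nat).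
    assert (X : forall n, (n < 5)%nat -> mf (inv n) z = RtoC 0).
    { apply (B_independent lamt L Bf bhat HbE Hbd z (fun n => mf (inv n) z) Hz).
      intros a Ha. refine (eq_trans _ (E z a Hz Ha)). cbn [csum]. rewrite !HBp. cbn [perm inv]. ring. }
    destruct i as [|[|[|[|[|i]]]]]; [apply (X 0%nat)|apply (X 3%nat)|apply (X 1%nat)|apply (X 4%nat)|apply (X 2%nat)|]; lia.
  - assert (Step := fun n d => Hk_dim_step rho v k1 lamt L Bf Bweight bhat Hv Hrho HLd Hrng Hadm HP HE4 HE6 HB Hbh HbE Hbd n d).
    (* For n < 6 the weight k1 + 2n - 12 lies below k1, where the space is zero. *)
    assert (Base : forall n, (n < 6)%nat -> has_dimension (Hk (k1 + 2 * INR n) rho v) (0 + nactive (active Bweight n) 5)).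
    { intros n Hn. apply Step. apply (Hk_dim_below rho v k1 lamt L Bf Bweight bhat); auto.
      assert (INR n < 6) by (replace 6 with (INR 6) by (simpl; ring); apply lt_INR; auto). lra. }
    assert (Ind : forall q n, (n < 6)%nat -> has_dimension (Hk (k1 + 2 * INR (n + 6 * q)) rho v)
        (nactive (active Bweight n) 5 + 5 * q)).
    { induction q; intros n Hn.
      - rewrite !Nat.mul_0_r, !Nat.add_0_r. apply (Base n Hn).
      - replace (nactive (active Bweight n) 5 + 5 * S q)%nat
          with (nactive (active Bweight n) 5 + 5 * q + nactive (active Bweight (n + 6 * S q)) 5)%nat.
        + apply Step. replace (k1 + 2 * INR (n + 6 * S q) - 12) with (k1 + 2 * INR (n + 6 * q)); [auto|].
          rewrite !plus_INR, !mult_INR, (S_INR q). replace (INR 6) with 6 by (simpl; ring). ring.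
        (* Here the index is at least 6 and every s_i is at most 2, so the difference is at least 4
           and never 1; all five vectors contribute, and each step of 12 in weight adds 5. *)
        + assert (A : forall i, (i < 5)%nat -> active Bweight (n + 6 * S q) i = true).
          { intros i Hi. apply active_spec. assert (Bweight i <= 2)%nat by (destruct i as [|[|[|[|i]]]]; cbn; lia). lia. }
          cbn [nactive]. rewrite !(fun i Hi => A i Hi) by lia. lia. }
    intros n. pose proof (Nat.div_mod_eq n 6) as Hdm. pose proof (Nat.mod_upper_bound n 6 ltac:(lia)) as Hmb.
    set (p := (n mod 6)%nat) in *. set (q := (n / 6)%nat) in *.
    rewrite Hdm, (Nat.add_comm (6 * q) p).
    replace (if (p =? 5)%nat then (5 * (p + 6 * q) / 6 + 1)%nat else (5 * (p + 6 * q) / 6 + 2)%nat)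
      with (nactive (active Bweight p) 5 + 5 * q)%nat; [apply Ind; auto|].
    replace (5 * (p + 6 * q))%nat with (5 * p + 5 * q * 6)%nat by lia. rewrite Nat.div_add by lia.
    clear Hdm. clearbody p q. clear -Hmb.
    (* The counts for p = 0, ..., 5 are 2, 2, 3, 4, 5, 5; the missing weight 2 is what breaks the
       regularity of the formula. *)
    destruct p as [|[|[|[|[|[|p]]]]]]; [| | | | | |lia]; cbn; lia.
Qed.
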